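(* Consider the random walk in random environment on $\hat\omega$ described in the context, satisfying Assumptions 1, 2*, 3, 4 listed there, and let $\Omega_{\rm typ}$ be the $\mathbb G$-invariant set of $\mathbb P$-probability one fixed there. Then there exists a measurable set $\Omega^*_{\rm typ}\subset\Omega_{\rm typ}$, $\mathbb G$-invariant and with $\mathbb P(\Omega^*_{\rm typ})=1$, such that, as $\varepsilon\downarrow0$, the following limits hold for any $\omega\in\Omega^*_{\rm typ}$, $t\ge0$, $\lambda>0$ and $f\in C_*(\mathbb R^d)$: $$\begin{aligned} &(1)\quad L^2(\mu^\varepsilon_\omega)\ni P^\varepsilon_{\omega,t}f\to P_tf\in L^2(m\,dx)\quad\text{(strong convergence)},\\ &(2)\quad L^2(\mu^\varepsilon_\omega)\ni R^\varepsilon_{\omega,\lambda}f\to R_\lambda f\in L^2(m\,dx)\quad\text{(strong convergence)},\\ &(3)\quad \int|P^\varepsilon_{\omega,t}f(x)-P_tf(x)|^2\,d\mu^\varepsilon_\omega(x)\to0,\\ &(4)\quad \int|R^\varepsilon_{\omega,\lambda}f(x)-R_\lambda f(x)|^2\,d\mu^\varepsilon_\omega(x)\to0,\\ &(5)\quad \int|P^\varepsilon_{\omega,t}f(x)-P_tf(x)|\,d\mu^\varepsilon_\omega(x)\to0,\\ &(6)\quad \int|R^\varepsilon_{\omega,\lambda}f(x)-R_\lambda f(x)|\,d\mu^\varepsilon_\omega(x)\to0. \end{aligned}$$ More specifically (for all $\omega\in\Omega^*_{\rm typ}$, $t\ge 0$, $\lambda>0$): (i) (1), (2), (3), (4) hold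 if $f\in\mathcal G(d+1)$, and (5), (6) hold if $f\in\mathcal G(2d+2)$; (ii) if in addition $\mathbb E[\mu_\omega(\Delta)^\alpha]<+\infty$ for some $\alpha>1$, then (1), (2), (3), (4) hold when $f\in\mathcal G(d/2)$, while (5), (6) hold when $f\in\mathcal G(d)$.
   Context: **Basic setting.** $|x|$ is the Euclidean norm. $\mathbb G$ is $\mathbb R^d$ (Euclidean topology) or $\mathbb Z^d$ (discrete topology). $\mathbb G$ acts on a probability space $(\Omega,\mathcal F,\mathbb P)$ by $(\theta_g)_{g\in\mathbb G}$: $\theta_0$ is the identity, $\theta_g\circ\theta_{g'}=\theta_{g+g'}$, and $(g,\omega)\mapsto\theta_g\omega$ is measurable. $A\in\mathcal F$ is $\mathbb G$-invariant if $\theta_gA=A$ for all $g$. $\mathbb G$ acts on $\mathbb R^d$ by $\tau_gx=x+Vg$, $V$ a fixed invertible $d\times d$ matrix with columns $v^1,\dots,v^d$; $\Delta:=\{\sum_it_iv^i:0\le t_i<1\}$. $\mathcal M$ is the space of locally finite non-negative Borel measures on $\mathbb R^d$ with the vague topology and its Borel $\sigma$-algebra; $\tau_g\mathfrak m(A):=\mathfrak m(\tau_gA)$. A random measure $\mu_\omega$ (measurable map $\omega\mapsto\mu_\omega\in\mathcal M$) is given which for every $\omega$ is purely atomic with locally finite support: $\mu_\omega=\sum_{x\in\hat\omega}n_x(\omega)\delta_x$, $n_x(\omega):=\mu_\omega(\{x\})$, $\hat\omega:=\{x:n_x(\omega)>0\}$. The intensity is $m:=\ell(\Delta)^{-1}\int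 d\mathbb P(\omega)\mu_\omega(\Delta)$ ($\ell$ = Lebesgue measure), and $\mu^\varepsilon_\omega:=\varepsilon^d\sum_{x\in\hat\omega}n_x(\omega)\delta_{\varepsilon x}$ for $\varepsilon>0$. Also given is a measurable function $(\omega,x,y)\mapsto r_{x,y}(\omega)\in[0,+\infty)$ on $\Omega\times\mathbb R^d\times\mathbb R^d$ with $r_{x,x}(\omega)=0$ and $r_{x,y}(\omega)=0$ if $\{x,y\}\not\subset\hat\omega$. **Palm distribution $\mathbb P_0$.** If $\mathbb G=\mathbb R^d$: $\mathbb P_0$ is the probability measure on $(\Omega,\mathcal F)$ with $\mathbb P_0(A)=\frac1{m\,\ell(U)}\int_\Omega d\mathbb P(\omega)\int_Ud\mu_\omega(x)\mathbf 1_A(\theta_{V^{-1}x}\omega)$ for any Borel $U$ with $\ell(U)\in(0,\infty)$ (independent of $U$); it is supported in $\Omega_0:=\{\omega:n_0(\omega)>0\}$. If $\mathbb G=\mathbb Z^d$: $\mathbb P_0$ is the probability measure on $\Omega\times\Delta$ with $\mathbb P_0(A)=\frac1{m\,\ell(\Delta)}\int_\Omega d\mathbb P(\omega)\int_\Delta d\mu_\omega(x)\mathbf 1_A(\omega,x)$, supported in $\Omega_0:=\{(\omega,x)\in\Omega\times\Delta:n_x(\omega)>0\}$. For $k\ge0$ define $\lambda_k$ on $\Omega_0$ by $\lambda_k(\omega):=\sum_{x\in\hat\omega}r_{0,x}(\omega)|x|^k$ if $\mathbb G=\mathbb R^d$, and $\lambda_k(\omega,a):=\sum_{x\in\hat\omega}r_{a,x}(\omega)|x-a|^k$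 if $\mathbb G=\mathbb Z^d$. **Assumptions.** - Assumption 1: $\mathbb P\circ\theta_g^{-1}=\mathbb P$ for all $g\in\mathbb G$, and $\mathbb P(A)\in\{0,1\}$ for every $\mathbb G$-invariant $A\in\mathcal F$. - Assumption 2*: $\mu_{\theta_g\omega}=\tau_g\mu_\omega$ for all $g\in\mathbb G$ and all $\omega$ in a $\mathbb G$-invariant set $\Omega_*\in\mathcal F$ with $\mathbb P(\Omega_* )=1$. - Assumption 3: $0<m<+\infty$. - Assumption 4: for some $\mathbb G$-invariant $\Omega_*\in\mathcal F$ with $\mathbb P(\Omega_* )=1$: (i) $\theta_g\omega\ne\theta_{g'}\omega$ for all $\omega\in\Omega_*$, $g\ne g'$ in $\mathbb G$; (ii) $r_{x,y}(\theta_g\omega)=r_{\tau_gx,\tau_gy}(\omega)$ for all $\omega\in\Omega_*$, $g\in\mathbb G$, $x,y\in\mathbb R^d$; (iii) $n_x(\omega)r_{x,y}(\omega)=n_y(\omega)r_{y,x}(\omega)$ for all $\omega\in\Omega_*$, $x,y\in\hat\omega$; (iv) for all $\omega\in\Omega_*$ and $x\ne y$ in $\hat\omega$ there is a path $x=x_0,x_1,\dots,x_n=y$ in $\hat\omega$ with $r_{x_i,x_{i+1}}(\omega)>0$ for all $i$; (v) $\lambda_0,\lambda_2\in L^1(\mathbb P_0)$; (vi) $L^2(\mathbb P_0)$ is separable. **Random walk.** For $\omega\in\Omega$, $(X^\omega_t)_{t\ge0}$ is the continuous-time random walk on $\hat\omega$ jumping from $x$ to $y\neq x$ with rate $r_{x,y}(\omega)$.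 It is known that, under Assumptions 1, 2*, 3, 4, for all $\omega$ in a $\mathbb G$-invariant set of probability one, $r_x(\omega):=\sum_yr_{x,y}(\omega)\in(0,\infty)$ for all $x\in\hat\omega$ and the walk a.s. does not explode from any starting point. $(P^\varepsilon_{\omega,t})_{t\ge0}$ is the $L^2(\mu^\varepsilon_\omega)$-Markov semigroup of $(\varepsilon X^\omega_{\varepsilon^{-2}t})_{t\ge0}$ on $\varepsilon\hat\omega$: $P^\varepsilon_{\omega,t}f(\varepsilon x)$ is the expectation of $f(\varepsilon X^\omega_{\varepsilon^{-2}t})$ with starting point $\varepsilon x$. $\mathbb L^\varepsilon_\omega$ is its self-adjoint generator and $R^\varepsilon_{\omega,\lambda}:=(\lambda-\mathbb L^\varepsilon_\omega)^{-1}=\int_0^\infty e^{-\lambda s}P^\varepsilon_{\omega,s}\,ds$. **Effective matrix.** $D$ is the symmetric positive semidefinite $d\times d$ matrix such that for all $a\in\mathbb R^d$: if $\mathbb G=\mathbb R^d$, $a\cdot Da=\inf_{f\in L^\infty(\mathbb P_0)}\frac12\int d\mathbb P_0(\omega)\sum_{x\in\hat\omega}r_{0,x}(\omega)\big(a\cdot x-[f(\theta_{V^{-1}x}\omega)-f(\omega)]\big)^2$; if $\mathbb G=\mathbb Z^d$, $a\cdot Da=\inf_{f\in L^\infty(\mathbb P_0)}\frac12\int d\mathbb P_0(\omega,x)\sum_{y\in\hat\omega}r_{x,y}(\omega)\big(a\cdot(y-x)-[f(\theta_{g(y)}\omega,b(y))-f(\omega,x)]\big)^2$, where $y=Vg(y)+b(y)$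 with $g(y)\in\mathbb Z^d$, $b(y)\in\Delta$. $(P_t)_{t\ge0}$ and $R_\lambda=\int_0^\infty e^{-\lambda s}P_s\,ds$ are the Markov semigroup and the $\lambda$-resolvent on $L^2(m\,dx)$ of the (possibly degenerate) Brownian motion on $\mathbb R^d$ with diffusion matrix $2D$; for bounded continuous $f$, $P_tf(x)$ is the expectation of $f$ at time $t$ for the Brownian motion started at $x$, so that $P_tf$, $R_\lambda f$ are defined pointwise. **Convergence.** For fixed $\omega$, a family $v_\varepsilon\in L^2(\mu^\varepsilon_\omega)$ converges weakly to $v\in L^2(m\,dx)$ ($v_\varepsilon\rightharpoonup v$) if $\limsup_{\varepsilon\downarrow0}\|v_\varepsilon\|_{L^2(\mu^\varepsilon_\omega)}<\infty$ and $\int v_\varepsilon\varphi\,d\mu^\varepsilon_\omega\to m\int v\varphi\,dx$ for all $\varphi\in C_c(\mathbb R^d)$. It converges strongly ($v_\varepsilon\to v$) if $\limsup_{\varepsilon\downarrow0}\|v_\varepsilon\|_{L^2(\mu^\varepsilon_\omega)}<\infty$ and $\int v_\varepsilon g_\varepsilon\,d\mu^\varepsilon_\omega\to m\int vg\,dx$ for every family $g_\varepsilon\in L^2(\mu^\varepsilon_\omega)$ with $g_\varepsilon\rightharpoonup g\in L^2(m\,dx)$. **The set $\Omega_{\rm typ}$.** It is known (earlier homogenization theorem, to be taken as given) that under Assumptions 1, 2*, 3, 4 there is a $\mathbb G$-invariant set $\Omega_{\rm typ}\in\mathcal F$ with $\mathbb P(\Omega_{\rm typ})=1$, on which the random walk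 $(X^\omega_t)_{t\ge0}$ is well defined for all times (that is, for every $\omega\in\Omega_{\rm typ}$ one has $\sum_{y\in\hat\omega}r_{x,y}(\omega)\in(0,\infty)$ for all $x\in\hat\omega$, and the walk a.s. does not explode from any starting point), such that for all $\omega\in\Omega_{\rm typ}$ and $\lambda>0$, for any $f_\varepsilon\in L^2(\mu^\varepsilon_\omega)$ and $f\in L^2(m\,dx)$: $f_\varepsilon\rightharpoonup f$ implies $R^\varepsilon_{\omega,\lambda}f_\varepsilon\rightharpoonup R_\lambda f$, and $f_\varepsilon\to f$ implies $R^\varepsilon_{\omega,\lambda}f_\varepsilon\to R_\lambda f$. Such a set is fixed. **Function classes.** $\mathcal G(r):=\{f\in C(\mathbb R^d):\exists C>0,\exists\beta>r\text{ with }|f(x)|\le C(1+|x|)^{-\beta}\ \forall x\}$ and $C_*(\mathbb R^d):=\bigcap_{r>0}\mathcal G(r)$. *)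

(* Defs.v *)
From HB Require Import structures.
From mathcomp Require Import all_boot all_order all_algebra.
From mathcomp Require Import all_classical all_reals all_analysis.
From mathcomp Require Import measurable_realfun.

Set Implicit Arguments.
Unset Strict Implicit.
Unset Printing Implicit Defensive.

Import Order.TTheory GRing.Theory Num.Theory.
Import numFieldNormedType.Exports.

Local Open Scope classical_set_scope.
Local Open Scope ring_scope.

(* R^d is 'rV[R]_d, equipped with its Borel sigma-algebra. *)
HB.instance Definition _ (R : realType) (d : nat) :=
  Measurable.copy 'rV[R]_d (g_sigma_algebraType (@open 'rV[R]_d)).

Section pushforward_measure.
Context d d' (T : measurableType d) (T' : measurableType d') (R : realType).

Definition pushforward_measure (m : {measure set T -> \bar R}) (f : T -> T')
    (mf : measurable_fun setT f) : {measure set T' -> \bar R} :=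
  measure_function_pushforward__canonical__measure_function_Measure m mf.

End pushforward_measure.

Lemma measurable_to_rV d (T : measurableType d) (R : realType) (n : nat)
    (f : T -> 'rV[R]_n) :
  (forall U, open U -> measurable (f @^-1` U)) -> measurable_fun setT f.
Proof.
move=> mf; apply: (@measurability _ _ _ _ _ _ (@open 'rV[R]_n)) => // _ [U oU <-].
by rewrite setTI; exact: mf.
Qed.
Section lebesgue_measure_rV.
Context {R : realType}.

Definition tuple_snoc n (p : n.-tuple R * R) : n.+1.-tuple R :=
  [tuple of p.2 :: p.1].

Lemma measurable_tuple_snoc n : measurable_fun setT (@tuple_snoc n).
Proof. exact: (measurable_cons measurable_snd measurable_fst). Qed.

Fixpoint lebesgue_tuple n : {measure set (n.-tuple R) -> \bar R} :=
  match n with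
  | 0%N => \d_[tuple]
  | n.+1 => pushforward_measure
      [the measure _ _ of (lebesgue_tuple n \x lebesgue_measure)%E]
      (@measurable_tuple_snoc n)
  end.

Definition row_of_tuple d (t : d.-tuple R) : 'rV[R]_d := \row_i tnth t i.

Lemma measurable_row_of_tuple d : measurable_fun setT (@row_of_tuple d).
Proof.
apply: measurable_to_rV => U oU.
pose box (p : d.-tuple rat * nat) : set 'rV[R]_d :=
  [set x | forall i, `|x ord0 i - ratr (tnth p.1 i)| < p.2.+1%:R^-1].
have -> : @row_of_tuple d @^-1` U =
    \bigcup_(p in [set p | box p `<=` U]) (@row_of_tuple d @^-1` box p).
  apply/seteqP; split => [t /= Ut|t [p /= pU pt]]; last exact: pU.
  have /nbhs_ballP[e /= e0 eU] : nbhs (row_of_tuple t) U by exact: open_nbhs_nbhs.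
  pose n := Num.bound (2 / e).
  have ne : n.+1%:R^-1 < e / 2.
    rewrite -[e / 2]invrK ltf_pV2 ?posrE ?invr_gt0 ?divr_gt0// invf_div.
    apply: (lt_le_trans (archi_boundP _)); first by rewrite divr_ge0// ltW.
    by rewrite ler_nat.
  have qE (i : 'I_d) : exists q : rat, `|tnth t i - ratr q| < n.+1%:R^-1.
    have [|q] := @rat_in_itvoo R (tnth t i - n.+1%:R^-1) (tnth t i + n.+1%:R^-1).
      by rewrite ltrD2l gtrN ?invr_gt0.
    by rewrite in_itv/= => qt; exists q; rewrite distrC ltr_distl.
  have [q qP] := choice qE.
  exists ([tuple q i | i < d], n) => /=; last by move=> i /=; rewrite mxE tnth_mktuple.
  move=> x /= bx; apply: eU; split => // i j; rewrite (ord1 i) mxE.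
  rewrite /ball/= [e]splitr.
  have := bx j; rewrite tnth_mktuple => bxj.
  rewrite (le_lt_trans (ler_distD (ratr (q j)) _ _))// ltrD//.
    exact: lt_trans (qP j) ne.
  by rewrite distrC; exact: lt_trans bxj ne.
rewrite bigcup_mkcond; apply: countable_bigcupT_measurable => [|p].
  by apply/countableP.
case: ifPn => // _.
have -> : @row_of_tuple d @^-1` box p = \bigcap_(i in [set: 'I_d])
    (setT `&` (fun t : d.-tuple R => tnth t i) @^-1`
       ball (ratr (tnth p.1 i) : R) p.2.+1%:R^-1).
  apply/seteqP; split => t bt i.
    by move=> _; split => //; rewrite /= /ball/= distrC; have := bt i; rewrite mxE.
  by rewrite mxE distrC; have [] := bt i I.
apply: fin_bigcap_measurable => // i _.
by apply: measurable_tnth => //; exact: open_measurable (ball_open _ _).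
Qed.

(* Lebesgue measure on R^d: d-fold product of the one-dimensional one,
   transported from d-tuples to row vectors. *)
Definition lebesgue_rV d : {measure set 'rV[R]_d -> \bar R} :=
  pushforward_measure (lebesgue_tuple d) (@measurable_row_of_tuple d).

End lebesgue_measure_rV.

Section euclidean_space.
Context {R : realType} {d : nat}.
Implicit Types (x y : 'rV[R]_d) (A V : 'M[R]_d).

(* The library norm `|x| on 'rV[R]_d is the sup norm; enorm is the Euclidean
   one. The two define the same topology. *)
Definition enorm x : R := Num.sqrt (\sum_i x ord0 i ^+ 2).

Definition dot x y : R := \sum_i x ord0 i * y ord0 i.

(* The product A x of the column vector x by A, in row-vector notation. *)
Definition mulmv A x : 'rV[R]_d := x *m A^T.

Definition cell V : set 'rV[R]_d :=
  [set x | exists t : 'rV[R]_d,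
    (forall i, 0 <= t ord0 i < 1) /\ x = mulmv V t].

(* x = V (lattice_part V x) + cell_part V x, with lattice_part V x in Z^d and
   cell_part V x in cell V. *)
Definition lattice_part V x : 'rV[R]_d :=
  \row_i (Num.floor (mulmv (invmx V) x ord0 i))%:~R.
Definition cell_part V x : 'rV[R]_d := x - mulmv V (lattice_part V x).

Definition tau V (g x : 'rV[R]_d) : 'rV[R]_d := x + mulmv V g.

Definition Cc (phi : 'rV[R]_d -> R) : Prop :=
  continuous phi /\
  exists2 K : set 'rV[R]_d, compact K & forall x, ~ K x -> phi x = 0.

Definition classG (r : R) (f : 'rV[R]_d -> R) : Prop :=
  continuous f /\ exists C beta : R, [/\ 0 < C, r < beta &
    forall x, `|f x| <= C * (1 + enorm x) `^ (- beta)].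

Definition Cstar (f : 'rV[R]_d -> R) : Prop :=
  forall r : R, 0 < r -> classG r f.

End euclidean_space.

(* The group acting on Omega is R^d or Z^d. It is realized as a subset of R^d,
   Z^d being the set of vectors with integer entries; the Borel sigma-algebra
   of R^d induces the discrete one on Z^d. *)
Variant group_kind := RealGroup | LatticeGroup.

Definition group_set {R : realType} {d : nat} (k : group_kind) :
    set 'rV[R]_d :=
  match k with
  | RealGroup => setT
  | LatticeGroup => [set g | forall i, g ord0 i \is a Num.int]
  end.

Section random_environment.
Context {R : realType} {d : nat} {dO : measure_display}
  {Omega : measurableType dO}.
Variables (k : group_kind) (theta : 'rV[R]_d -> Omega -> Omega).

(* The values of theta outside of the group are irrelevant. *)
Definition group_action : Prop :=
  [/\ forall w, theta 0 w = w,
      forall g g', group_set k g -> group_set k g' ->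
        forall w, theta g (theta g' w) = theta (g + g') w &
      measurable_fun (group_set k `*` [set: Omega])
        (fun p : 'rV[R]_d * Omega => theta p.1 p.2)].

Definition invariant (A : set Omega) : Prop :=
  forall g, group_set k g -> theta g @` A = A.

Definition stationary_ergodic (P : probability Omega R) : Prop :=
  (forall g, group_set k g ->
     forall A, measurable A -> P (theta g @^-1` A) = P A) /\
  (forall A, measurable A -> invariant A -> P A = 0%E \/ P A = 1%E).

End random_environment.

Section locally_finite_measures.
Context {R : realType} {d : nat}.

Record lfmeasure := LFMeasure {
  lfm_measure :> {measure set 'rV[R]_d -> \bar R} ;
  lfm_finite : forall K, compact K -> (lfm_measure K < +oo)%E }.

(* The vague topology: the coarsest one making m |-> \int phi dm continuous
   for all phi in C_c(R^d). *)
Definition vague_open (U : set lfmeasure) : Prop :=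
  forall m, U m -> exists (n : nat) (phi : 'I_n -> 'rV[R]_d -> R) (e : R),
    [/\ 0 < e, forall i, Cc (phi i) &
        forall m' : lfmeasure,
          (forall i, `|\int[m']_x phi i x - \int[m]_x phi i x| < e) -> U m'].

Definition random_measure {dO} {Omega : measurableType dO}
    (mu : Omega -> lfmeasure) : Prop :=
  forall B, <<s vague_open >> B -> measurable (mu @^-1` B).

Definition atoms (m : {measure set 'rV[R]_d -> \bar R}) : set 'rV[R]_d :=
  [set x | (0 < m [set x])%E].

Definition purely_atomic (m : {measure set 'rV[R]_d -> \bar R}) : Prop :=
  (forall K, compact K -> finite_set (K `&` atoms m)) /\
  (forall A, measurable A -> m A = \esum_(x in A `&` atoms m) m [set x]).

Lemma measurable_scale (e : R) :
  measurable_fun setT (fun x : 'rV[R]_d => e *: x).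
Proof.
apply: measurable_to_rV => U oU; apply: sub_sigma_algebra.
by apply: open_comp => // x _; exact: scaler_continuous.
Qed.

(* For m = \sum_x n_x \delta_x and e > 0 this is
   e ^ d \sum_x n_x \delta_(e x); the absolute value only serves to have a
   non-negative factor for all e. *)
Definition rescaled (m : {measure set 'rV[R]_d -> \bar R}) (e : R) :
    {measure set 'rV[R]_d -> \bar R} :=
  mscale (`|e| ^+ d)%:nng (pushforward_measure m (measurable_scale e)).

End locally_finite_measures.
Arguments lfmeasure : clear implicits.

(* Weak and strong convergence of families v_e in L^2(rescaled m e), e > 0,
   as e decreases to 0, to v0 in L^2(c dx). *)
Section varying_L2_convergence.
Context {R : realType} {d : nat}.
Variables (m : {measure set 'rV[R]_d -> \bar R}) (c : R).
Implicit Types v : R -> 'rV[R]_d -> R.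

Definition L2_bounded_family v : Prop :=
  (forall e, 0 < e -> v e \in Lfun (rescaled m e) 2%:E) /\
  (limf_esup (fun e => 'N[rescaled m e]_2%:E[EFin \o v e]) 0^'+ < +oo)%E.

Definition weak_cvg v (v0 : 'rV[R]_d -> R) : Prop :=
  [/\ L2_bounded_family v, v0 \in Lfun (lebesgue_rV d) 2%:E &
      forall phi, Cc phi ->
        \int[rescaled m e]_x (v e x * phi x) @[e --> 0^'+] -->
        c * \int[lebesgue_rV d]_x (v0 x * phi x)].

Definition strong_cvg v (v0 : 'rV[R]_d -> R) : Prop :=
  [/\ L2_bounded_family v, v0 \in Lfun (lebesgue_rV d) 2%:E &
      forall g g0, weak_cvg g g0 ->
        \int[rescaled m e]_x (v e x * g e x) @[e --> 0^'+] -->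
        c * \int[lebesgue_rV d]_x (v0 x * g0 x)].

End varying_L2_convergence.

Section palm.
Context {R : realType} {d : nat} {dO : measure_display}.

Definition palm_display (k : group_kind) : measure_display :=
  match k with
  | RealGroup => dO
  | LatticeGroup => (dO, (@open 'rV[R]_d).-sigma)%mdisp.-prod%mdisp
  end.

(* The Palm distribution lives on Omega for R^d and on Omega x cell V for Z^d;
   in the latter case it is seen as a measure on Omega x R^d which, by
   is_palm, gives full mass to Omega x cell V. *)
Definition palm_space (k : group_kind) (Omega : measurableType dO) :
    measurableType (palm_display k) :=
  match k return measurableType (palm_display k) with
  | RealGroup => Omega
  | LatticeGroup => (Omega * 'rV[R]_d)%type
  end.

Context {Omega : measurableType dO}.
Variables (V : 'M[R]_d) (P : probability Omega R)
  (theta : 'rV[R]_d -> Omega -> Omega) (mu : Omega -> lfmeasure R d)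
  (r : Omega -> 'rV[R]_d -> 'rV[R]_d -> R).

Definition intensity : \bar R :=
  ((lebesgue_rV d (cell V))^-1 * \int[P]_w mu w (cell V))%E.

Definition is_palm (k : group_kind) :
    probability (palm_space k Omega) R -> Prop :=
  match k return probability (palm_space k Omega) R -> Prop with
  | RealGroup => fun P0 =>
      forall A U, measurable A -> measurable U ->
        (0 < lebesgue_rV d U < +oo)%E ->
        P0 A = ((intensity * lebesgue_rV d U)^-1 *
          \int[P]_w \int[mu w]_(x in U)
            (\1_A (theta (mulmv (invmx V) x) w))%:E)%E
  | LatticeGroup => fun P0 =>
      forall A, measurable A ->
        P0 A = ((intensity * lebesgue_rV d (cell V))^-1 *
          \int[P]_w \int[mu w]_(x in cell V) (\1_A (w, x))%:E)%E
  end.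

Definition palm_moment (k : group_kind) (j : nat) :
    palm_space k Omega -> \bar R :=
  match k return palm_space k Omega -> \bar R with
  | RealGroup => fun w =>
      \esum_(x in atoms (mu w)) (r w 0 x * enorm x ^+ j)%:E
  | LatticeGroup => fun p =>
      \esum_(x in atoms (mu p.1)) (r p.1 p.2 x * enorm (x - p.2) ^+ j)%:E
  end.

Definition palm_energy (k : group_kind) (a : 'rV[R]_d) :
    (palm_space k Omega -> R) -> palm_space k Omega -> \bar R :=
  match k return (palm_space k Omega -> R) -> palm_space k Omega -> \bar R with
  | RealGroup => fun f w =>
      \esum_(x in atoms (mu w))
        (r w 0 x *
         (dot a x - (f (theta (mulmv (invmx V) x) w) - f w)) ^+ 2)%:E
  | LatticeGroup => fun f p =>
      \esum_(y in atoms (mu p.1))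
        (r p.1 p.2 y *
         (dot a (y - p.2) -
          (f (theta (lattice_part V y) p.1, cell_part V y) - f p)) ^+ 2)%:E
  end.

Definition effective_matrix (k : group_kind)
    (P0 : probability (palm_space k Omega) R) (D : 'M[R]_d) : Prop :=
  [/\ D^T = D, forall a, 0 <= dot a (mulmv D a) &
      forall a, (dot a (mulmv D a))%:E =
        ereal_inf [set (2^-1%:E * \int[P0]_p palm_energy a f p)%E |
                   f in [set f | f \in Lfun P0 +oo%E]]].

End palm.
Arguments palm_space R d {dO} k Omega.

Definition L2_separable {R : realType} {dT} {T : measurableType dT}
    (m : {measure set T -> \bar R}) : Prop :=
  exists s : nat -> T -> R, (forall n, s n \in Lfun m 2%:E) /\
    forall f, f \in Lfun m 2%:E -> forall e : R, 0 < e ->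
      exists n, ('N[m]_2%:E[EFin \o (f \- s n)%R] < e%:E)%E.

Section assumptions.
Context {R : realType} {d : nat} {dO : measure_display}
  {Omega : measurableType dO}.
Variables (k : group_kind) (V : 'M[R]_d) (P : probability Omega R)
  (theta : 'rV[R]_d -> Omega -> Omega) (mu : Omega -> lfmeasure R d)
  (r : Omega -> 'rV[R]_d -> 'rV[R]_d -> R).

Definition jump_rates : Prop :=
  [/\ measurable_fun setT
        (fun p : Omega * 'rV[R]_d * 'rV[R]_d => r p.1.1 p.1.2 p.2),
      forall w x y, 0 <= r w x y,
      forall w x, r w x x = 0 &
      forall w x y, ~ (atoms (mu w) x /\ atoms (mu w) y) -> r w x y = 0].

Definition full_invariant (A : set Omega) : Prop :=
  [/\ measurable A, invariant k theta A & P A = 1%E].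

Definition covariant_measure : Prop :=
  exists2 A, full_invariant A &
    forall g w, group_set k g -> A w -> forall B, measurable B ->
      mu (theta g w) B = mu w (tau V g @` B).

Definition walk_assumptions (P0 : probability (palm_space R d k Omega) R) :
    Prop :=
  (exists2 A, full_invariant A & forall w, A w ->
    [/\ forall g g', group_set k g -> group_set k g' -> g <> g' ->
          theta g w <> theta g' w,
        forall g x y, group_set k g ->
          r (theta g w) x y = r w (tau V g x) (tau V g y),
        forall x y, atoms (mu w) x -> atoms (mu w) y ->
          (mu w [set x] * (r w x y)%:E = mu w [set y] * (r w y x)%:E)%E &
        forall x y, atoms (mu w) x -> atoms (mu w) y -> x <> y ->
          exists s : seq 'rV[R]_d,
            [/\ forall z, z \in s -> atoms (mu w) z,
                path (fun u v => 0 < r w u v) x s & last x s = y]]) /\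
  [/\ P0.-integrable setT (palm_moment mu r 0%N),
      P0.-integrable setT (palm_moment mu r 2%N) &
      L2_separable P0].

Definition moment_condition : Prop :=
  exists2 alpha : R, 1 < alpha &
    (\int[P]_w (mu w (cell V) `^ alpha) < +oo)%E.

End assumptions.

(* The continuous-time random walk is given by its jump chain Y and its holding
   times S, defined on a probability space (Xi, Q). *)
Section random_walk.
Context {R : realType} {d : nat} {dX : measure_display}
  {Xi : measurableType dX}.
Variables (Y : nat -> Xi -> 'rV[R]_d) (S : nat -> Xi -> R).

Definition jump_time (n : nat) (xi : Xi) : R := \sum_(i < n) S i xi.

(* The position at time t is Y n for the n such that
   jump_time n <= t < jump_time n.+1; the value after an explosion is
   irrelevant. *)
Definition walk (t : R) (xi : Xi) : 'rV[R]_d :=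
  Y (xget 0%N [set n | jump_time n xi <= t < jump_time n.+1 xi]) xi.

Definition non_explosive (Q : probability Xi R) : Prop :=
  {ae Q, forall xi, jump_time n xi @[n --> \oo] --> +oo}.

Definition total_rate (A : set 'rV[R]_d) (q : 'rV[R]_d -> 'rV[R]_d -> R) x :
    \bar R := \esum_(y in A) (q x y)%:E.

(* Under Q, the walk with state space A and jump rates q starts at x0: the jump
   chain has transition probabilities q x y / total_rate x and, given the chain,
   the holding times are independent, that at x being exponential of parameter
   total_rate x. *)
Definition walk_law (A : set 'rV[R]_d) (q : 'rV[R]_d -> 'rV[R]_d -> R)
    (Q : probability Xi R) (x0 : 'rV[R]_d) : Prop :=
  [/\ forall n, measurable_fun setT (Y n),
      forall n, measurable_fun setT (S n) &
      forall n (y : nat -> 'rV[R]_d) (s : nat -> R),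
        (forall i, A (y i)) -> (forall i, 0 <= s i) ->
        Q [set xi | (forall i, (i <= n)%N -> Y i xi = y i) /\
                    (forall i, (i < n)%N -> s i < S i xi)] =
        ((y 0%N == x0)%:R *
         \prod_(i < n) (expR (- (fine (total_rate A q (y i)) * s i)) *
                        (q (y i) (y i.+1) / fine (total_rate A q (y i)))))%:E].

End random_walk.

Section rescaled_walk.
Context {R : realType} {d : nat} {dO dX : measure_display}
  {Omega : measurableType dO} {Xi : measurableType dX}.
Variables (mu : Omega -> lfmeasure R d)
  (r : Omega -> 'rV[R]_d -> 'rV[R]_d -> R)
  (Y : nat -> Xi -> 'rV[R]_d) (S : nat -> Xi -> R)
  (Q : Omega -> 'rV[R]_d -> probability Xi R).

Definition positive_rates (w : Omega) : Prop :=
  forall x, atoms (mu w) x ->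
    (0 < total_rate (atoms (mu w)) (r w) x < +oo)%E.

(* Q w x is the law of the walk in the environment w started at x. *)
Definition walk_realization : Prop :=
  forall w, positive_rates w -> forall x, atoms (mu w) x ->
    walk_law Y S (atoms (mu w)) (r w) (Q w x) x.

Definition walk_well_defined (w : Omega) : Prop :=
  positive_rates w /\
  forall x, atoms (mu w) x -> non_explosive S (Q w x).

(* P^e_{w,t} f and R^e_{w,lambda} f, functions on e * atoms (mu w), are
   extended by 0 to R^d. *)
Definition walk_semigroup (e : R) (w : Omega) (t : R) (f : 'rV[R]_d -> R)
    (z : 'rV[R]_d) : R :=
  if `[< atoms (mu w) (e^-1 *: z) >] then
    \int[Q w (e^-1 *: z)]_xi f (e *: walk Y S (e ^- 2 * t) xi)
  else 0.

Definition walk_resolvent (e : R) (w : Omega) (lambda : R)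
    (f : 'rV[R]_d -> R) (z : 'rV[R]_d) : R :=
  \int[lebesgue_measure]_(s in `[0, +oo[)
    (expR (- (lambda * s)) * walk_semigroup e w s f z).

End rescaled_walk.

Section brownian_motion.
Context {R : realType} {d : nat} {dB : measure_display}
  {B : measurableType dB}.
Variables (PB : probability B R) (W : R -> B -> 'rV[R]_d).

(* The centred normal law of variance v >= 0 (normal_prob takes the standard
   deviation, which it expects to be nonzero). *)
Definition centred_normal (v : R) (A : set R) : \bar R :=
  if v == 0 then \d_(0 : R) A else normal_prob 0 (Num.sqrt v) A.

(* Possibly degenerate Brownian motion started at 0 with diffusion matrix
   Sigma, i.e. W t - W s has covariance matrix (t - s) Sigma. *)
Definition brownian (Sigma : 'M[R]_d) : Prop :=
  [/\ forall t, 0 <= t -> measurable_fun setT (W t),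
      {ae PB, forall b, W 0 b = 0},
      {ae PB, forall b, {within `[0, +oo[, continuous (fun t => W t b)}},
      forall n (t : nat -> R) (A : nat -> set 'rV[R]_d),
        0 <= t 0%N -> (forall i, t i <= t i.+1) ->
        (forall i, measurable (A i)) ->
        PB [set b | forall i, (i < n)%N -> A i (W (t i.+1) b - W (t i) b)] =
        (\prod_(i < n) PB [set b | A i (W (t i.+1) b - W (t i) b)%R])%E &
      forall s t, 0 <= s <= t -> forall (a : 'rV[R]_d) (A : set R),
        measurable A ->
        PB [set b | A (dot a (W t b - W s b))] =
        centred_normal ((t - s) * dot a (mulmv Sigma a)) A].

Definition brownian_semigroup (t : R) (f : 'rV[R]_d -> R) (x : 'rV[R]_d) : R :=
  \int[PB]_b f (x + W t b).

Definition brownian_resolvent (lambda : R) (f : 'rV[R]_d -> R)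
    (x : 'rV[R]_d) : R :=
  \int[lebesgue_measure]_(s in `[0, +oo[)
    (expR (- (lambda * s)) * brownian_semigroup s f x).

End brownian_motion.

Section limits.
Context {R : realType} {d : nat} {dO dX dB : measure_display}
  {Omega : measurableType dO} {Xi : measurableType dX} {B : measurableType dB}.
Variables (V : 'M[R]_d) (P : probability Omega R) (mu : Omega -> lfmeasure R d)
  (Y : nat -> Xi -> 'rV[R]_d) (S : nat -> Xi -> R)
  (Q : Omega -> 'rV[R]_d -> probability Xi R)
  (PB : probability B R) (W : R -> B -> 'rV[R]_d).

Local Notation m := (fine (intensity V P mu)).
Local Notation Pe := (walk_semigroup mu Y S Q).
Local Notation Re := (walk_resolvent mu Y S Q).
Local Notation Pt := (brownian_semigroup PB W).
Local Notation Rl := (brownian_resolvent PB W).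

Definition resolvent_homogenization (w : Omega) : Prop :=
  forall lambda, 0 < lambda ->
  forall (fe : R -> 'rV[R]_d -> R) (f : 'rV[R]_d -> R),
    (weak_cvg (mu w) m fe f ->
     weak_cvg (mu w) m (fun e => Re e w lambda (fe e)) (Rl lambda f)) /\
    (strong_cvg (mu w) m fe f ->
     strong_cvg (mu w) m (fun e => Re e w lambda (fe e)) (Rl lambda f)).

Definition L2_limits (w : Omega) (t lambda : R) (f : 'rV[R]_d -> R) : Prop :=
  [/\ strong_cvg (mu w) m (fun e => Pe e w t f) (Pt t f),
      strong_cvg (mu w) m (fun e => Re e w lambda f) (Rl lambda f),
      (\int[rescaled (mu w) e]_x (`|Pe e w t f x - Pt t f x| ^+ 2)%:E)%E
        @[e --> 0^'+] --> 0%E &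
      (\int[rescaled (mu w) e]_x
         (`|Re e w lambda f x - Rl lambda f x| ^+ 2)%:E)%E
        @[e --> 0^'+] --> 0%E].

Definition L1_limits (w : Omega) (t lambda : R) (f : 'rV[R]_d -> R) : Prop :=
  (\int[rescaled (mu w) e]_x (`|Pe e w t f x - Pt t f x|)%:E)%E
    @[e --> 0^'+] --> 0%E /\
  (\int[rescaled (mu w) e]_x (`|Re e w lambda f x - Rl lambda f x|)%:E)%E
    @[e --> 0^'+] --> 0%E.

End limits.

(* Main.v *)
(** A Vitali covering by lattice tiles gives the ergodic theorem for the mass of
    every box around the origin, hence the vague convergence of the rescaled
    measures and a bound [K L^d] on the mass of cubes, uniform in the scale, so
    that decaying functions are controlled by cutoffs.  By reversibility the
    semigroup [U] of the walk is self-adjoint and [|U_s f|^2] is convex in [s],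
    which bounds [|U_s f - U_(s+h) f|^2] by [|f|^2 h / (2 s)].  The strong
    convergence of the resolvents therefore passes to the semigroups by
    inverting the Laplace transform, through its finite differences at
    [a, a + 1, ..., a + n].  Strong convergence to a continuous decaying limit
    gives L^2 convergence by expanding the square; for L^1 the mass of [U_t |f|]
    far away is that of [|f| (1 - U_t phi)] with [phi] a cutoff. *)
Require Import Defs.
From mathcomp Require Import all_boot all_order all_algebra.
From mathcomp Require Import ring lra zify.

Set Implicit Arguments.
Unset Strict Implicit.
Unset Printing Implicit Defensive.

Import Order.TTheory GRing.Theory Num.Theory.

Local Open Scope ring_scope.

(** * Coverings by lattice tiles *)

(** One pass of the greedy selection covers only a fraction [2 ^- d] of what is left, because a
    chosen tile may spoil [2 ^ d] times its volume of centres. Hence many rounds at well separated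
    scales, large tiles before small ones, so that the boundaries of old tiles cost little. Only
    integer translations occur, which belong to both groups, and only boxes of integer proportions,
    which are countably many; the other boxes used for vague convergence come from these by
    subtraction.

    The walk is given by its jump chain and holding times, so that neither the Markov property nor
    the symmetry of its transition probabilities is at hand, and its rates may be unbounded. Both
    properties are proved on the Laplace side, where the Green function is an explicit series with a
    minimality property, and are brought back by uniqueness of the transform among bounded
    right-continuous functions. The inversion must be uniform: its error depends on the function
    only through a bound and a modulus of continuity at one time, which the walk provides uniformly
    in the scale. *)

Section vitali_covering.
Context {R : realFieldType} {I : finType}.
Implicit Types (P : {set {set I}}) (C : {set I}) (T : I -> {set I}).

Lemma trivIset_add P (A : {set I}) : trivIset P -> set0 \notin P -> A != set0 ->
  [disjoint A & cover P] -> [/\ trivIset (A |: P), set0 \notin A |: P &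
    #|cover (A |: P)| = (#|A| + #|cover P|)%N].
Proof.
move=> tP P0 A0 dA.
have dB B : B \in P -> [disjoint A & B].
  by move=> BP; apply: disjointWr dA; exact: bigcup_sup.
have [tAP _] := trivIsetU1 dB tP P0.
split=> //; first by rewrite !inE negb_or eq_sym A0.
have -> : cover (A |: P) = A :|: cover P.
  by apply/setP => x; rewrite /cover bigcup_setU inE big_set1 inE.
by rewrite cardsU disjoint_setI0// cards0 subn0.
Qed.

(** Greedy choice of a centre of maximal scale among those whose tile is still free. Every free
    centre spoiled by that tile has at most its scale, so these are at most [kap] times as many as
    the points of the tile: each step of the induction pays for the centres it discards. *)
Lemma vitali (kap : nat) P C T (n : I -> nat) :
  trivIset P -> set0 \notin P -> (forall g, g \in C -> g \in T g) ->
  (forall g', g' \in C ->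
    (#|[set g in C | (n g <= n g') && ~~ [disjoint T g & T g']]| <= kap * #|T g'|)%N) ->
  exists P', [/\ P \subset P', trivIset P', set0 \notin P',
    (forall A, A \in P' -> A \in P \/ exists2 g, g \in C & A = T g) &
    (#|[set g in C | [disjoint T g & cover P]]| + kap * #|cover P| <= kap * #|cover P'|)%N].
Proof.
move=> + + CT; have [k] := ubnP #|[set g in C | [disjoint T g & cover P]]|.
elim: k P => // k IH P; set C' := [set g in C | _]; rewrite ltnS => Ck tP P0 conf.
have [C0|[g0 g0C]] := set_0Vmem C'.
  exists P; split=> //; first by move=> A; left.
  by rewrite C0 cards0.
pose g1 := [arg max_(g > g0 in C') n g].
have [g1C g1max] : g1 \in C' /\ forall g, g \in C' -> (n g <= n g1)%N.
  by rewrite /g1; case: arg_maxnP => // i iC H; split.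
have [g1C0 dg1] : g1 \in C /\ [disjoint T g1 & cover P].
  by move: g1C; rewrite inE => /andP[].
have T0 : T g1 != set0 by apply/set0Pn; exists g1; exact: CT.
have [tP1 P10 cP1] := trivIset_add tP P0 T0 dg1.
have [C1|] := boolP (C' \subset C'); last by rewrite subxx.
pose C2 := [set g in C | [disjoint T g & cover (T g1 |: P)]].
have covE : cover (T g1 |: P) = T g1 :|: cover P.
  by apply/setP => x; rewrite /cover bigcup_setU inE big_set1 inE.
have C2sub : C2 \proper C'.
  apply/properP; split.
    apply/subsetP => g; rewrite !inE => /andP[-> /=]; apply: disjointWr.
    by rewrite covE subsetUr.
  exists g1 => //; rewrite inE g1C0/= covE; apply/negP => D.
  have := disjointFr D (CT _ g1C0).
  by rewrite inE CT.
have Csub : C' \subset C2 :|: [set g in C | (n g <= n g1)%N && ~~ [disjoint T g & T g1]].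
  apply/subsetP => g gC'; have ng := g1max _ gC'; move: gC'; rewrite !inE => /andP[gC dg].
  rewrite gC ng/= covE; have [d1|_] := boolP [disjoint T g & T g1]; last by rewrite orbT.
  rewrite orbF; rewrite -setI_eq0 setIUr setU_eq0 !setI_eq0 d1; exact: dg.
have [|P' [sP' tP' P'0 P'T cP']] := IH (T g1 |: P) _ tP1 P10 conf.
  by apply: (leq_trans (proper_card C2sub)).
exists P'; split=> //.
- by apply: subset_trans sP'; exact: subsetUr.
- move=> A /P'T[|?]; last by right.
  by rewrite !inE => /orP[/eqP->|]; [right; exists g1|left].
have h1 : (#|C'| <= #|C2| + kap * #|T g1|)%N.
  apply: (leq_trans (subset_leq_card Csub)); apply: (leq_trans (leq_card_setU _ _).1).
  by rewrite leq_add2l conf.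
apply: leq_trans cP'; rewrite -/C2 cP1 mulnDr addnA leq_add2r.
exact: h1.
Qed.

(** An old tile [A] spoils at most [(1 + rho) * #|A|] centres, so about [#|I| - #|cover P|] centres
    stay free, and [vitali] covers at least a fraction [kap^-1] of that many new points. The losses
    are the points outside [C] and [rho * #|I|]. *)
Lemma covering_round (kap : nat) (rho : R) P C T (n : I -> nat) : (0 < kap)%N ->
  trivIset P -> set0 \notin P -> (forall g, g \in C -> g \in T g) -> 0 <= rho ->
  (forall g', g' \in C ->
    (#|[set g in C | (n g <= n g') && ~~ [disjoint T g & T g']]| <= kap * #|T g'|)%N) ->
  (forall A, A \in P -> #|[set g in C | ~~ [disjoint T g & A]]|%:R <= (1 + rho) * #|A|%:R) ->
  exists P', [/\ trivIset P', set0 \notin P',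
    (forall A, A \in P' -> A \in P \/ exists2 g, g \in C & A = T g) &
    #|I|%:R - #|cover P'|%:R <=
      (1 - kap%:R^-1) * (#|I|%:R - #|cover P|%:R) + #|~: C|%:R + rho * #|I|%:R :> R].
Proof.
move=> k0 tP P0 CT rho0 conf old.
have [P' [_ tP' P'0 P'T]] := vitali tP P0 CT conf.
set C' := [set g in C | _] => cP'.
exists P'; split=> //.
have kR : 0 < kap%:R :> R by rewrite ltr0n.
have c1 : #|C|%:R <= #|C'|%:R + (1 + rho) * #|cover P|%:R :> R.
  have sub : C \subset C' :|: \bigcup_(A in P) [set g in C | ~~ [disjoint T g & A]].
    apply/subsetP => g gC; rewrite in_setU [in X in X || _]inE gC/=.
    have [//|/= nd] := boolP [disjoint T g & cover P].
    move: nd; rewrite -setI_eq0 => /set0Pn[x]; rewrite inE => /andP[xT /bigcupP[A AP xA]].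
    apply/bigcupP; exists A => //; rewrite inE gC/= -setI_eq0; apply/set0Pn; exists x.
    by rewrite inE xT.
  have le1 : #|C|%:R <= #|C'|%:R + \sum_(A in P) #|[set g in C | ~~ [disjoint T g & A]]|%:R :> R.
    rewrite -natr_sum -natrD ler_nat; apply: (leq_trans (subset_leq_card sub)).
    apply: (leq_trans (leq_card_setU _ _).1); rewrite leq_add2l.
    elim/big_ind2: _ => [|s a t b sa tb|//]; first by rewrite cards0.
    by apply: (leq_trans (leq_card_setU _ _).1); exact: leq_add.
  apply: (le_trans le1); rewrite lerD2l.
  have -> : #|cover P| = (\sum_(A in P) #|A|)%N by apply/eqP; rewrite eq_sym.
  by rewrite natr_sum mulr_sumr; apply: ler_sum => A AP; exact: old.
have c2 : #|C|%:R + #|~: C|%:R = #|I|%:R :> R by rewrite -natrD cardsC.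
have c3 : #|C'|%:R + kap%:R * #|cover P|%:R <= kap%:R * #|cover P'|%:R :> R.
  by rewrite -!natrM -natrD ler_nat.
have c4 : #|cover P|%:R <= #|I|%:R :> R by rewrite ler_nat max_card.
have k1 : 0 <= 1 - kap%:R^-1 :> R.
  by rewrite subr_ge0 invf_le1// ler1n.
have nC0 : 0 <= #|~: C|%:R :> R by [].
move: c1 c3 c2 c4 nC0.
set c := #|C|%:R; set c' := #|C'|%:R; set u := #|cover P|%:R; set u' := #|cover P'|%:R.
set i := #|I|%:R; set b := #|~: C|%:R => c1 c3 c2 c4 b0.
have c5 : u + kap%:R^-1 * c' <= u'.
  rewrite -(ler_pM2l kR) mulrDr mulrA divff ?gt_eqF// mul1r addrC.
  exact: c3.
have c6 : kap%:R^-1 * (i - b - u - rho * i) <= kap%:R^-1 * c'.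
  rewrite ler_wpM2l ?invr_ge0 ?(ltW kR)//.
  have : rho * u <= rho * i by rewrite ler_wpM2l.
  by move: c1; rewrite -c2 mulrDl mul1r; lra.
have ki1 : kap%:R^-1 * (b + rho * i) <= b + rho * i.
  rewrite ler_piMl// ?invf_le1 ?ler1n//.
  by rewrite addr_ge0// mulr_ge0// (le_trans _ c4).
move: c5 c6 ki1; rewrite !mulrBr !mulrBl !mulrDr !mul1r; lra.
Qed.

End vitali_covering.

(** * Tiles of fixed proportions inside a discrete box *)

Section lattice_tiles.
Variables (d N : nat) (p q : 'I_d -> nat).
Hypothesis p_gt0 : forall i, (0 < p i)%N.
Hypothesis q_gt0 : forall i, (0 < q i)%N.
Local Notation box := {ffun 'I_d -> 'I_N}.
Implicit Types g h : box.

Lemma card_ord_itv lo hi : #|[pred x : 'I_N | (lo <= x < hi)%N]| = (minn hi N - lo)%N.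
Proof.
rewrite -sum1_card big_mkcond /=.
under eq_bigr do rewrite inE.
elim: (N) => [|n IH]; first by rewrite big_ord0; lia.
by rewrite big_ord_recr/= IH; case: ifP => h; lia.
Qed.

Lemma card_ffun_box (lo hi : 'I_d -> nat) :
  #|[set h : box | [forall i, (lo i <= h i < hi i)%N]]| = (\prod_i (minn (hi i) N - lo i))%N.
Proof.
have -> : #|[set h : box | [forall i, (lo i <= h i < hi i)%N]]| =
    #|family (fun i => [pred x : 'I_N | (lo i <= x < hi i)%N])|.
  apply: eq_card => h; rewrite inE; apply/forallP/familyP => H i; have := H i; by rewrite inE.
rewrite card_family foldrE big_image/=.
by apply: eq_bigr => i _; rewrite card_ord_itv.
Qed.

(** Coordinatewise [g - n p <= h < g + n q], written with sums because subtraction on [nat]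
    truncates. *)
Definition tile (n : nat) g : {set box} :=
  [set h : box | [forall i, (g i <= h i + n * p i)%N && (h i < g i + n * q i)%N]].

Definition inner (n : nat) : {set box} :=
  [set g : box | [forall i, (n * p i <= g i)%N && (g i + n * q i <= N)%N]].

Definition tile_volume : nat := (\prod_i (p i + q i))%N.

Lemma tile_volume_gt0 : (0 < tile_volume)%N.
Proof. by rewrite prodn_gt0// => i; rewrite addn_gt0 p_gt0. Qed.

Lemma card_tile n g : g \in inner n -> #|tile n g| = (n ^ d * tile_volume)%N.
Proof.
rewrite inE => /forallP gi.
have -> : tile n g = [set h : box | [forall i, (g i - n * p i <= h i < g i + n * q i)%N]].
  apply/setP => h; rewrite !inE; apply: eq_forallb => i; have /andP[] := gi i; lia.
rewrite card_ffun_box.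
have -> : (n ^ d = \prod_(i < d) n)%N by rewrite prod_nat_const card_ord.
rewrite /tile_volume -big_split/=; apply: eq_bigr => i _.
have /andP[h1 h2] := gi i; nia.
Qed.

Lemma mem_tile n g : (0 < n)%N -> g \in tile n g.
Proof.
move=> n0; rewrite inE; apply/forallP => i; rewrite leq_addr/=.
by rewrite -[X in (X < _)%N]addn0 ltn_add2l muln_gt0 n0 q_gt0.
Qed.

Lemma inner_leq m n : (m <= n)%N -> inner n \subset inner m.
Proof.
move=> mn; apply/subsetP => g; rewrite !inE => /forallP gi; apply/forallP => i.
have /andP[h1 h2] := gi i; apply/andP; split; nia.
Qed.

(** In each coordinate the admissible [g] fill an interval of length at most [(n + n') (p + q)]. For
    equal scales this is [2 ^ d] times the size of a tile. *)
Lemma card_tile_meet n n' g' :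
  (#|[set g : box | ~~ [disjoint tile n g & tile n' g']]| <= (n + n') ^ d * tile_volume)%N.
Proof.
have sub : [set g : box | ~~ [disjoint tile n g & tile n' g']] \subset
    [set h : box | [forall i, (g' i - (n' * p i + n * q i).-1 <= h i < g' i + (n' * q i + n * p i))%N]].
  apply/subsetP => g; rewrite !inE -setI_eq0 => /set0Pn[x].
  rewrite !inE => /andP[/forallP x1 /forallP x2]; apply/forallP => i.
  have /andP[] := x1 i; have /andP[] := x2 i; lia.
apply: (leq_trans (subset_leq_card sub)); rewrite card_ffun_box.
have -> : ((n + n') ^ d = \prod_(i < d) (n + n'))%N by rewrite prod_nat_const card_ord.
rewrite /tile_volume -big_split/=; apply: leq_prod => i _.
have := p_gt0 i; have := q_gt0 i; nia.
Qed.

Lemma card_tile_meet_le n n' (m : box -> nat) (C : {set box}) g' :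
  (#|[set g in C | (m g <= n)%N && ~~ [disjoint tile (m g) g & tile n' g']]| <=
    (n + n') ^ d * tile_volume)%N.
Proof.
apply: leq_trans (card_tile_meet n n' g'); apply/subset_leq_card/subsetP => g.
rewrite !inE => /and3P[_ mn]; rewrite -!setI_eq0 => /set0Pn[x]; rewrite inE => /andP[x1 x2].
apply/set0Pn; exists x; rewrite inE x2 andbT; move: x1; rewrite !inE => /forallP H.
apply/forallP => i; have /andP[h1 h2] := H i; apply/andP; split; nia.
Qed.

(** Bernoulli's inequality for products: the inner points make up at least the fraction
    [\prod_i (1 - x i)] of the box, with [x i = n (p i + q i) / N], and this is at least
    [1 - \sum_i x i]. *)
Lemma card_inner (R : realFieldType) n : (0 < N)%N -> (forall i, n * (p i + q i) <= N)%N ->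
  #|~: inner n|%:R <= (n * \sum_i (p i + q i))%:R / N%:R * N%:R ^+ d :> R.
Proof.
move=> N0 nN.
have NR : 0 < N%:R :> R by rewrite ltr0n.
have cI : (\prod_i (N - n * (p i + q i)) <= #|inner n|)%N.
  (* The condition [h + n q <= N] as a strict upper bound: [N - (n q - 1)] is [N - n q + 1], and it
     is [N] when [n q = 0]. *)
  have -> : inner n = [set h : box | [forall i, (n * p i <= h i < N - (n * q i - 1))%N && true]] by
    apply/setP => h; rewrite !inE; apply: eq_forallb => i; have := nN i;
    have := ltn_ord (h i); rewrite mulnDr; move: (n * p i)%N (n * q i)%N (nat_of_ord (h i)) => a b x;
    move=> xN abN; apply/andP/andP => [[ax xb]|[/andP[ax xb] _]]; (split; [lia|lia]).
  have -> : [set h : box | [forall i, (n * p i <= h i < N - (n * q i - 1))%N && true]] =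
     [set h : box | [forall i, (n * p i <= h i < N - (n * q i - 1))%N]].
    by apply/setP => h; rewrite !inE; apply: eq_forallb => i; rewrite andbT.
  rewrite card_ffun_box; apply: leq_prod => i _; have := nN i; rewrite mulnDr.
  by move: (n * p i)%N (n * q i)%N => a b; lia.
have cT : #|[set: box]| = (N ^ d)%N by rewrite cardsT card_ffun !card_ord.
have cC : #|~: inner n|%:R = N%:R ^+ d - #|inner n|%:R :> R.
  by rewrite -natrX -cT cardsT -(cardsC (inner n)) natrD [X in X - _]addrC addrK.
have bern (s : seq 'I_d) (x : 'I_d -> R) : (forall i, 0 <= x i <= 1) ->
    0 <= \prod_(i <- s) (1 - x i) <= 1 /\ 1 - \sum_(i <- s) x i <= \prod_(i <- s) (1 - x i).
  move=> x01; elim: s => [|i s [/andP[IH1 IH2] IH3]]; first by rewrite !big_nil subr0 ler01 lexx.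
  rewrite !big_cons; have /andP[xi0 xi1] := x01 i.
  have y0 : 0 <= 1 - x i by rewrite subr_ge0.
  split.
    by apply/andP; split; [exact: mulr_ge0|rewrite mulr_ile1// lerBlDr lerDl].
  have h1 : x i * \prod_(i <- s) (1 - x i) <= x i by rewrite ler_piMr.
  by rewrite mulrBl mul1r; lra.
pose y i : R := (n * (p i + q i))%:R / N%:R.
have xi i : 0 <= y i <= 1.
  by rewrite /y divr_ge0//= ler_pdivrMr// mul1r ler_nat.
have [_ B] := bern (index_enum 'I_d) y xi.
have sy : \sum_i y i = (n * \sum_i (p i + q i))%:R / N%:R.
  by rewrite /y big_distrr/= natr_sum mulr_suml.
have cIR : N%:R ^+ d * \prod_i (1 - (n * (p i + q i))%:R / N%:R) <= #|inner n|%:R :> R.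
  move: cI; rewrite -(ler_nat R); congr (_ <= _); rewrite natr_prod -[X in _ ^+ X](card_ord d) -prodr_const -big_split/=.
  apply: eq_bigr => i _; rewrite natrB// mulrBr mulr1; congr (_ - _).
  by rewrite mulrC divfK ?gt_eqF.
rewrite cC lerBlDr -lerBlDl; apply: le_trans cIR.
rewrite mulrC -[X in X - _]mulr1 -mulrBr ler_wpM2l ?exprn_ge0 ?(ltW NR)//.
by rewrite -sy.
Qed.

Section tiling_round.
Variables (R : realFieldType) (rho : R) (N0 M0 : nat).
Hypothesis rho_ge0 : 0 <= rho.
Hypothesis M0N0 : (1 + M0%:R / N0%:R) ^+ d <= 1 + rho :> R.
Hypothesis N0_gt0 : (0 < N0)%N.

(* A new round of tiles of scale at most M0 completes a family of tiles of
   scale at least N0 much bigger than M0. *)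
Lemma tiling_round (P : {set {set box}}) (C : {set box}) (n : box -> nat) :
  trivIset P -> set0 \notin P ->
  (forall A, A \in P -> exists2 m, (N0 <= m)%N & exists2 g, g \in inner m & A = tile m g) ->
  (forall g, g \in C -> (0 < n g <= M0)%N /\ g \in inner (n g)) ->
  exists P', [/\ trivIset P', set0 \notin P',
    (forall A, A \in P' -> A \in P \/ exists2 g, g \in C & A = tile (n g) g) &
    N%:R ^+ d - #|cover P'|%:R <=
      (1 - (2 ^+ d)^-1) * (N%:R ^+ d - #|cover P|%:R) + #|~: C|%:R + rho * N%:R ^+ d :> R].
Proof.
move=> tP P0 PT CT.
have cT : #|{: box}|%:R = N%:R ^+ d :> R by rewrite card_ffun !card_ord natrX.
(* The constant of the covering is [2 ^ d]: tiles of scale at most [n g'] that meet the tile of [g']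
   have at most [(2 n g') ^ d * tile_volume] centres. *)
have k0 : (0 < 2 ^ d)%N by rewrite expn_gt0.
have := @covering_round R _ (2 ^ d) rho P C (fun g => tile (n g) g) n k0 tP P0 _ rho_ge0.
rewrite cT natrX; apply.
- by move=> g /CT[/andP[n0 _] _]; exact: mem_tile.
- move=> g' g'C; have [/andP[n0 _] g'I] := CT _ g'C.
  apply: (leq_trans (card_tile_meet_le _ _ _ _ _)).
  by rewrite card_tile// addnn -mul2n expnMn mulnA.
- move=> A /PT[m mN [g' g'I ->]].
  have -> : [set g in C | ~~ [disjoint tile (n g) g & tile m g']] =
      [set g in C | (n g <= M0)%N && ~~ [disjoint tile (n g) g & tile m g']].
    by apply/setP => g; rewrite !inE; case: (boolP (g \in C)) => // /CT[/andP[_ ->] _].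
  apply: (@le_trans _ _ ((M0 + m) ^ d * tile_volume)%:R).
    by rewrite ler_nat card_tile_meet_le.
  rewrite card_tile// !natrM !natrX mulrA ler_wpM2r//.
  have m0 : 0 < m%:R :> R by rewrite ltr0n (leq_trans N0_gt0).
  have -> : (M0 + m)%:R = (1 + M0%:R / m%:R) * m%:R :> R.
    by rewrite mulrDl mul1r divfK ?gt_eqF// natrD addrC.
  rewrite exprMn ler_wpM2r ?exprn_ge0//; apply: le_trans M0N0.
  rewrite lerXn2r ?nnegrE ?addr_ge0 ?divr_ge0// lerD2l ler_wpM2l//.
  by rewrite lef_pV2 ?posrE ?ltr0n ?ler_nat// (leq_trans N0_gt0).
Qed.

End tiling_round.

End lattice_tiles.

From mathcomp Require Import all_classical all_reals all_analysis.
From mathcomp Require Import measurable_realfun.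

Import Order.TTheory GRing.Theory Num.Theory.
Import numFieldNormedType.Exports.

Local Open Scope classical_set_scope.
Local Open Scope ring_scope.

Lemma eq_leW {disp : Order.disp_t} {T : porderType disp} (x y : T) : x = y -> (x <= y)%O.
Proof. by move->. Qed.

(** * Comparison of integrals and square-integrable functions *)

Section integral_utilities.
Context d (T : measurableType d) (R : realType).
Variable mu : {measure set T -> \bar R}.
Local Open Scope ereal_scope.

Lemma ge0_le_integralT (f g : T -> \bar R) : (forall x, 0 <= f x) ->
  (forall x, f x <= g x) -> \int[mu]_x f x <= \int[mu]_x g x.
Proof.
move=> f0 fg; rewrite !ge0_integralTE//; last by move=> x; exact: le_trans (fg x).
apply: le_ereal_sup => _ [h hf <-]; exists h => // x.
by rewrite (le_trans (hf x)).
Qed.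

(** The function [f] is caught between the two functions equal to [h] off [N] and to [0] or [+oo] on
    [N]. This serves for functions of [walk], whose value comes from a choice and which is only
    compared with measurable functions off a null set. *)
Lemma ge0_integral_null_eq (N : set T) (f h : T -> \bar R) :
  measurable N -> mu N = 0 -> measurable_fun setT h ->
  (forall x, 0 <= f x) -> (forall x, 0 <= h x) ->
  (forall x, ~ N x -> f x = h x) -> \int[mu]_x f x = \int[mu]_x h x.
Proof.
move=> mN N0 mh f0 h0 fh.
have key (c : \bar R) : 0 <= c ->
    \int[mu]_x (if x \in N then c else h x) = \int[mu]_x h x.
  move=> c0; apply: ge0_ae_eq_integral => //.
  - apply: measurable_fun_if => //; last by apply: measurable_funTS.
    by apply: (measurable_fun_bool true); rewrite setTI preimage_mem_true.
  - by move=> x _; case: ifP.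
  - exists N; split => // x /= xN; apply: contrapT => Nx; apply: xN => _.
    by rewrite (memNset Nx).
apply/eqP; rewrite eq_le; apply/andP; split.
- rewrite -(key +oo)//; apply: ge0_le_integralT => // x.
  by case: ifPn => [_|/negP]; [rewrite leey|rewrite inE => /fh ->].
- rewrite -(key 0)//; apply: ge0_le_integralT => x.
  by case: ifP.
  by case: ifPn => // /negP; rewrite inE => /fh ->.
Qed.

Lemma integral_null_eq (N : set T) (f h : T -> \bar R) :
  measurable N -> mu N = 0 -> measurable_fun setT h ->
  (forall x, ~ N x -> f x = h x) -> \int[mu]_x f x = \int[mu]_x h x.
Proof.
move=> mN N0 mh fh; rewrite integralE [RHS]integralE; congr (_ - _).
- apply: (ge0_integral_null_eq mN) => //; first exact: measurable_funepos.
  by move=> x /fh fhx; rewrite !funeposE fhx.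
- apply: (ge0_integral_null_eq mN) => //; first exact: measurable_funeneg.
  by move=> x /fh fhx; rewrite !funenegE fhx.
Qed.

Lemma Lfun2P (f : T -> R) : f \in Lfun mu 2%:E <->
  measurable_fun setT f /\ \int[mu]_x (f x ^+ 2)%:E < +oo.
Proof.
split=> [f2|[mf f2]].
  split; first by move: f2; rewrite inE => /andP[/[!inE]].
  have /integrableP[_] := Lfun2_integrable_sqr f2.
  by under eq_integral do rewrite /= ger0_norm ?sqr_ge0//.
rewrite inE; apply/andP; split; rewrite inE//= /finite_norm unlock.
rewrite poweR_lty//; apply: le_lt_trans f2.
apply: eq_leW; apply: eq_integral => x _ /=.
by rewrite powR_mulrn// real_normK ?num_real.
Qed.

Lemma Lnorm2E (f : T -> R) : measurable_fun setT f ->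
  'N[mu]_2%:E[EFin \o f] = (\int[mu]_x (f x ^+ 2)%:E) `^ 2^-1.
Proof.
move=> mf; rewrite unlock; congr (_ `^ _); apply: eq_integral => x _ /=.
by rewrite powR_mulrn// real_normK ?num_real.
Qed.

Lemma Rintegral_sqr (f : T -> R) : f \in Lfun mu 2%:E ->
  (\int[mu]_x (f x ^+ 2))%R%:E = \int[mu]_x (f x ^+ 2)%:E.
Proof.
move=> /Lfun2P[mf f2]; rewrite /Rintegral fineK// ge0_fin_numE//.
by apply: integral_ge0 => x _; rewrite lee_fin sqr_ge0.
Qed.

Lemma Rintegral_sqr_ge0 (f : T -> R) : (0 <= \int[mu]_x (f x ^+ 2))%R.
Proof. by apply: Rintegral_ge0 => // x _; exact: sqr_ge0. Qed.

Lemma Lfun2_mulP (f g : T -> R) : f \in Lfun mu 2%:E -> g \in Lfun mu 2%:E ->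
  mu.-integrable setT (EFin \o (fun x => f x * g x)%R).
Proof. by move=> f2 g2; apply/Lfun1_integrable; exact: Lfun2_mul_Lfun1. Qed.

Lemma cauchy_schwarz (f g : T -> R) :
  f \in Lfun mu 2%:E -> g \in Lfun mu 2%:E ->
  (`|\int[mu]_x (f x * g x)| <=
   Num.sqrt (\int[mu]_x (f x ^+ 2)) * Num.sqrt (\int[mu]_x (g x ^+ 2)))%R.
Proof.
move=> f2 g2; have fg1 := Lfun2_mulP f2 g2.
have [mf _] := (Lfun2P f).1 f2; have [mg _] := (Lfun2P g).1 g2.
apply: (le_trans (le_normr_Rintegral _ fg1)) => //.
rewrite -lee_fin EFinM /Rintegral fineK; last first.
  have /integrableP[_ fgoo] := fg1; rewrite ge0_fin_numE//.
  by apply: integral_ge0 => x _; rewrite lee_fin.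
have := @hoelder _ _ _ mu f g 2 2 mf mg ltac:(lra) ltac:(lra) ltac:(lra).
rewrite Lnorm1 !Lnorm2E// -!Rintegral_sqr// !poweR_EFin !powR12_sqrt//.
exact: Rintegral_sqr_ge0. exact: Rintegral_sqr_ge0.
Qed.

End integral_utilities.

(** * Sums over countable sets as series *)

Section countable_sums.
Context {R : realType}.
Local Open Scope ereal_scope.

Lemma esum_single (T : choiceType) (A : set T) (a : T -> \bar R) t :
  A t -> (forall x, 0 <= a x) -> (forall x, A x -> x <> t -> a x = 0) ->
  \esum_(x in A) a x = a t.
Proof.
move=> At a0 ax; rewrite -(esum_set1 (a0 t)) esum_mkcond [RHS]esum_mkcond.
apply: eq_esum => x _; case: ifPn => [|/negP]; rewrite inE => Ax.
  case: ifPn => [//|/negP]; rewrite inE => xt; exact: ax.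
by case: ifPn => //; rewrite inE => xt; case: Ax; rewrite xt.
Qed.

Lemma esum_exchange (T1 T2 : choiceType) (A : set T1) (B : set T2)
    (a : T1 -> T2 -> \bar R) : (forall x y, 0 <= a x y) ->
  \esum_(x in A) \esum_(y in B) a x y = \esum_(y in B) \esum_(x in A) a x y.
Proof.
move=> a0; rewrite (@esum_esum _ _ _ A (fun=> B))// (@esum_esum _ _ _ B (fun=> A))//.
rewrite (reindex_esum (B `*` A) _ (fun x => (x.2, x.1)))//; split=> //=.
- by move=> [i j] [/=].
- by move=> [i1 i2] [j1 j2] /= _ _ [] -> ->.
- by move=> [i1 i2] [Pi1 Qi2] /=; exists (i2, i1).
Qed.

(** One enumeration [e] serves all summands at once, so that a sum depending on a parameter becomes
    a series of functions, to which the convergence theorems for integrals apply. *)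
Lemma countable_esum (T : choiceType) (A : set T) (t0 : T) : countable A ->
  exists (e : nat -> T) (P : set nat), (forall n, P n -> A (e n)) /\
  forall a : T -> \bar R, (forall x, A x -> 0 <= a x) ->
    \esum_(x in A) a x = \sum_(n <oo) (if n \in P then a (e n) else 0).
Proof.
move=> /countable_bijP[P] /card_set_bijP[f fbij].
have [fAP finj fsurj] := fbij.
pose e n := xget t0 [set x | A x /\ f x = n].
have eP n : P n -> A (e n) /\ f (e n) = n.
  by move=> /fsurj[x Ax fxn]; rewrite /e; case: xgetP => // /(_ x) [].
have ef x : A x -> e (f x) = x.
  move=> Ax; have [Aefx fefx] := eP _ (fAP _ Ax).
  by apply: finj; rewrite ?inE.
exists e, P; split=> [n /eP[]//|a a0].
transitivity (\esum_(x in A) a (e (f x))).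
  by apply: eq_esum => x /ef ->.
rewrite -(reindex_esum A P f (a \o e))// esum_mkcond nneseries_esumT// => n.
by case: ifPn => //; rewrite inE => /eP[? _]; exact: a0.
Qed.

Lemma integral_esum d (T : measurableType d) (I : choiceType) (i0 : I) (A : set I)
    (mu : {measure set T -> \bar R}) (D : set T) (f : I -> T -> \bar R) :
  measurable D -> countable A -> (forall i, A i -> measurable_fun D (f i)) ->
  (forall i x, A i -> 0 <= f i x) ->
  \int[mu]_(x in D) (\esum_(i in A) f i x) = \esum_(i in A) \int[mu]_(x in D) f i x.
Proof.
move=> mD cA mf f0; have [e [P [PA eA]]] := countable_esum i0 cA.
rewrite eA; last by move=> i Ai; apply: integral_ge0 => x _; exact: f0.
under eq_integral do (rewrite eA; last by move=> i Ai; exact: f0).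
rewrite integral_nneseries//.
- apply: eq_eseriesr => n _; case: ifPn => //; rewrite ?integral0//.
- move=> n; case: (boolP (n \in P)) => [|_]; last exact: measurable_cst.
  by rewrite inE => /PA/mf.
- by move=> n x _; case: ifPn => // /[!inE] /PA An; exact: f0.
Qed.

Lemma measurable_fun_esum d (T : measurableType d) (I : choiceType) (i0 : I)
    (A : set I) (D : set T) (f : I -> T -> \bar R) :
  measurable D -> countable A -> (forall i, A i -> measurable_fun D (f i)) ->
  (forall i x, A i -> 0 <= f i x) ->
  measurable_fun D (fun x => \esum_(i in A) f i x).
Proof.
move=> mD cA mf f0; have [e [P [PA eA]]] := countable_esum i0 cA.
apply: (eq_measurable_fun (fun x => \sum_(n <oo) (if n \in P then f (e n) x else 0))).
  by move=> x _; rewrite eA// => i Ai; exact: f0.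
apply: ge0_emeasurable_sum => [n x Dx _|n _].
  by case: ifPn => // /[!inE] /PA An; exact: f0.
case: (boolP (n \in P)) => [|_]; last exact: measurable_cst.
by rewrite inE => /PA/mf.
Qed.

End countable_sums.

(** * Borel sets of R^d *)

Section rV_measurability.
Context {R : realType} {d : nat}.

Lemma open_measurable_rV (U : set 'rV[R]_d) : open U -> measurable U.
Proof. by move=> oU; exact: sub_sigma_algebra. Qed.

Lemma closed_measurable_rV (F : set 'rV[R]_d) : closed F -> measurable F.
Proof.
move=> cF; rewrite -(setCK F); apply: measurableC; apply: open_measurable_rV.
by apply: closed_openC.
Qed.

Lemma measurable_set1_rV (x : 'rV[R]_d) : measurable [set x].
Proof. by apply: closed_measurable_rV; apply: accessible_closed_set1; exact/hausdorff_accessible/norm_hausdorff. Qed.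

Lemma countable_measurable_rV (A : set 'rV[R]_d) : countable A -> measurable A.
Proof. by apply: countable_measurable => x; exact: measurable_set1_rV. Qed.

Lemma continuous_measurable_rV (f : 'rV[R]_d -> R) :
  continuous f -> measurable_fun setT f.
Proof.
move=> cf; apply: (measurability _ (RGenOpens.measurableE R)).
move=> _ [_ [a [b ->] <-]]; rewrite setTI; apply: open_measurable_rV.
by apply: open_comp => [x _|]; [exact: cf|exact: interval_open].
Qed.

(** Countable sets are Borel. This settles the measurability in the space variable of everything
    attached to the walk, which vanishes off the countable set of atoms. *)
Lemma measurable_fun_countable_support dT (T : measurableType dT) (A : set 'rV[R]_d)
    (f : 'rV[R]_d -> T) (t : T) :
  countable A -> (forall x, ~ A x -> f x = t) -> measurable_fun setT f.
Proof.
move=> cA fA _ B mB; rewrite setTI.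
have cI : countable (A `&` f @^-1` B) by apply: sub_countable cA; apply: subset_card_le; exact: subIsetl.
have [tB|tB] := pselect (B t).
  have -> : f @^-1` B = (A `&` f @^-1` B) `|` ~` A.
    apply/seteqP; split=> x /=; last by move=> [[]//|/fA ->].
    by have [Ax|nAx] := pselect (A x); [left|right].
  apply: measurableU; first exact: (countable_measurable_rV cI).
  exact: (measurableC (countable_measurable_rV cA)).
have -> : f @^-1` B = A `&` f @^-1` B.
  apply/seteqP; split=> x /=; last by case.
  by have [Ax|/fA ->] := pselect (A x).
exact: (countable_measurable_rV cI).
Qed.

Lemma compact_ball_rV (r : R) : compact [set x : 'rV[R]_d | `|x| <= r].
Proof.
apply: bounded_closed_compact.
  by exists r; split; rewrite ?num_real// => M rM x /= xr; rewrite (le_trans xr)// ltW.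
rewrite (_ : [set x | _] = Num.norm @^-1` [set t | t <= r])//.
by apply: closed_comp => [x _|]; [exact: norm_continuous|exact: closed_le].
Qed.

End rV_measurability.

Section purely_atomic_measures.
Context {R : realType} {d : nat}.
Variable mu : lfmeasure R d.
Hypothesis atomic_mu : purely_atomic mu.
Local Open Scope ereal_scope.

Lemma countable_atoms : countable (atoms mu).
Proof.
have -> : atoms mu = \bigcup_(n in [set: nat]) ([set x : 'rV[R]_d | `|x| <= n%:R]%R `&` atoms mu).
  apply/seteqP; split=> [x mx|x [n _ []]//]; exists (Num.bound `|x|)%R => //; split=> //=.
  by rewrite ltW// archi_boundP.
apply: bigcup_countable => // n _; apply: finite_set_countable.
by apply: atomic_mu.1; exact: compact_ball_rV.
Qed.

Lemma measure_set1_fin x : mu [set x] < +oo.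
Proof. by apply: lfm_finite; exact: compact_set1. Qed.

(** The complement of the atoms is null, and on the atoms [h] is the countable sum of its
    restrictions to single points. *)
Lemma integral_atomic (h : 'rV[R]_d -> \bar R) : measurable_fun setT h ->
  (forall x, 0 <= h x) ->
  \int[mu]_x h x = \esum_(x in atoms mu) (mu [set x] * h x).
Proof.
move=> mh h0; have cA := countable_atoms; have mA := countable_measurable_rV cA.
have nA : mu (~` atoms mu) = 0.
  by rewrite atomic_mu.2 ?setICl ?esum_set0//; exact: measurableC.
pose g x := \esum_(y in atoms mu) (h y * (\1_[set y] x)%:E).
have mg1 y : measurable_fun setT (fun x : 'rV[R]_d => h y * (\1_[set y] x)%:E).
  apply: (measurable_fun_countable_support (A := [set y]) (t := 0)) => [|x xy].
    exact: countable1.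
  by rewrite indicE memNset// mule0.
have g10 (y x : 'rV[R]_d) : 0 <= h y * (\1_[set y] x)%:E by rewrite mule_ge0// lee_fin.
transitivity (\int[mu]_x g x).
  apply: (@ge0_integral_null_eq _ _ _ _ (~` atoms mu)) => //.
  - exact: measurableC.
  - by apply: measurable_fun_esum => //; exact: 0%R.
  - by move=> x; apply: esum_ge0.
  - move=> x /contrapT Ax; rewrite /g (esum_single Ax)//.
      by rewrite indicE mem_set// mule1.
    by move=> y _ yx; rewrite indicE memNset ?mule0// => /= xy; apply: yx.
rewrite integral_esum//; last exact: 0%R.
apply: eq_esum => y Ay.
rewrite ge0_integralZl//.
- by rewrite integral_indic ?setIT 1?muleC//; exact: measurable_set1_rV.
- by apply/measurable_EFinP/measurable_indic; exact: measurable_set1_rV.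
Qed.

End purely_atomic_measures.

(** * Inversion of the Laplace transform *)

Section laplace_transform.
Context {R : realType}.
Local Notation mu := (@lebesgue_measure R).
Implicit Types (G H : R -> R) (L : R -> R) (a : R).

Definition half_line : set R := `[0, +oo[%classic.

Lemma half_lineE s : half_line s = (0 <= s).
Proof. by rewrite /half_line/= in_itv/= andbT. Qed.

Lemma measurable_half_line : measurable half_line.
Proof. exact: measurable_itv. Qed.
Hint Resolve measurable_half_line : core.

Definition lap G a : R :=
  \int[mu]_(s in `[0, +oo[) (expR (- (a * s)) * G s).

Definition bounded_meas G (M : R) : Prop :=
  measurable_fun half_line G /\ forall s, 0 <= s -> `|G s| <= M.

Fixpoint lapdiff (n : nat) L a : R :=
  if n is n'.+1 then lapdiff n' L a - lapdiff n' L (a + 1) else L a.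

Lemma measurable_expRM a : measurable_fun setT (fun s : R => expR (- (a * s))).
Proof.
by apply: measurableT_comp => //; apply: measurableT_comp => //; exact: mulrl_measurable.
Qed.

Lemma integral_expR a : 0 < a ->
  (\int[mu]_(s in half_line) (expR (- (a * s)))%:E = (a^-1)%:E)%E.
Proof.
move=> a0; have /= := integral_exponential_pdf a0.
under eq_integral do rewrite /exponential_pdf -[_%:E]/((EFin \o _) _) -restrict_EFin.
rewrite -integral_mkcond/=.
under eq_integral do rewrite EFinM.
rewrite ge0_integralZl//.
- move=> h; have : (a^-1%:E * (a%:E * \int[mu]_(x in half_line) (expR (- a * x))%:E) = a^-1%:E)%E.
    by rewrite h mule1.
  rewrite muleA -EFinM mulVf ?gt_eqF// mul1e => <-.
  by apply: eq_integral => x _; rewrite mulNr.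
- apply/measurable_EFinP; apply: measurable_funTS.
  by under eq_fun do rewrite mulNr; exact: measurable_expRM.
- by rewrite lee_fin ltW.
Qed.

Lemma integrable_expR a : 0 < a ->
  mu.-integrable half_line (EFin \o (fun s => expR (- (a * s)))).
Proof.
move=> a0; apply/integrableP; split.
  by apply/measurable_EFinP/measurable_funTS; exact: measurable_expRM.
under eq_integral do rewrite /= ger0_norm ?expR_ge0//.
by rewrite integral_expR// ltry.
Qed.

Lemma integrable_lap G M a : bounded_meas G M -> 0 < a ->
  mu.-integrable half_line (EFin \o (fun s => expR (- (a * s)) * G s)).
Proof.
move=> [mG GM] a0.
have M0 : 0 <= M by rewrite (le_trans _ (GM 0 _)).
apply: (@le_integrable _ _ _ mu _ _ _ (EFin \o (fun s => M * expR (- (a * s))))) => //.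
- apply/measurable_EFinP; apply: measurable_funM => //.
  by apply/measurable_funTS; exact: measurable_expRM.
- move=> s; rewrite half_lineE => s0; rewrite lee_fin !normrM mulrC.
  by rewrite ler_wpM2r// (ger0_norm M0) GM.
- by apply: (integrableZl _ M (integrable_expR a0)).
Qed.

Lemma bounded_meas_expM G M n : bounded_meas G M ->
  bounded_meas (fun s => (1 - expR (- s)) ^+ n * G s) M.
Proof.
move=> [mG GM]; split.
  apply: measurable_funM => //; apply: measurable_funTS; apply: measurable_funX.
  by apply: measurable_funB => //; apply: measurableT_comp.
move=> s s0; rewrite normrM (le_trans _ (GM s s0))// ler_piMl// normrX.
rewrite exprn_ile1// ger0_norm ?subr_ge0 ?lerBlDl ?lerDr ?expR_ge0//.
by rewrite -expR0 ler_expR oppr_le0.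
Qed.

Lemma lapdiffE G M n a : bounded_meas G M -> 0 < a ->
  lapdiff n (lap G) a = lap (fun s => (1 - expR (- s)) ^+ n * G s) a.
Proof.
move=> bG; elim: n a => [|n IH] a a0 /=.
  by rewrite /lap; apply: eq_Rintegral => s _; rewrite expr0 mul1r.
have a10 : 0 < a + 1 by rewrite addr_gt0.
rewrite !IH// /lap -RintegralB//; last 2 first.
- by apply: (integrable_lap (bounded_meas_expM n bG)).
- by apply: (integrable_lap (bounded_meas_expM n bG)).
apply: eq_Rintegral => s _; rewrite mulrDl mul1r opprD expRD exprS; ring.
Qed.

Lemma lap1 a : 0 < a -> lap (fun=> 1) a = a^-1.
Proof.
move=> a0; rewrite /lap; under eq_Rintegral do rewrite mulr1.
by rewrite /Rintegral integral_expR.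
Qed.

Lemma eq_lapdiff n L1 L2 a : 0 < a -> (forall b, 0 < b -> L1 b = L2 b) ->
  lapdiff n L1 a = lapdiff n L2 a.
Proof.
move=> + L12; elim: n a => [|n IH] a a0 /=; first exact: L12.
by rewrite !IH// addr_gt0.
Qed.

(** The number [lapdiff n GRing.inv a] is the Beta integral of [u ^ (a - 1) (1 - u) ^ n] over the
    unit interval; the second claim is its recurrence in [a]. *)
Lemma lapdiff_inv n a : 0 < a ->
  0 < lapdiff n GRing.inv a /\
  lapdiff n GRing.inv (a + 1) = a / (a + n.+1%:R) * lapdiff n GRing.inv a.
Proof.
elim: n a => [|n IH] a a0 /=.
  by split; [rewrite invr_gt0|field; rewrite !gt_eqF// addr_gt0].
have [P1 E1] := IH a a0; have [P2 E2] := IH (a + 1) ltac:(by rewrite addr_gt0).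
have n0 : 0 <= n%:R :> R by rewrite ler0n.
have an0 : 0 < a + n.+1%:R by rewrite addr_gt0// ltr0n.
rewrite E2 E1 -[n.+2]addn1 -[n.+1]addn1 !natrD; split.
  rewrite -[X in X - _]mul1r -mulrBl mulr_gt0//.
  rewrite subr_gt0 ltr_pdivrMr ?mul1r ?ltrDl ?ltr0n//; lra.
by field; apply/andP; split; rewrite gt_eqF//; lra.
Qed.

(** The solution [a] of [a / (a + n.+1) = expR (- t)]: the Beta law of parameters [a] and [n.+1]
    then has mean [expR (- t)]. *)
Definition kernel_pt (t : R) (n : nat) : R := n.+1%:R * (expR (- t) / (1 - expR (- t))).

(* The operator [linv t n], applied to a Laplace transform, averages the
   original function against the law of -ln U, with U of Beta distribution of
   mean exp(-t) and variance O(1/n). *)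
Definition linv (t : R) (n : nat) L : R :=
  lapdiff n L (kernel_pt t n) / lapdiff n GRing.inv (kernel_pt t n).

Lemma kernel_pt_gt0 t n : 0 < t -> 0 < kernel_pt t n.
Proof.
move=> t0; rewrite /kernel_pt mulr_gt0 ?divr_gt0 ?expR_gt0//.
by rewrite subr_gt0 -expR0 ltr_expR oppr_lt0.
Qed.

Lemma lap_le G H M N a : bounded_meas G M -> bounded_meas H N -> 0 < a ->
  (forall s, 0 <= s -> G s <= H s) -> lap G a <= lap H a.
Proof.
move=> bG bH a0 GH; apply: le_Rintegral => //.
- exact: integrable_lap bG a0.
- exact: integrable_lap bH a0.
- by move=> s /=; rewrite in_itv/= andbT => s0; rewrite ler_wpM2l ?expR_ge0 ?GH.
Qed.

Lemma lapD G H M N a : bounded_meas G M -> bounded_meas H N -> 0 < a ->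
  lap (fun s => G s + H s) a = lap G a + lap H a.
Proof.
move=> bG bH a0; rewrite /lap -RintegralD//.
- by apply: eq_Rintegral => s _; rewrite mulrDr.
- exact: integrable_lap bG a0.
- exact: integrable_lap bH a0.
Qed.

Lemma lapZ G M c a : bounded_meas G M -> 0 < a ->
  lap (fun s => c * G s) a = c * lap G a.
Proof.
move=> bG a0; rewrite /lap -RintegralZl//; last exact: integrable_lap bG a0.
by apply: eq_Rintegral => s _; rewrite mulrCA.
Qed.

Lemma lap_expR G a : 0 < a -> lap (fun s => expR (- s) * G s) a = lap G (a + 1).
Proof.
move=> a0; apply: eq_Rintegral => s _.
by rewrite mulrA -expRD; congr (expR _ * _); ring.
Qed.

Lemma bounded_meas_cst c : bounded_meas (fun=> c) `|c|.
Proof. by split. Qed.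

Lemma bounded_measM G H M N : bounded_meas G M -> bounded_meas H N ->
  bounded_meas (fun s => G s * H s) (M * N).
Proof.
move=> [mG GM] [mH HN]; split; first exact: measurable_funM.
by move=> s s0; rewrite normrM ler_pM ?GM ?HN.
Qed.

Lemma bounded_measD G H M N : bounded_meas G M -> bounded_meas H N ->
  bounded_meas (fun s => G s + H s) (M + N).
Proof.
move=> [mG GM] [mH HN]; split; first exact: measurable_funD.
by move=> s s0; rewrite (le_trans (ler_normD _ _))// lerD ?GM ?HN.
Qed.

Lemma bounded_meas_expR : bounded_meas (fun s => expR (- s)) 1.
Proof.
split; first by apply: measurable_funTS; apply: measurableT_comp.
by move=> s s0; rewrite ger0_norm ?expR_ge0// -expR0 ler_expR oppr_le0.
Qed.

(** Chebyshev's inequality: under the normalized weight, [expR (- s)] has mean [expR (- t)] and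
    variance at most [n.+1%:R^-1], so it deviates by [delta] with probability at most
    [delta ^- 2 / n.+1%:R]. *)
Lemma linv_approx (t delta M c eta : R) G n K :
  0 < t -> 0 < delta -> 0 <= eta -> bounded_meas G K ->
  (forall s : R, 0 <= s -> `|G s - c| <= M) ->
  (forall s : R, 0 <= s -> `|expR (- s) - expR (- t)| < delta -> `|G s - c| <= eta) ->
  `|linv t n (lap G) - c| <= eta + M / delta ^+ 2 / n.+1%:R.
Proof.
move=> t0 d0 eta0 bG GM Geta.
set u := expR (- t); set a := kernel_pt t n.
have a0 : 0 < a by exact: kernel_pt_gt0.
have u0 : 0 < u by exact: expR_gt0.
have u1 : u < 1 by rewrite -expR0 ltr_expR oppr_lt0.
have M0 : 0 <= M by rewrite (le_trans _ (GM 0 _)).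
have aE : a = n.+1%:R * (u / (1 - u)) by [].
pose I := lapdiff n (@GRing.inv R).
have [I0 I1] : 0 < I a /\ I (a + 1) = a / (a + n.+1%:R) * I a := lapdiff_inv n a0.
have a10 : 0 < a + 1 by lra.
have I2 : I (a + 1 + 1) = (a + 1) / (a + 1 + n.+1%:R) * I (a + 1) := (lapdiff_inv n a10).2.
pose k (s : R) : R := (1 - expR (- s)) ^+ n.
have bk : bounded_meas (fun s => k s * 1) `|1| by exact: bounded_meas_expM (bounded_meas_cst 1).
have bk1 : bounded_meas k 1.
  by rewrite normr1 in bk; have -> : k = (fun s => k s * 1) by apply/funext => s; rewrite mulr1.
have lapk b : 0 < b -> lap k b = I b.
  move=> b0; rewrite /I (eq_lapdiff n b0 (fun x x0 => esym (lap1 x0))).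
  rewrite (lapdiffE n (bounded_meas_cst 1) b0); congr lap.
  by apply/funext => s; rewrite mulr1.
have be := bounded_meas_expR.
pose Q (s : R) : R := (expR (- s) - u) ^+ 2.
have QE : Q = (fun s => expR (- s) * (expR (- s) * 1) + ((- 2 * u) * (expR (- s) * 1) + u ^+ 2)).
  by apply/funext => s; rewrite /Q; ring.
have [KQ bQ] : exists KQ, bounded_meas (fun s => k s * Q s) KQ.
  eexists; apply: (bounded_measM bk1); rewrite QE; apply: (bounded_measD (bounded_measM be (bounded_measM be (bounded_meas_cst 1)))).
  by apply: (bounded_measD (bounded_measM (bounded_meas_cst _) (bounded_measM be (bounded_meas_cst 1))) (bounded_meas_cst _)).
(* The unnormalized variance. Two uses of the recurrence give [u * (X - u)] with
   [X = (a + 1) / (a + 1 + n.+1%:R)], and [X - u] is at most [n.+1%:R^-1]. *)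
have lapQ : lap (fun s => k s * Q s) a <= I a / n.+1%:R.
  have -> : (fun s => k s * Q s) = (fun s => expR (- s) * (expR (- s) * k s) +
      ((- 2 * u) * (expR (- s) * k s) + u ^+ 2 * k s)).
    by rewrite QE; apply/funext => s; ring.
  rewrite (lapD (bounded_measM be (bounded_measM be bk1))
    (bounded_measD (bounded_measM (bounded_meas_cst _) (bounded_measM be bk1)) (bounded_measM (bounded_meas_cst _) bk1)) a0).
  rewrite (lapD (bounded_measM (bounded_meas_cst _) (bounded_measM be bk1)) (bounded_measM (bounded_meas_cst _) bk1) a0).
  rewrite (lapZ _ (bounded_measM be bk1) a0) (lapZ _ bk1 a0).
  rewrite !lap_expR// !lapk//; last lra.
  rewrite I2 I1.
  have n0 : 0 < n.+1%:R :> R by rewrite ltr0n.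
  have ua : a / (a + n.+1%:R) = u.
    rewrite aE; move: (n.+1%:R : R) n0 => N N0.
    field; apply/andP; split; first by rewrite gt_eqF//; lra.
    by rewrite (_ : N * u + N * (1 - u) = N) ?gt_eqF//; ring.
  rewrite ua.
  have : (a + 1) / (a + 1 + n.+1%:R) - u <= n.+1%:R^-1.
    rewrite -ua; have -> : (a + 1) / (a + 1 + n.+1%:R) - a / (a + n.+1%:R) =
       n.+1%:R / ((a + 1 + n.+1%:R) * (a + n.+1%:R)).
      by field; apply/andP; split; rewrite gt_eqF//; lra.
    rewrite ler_pdivrMr; last by rewrite mulr_gt0//; lra.
    rewrite mulrC ler_pdivlMr// ler_pM//; lra.
  set X := _ / _ => h.
  have -> : X * (u * I a) + (- 2 * u * (u * I a) + u ^+ 2 * I a) = I a * (u * (X - u)) by ring.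
  rewrite ler_wpM2l ?(ltW I0)//.
  have [Xu|Xu] := leP 0 (X - u).
    by rewrite (le_trans _ h)// ler_piMl// ltW.
  by rewrite (@le_trans _ _ 0)// ?invr_ge0// mulr_ge0_le0// ltW.
have bGc : bounded_meas (fun s => G s - c) (K + `|- c|).
  by apply: bounded_measD => //; exact: bounded_meas_cst.
have bkGc := bounded_measM bk1 bGc.
have [Kup bup] : exists Kup,
    bounded_meas (fun s => eta * k s + (M / delta ^+ 2) * (k s * Q s)) Kup.
  eexists; apply: (bounded_measD (bounded_measM (bounded_meas_cst _) bk1) (bounded_measM (bounded_meas_cst _) bQ)).
have main s : 0 <= s -> `|k s * (G s - c)| <= eta * k s + (M / delta ^+ 2) * (k s * Q s).
  move=> s0.
  have k0 : 0 <= k s.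
    by rewrite exprn_ge0// subr_ge0 -expR0 ler_expR oppr_le0.
  rewrite normrM (ger0_norm k0) mulrC mulrCA [eta * _]mulrC -mulrDr mulrC ler_wpM2l//.
  have [ds|ds] := ltP `|expR (- s) - u| delta.
    by rewrite (le_trans (Geta s s0 ds))// lerDl mulr_ge0 ?sqr_ge0// divr_ge0// exprn_ge0// ltW.
  rewrite (le_trans (GM s s0))// ler_wpDl// -mulrA ler_peMr// mulrC ler_pdivlMr ?exprn_gt0// mul1r.
  by rewrite /Q -(real_normK (num_real (expR (- s) - u))) ler_sqr ?nnegrE ?(ltW d0).
have J : lapdiff n (lap G) a - c * I a = lap (fun s => k s * (G s - c)) a.
  rewrite (lapdiffE n bG a0) -(lapk a a0).
  have := lapD (bounded_meas_expM n bG) (bounded_measM (bounded_meas_cst (- c)) bk1) a0.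
  rewrite (lapZ _ bk1 a0) mulNr => <-; apply: eq_Rintegral => s _; rewrite /k; ring.
have Jup : lap (fun s => eta * k s + M / delta ^+ 2 * (k s * Q s)) a <=
    (eta + M / delta ^+ 2 / n.+1%:R) * I a.
  rewrite (lapD (bounded_measM (bounded_meas_cst _) bk1) (bounded_measM (bounded_meas_cst _) bQ) a0).
  rewrite (lapZ _ bk1 a0) (lapZ _ bQ a0) lapk// mulrDl lerD2l.
  by rewrite -[leRHS]mulrA [_^-1 * _]mulrC ler_wpM2l// divr_ge0// exprn_ge0// ltW.
have -> : linv t n (lap G) - c = (lapdiff n (lap G) a - c * I a) / I a.
  by rewrite mulrBl mulfK ?gt_eqF.
rewrite normrM normfV (gtr0_norm I0) ler_pdivrMr// (le_trans _ Jup)// J ler_norml.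
apply/andP; split.
  have := lap_le (bounded_measM (bounded_meas_cst (-1)) bup) bkGc a0.
  rewrite (lapZ _ bup a0) mulN1r; apply => s s0.
  by rewrite mulN1r; have := main s s0; rewrite ler_norml => /andP[].
by apply: (lap_le bkGc bup a0) => s s0; rewrite (le_trans (ler_norm _))// main.
Qed.

(** The order [N] depends on [t], [delta], [M] and [eps] but neither on [G] nor on [c]. A single
    order thus serves a whole family of functions, and it can be fixed before another limit is
    taken. *)
Lemma linv_uniform (t delta M eps : R) : 0 < t -> 0 < delta -> 0 < eps ->
  exists N, forall n, (N <= n)%N -> forall (eta c : R) G, 0 <= eta -> bounded_meas G M ->
  `|c| <= M ->
  (forall s, 0 <= s -> `|s - t| < delta -> `|G s - c| <= eta) ->
  `|linv t n (lap G) - c| <= eta + eps.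
Proof.
move=> t0 d0 e0.
have [M0|M0] := ltP M 0.
  by exists 0%N => n _ eta c G _ _ cM; have := le_trans (normr_ge0 _) cM; lra.
pose u := expR (- t).
have uM : u < expR (- (t - delta)) by rewrite ltr_expR; lra.
have um : expR (- (t + delta)) < u by rewrite ltr_expR; lra.
(* The window around [t] transported by [s |-> expR (- s)]. *)
pose d' := Num.min (u - expR (- (t + delta))) (expR (- (t - delta)) - u).
have d'0 : 0 < d' by rewrite lt_min !subr_gt0 uM um.
have C0 : 0 <= M * 2 / d' ^+ 2 by rewrite divr_ge0 ?mulr_ge0// ?exprn_ge0// ?ltW.
exists (Num.bound (M * 2 / d' ^+ 2 / eps)) => n Nn eta c G eta0 bG cM Geta.
apply: (@le_trans _ _ (eta + M * 2 / d' ^+ 2 / n.+1%:R)).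
  apply: (@linv_approx t d' (M * 2) c eta G n M) => //.
    move=> s s0; rewrite (le_trans (ler_normB _ _))// mulr_natr mulr2n lerD//.
    by case: bG => _; apply.
  move=> s s0 sd; apply: Geta => //.
  have : d' <= u - expR (- (t + delta)) by rewrite ge_min lexx.
  have : d' <= expR (- (t - delta)) - u by rewrite ge_min lexx orbT.
  move: sd; rewrite ltr_norml => /andP[h1 h2] h3 h4.
  have h5 : expR (- s) < expR (- (t - delta)) by rewrite /u in h2 h3; lra.
  have h6 : expR (- (t + delta)) < expR (- s) by rewrite /u in h1 h4; lra.
  by rewrite ltr_norml; rewrite !ltr_expR in h5 h6; apply/andP; split; lra.
rewrite lerD2l ler_pdivrMr ?ltr0n// [leRHS]mulrC -ler_pdivrMr// ltW//.
apply: lt_le_trans (archi_boundP _) _; first by rewrite divr_ge0// ltW.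
by rewrite ler_nat; apply: leq_trans Nn _.
Qed.

Lemma lapdiff_cvg (I : Type) (F : set_system I) {FF : Filter F} (L : I -> R -> R) (L0 : R -> R) n a :
  0 < a -> (forall b, 0 < b -> L i b @[i --> F] --> L0 b) ->
  lapdiff n (L i) a @[i --> F] --> lapdiff n L0 a.
Proof.
move=> + LL; elim: n a => [|n IH] a a0 /=; first exact: LL.
by apply: cvgB; apply: IH => //; rewrite addr_gt0.
Qed.

Lemma linv_cvg (I : Type) (F : set_system I) {FF : Filter F} (L : I -> R -> R) (L0 : R -> R) t n :
  0 < t -> (forall b, 0 < b -> L i b @[i --> F] --> L0 b) ->
  linv t n (L i) @[i --> F] --> linv t n L0.
Proof.
move=> t0 LL; apply: cvgM; last exact: cvg_cst.
by apply: lapdiff_cvg => //; exact: kernel_pt_gt0.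
Qed.

Definition right_continuous_half_line G : Prop := forall t, 0 <= t -> forall eta, 0 < eta ->
  exists2 delta, 0 < delta & forall s, t <= s < t + delta -> `|G s - G t| <= eta.

(** As [n] grows the sampling points of [linv] go to infinity, so values of the transforms beyond
    [a0] suffice. Right continuity is the regularity proved below for the transition probabilities
    of the walk. *)
Lemma lap_uniq_half_line G H M a0 : bounded_meas G M -> bounded_meas H M ->
  right_continuous_half_line G -> right_continuous_half_line H ->
  (forall a, a0 < a -> 0 < a -> lap G a = lap H a) ->
  forall t, 0 <= t -> G t = H t.
Proof.
move=> bG bH rG rH GH t t0; apply/eqP; rewrite -subr_eq0 -normr_le0.
apply/ler_addgt0Pl => e e0; rewrite addr0.
have e4 : 0 < e / 4 by lra.
have [d1 d10 D1] := rG t t0 _ e4; have [d2 d20 D2] := rH t t0 _ e4.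
pose d := Num.min d1 d2.
have d0 : 0 < d by rewrite lt_min d10.
have dd1 : d <= d1 by rewrite ge_min lexx.
have dd2 : d <= d2 by rewrite ge_min lexx orbT.
(* The inversion is centred to the right of [t], in the middle of an interval where both functions
   are close to their values at [t]: nothing is known to the left of [t]. *)
pose tau := t + d / 2.
have tau0 : 0 < tau by rewrite /tau; lra.
have [N1 P1] := @linv_uniform tau (d / 2) M (e / 4) tau0 ltac:(lra) e4.
pose lam := expR (- tau) / (1 - expR (- tau)).
have lam0 : 0 < lam.
  by rewrite /lam divr_gt0 ?expR_gt0// subr_gt0 -expR0 ltr_expR oppr_lt0.
(* The sampling point is [n.+1%:R * lam], which exceeds [a0] for this [n]. *)
pose n := maxn N1 (Num.bound (a0 / lam)).
have a0n : a0 < kernel_pt tau n.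
  rewrite -ltr_pdivrMr//.
  have [a00|a00] := leP 0 a0; last by rewrite (@lt_trans _ _ 0) ?ltr0n// pmulr_llt0 ?invr_gt0.
  apply: lt_le_trans (archi_boundP _) _; first by rewrite divr_ge0// ltW.
  by rewrite ler_nat (leq_trans (leq_maxr N1 _))// leqW.
have near s : 0 <= s -> `|s - tau| < d / 2 -> t <= s < t + d.
  by move=> s0; rewrite /tau ltr_norml => /andP[h1 h2]; apply/andP; split; lra.
have Gt : `|G t| <= M by case: bG => _; exact.
have Ht : `|H t| <= M by case: bH => _; exact.
have PG := P1 n (leq_maxl _ _) (e / 4) (G t) G (ltW e4) bG Gt.
have PH := P1 n (leq_maxl _ _) (e / 4) (H t) H (ltW e4) bH Ht.
have {}PG : `|linv tau n (lap G) - G t| <= e / 4 + e / 4.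
  by apply: PG => s s0 /near; move=> /(_ s0) /andP[h1 h2]; apply: D1; rewrite h1/=; lra.
have {}PH : `|linv tau n (lap H) - H t| <= e / 4 + e / 4.
  by apply: PH => s s0 /near; move=> /(_ s0) /andP[h1 h2]; apply: D2; rewrite h1/=; lra.
have E : linv tau n (lap G) = linv tau n (lap H).
  rewrite /linv; congr (_ / _).
  have : 0 < kernel_pt tau n by exact: kernel_pt_gt0.
  elim: (n in lapdiff n) (kernel_pt tau n) a0n => [|m IH] a aa a00 /=; first exact: GH.
  by congr (_ - _); apply: IH => //; lra.
rewrite E in PG; move: PG PH; rewrite !ler_norml => /andP[h1 h2] /andP[h3 h4].
by apply/andP; split; lra.
Qed.

End laplace_transform.
#[global] Hint Resolve measurable_half_line : core.

(** * Exponential holding times and killing *)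

Section killed_exponential.
Context {R : realType} dX (Xi : measurableType dX).
Local Open Scope ereal_scope.

Lemma measurable_natr_bool d (T : measurableType d) (D : set T) (b : T -> bool) :
  measurable_fun D b -> measurable_fun D (fun x => (b x)%:R : R).
Proof.
move=> mb mD; have -> : (fun x => (b x)%:R : R) = (fun x => if b x then 1%R else 0%R).
  by apply/funext => x; case: (b x).
exact: (measurable_fun_if mD mb).
Qed.

(* Weight given to a holding time s by the clock killing at rate lam. *)
Definition killed (lam s : R) : R := (if 0 < s then expR (- (lam * s)) else 0)%R.

Lemma killed_ge0 lam s : (0 <= killed lam s)%R.
Proof. by rewrite /killed; case: ifP => // _; exact: expR_ge0. Qed.

Lemma measurable_killed lam : measurable_fun setT (killed lam).
Proof.
apply: measurable_fun_ifT => //; last exact: measurable_expRM.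
by apply: measurable_fun_ltr.
Qed.

Lemma integral_expR_trunc (lam s : R) : (0 < lam)%R ->
  \int[lebesgue_measure]_(u in half_line) (lam * expR (- (lam * u)) * (u < s)%R%:R)%:E =
  ((0 < s)%R%:R - killed lam s)%:E.
Proof.
move=> l0; have [s0|s0] := ltP 0%R s; last first.
  rewrite /killed ltNge s0/= subrr integral0_eq// => u.
  by rewrite half_lineE => u0; rewrite ltNge (le_trans s0 u0) mulr0.
have := exponential_prob_itv0c lam s0; rewrite /exponential_prob => h.
rewrite /killed s0.
transitivity (\int[lebesgue_measure]_(x in `[0%R, s]) (exponential_pdf lam x)%:E); last first.
  by rewrite h -EFinB mulNr.
rewrite -integral_itv_bndo_bndc; last first.
  by apply/measurable_EFinP/measurable_funTS; exact: measurable_exponential_pdf.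
rewrite integral_mkcond [RHS]integral_mkcond; apply: eq_integral => u _.
rewrite !patchE; case: ifPn => [|nu].
  rewrite inE half_lineE => u0; case: ifPn.
    rewrite inE/= in_itv/= u0/= => us; rewrite us mulr1 exponential_pdfE//.
    by rewrite mulNr.
  by move/negP; rewrite inE/= in_itv/= u0/= => /negP/negbTE ->; rewrite mulr0.
case: ifPn => //; rewrite inE/= in_itv/= => /andP[u0 _].
by move: nu => /negP; rewrite inE half_lineE u0.
Qed.

(** The law of [s] is known only through its weighted tails. Since [killed lam s] is the indicator
    of [0 < s] minus the integral over [u] of [lam * expR (- (lam * u))] on [u < s], Tonelli's
    theorem expresses its integral by the tails; the outcome is the Laplace transform of an
    exponential law of rate [r]. *)
Lemma integral_killed (Q : probability Xi R) (Z : Xi -> \bar R) (s : Xi -> R) (c r lam : R) :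
  measurable_fun setT Z -> (forall xi, 0 <= Z xi) -> measurable_fun setT s ->
  (0 < r)%R -> (0 <= lam)%R ->
  (forall u, (0 <= u)%R ->
    \int[Q]_xi (Z xi * ((u < s xi)%R%:R)%:E) = (c * expR (- (r * u)))%:E) ->
  \int[Q]_xi (Z xi * (killed lam (s xi))%:E) = (c * (r / (lam + r)))%:E.
Proof.
move=> mZ Z0 ms r0; rewrite le_eqVlt => /predU1P[<-|l0] H.
  rewrite add0r divff ?gt_eqF// mulr1; have := H 0%R (lexx _).
  rewrite mulr0 oppr0 expR0 mulr1 => <-; apply: eq_integral => xi _.
  by rewrite /killed mul0r oppr0 expR0; case: ifP.
have mlt (u : R) : measurable_fun setT (fun xi => ((u < s xi)%R%:R)%:E : \bar R).
  by apply/measurable_EFinP/measurable_natr_bool/measurable_fun_ltr.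
have mk : measurable_fun setT (fun xi => (killed lam (s xi))%:E : \bar R).
  by apply/measurable_EFinP; apply: (measurableT_comp (measurable_killed lam)).
pose f (p : Xi * R) : \bar R := Z p.1 *
  ((lam * expR (- (lam * p.2)) * (p.2 < s p.1)%R%:R) * \1_half_line p.2)%:E.
have mf : measurable_fun setT f.
  apply: emeasurable_funM; first exact: (measurableT_comp mZ measurable_fst).
  apply/measurable_EFinP; apply: measurable_funM.
    apply: measurable_funM; last first.
      apply: measurable_natr_bool; apply: measurable_fun_ltr => //.
      exact: (measurableT_comp ms measurable_fst).
    apply: measurable_funM => //.
    exact: (measurableT_comp (measurable_expRM lam) measurable_snd).
  exact: (measurableT_comp (measurable_indic measurable_half_line) measurable_snd).
have f0 p : 0 <= f p.
  by rewrite mule_ge0// lee_fin !mulr_ge0 ?expR_ge0 ?(ltW l0).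
have split xi : Z xi * ((0 < s xi)%R%:R)%:E = Z xi * (killed lam (s xi))%:E +
    \int[lebesgue_measure]_u f (xi, u).
  rewrite /f /= ge0_integralZl//; last 2 first.
  - apply/measurable_EFinP; apply: measurable_funM; last exact: (measurable_indic measurable_half_line).
    apply: measurable_funM; last by apply: measurable_natr_bool; apply: measurable_fun_ltr.
    by apply: measurable_funM => //; exact: measurable_expRM.
  - by move=> u _; rewrite lee_fin !mulr_ge0 ?expR_ge0 ?(ltW l0).
  rewrite (_ : \int[lebesgue_measure]_x _ = ((0 < s xi)%R%:R - killed lam (s xi))%:E).
    rewrite -ge0_muleDr ?lee_fin ?killed_ge0//.
      by rewrite -EFinD addrC subrK.
    rewrite /killed; case: ifP => //= s0.
    by rewrite subr_ge0 -expR0 ler_expR oppr_le0 mulr_ge0// ltW.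
  rewrite -(integral_expR_trunc (s xi) l0) [RHS]integral_mkcond.
  apply: eq_integral => u _; rewrite patchE indicE.
  by case: ifPn => uh; rewrite ?mulr1 ?mulr0.
have E1 := H 0%R (lexx _); rewrite mulr0 oppr0 expR0 mulr1 in E1.
have : c%:E = \int[Q]_xi (Z xi * (killed lam (s xi))%:E) + (c * (lam / (lam + r)))%:E.
  rewrite -E1; under eq_integral do rewrite split.
  rewrite ge0_integralD//; last 4 first.
  - by move=> xi _; rewrite mule_ge0// lee_fin killed_ge0.
  - exact: emeasurable_funM.
  - by move=> xi _; apply: integral_ge0.
  - by apply: (@measurable_fun_fubini_tonelli_F _ _ _ _ _ lebesgue_measure f).
  congr (_ + _); rewrite (@fubini_tonelli _ _ _ _ _ Q lebesgue_measure f)//.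
  transitivity (\int[lebesgue_measure]_(u in half_line) ((c * lam) * expR (- ((lam + r) * u)))%:E).
    rewrite [RHS]integral_mkcond; apply: eq_integral => u _; rewrite patchE.
    rewrite /f /=; case: ifPn => [|nu]; last first.
      rewrite integral0_eq// => xi _; rewrite indicE (negbTE nu) mulr0 mule0//.
    rewrite inE => /[dup] u0; rewrite half_lineE => u00; rewrite indicE mem_set//.
    under eq_integral do rewrite mulr1 EFinM [X in _ * X]muleC muleA.
    rewrite ge0_integralZr// ?H//; last 3 first.
    - exact: emeasurable_funM.
    - by move=> xi _; rewrite mule_ge0// lee_fin.
    - by rewrite lee_fin mulr_ge0 ?expR_ge0 ?(ltW l0).
    rewrite -EFinM; congr EFin.
    rewrite [in RHS](_ : - ((lam + r) * u) = - (lam * u) + - (r * u))%R ?expRD; ring.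
  under eq_integral do rewrite EFinM.
  rewrite ge0_integralZl//.
  - rewrite integral_expR ?addr_gt0// -EFinM; congr EFin; ring.
  - exact: measurable_half_line.
  - by apply/measurable_EFinP/measurable_funTS; exact: measurable_expRM.
  - by rewrite lee_fin mulr_ge0// ?(ltW l0)// -lee_fin -E1; apply: integral_ge0 => xi _; rewrite mule_ge0// lee_fin.
move=> /(congr1 (fun t => t - (c * (lam / (lam + r)))%:E)); rewrite addeK// => <-.
by rewrite -EFinB; congr EFin; field; rewrite gt_eqF// addr_gt0.
Qed.

End killed_exponential.

(** * Reversible jump chains *)

Section jump_chain.
Context {R : realType} {d : nat} {dX : measure_display} {Xi : measurableType dX}.
Variables (Y : nat -> Xi -> 'rV[R]_d) (S : nat -> Xi -> R).
Variables (A : set 'rV[R]_d) (q : 'rV[R]_d -> 'rV[R]_d -> R).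
Hypothesis cA : countable A.
Hypothesis q_ge0 : forall x y, 0 <= q x y.
Hypothesis rateA : forall x, A x -> (0 < total_rate A q x < +oo)%E.

Lemma esumZ (B : set 'rV[R]_d) (c : \bar R) (a : 'rV[R]_d -> \bar R) : countable B ->
  (0 <= c)%E -> (forall x, B x -> 0 <= a x)%E ->
  (\esum_(x in B) (c * a x) = c * \esum_(x in B) a x)%E.
Proof.
move=> cB c0 a0; have [e [P [PB eB]]] := @countable_esum R _ _ (0 : 'rV[R]_d) cB.
have ae n : (0 <= if n \in P then a (e n) else 0)%E.
  by case: ifPn => //; rewrite inE => /PB; exact: a0.
rewrite !eB//; last by move=> x Bx; rewrite mule_ge0// a0.
rewrite -!ge0_integral_count//; last first.
  by move=> n; case: ifPn => //; rewrite inE => /PB Bn; rewrite mule_ge0// a0.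
by rewrite -ge0_integralZl//; apply: eq_integral => n _; case: ifPn => //; rewrite mule0.
Qed.

Definition exit_rate x : R := fine (total_rate A q x).
Local Notation rr := exit_rate.

Lemma exit_rate_ge0 x : 0 <= rr x.
Proof. by apply/fine_ge0/esum_ge0 => y _; rewrite lee_fin. Qed.

Lemma exit_rate_gt0 x : A x -> 0 < rr x.
Proof. by move=> /rateA; exact: fine_gt0. Qed.

Lemma exit_rateE x : A x -> (\esum_(y in A) (q x y)%:E = (rr x)%:E)%E.
Proof.
by move=> /rateA/andP[r0 roo]; rewrite /exit_rate fineK// ge0_fin_numE// ltW.
Qed.

(* n-step transition weights of the jump chain killed at rate lam. *)
Fixpoint killed_power (lam : R) (n : nat) (x z : 'rV[R]_d) : \bar R :=
  if n is n'.+1 then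
    (\esum_(y in A) (killed_power lam n' x y * (q y z / (lam + rr y))%:E))%E
  else ((x == z)%:R)%:E.
Local Notation M := killed_power.

Lemma killed_power_ge0 lam n x z : 0 <= lam -> (0 <= M lam n x z)%E.
Proof.
move=> l0; elim: n z => [|n IH] z /=; first by rewrite lee_fin.
by apply: esum_ge0 => y _; rewrite mule_ge0// lee_fin divr_ge0// addr_ge0// exit_rate_ge0.
Qed.

Lemma step_weight_ge0 lam y z : 0 <= lam -> 0 <= q y z / (lam + rr y).
Proof. by move=> l0; rewrite divr_ge0// addr_ge0// exit_rate_ge0. Qed.

Lemma esum_step_weight lam y : 0 <= lam -> A y ->
  (\esum_(z in A) (q y z / (lam + rr y))%:E = (rr y / (lam + rr y))%:E)%E.
Proof.
move=> l0 Ay; under eq_esum do rewrite mulrC EFinM.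
rewrite esumZ//; first by rewrite exit_rateE// -EFinM mulrC.
  by rewrite lee_fin invr_ge0 addr_ge0// exit_rate_ge0.
by move=> z _; rewrite lee_fin.
Qed.

Lemma killed_power_mass n x : A x -> (\esum_(z in A) M 0 n x z = 1)%E.
Proof.
move=> Ax; elim: n => [|n IH] /=.
  rewrite (esum_single Ax) ?eqxx//.
  by move=> y _ yx; rewrite eq_sym (negbTE (introN eqP yx)).
rewrite esum_exchange; last first.
  by move=> y z; rewrite mule_ge0 ?killed_power_ge0// lee_fin step_weight_ge0.
rewrite -IH; apply: eq_esum => y Ay.
rewrite esumZ ?killed_power_ge0//; last by move=> z _; rewrite lee_fin step_weight_ge0.
by rewrite esum_step_weight// add0r divff ?mule1// gt_eqF// exit_rate_gt0.
Qed.

Variables (Q : probability Xi R) (x0 : 'rV[R]_d).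
Hypothesis Ax0 : A x0.
Hypothesis law : walk_law Y S A q Q x0.

Let mY n : measurable_fun setT (Y n). Proof. by case: law. Qed.
Let mS n : measurable_fun setT (S n). Proof. by case: law. Qed.

Definition path_event (k n : nat) (y : nat -> 'rV[R]_d) : set Xi :=
  [set xi | forall i, (k <= i <= n)%N -> Y i xi = y i].

Lemma measurable_visit n y : measurable [set xi | Y n xi = y].
Proof.
have -> : [set xi | Y n xi = y] = setT `&` Y n @^-1` [set y] by rewrite setTI.
by apply: mY => //; exact: measurable_set1_rV.
Qed.

Lemma measurable_path_event k n y : measurable (path_event k n y).
Proof.
have -> : path_event k n y = \bigcap_(i in [set i | (k <= i <= n)%N]) [set xi | Y i xi = y i].
  by apply/seteqP; split=> xi.
by apply: bigcap_measurableType => i _; exact: measurable_visit.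
Qed.

Definition survival (lam : R) (n : nat) (xi : Xi) : R := \prod_(i < n) killed lam (S i xi).

Lemma survival_ge0 lam n xi : 0 <= survival lam n xi.
Proof. by apply: prodr_ge0 => i _; exact: killed_ge0. Qed.

Lemma measurable_survival lam n : measurable_fun setT (survival lam n).
Proof. by apply: measurable_prod => i _; exact: (measurableT_comp (measurable_killed lam)). Qed.

Lemma prodr_natr_bool n (b : 'I_n -> bool) :
  \prod_(i < n) (b i)%:R = [forall i, b i]%:R :> R.
Proof.
have [/forallP h|] := boolP [forall i, b i]; first by rewrite big1// => i _; rewrite h.
by move=> /forallPn[i ni]; rewrite (bigD1 i)//= (negbTE ni) mul0r.
Qed.

(** Interpolates between the description of the walk by tails ([k = 0]) and the killed weights
    ([k = n]): each step of the induction converts the tail of one more holding time by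
    [integral_killed]. *)
Lemma integral_path_mixed lam n y k (s : nat -> R) : 0 <= lam -> (forall i, A (y i)) ->
  (forall i, 0 <= s i) -> (k <= n)%N ->
  (\int[Q]_xi ((\prod_(i < n) (if (i < k)%N then killed lam (S i xi) else (s i < S i xi)%R%:R))%:E
     * (\1_(path_event 0 n y) xi)%:E) =
  ((y 0%N == x0)%:R * \prod_(i < n)
    ((if (i < k)%N then rr (y i) / (lam + rr (y i)) else expR (- (rr (y i) * s i))) *
     (q (y i) (y i.+1) / rr (y i))))%:E)%E.
Proof.
move=> l0 Ay; elim: k s => [|k IH] s s0 kn.
  case: law => _ _ /(_ n y s Ay s0) <-.
  rewrite -[in RHS](setIT [set xi | _ /\ _]) -integral_indic//; last first.
    rewrite (_ : [set xi | _] = path_event 0 n y `&`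
      \bigcap_(i in [set i | (i < n)%N]) [set xi | s i < S i xi]).
      apply: measurableI; first exact: measurable_path_event.
      apply: bigcap_measurableType => i _.
      rewrite -[X in measurable X]setTI; apply: (measurable_fun_ltr (measurable_cst _) (mS i)) => //.
    by apply/seteqP; split=> xi [h1 h2]; split=> // i; apply: h1.
  apply: eq_integral => xi _ /=; rewrite -EFinM prodr_natr_bool !indicE; congr EFin.
  have [/forallP h|/forallPn[i ni]] := boolP [forall i : 'I_n, s i < S i xi].
    rewrite mul1r; congr (_%:R); congr nat_of_bool.
    apply/idP/idP; rewrite !inE /path_event/=; last by case.
    by move=> h1; split => // i ilt; exact: (h (Ordinal ilt)).
  rewrite mul0r memNset//= => -[_ /(_ i (ltn_ord i)) h].
  by rewrite h in ni.
pose ik := Ordinal kn.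
pose F (s : nat -> R) k (i : 'I_n) xi := (if (i < k)%N then killed lam (S i xi) else (s i < S i xi)%R%:R) : R.
pose c := (y 0%N == x0)%:R * \prod_(i < n | i != ik)
    ((if (i < k)%N then rr (y i) / (lam + rr (y i)) else expR (- (rr (y i) * s i))) *
     (q (y i) (y i.+1) / rr (y i))) * (q (y k) (y k.+1) / rr (y k)).
have F0 s' k' i xi : 0 <= F s' k' i xi by rewrite /F; case: ifP => // _; exact: killed_ge0.
have mF s' k' i : measurable_fun setT (F s' k' i).
  rewrite /F; case: (i < k')%N; first exact: (measurableT_comp (measurable_killed lam)).
  by apply: measurable_natr_bool; exact: measurable_fun_ltr.
pose Z xi := ((\prod_(i < n | i != ik) F s k i xi)%:E * (\1_(path_event 0 n y) xi)%:E)%E.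
have nik (i : 'I_n) : i != ik -> (i < k.+1)%N = (i < k)%N.
  by move=> ink; rewrite ltnS leq_eqVlt (_ : (i == k :> nat) = false)//; apply/negbTE.
transitivity (\int[Q]_xi (Z xi * (killed lam (S k xi))%:E))%E.
  apply: eq_integral => xi _; rewrite /Z muleAC; congr (_ * _)%E; rewrite -EFinM; congr EFin.
  rewrite (bigD1 ik)//= ltnSn mulrC; congr (_ * _).
  by apply: eq_bigr => i /nik ->.
rewrite (@integral_killed _ _ _ Q Z (S k) c (rr (y k)) lam)//.
- congr EFin; rewrite [in RHS](bigD1 ik)//= ltnSn /c.
  under [in RHS]eq_bigr => i ink do rewrite nik//.
  ring.
- apply: emeasurable_funM; last first.
    by apply/measurable_EFinP/measurable_indic; exact: measurable_path_event.
  apply/measurable_EFinP; under eq_fun do rewrite big_mkcond.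
  by apply: measurable_prod => i _; case: (i != ik).
- by move=> xi; rewrite mule_ge0// lee_fin prodr_ge0.
- exact: exit_rate_gt0.
(* The induction hypothesis with [s k] replaced by an arbitrary [u] provides the tail of the holding
   time [S k]. *)
- move=> u u0; pose s' i := if i == k then u else s i.
  have s'0 i : 0 <= s' i by rewrite /s'; case: ifP.
  have s'k : s' k = u by rewrite /s' eqxx.
  have s'i (i : 'I_n) : i != ik -> s' i = s i.
    by move=> ink; rewrite /s' (_ : (i == k :> nat) = false)//; apply/negbTE.
  have -> : c * expR (- (rr (y k) * u)) = (y 0%N == x0)%:R * \prod_(i < n)
      ((if (i < k)%N then rr (y i) / (lam + rr (y i)) else expR (- (rr (y i) * s' i))) *
       (q (y i) (y i.+1) / rr (y i))).
    rewrite (bigD1 ik)//= ltnn s'k /c.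
    under [in RHS]eq_bigr => i ink do rewrite s'i//.
    ring.
  rewrite -(IH s' s'0 (ltnW kn)).
  apply: eq_integral => xi _; rewrite /Z muleAC; congr (_ * _)%E; rewrite -EFinM; congr EFin.
  rewrite [RHS](bigD1 ik)//= ltnn s'k mulrC; congr (_ * _).
  by apply: eq_bigr => i ink; rewrite /F s'i.
Qed.

Lemma integral_path_survival lam n y : 0 <= lam -> (forall i, A (y i)) ->
  (\int[Q]_xi ((survival lam n xi)%:E * (\1_(path_event 0 n y) xi)%:E) =
  ((y 0%N == x0)%:R * \prod_(0 <= i < n) (q (y i) (y i.+1) / (lam + rr (y i))))%:E)%E.
Proof.
move=> l0 Ay; have := @integral_path_mixed lam n y n (fun=> 0) l0 Ay (fun=> lexx _) (leqnn _).
under eq_integral do under eq_bigr do rewrite ltn_ord.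
move=> ->; congr (EFin (_ * _)); rewrite big_mkord; apply: eq_bigr => i _.
by rewrite ltn_ord; have := exit_rate_gt0 (Ay i) => r0; field; rewrite !gt_eqF//; lra.
Qed.

(** The first [k] positions are summed out one at a time, each sum adding one step to the power of
    the killed kernel. It needs the chain to be almost surely in [A] at those times, which
    [good_event_ae] obtains by an induction using this very lemma. *)
Lemma integral_chain_survival lam n k y : 0 <= lam -> (k <= n)%N ->
  (forall j, (j < k)%N -> {ae Q, forall xi, A (Y j xi)}) -> (forall i, A (y i)) ->
  (\int[Q]_xi ((survival lam n xi)%:E * (\1_(path_event k n y) xi)%:E) =
  M lam k x0 (y k) * (\prod_(k <= i < n) (q (y i) (y i.+1) / (lam + rr (y i))))%:E)%E.
Proof.
move=> l0; elim: k y => [|k IH] y kn Yae Ay.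
  by rewrite integral_path_survival//= EFinM eq_sym.
have mW : measurable_fun setT (fun xi => (survival lam n xi)%:E).
  by apply/measurable_EFinP; exact: measurable_survival.
pose y' z i := if i == k then z else y i.
have m1 y1 k1 : measurable_fun setT (fun xi => (survival lam n xi)%:E * (\1_(path_event k1 n y1) xi)%:E)%E.
  apply: emeasurable_funM => //.
  by apply/measurable_EFinP/measurable_indic; exact: measurable_path_event.
have p1 y1 k1 xi : (0 <= (survival lam n xi)%:E * (\1_(path_event k1 n y1) xi)%:E)%E.
  by rewrite mule_ge0// lee_fin survival_ge0.
transitivity (\int[Q]_xi (\esum_(z in A) ((survival lam n xi)%:E * (\1_(path_event k n (y' z)) xi)%:E)))%E.
  apply: ge0_ae_eq_integral => //.
  - by apply: (measurable_fun_esum x0).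
  - by move=> xi _; apply: esum_ge0.
  - have := Yae k (leqnn _); apply: filterS => xi AYk _.
    rewrite (esum_single AYk)//.
      congr (_ * _)%E; congr EFin; rewrite !indicE; congr (_%:R); congr nat_of_bool.
      apply/idP/idP; rewrite !inE /path_event/= => h i /andP[h1 h2]; last first.
        by rewrite h ?h2 ?andbT 1?ltnW// /y' gtn_eqF.
      by rewrite /y'; case: eqVneq => [->//|ik]; apply: h; rewrite h2 andbT ltn_neqAle eq_sym ik.
    move=> z Az zY; rewrite indicE memNset ?mule0//= => /(_ k); rewrite leqnn (ltnW kn)/= /y' eqxx.
    by move=> /(_ isT) h; exact: zY.
rewrite (integral_esum x0)//.
have Ay' z : A z -> forall i, A (y' z i) by move=> Az i; rewrite /y'; case: ifP.
transitivity (\esum_(z in A) (M lam k x0 z * (q z (y k.+1) / (lam + rr z))%:E *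
    (\prod_(k.+1 <= i < n) (q (y i) (y i.+1) / (lam + rr (y i))))%:E))%E.
  apply: eq_esum => z Az; rewrite IH//; last 3 first.
  - exact: ltnW.
  - by move=> j jk; apply: Yae; exact: ltnW.
  - exact: Ay'.
  rewrite {1}/y' eqxx (big_ltn kn) EFinM -muleA /y' eqxx gtn_eqF//; congr (_ * (_ * _))%E.
  congr EFin; apply: eq_big_nat => i /andP[ki _].
  by rewrite gtn_eqF// gtn_eqF// ltnW.
under eq_esum do rewrite muleC.
rewrite esumZ//; first by rewrite muleC.
  by rewrite lee_fin prodr_ge0// => i _; exact: step_weight_ge0.
by move=> z _; rewrite mule_ge0 ?killed_power_ge0// lee_fin step_weight_ge0.
Qed.

(** The law only gives the probabilities of paths inside [A]. At [lam = 0] the weight [survival] is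
    the indicator that the holding times are positive, and the [m]-step weights sum to one by
    [killed_power_mass], so these paths exhaust the probability. *)
Lemma good_event_ae m : {ae Q, forall xi, A (Y m xi) /\ forall i, (i < m)%N -> 0 < S i xi}.
Proof.
have [k] := ubnP m; elim: k m => // k IH m /ltnSE mk.
pose E := [set xi | A (Y m xi) /\ forall i, (i < m)%N -> 0 < S i xi].
have mE : measurable E.
  rewrite (_ : E = (Y m @^-1` A) `&` \bigcap_(i in [set i | (i < m)%N]) [set xi | 0 < S i xi])//.
  apply: measurableI; first by rewrite -[X in measurable X]setTI; apply: mY => //; exact: countable_measurable_rV.
  apply: bigcap_measurableType => i _.
  by rewrite -[X in measurable X]setTI; apply: (measurable_fun_ltr (measurable_cst _) (mS i)).
suff QE : Q E = 1%E.
  exists (~` E); split; [exact: measurableC|by rewrite probability_setC// QE subee|].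
  by apply: subsetC.
rewrite -(killed_power_mass m Ax0) -(setIT E) -integral_indic//.
transitivity (\int[Q]_xi (\esum_(z in A) ((survival 0 m xi)%:E * (\1_(path_event m m (fun=> z)) xi)%:E)))%E.
  apply: eq_integral => xi _.
  have W0 : survival 0 m xi = [forall i : 'I_m, 0 < S i xi]%:R.
    rewrite -prodr_natr_bool; apply: eq_bigr => i _.
    by rewrite /killed mul0r oppr0 expR0; case: ifP.
  have [AY|nAY] := pselect (A (Y m xi)); last first.
    rewrite indicE memNset; last by case.
    rewrite esum1// => z Az; rewrite indicE memNset ?mule0//= => /(_ m).
    by rewrite leqnn => /(_ isT) Yz; apply: nAY; rewrite Yz.
  rewrite (esum_single AY).
  - rewrite W0 !indicE [X in (_ * (nat_of_bool X)%:R%:E)%E]mem_set; last first.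
      by move=> i; rewrite -eqn_leq => /eqP ->.
    rewrite mule1; congr (_%:R%:E); congr nat_of_bool; apply/idP/forallP => [|h].
      by rewrite inE => -[_ h] i; exact: h.
    by rewrite inE; split=> // i im; exact: (h (Ordinal im)).
  - by move=> z; rewrite mule_ge0// lee_fin survival_ge0.
  - move=> z Az zY; rewrite indicE memNset ?mule0//= => /(_ m); rewrite leqnn => /(_ isT) h.
    exact: zY.
rewrite (integral_esum x0)//; last 2 first.
- move=> z _; apply: emeasurable_funM; first by apply/measurable_EFinP; exact: measurable_survival.
  by apply/measurable_EFinP/measurable_indic; exact: measurable_path_event.
- by move=> z xi _; rewrite mule_ge0// lee_fin survival_ge0.
apply: eq_esum => z Az; rewrite integral_chain_survival//.
  by rewrite big_geq// mule1.
by move=> j jm; apply: filterS (IH j (leq_trans jm mk)) => xi [].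
Qed.

Lemma visits_ae j : {ae Q, forall xi, A (Y j xi)}.
Proof. by apply: filterS (good_event_ae j) => xi []. Qed.

Lemma integral_visit lam n y : 0 <= lam -> A y ->
  (\int[Q]_xi ((survival lam n xi)%:E * (\1_[set xi | Y n xi = y] xi)%:E) = M lam n x0 y)%E.
Proof.
move=> l0 Ay; have := @integral_chain_survival lam n n (fun=> y) l0 (leqnn _) (fun j _ => visits_ae j) (fun=> Ay).
rewrite big_geq// mule1 => <-; congr integral; apply/funext => xi; congr (_ * _%:E)%E.
rewrite !indicE; congr (_%:R); congr nat_of_bool; apply/idP/idP; rewrite !inE /path_event/=.
  by move=> h i; rewrite -eqn_leq => /eqP <-.
by apply; rewrite leqnn.
Qed.

(** One more holding time survives than steps are fixed. Splitting along the next position brings in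
    the step weights out of [y], which sum to [rr y / (lam + rr y)]. *)
Lemma integral_visit_next lam n y : 0 <= lam -> A y ->
  (\int[Q]_xi ((survival lam n.+1 xi)%:E * (\1_[set xi | Y n xi = y] xi)%:E) =
   M lam n x0 y * (rr y / (lam + rr y))%:E)%E.
Proof.
move=> l0 Ay; pose y' z i := if i == n then y else z.
have mW : measurable_fun setT (fun xi => (survival lam n.+1 xi)%:E).
  by apply/measurable_EFinP; exact: measurable_survival.
have p1 (B : set Xi) xi : (0 <= (survival lam n.+1 xi)%:E * (\1_B xi)%:E)%E.
  by rewrite mule_ge0// lee_fin survival_ge0.
have m1 (B : set Xi) : measurable B -> measurable_fun setT (fun xi => (survival lam n.+1 xi)%:E * (\1_B xi)%:E)%E.
  by move=> mB; apply: emeasurable_funM => //; apply/measurable_EFinP/measurable_indic.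
transitivity (\int[Q]_xi (\esum_(z in A) ((survival lam n.+1 xi)%:E * (\1_(path_event n n.+1 (y' z)) xi)%:E)))%E.
  apply: ge0_ae_eq_integral => //.
  - by apply: m1; exact: measurable_visit.
  - apply: (measurable_fun_esum x0) => //.
    by move=> z _; apply: m1; exact: measurable_path_event.
  - by move=> xi _; apply: esum_ge0.
  - apply: filterS (visits_ae n.+1) => xi AY _.
    rewrite (esum_single AY)//.
      congr (_ * _%:E)%E; rewrite !indicE; congr (_%:R); congr nat_of_bool.
      apply/idP/idP; rewrite !inE /path_event/=; last first.
        by move=> /(_ n); rewrite leqnn leqnSn /y' eqxx; apply.
      move=> h i /andP[ni]; rewrite leq_eqVlt => /predU1P[->|iS].
        by rewrite /y' gtn_eqF.
      have -> : i = n by apply/eqP; rewrite eqn_leq ni andbT.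
      by rewrite /y' eqxx.
    move=> z Az zY; rewrite indicE memNset ?mule0//= => /(_ n.+1); rewrite leqnSn leqnn => /(_ isT).
    by rewrite /y' gtn_eqF// => h; exact: zY.
rewrite (integral_esum x0)//; last first.
- by move=> z _; apply: m1; exact: measurable_path_event.
rewrite -esum_step_weight// -esumZ ?killed_power_ge0//; last first.
  by move=> z _; rewrite lee_fin step_weight_ge0.
apply: eq_esum => z Az; rewrite integral_chain_survival//.
- by rewrite big_nat1 /y' eqxx gtn_eqF.
- by move=> j _; exact: visits_ae.
- by move=> i; rewrite /y'; case: ifP.
Qed.

Definition occupation (n : nat) (t : R) (y : 'rV[R]_d) : set Xi :=
  [set xi | Y n xi = y /\ jump_time S n xi <= t < jump_time S n.+1 xi].

(** The probability of being at [y] at time [t], split by the number of jumps made; it is built on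
    the measurable events [occupation] instead of the chosen value [walk]. *)
Definition trans_prob (t : R) (y : 'rV[R]_d) : \bar R :=
  (\sum_(n <oo) Q (occupation n t y))%E.
Local Notation p := trans_prob.

Lemma measurable_jump_time n : measurable_fun setT (jump_time S n).
Proof. by apply: measurable_sum => i; exact: mS. Qed.

Lemma measurable_occupation n t y : measurable (occupation n t y).
Proof.
have -> : occupation n t y = [set xi | Y n xi = y] `&`
    ([set xi | jump_time S n xi <= t] `&` [set xi | t < jump_time S n.+1 xi]).
  apply/seteqP; split=> xi; first by move=> [h1 /andP[]].
  by move=> [h1 [/= h2 h3]]; split=> //; rewrite h2.
apply: measurableI; first exact: measurable_visit.
apply: measurableI.
- rewrite -[X in measurable X]setTI; apply: (measurable_fun_ler (measurable_jump_time n) (measurable_cst t)) => //.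
- rewrite -[X in measurable X]setTI; apply: (measurable_fun_ltr (measurable_cst t) (measurable_jump_time n.+1)) => //.
Qed.

Lemma trans_prob_ge0 t y : (0 <= p t y)%E.
Proof. exact: nneseries_ge0. Qed.

Let graph n y : set (R * Xi) := [set z | occupation n z.1 y z.2].

Let measurable_graph n y : measurable (graph n y).
Proof.
have -> : graph n y = (snd @^-1` [set xi | Y n xi = y]) `&`
   ([set z | jump_time S n z.2 <= z.1] `&` [set z | z.1 < jump_time S n.+1 z.2]).
  apply/seteqP; split=> z; first by move=> [h1 /andP[]].
  by move=> [h1 [/= h2 h3]]; split=> //; rewrite h2.
apply: measurableI.
  by rewrite -[X in measurable X]setTI; apply: measurable_snd => //; exact: measurable_visit.
have mJ k : measurable_fun setT (fun z : R * Xi => jump_time S k z.2).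
  exact: (measurableT_comp (measurable_jump_time k) measurable_snd).
apply: measurableI.
- by rewrite -[X in measurable X]setTI; apply: (measurable_fun_ler (mJ n) measurable_fst).
- by rewrite -[X in measurable X]setTI; apply: (measurable_fun_ltr measurable_fst (mJ n.+1)).
Qed.

Lemma measurable_occupation_prob n y : measurable_fun setT (fun t => Q (occupation n t y)).
Proof.
have -> : (fun t => Q (occupation n t y)) = Q \o xsection (graph n y).
  by apply/funext => t /=; congr (Q _); apply/seteqP; split=> xi; rewrite /xsection/= inE.
by apply: measurable_fun_xsection; exact: measurable_graph.
Qed.

Lemma measurable_trans_prob y : measurable_fun setT (p ^~ y).
Proof. by apply: ge0_emeasurable_sum => // n _; exact: measurable_occupation_prob. Qed.

Lemma killed_power_le1 n y lam : 0 <= lam -> A y -> (killed_power lam n x0 y <= 1)%E.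
Proof.
move=> l0 Ay; rewrite -integral_visit//.
apply: (@le_trans _ _ (\int[Q]_xi 1%:E)%E); last first.
  by rewrite integral_cst// mul1e probability_le1.
apply: ge0_le_integralT => xi; first by rewrite mule_ge0// lee_fin survival_ge0.
rewrite -EFinM lee_fin; apply: mulr_ile1; [exact: survival_ge0|by rewrite indicE| |
  by rewrite indicE; case: (_ \in _)].
apply: prodr_ile1 => i _; rewrite killed_ge0/= /killed; case: ifP => // s0.
by rewrite -expR0 ler_expR oppr_le0 mulr_ge0// ltW.
Qed.

Lemma integral_expR_itv (lam a b : R) : 0 < lam -> 0 <= a -> a <= b ->
  (\int[lebesgue_measure]_(t in half_line) ((expR (- (lam * t)) * (a <= t < b)%R%:R)%:E) =
  ((expR (- (lam * a)) - expR (- (lam * b))) / lam)%:E)%E.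
Proof.
move=> l0 a0 ab.
have trunc s : 0 <= s -> (\int[lebesgue_measure]_(u in half_line)
    (lam * expR (- (lam * u)) * (u < s)%R%:R)%:E = (1 - expR (- (lam * s)))%:E)%E.
  move=> s0; rewrite integral_expR_trunc//; move: s0; rewrite le_eqVlt => /predU1P[<-|s0].
    rewrite /killed !ltxx /= mulr0 oppr0 expR0; congr EFin; lra.
  by rewrite /killed s0.
have m s : measurable_fun half_line (fun u => (expR (- (lam * u)) * (u < s)%R%:R)%:E : \bar R).
  apply/measurable_EFinP; apply: measurable_funTS; apply: measurable_funM.
    exact: measurable_expRM.
  by apply: measurable_natr_bool; apply: measurable_fun_ltr.
have Z s : 0 <= s -> (\int[lebesgue_measure]_(u in half_line)
    (expR (- (lam * u)) * (u < s)%R%:R)%:E = ((1 - expR (- (lam * s))) / lam)%:E)%E.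
  move=> /trunc; under eq_integral do rewrite -mulrA EFinM.
  rewrite ge0_integralZl//; last 3 first.
  - exact: measurable_half_line.
  - exact: m.
  - by rewrite lee_fin ltW.
  move=> h; rewrite mulrC EFinM -h muleA -EFinM mulVf ?mul1e// gt_eqF//.
have := Z b (le_trans a0 ab).
have -> : (fun u => (expR (- (lam * u)) * (u < b)%R%:R)%:E) =
   (fun u => (expR (- (lam * u)) * (u < a)%R%:R)%:E + (expR (- (lam * u)) * (a <= u < b)%R%:R)%:E)%E.
  apply/funext => u; rewrite -EFinD -mulrDr; congr (EFin (_ * _)).
  by have [ua|ua] := ltP u a; rewrite /= ?addr0 ?add0r// (lt_le_trans ua ab).
have m2 : measurable_fun half_line (fun u => (expR (- (lam * u)) * (a <= u < b)%R%:R)%:E : \bar R).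
  apply/measurable_EFinP; apply: measurable_funTS; apply: measurable_funM.
    exact: measurable_expRM.
  apply: measurable_natr_bool; apply: measurable_and; first exact: measurable_fun_ler.
  exact: measurable_fun_ltr.
rewrite ge0_integralD; try first [exact: measurable_half_line | exact: m | exact: m2 |
  by move=> u _; rewrite lee_fin mulr_ge0 ?expR_ge0].
rewrite Z// => /(congr1 (fun z => z - ((1 - expR (- (lam * a))) / lam)%:E)%E).
rewrite [X in (X - _)%E]addeC addeK// => ->; rewrite -EFinB; congr EFin; field.
by rewrite gt_eqF.
Qed.

Lemma survivalE lam n xi : (forall i, (i < n)%N -> 0 < S i xi) ->
  survival lam n xi = expR (- (lam * jump_time S n xi)).
Proof.
move=> S0; rewrite /jump_time mulr_sumr -sumrN expR_sum; apply: eq_bigr => i _.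
by rewrite /killed S0.
Qed.

Lemma jump_time_ge0 n xi : (forall i, (i < n)%N -> 0 < S i xi) -> 0 <= jump_time S n xi.
Proof. by move=> S0; apply: sumr_ge0 => i _; rewrite ltW// S0. Qed.

Lemma jump_timeS n xi : jump_time S n.+1 xi = jump_time S n xi + S n xi.
Proof. by rewrite /jump_time big_ord_recr. Qed.

(** The discounted duration of the [n]-th stay is [(expR (- (lam * J n)) - expR (- (lam * J n.+1)))
    / lam], with [J] the jump times. So [lam] times the left-hand side is the difference between
    [integral_visit] and [integral_visit_next], that is [lam / (lam + rr y)] times the killed
    power. *)
Lemma integral_occupation lam n y : 0 < lam -> A y ->
  (\int[lebesgue_measure]_(t in half_line) ((expR (- (lam * t)))%:E * Q (occupation n t y)) =
   killed_power lam n x0 y * ((lam + exit_rate y)^-1)%:E)%E.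
Proof.
move=> l0 Ay; have r0 := exit_rate_gt0 Ay.
have l0' := ltW l0.
pose f (z : R * Xi) : \bar R := ((expR (- (lam * z.1)) * \1_half_line z.1)%:E * (\1_(graph n y) z)%:E)%E.
have mf : measurable_fun setT f.
  apply: emeasurable_funM; apply/measurable_EFinP; last exact: measurable_indic.
  apply: measurable_funM; first exact: (measurableT_comp (measurable_expRM lam) measurable_fst).
  exact: (measurableT_comp (measurable_indic measurable_half_line) measurable_fst).
have f0 z : (0 <= f z)%E by rewrite mule_ge0// lee_fin mulr_ge0 ?expR_ge0.
transitivity (\int[lebesgue_measure]_t \int[Q]_xi f (t, xi))%E.
  rewrite integral_mkcond; apply: eq_integral => t _; rewrite patchE.
  rewrite /f /=; case: ifPn => [th|nt]; last first.
    by rewrite integral0_eq// => xi _; rewrite indicE (negbTE nt) mulr0 mul0e.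
  rewrite ge0_integralZl//; last first.
    apply/measurable_EFinP.
    have -> : (fun xi => \1_(graph n y) (t, xi)) = \1_(occupation n t y) :> (Xi -> R).
      by apply/funext => xi; rewrite !indicE; congr (_%:R); congr nat_of_bool; apply/idP/idP; rewrite !inE.
    by apply: measurable_indic; exact: measurable_occupation.
  rewrite indicE th mulr1; congr (_ * _)%E.
  rewrite -(setIT (occupation n t y)) -integral_indic//; last exact: measurable_occupation.
rewrite (@fubini_tonelli _ _ _ _ _ lebesgue_measure Q f)//.
pose g (k : nat) xi : \bar R := ((survival lam k xi)%:E * (\1_[set xi | Y n xi = y] xi)%:E)%E.
have mg k : measurable_fun setT (g k).
  apply: emeasurable_funM; apply/measurable_EFinP; first exact: measurable_survival.
  by apply: measurable_indic; exact: measurable_visit.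
have g0 k xi : (0 <= g k xi)%E by rewrite mule_ge0// lee_fin survival_ge0.
pose F xi := (\int[lebesgue_measure]_t f (t, xi))%E.
have mF : measurable_fun setT F by apply: (@measurable_fun_fubini_tonelli_G _ _ _ _ _ lebesgue_measure f).
have F0 xi : (0 <= F xi)%E by apply: integral_ge0.
have E : (\int[Q]_xi g n xi = lam%:E * \int[Q]_xi F xi + \int[Q]_xi g n.+1 xi)%E.
  rewrite -ge0_integralZl// -ge0_integralD//; last 2 first.
  - by move=> xi _; rewrite mule_ge0.
  - exact: measurable_funeM.
  apply: ge0_ae_eq_integral => //.
  - by apply: emeasurable_funD => //; exact: measurable_funeM.
  - by move=> xi _; rewrite adde_ge0// mule_ge0.
  apply: filterS (good_event_ae n.+1) => xi [_ S0] _.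
  have S0' i : (i < n)%N -> 0 < S i xi by move=> ni; apply: S0; exact: ltnW.
  rewrite /g !survivalE//; rewrite indicE.
  have [Yy|Yy] := pselect (Y n xi = y); last first.
    rewrite memNset// !mule0 adde0 /F integral0_eq ?mule0// => t _.
    by rewrite /f/= [\1_(graph n y) _]indicE memNset ?mule0//= => -[].
  rewrite mem_set// !mule1.
  have -> : F xi = ((expR (- (lam * jump_time S n xi)) - expR (- (lam * jump_time S n.+1 xi))) / lam)%:E.
    rewrite -integral_expR_itv//.
    - rewrite /F [RHS]integral_mkcond; apply: eq_integral => t _; rewrite patchE /f/= !indicE.
      case: ifPn => _; last by rewrite mulr0 mul0e.
      rewrite mulr1 -EFinM; congr (EFin (_ * _%:R)); congr nat_of_bool.
      apply/idP/idP; rewrite inE; first by case.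
      by move=> ?; split.
    - exact: jump_time_ge0.
    - by rewrite jump_timeS lerDl ltW// S0.
  by rewrite -EFinM -EFinD; congr EFin; field; rewrite gt_eqF.
move: E; rewrite integral_visit// integral_visit_next//.
have [M0 M1] := (killed_power_ge0 n x0 y l0', killed_power_le1 n l0' Ay).
have : killed_power lam n x0 y \is a fin_num by rewrite ge0_fin_numE// (le_lt_trans M1)// ltry.
move: (killed_power _ _ _ _) => [m||]// _.
have : (0 <= \int[Q]_xi F xi)%E by apply: integral_ge0.
case: (\int[Q]_xi F xi)%E => [v| |]// _; rewrite -?EFinM -?EFinD.
  move=> -[h]; congr EFin; have lr : lam + exit_rate y != 0 by rewrite gt_eqF// addr_gt0.
  apply: (mulfI (lt0r_neq0 l0)); apply: (addIr (m * (exit_rate y / (lam + exit_rate y)))).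
  by rewrite -h; field.
by rewrite gt0_muley ?lte_fin.
Qed.

Lemma laplace_trans_prob lam y : 0 < lam -> A y ->
  (\int[lebesgue_measure]_(t in half_line) ((expR (- (lam * t)))%:E * p t y) =
   \sum_(n <oo) (killed_power lam n x0 y * ((lam + exit_rate y)^-1)%:E))%E.
Proof.
move=> l0 Ay; rewrite /p.
under eq_integral do (rewrite -nneseriesZl; last by move=> *; exact: measure_ge0).
rewrite integral_nneseries//.
- by apply: eq_eseriesr => n _; exact: integral_occupation.
- exact: measurable_half_line.
- move=> n; apply: measurable_funTS; apply: emeasurable_funM.
    by apply/measurable_EFinP; exact: measurable_expRM.
  exact: measurable_occupation_prob.
- by move=> n t _; rewrite mule_ge0// lee_fin expR_ge0.
Qed.

Hypothesis nonexpl : non_explosive S Q.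

Lemma regular_path : exists N, [/\ measurable N, Q N = 0%E & forall xi, ~ N xi ->
  [/\ forall n, A (Y n xi), forall n, 0 < S n xi &
      forall t, 0 <= t -> exists n, jump_time S n xi <= t < jump_time S n.+1 xi]].
Proof.
have := nonexpl; have /ae_foralln := good_event_ae => hg hn.
have [N [mN N0 NP]] : \forall xi \ae Q, (forall n, A (Y n xi) /\ forall i, (i < n)%N -> 0 < S i xi) /\
    jump_time S n xi @[n --> \oo] --> +oo by apply: filterS2 hg hn => xi.
exists N; split=> // xi Nxi.
have [h1 h2] : (forall n, A (Y n xi) /\ forall i, (i < n)%N -> 0 < S i xi) /\
    jump_time S n xi @[n --> \oo] --> +oo.
  by apply: contrapT => h; apply: Nxi; apply: NP.
have S0 n : 0 < S n xi by have [_] := h1 n.+1; apply.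
split=> // [n|t t0]; first by have [] := h1 n.
have [n tn] : exists n, t < jump_time S n xi.
  have := h2; move/cvgryPgt => /(_ t)[N0' _ H].
  by exists N0'; apply: H => /=.
have ex : exists n, t < jump_time S n xi by exists n.
case: (ex_minnP ex) => -[|m] tm mmin.
  by move: tm; rewrite /jump_time big_ord0 ltNge t0.
exists m; rewrite tm andbT leNgt; apply/negP => /mmin; by rewrite ltnn.
Qed.

Lemma jump_time_nd xi : (forall n, 0 < S n xi) ->
  forall m n, (m <= n)%N -> jump_time S m xi <= jump_time S n xi.
Proof.
move=> S0 m; elim=> [|n IH]; first by rewrite leqn0 => /eqP ->.
rewrite leq_eqVlt => /predU1P[->//|]; rewrite ltnS => /IH h.
by rewrite (le_trans h)// jump_timeS lerDl ltW.
Qed.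

Lemma occupied_unique xi t m n : (forall n, 0 < S n xi) ->
  jump_time S m xi <= t < jump_time S m.+1 xi ->
  jump_time S n xi <= t < jump_time S n.+1 xi -> m = n.
Proof.
move=> S0 /andP[m1 m2] /andP[n1 n2]; apply/eqP; rewrite eqn_leq; apply/andP; split.
  rewrite leqNgt; apply/negP => /(jump_time_nd S0) h.
  by have := lt_le_trans n2 (le_trans h m1); rewrite ltxx.
rewrite leqNgt; apply/negP => /(jump_time_nd S0) h.
by have := lt_le_trans m2 (le_trans h n1); rewrite ltxx.
Qed.

(** Off the null set of [regular_path] exactly one pair of a number of jumps and a position is
    realized at time [t], so the integrand agrees there with a measurable double sum of
    indicators. *)
Lemma integral_walk t (g : 'rV[R]_d -> \bar R) : 0 <= t -> (forall y, 0 <= g y)%E ->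
  (\int[Q]_xi g (walk Y S t xi) = \esum_(y in A) (p t y * g y))%E.
Proof.
move=> t0 g0; have [N [mN N0 NP]] := regular_path.
pose h xi : \bar R := (\esum_(y in A) (\sum_(n <oo) (g y * (\1_(occupation n t y) xi)%:E)))%E.
have m1 n y : measurable_fun setT (fun xi => g y * (\1_(occupation n t y) xi)%:E)%E.
  apply: measurable_funeM; apply/measurable_EFinP; apply: measurable_indic.
  exact: measurable_occupation.
have p1 n y xi : (0 <= g y * (\1_(occupation n t y) xi)%:E)%E by rewrite mule_ge0.
have m2 y : measurable_fun setT (fun xi => \sum_(n <oo) (g y * (\1_(occupation n t y) xi)%:E))%E.
  by apply: ge0_emeasurable_sum => // n *; exact: p1.
have p2 y xi : (0 <= \sum_(n <oo) (g y * (\1_(occupation n t y) xi)%:E))%E.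
  by apply: nneseries_ge0.
rewrite (ge0_integral_null_eq (h := h) mN N0)//; last 3 first.
- exact: (measurable_fun_esum x0).
- by move=> xi; apply: esum_ge0.
- move=> xi /NP[AY S0 hex]; have [m mt] := hex t t0.
  have -> : walk Y S t xi = Y m xi.
    rewrite /walk; congr (Y _ xi); case: xgetP => [k _ /= kt|/(_ m)//].
    exact: (occupied_unique S0 kt mt).
  rewrite /h (esum_single (AY m))//.
    rewrite (@nneseriesD1 _ _ m)//.
      rewrite indicE mem_set// mule1 eseries0 ?adde0// => k _ km.
      rewrite indicE memNset ?mule0//= => -[_ kt].
      by move: km; rewrite (occupied_unique S0 kt mt) eqxx.
  move=> y Ay yY; apply: eseries0 => k _ _; rewrite indicE memNset ?mule0//= => -[Yk kt].
  by apply: yY; rewrite -Yk (occupied_unique S0 kt mt).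
rewrite (integral_esum x0)//; apply: eq_esum => y Ay.
rewrite integral_nneseries// /p muleC.
have ->: (\sum_(n <oo) \int[Q]_xi (g y * (\1_(occupation n t y) xi)%:E) =
    \sum_(n <oo) (g y * Q (occupation n t y)))%E.
  apply: eq_eseriesr => n _; rewrite ge0_integralZl//.
    by rewrite integral_indic// ?setIT//; exact: measurable_occupation.
  by apply/measurable_EFinP/measurable_indic; exact: measurable_occupation.
rewrite -!ge0_integral_count//; last by move=> n; rewrite mule_ge0.
by rewrite ge0_integralZl.
Qed.

Lemma trans_prob_mass t : 0 <= t -> (\esum_(y in A) p t y = 1)%E.
Proof.
move=> t0; have := @integral_walk t (fun=> 1%E) t0 (fun=> lee01).
rewrite (_ : \int[Q]__ 1 = 1)%E; last first.
  by have := integral_cst Q (@measurableT _ Xi) 1%E; rewrite /cst => ->; rewrite mul1e; exact: probability_setT.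
move=> ->.
by apply: eq_esum => y _; rewrite mule1.
Qed.

Lemma trans_prob_le1 t y : 0 <= t -> A y -> (p t y <= 1)%E.
Proof.
move=> t0 Ay; rewrite -(trans_prob_mass t0).
apply: (le_trans _ (esum_ge (x := p t y) _)) => //.
exists [set y]; last by rewrite fsbig_set1.
by split; [exact: finite_set1|move=> _ ->].
Qed.

(* Up to a small probability no jump occurs in [t, t + delta). *)
Lemma trans_prob_right_continuous t eta : 0 <= t -> 0 < eta ->
  exists2 delta, 0 < delta & exists c : 'rV[R]_d -> \bar R,
  [/\ forall y, (0 <= c y)%E, (1 - eta%:E <= \esum_(y in A) c y)%E &
      forall s, t <= s < t + delta -> forall y, (c y <= p s y)%E].
Proof.
move=> t0 eta0; have [N [mN N0 NP]] := regular_path.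
(* The walk rests at [y], after [n] jumps, during the whole of [[t, t + k.+1%:R^-1)]. These events
   increase with [k], and by monotone convergence their total mass tends to one. *)
pose ev (k n : nat) y := [set xi | Y n xi = y] `&`
    ([set xi | jump_time S n xi <= t] `&` [set xi | t + k.+1%:R^-1 <= jump_time S n.+1 xi]).
have mev k n y : measurable (ev k n y).
  apply: measurableI; first exact: measurable_visit.
  apply: measurableI.
  - by rewrite -[X in measurable X]setTI; apply: (measurable_fun_ler (measurable_jump_time n) (measurable_cst t)).
  - by rewrite -[X in measurable X]setTI; apply: (measurable_fun_ler (measurable_cst _) (measurable_jump_time n.+1)).
pose F k xi : \bar R := (\esum_(y in A) (\sum_(n <oo) (\1_(ev k n y) xi)%:E))%E.
have m1 k n y : measurable_fun setT (fun xi => (\1_(ev k n y) xi)%:E : \bar R).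
  by apply/measurable_EFinP/measurable_indic.
have m2 k y : measurable_fun setT (fun xi => \sum_(n <oo) (\1_(ev k n y) xi)%:E : \bar R)%E.
  by apply: ge0_emeasurable_sum => // n xi _ _; rewrite lee_fin.
have p2 k y xi : (0 <= \sum_(n <oo) ((\1_(ev k n y) xi)%:E : \bar R))%E.
  by apply: nneseries_ge0 => n _ _; rewrite lee_fin.
have mF k : measurable_fun setT (F k) by exact: (measurable_fun_esum x0).
have F0 k xi : (0 <= F k xi)%E by apply: esum_ge0.
have ndF xi : nondecreasing_seq (F ^~ xi).
  move=> k1 k2 k12; apply: le_esum => y _; apply: lee_nneseries => n _; rewrite lee_fin//.
  rewrite !indicE ler_nat; case: (boolP (_ \in _)) => //; rewrite inE => -[h1 [h2 h3]].
  rewrite mem_set//; split=> //; split=> //=; apply: le_trans h3; rewrite lerD2l lef_pV2 ?posrE//.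
  by rewrite ler_nat.
have : (\int[Q]_xi F k xi)%E @[k --> \oo] --> (\int[Q]_xi limn (F ^~ xi))%E.
  exact: cvg_monotone_convergence.
rewrite (_ : \int[Q]_xi limn (F ^~ xi) = 1)%E; last first.
  transitivity (\int[Q]_xi (cst 1%E xi))%E.
    apply: (ge0_integral_null_eq mN N0) => //.
      move=> xi; apply: lime_ge; first by apply: ereal_nondecreasing_is_cvgn.
      by apply: nearW => k.
    move=> xi /NP[AY S0 hex]; have [m mt] := hex t t0; have /andP[mt1 mt2] := mt.
    apply/cvg_lim => //; apply: cvg_near_cst.
    exists (Num.bound (jump_time S m.+1 xi - t)^-1) => // k /= k0k.
    have kJ : t + k.+1%:R^-1 <= jump_time S m.+1 xi.
      have J0 : 0 < jump_time S m.+1 xi - t by rewrite subr_gt0.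
      rewrite -lerBrDl -[leRHS]invrK lef_pV2 ?posrE ?invr_gt0//.
      rewrite ltW// (lt_le_trans (archi_boundP _))// ?invr_ge0 ?(ltW J0)//.
      by rewrite ler_nat ltnW.
    have uniq n y : ev k n y xi -> n = m.
      move=> [_ [/= n1 n2]]; apply: (occupied_unique S0 _ mt); rewrite n1/=.
      by apply: lt_le_trans n2; rewrite ltrDl invr_gt0.
    rewrite /F (esum_single (AY m))//.
      rewrite (@nneseriesD1 _ _ m)//.
      rewrite indicE mem_set// eseries0 ?adde0// => n _ nm.
      by rewrite indicE memNset// => /uniq h; move: nm; rewrite h eqxx.
    move=> y Ay yY; apply: eseries0 => n _ _; rewrite indicE memNset// => evn.
    by apply: yY; case: evn (uniq _ _ evn) => /= <- _ ->.
  by rewrite (integral_cst Q measurableT) mul1e; exact: probability_setT.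
move=> /fine_cvgP[finF /cvgrPdist_le/(_ eta eta0) cvF].
have [k _ kP] := filterI finF cvF.
have {kP} [/= fk dk] := kP k (leqnn k).
exists k.+1%:R^-1; first by rewrite invr_gt0.
exists (fun y => \sum_(n <oo) Q (ev k n y))%E; split.
- by move=> y; apply: nneseries_ge0.
- have -> : (\esum_(y in A) \sum_(n <oo) Q (ev k n y) = \int[Q]_xi F k xi)%E.
    rewrite /F (integral_esum x0)//; apply: eq_esum => y Ay.
    rewrite integral_nneseries//.
    by apply: eq_eseriesr => n _; rewrite integral_indic// setIT.
  rewrite -(fineK fk) -EFinB lee_fin.
  by move: dk => /=; rewrite ler_norml => /andP[_]; lra.
- move=> s /andP[ts st] y; apply: lee_nneseries => // n _.
  apply: le_measure; rewrite ?inE//; first exact: measurable_occupation.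
  move=> xi [h1 [/= h2 h3]]; split=> //; rewrite (le_trans h2 ts)/=.
  exact: lt_le_trans st h3.
Qed.

End jump_chain.

(** * Translations of Lebesgue measure on the line *)

Section lebesgue_translation.
Context {R : realType}.
Local Notation mu := (@lebesgue_measure R).

Lemma measurable_addr (t : R) :
  measurable_fun setT (fun x : measurableTypeR R => (x : R) + t : measurableTypeR R).
Proof. exact: measurable_funD. Qed.

Lemma lebesgue_measure_translation (t : R) (A : set R) : measurable A ->
  mu ((fun x => x + t) @^-1` A) = mu A.
Proof.
move=> mA; apply/esym.
transitivity (pushforward_measure mu (measurable_addr t) A); last by [].
apply: lebesgue_measure_unique => // X [[a b] _ <-]; rewrite /pushforward_measure/= /pushforward.
have -> : (fun x => x + t) @^-1` `]a, b] = `]a - t, b - t]%classic.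
  by apply/seteqP; split=> x /=; rewrite !in_itv/= ltrBlDr lerBrDr.
by rewrite !lebesgue_measure_itv/= !lte_fin ltrD2r; case: ifP => // _; rewrite -!EFinD; congr EFin; ring.
Qed.

Lemma ge0_integral_translation (t : R) (f : R -> \bar R) : measurable_fun setT f ->
  (forall x, 0 <= f x)%E -> (\int[mu]_x f ((x : R) + t)%R = \int[mu]_x f x)%E.
Proof.
move=> mf f0.
have E : (\int[pushforward_measure mu (measurable_addr t)]_x f x = \int[mu]_x f x)%E.
  by apply: eq_measure_integral => A mA _; exact: lebesgue_measure_translation.
rewrite -E /pushforward_measure ge0_integral_pushforward//.
exact: (measurable_addr t).
Qed.

Lemma integral_half_line_shift (t : R) (f : R -> \bar R) : 0 <= t -> measurable_fun setT f ->
  (forall x, 0 <= f x)%E ->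
  (\int[mu]_(s in half_line) f ((s : R) + t)%R =
   \int[mu]_(u in half_line) (((t < u)%R%:R)%:E * f u))%E.
Proof.
move=> t0 mf f0.
have mt : measurable_fun setT (fun u : R => ((t < u)%R%:R)%:E : \bar R).
  by apply/measurable_EFinP/measurable_natr_bool/measurable_fun_ltr.
transitivity (\int[mu]_(s in `]0%R, +oo[) f ((s : R) + t)%R)%E.
  rewrite [RHS]integral_itv_obnd_cbnd//; apply: measurable_funTS.
  exact: (measurableT_comp mf (measurable_addr t)).
rewrite integral_mkcond [RHS]integral_mkcond.
transitivity (\int[mu]_x ((fun u => ((t < u)%R%:R)%:E * f u) ((x : R) + t)%R))%E.
  apply: eq_integral => x _; rewrite patchE; case: ifPn.
    by rewrite inE/= in_itv/= andbT => x0; rewrite ltrDr x0 mul1e.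
  by move=> /negP; rewrite inE/= in_itv/= andbT => /negP/negbTE x0; rewrite ltrDr x0 mul0e.
transitivity (\int[mu]_x (((t < x)%R%:R)%:E * f x))%E.
  apply: (@ge0_integral_translation t (fun u => ((t < u)%R%:R)%:E * f u)%E).
    exact: emeasurable_funM.
  by move=> x; rewrite mule_ge0.
apply: eq_integral => u _; rewrite patchE; case: ifPn => // /negP; rewrite inE half_lineE => /negP.
by rewrite -ltNge => u0; rewrite ltNge (le_trans (ltW u0) t0) mul0e.
Qed.

End lebesgue_translation.

(** * Green function, symmetry and Markov property of a reversible walk *)

Section reversible_chain.
Context {R : realType} {d : nat} {dX : measure_display} {Xi : measurableType dX}.
Variables (Y : nat -> Xi -> 'rV[R]_d) (S : nat -> Xi -> R).
Variables (A : set 'rV[R]_d) (q : 'rV[R]_d -> 'rV[R]_d -> R).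
Hypothesis cA : countable A.
Hypothesis q_ge0 : forall x y, 0 <= q x y.
Hypothesis rateA : forall x, A x -> (0 < total_rate A q x < +oo)%E.
Variable Q : 'rV[R]_d -> probability Xi R.
Hypothesis law : forall x, A x -> walk_law Y S A q (Q x) x.
Hypothesis nonexpl : forall x, A x -> non_explosive S (Q x).
Variable nw : 'rV[R]_d -> R.
Hypothesis nw_gt0 : forall x, A x -> 0 < nw x.
Hypothesis balance : forall x y, A x -> A y -> nw x * q x y = nw y * q y x.

Local Notation leb := lebesgue_measure.
Local Notation rr := (exit_rate A q).
Local Notation M := (killed_power A q).
Local Notation p t x y := (trans_prob Y S (Q x) t y).

(** The expected discounted time spent in [z] during the [n]-th stay of the walk started at [x]. *)
Definition green_term (lam : R) (n : nat) (x z : 'rV[R]_d) : \bar R :=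
  (M lam n x z * ((lam + rr z)^-1)%:E)%E.
Local Notation Nk := green_term.

Let esumZr (c : \bar R) (a : 'rV[R]_d -> \bar R) : (0 <= c)%E -> (forall x, A x -> 0 <= a x)%E ->
  (\esum_(x in A) (a x * c) = (\esum_(x in A) a x) * c)%E.
Proof.
by move=> c0 a0; under eq_esum do rewrite muleC; rewrite (esumZ cA)// muleC.
Qed.

Let r_ge0 x : 0 <= rr x. Proof. exact: exit_rate_ge0. Qed.
Let G_ge0 (lam : R) x : 0 <= lam -> (0 <= ((lam + rr x)^-1)%:E)%E.
Proof. by move=> l0; rewrite lee_fin invr_ge0 addr_ge0. Qed.
Let Mge0 lam n x z : 0 <= lam -> (0 <= M lam n x z)%E.
Proof. exact: killed_power_ge0. Qed.

Lemma green_term_ge0 lam n x z : 0 <= lam -> (0 <= Nk lam n x z)%E.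
Proof. by move=> l0; rewrite mule_ge0 ?Mge0 ?G_ge0. Qed.

Lemma green_term_right lam n x z : 0 <= lam ->
  (Nk lam n.+1 x z = (\esum_(y in A) (Nk lam n x y * (q y z)%:E)) * ((lam + rr z)^-1)%:E)%E.
Proof.
move=> l0; rewrite {1}/green_term /=; congr (_ * _)%E; apply: eq_esum => y Ay.
by rewrite /green_term -muleA -EFinM [in RHS]mulrC.
Qed.

(** The powers are built by adding a last step; here the first step is split off instead. The two
    forms together give the symmetry, and this one gives the equation of the Green function. *)
Lemma green_term_left lam n x z : 0 <= lam -> A x -> A z ->
  (Nk lam n.+1 x z = ((lam + rr x)^-1)%:E * \esum_(y in A) ((q x y)%:E * Nk lam n y z))%E.
Proof.
move=> l0 Ax Az; elim: n z Az => [|n IH] z Az.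
  rewrite green_term_right// (esum_single Ax)//; last 2 first.
  - by move=> y; rewrite mule_ge0 ?green_term_ge0// lee_fin.
  - by move=> y _ yx; rewrite /green_term/= eq_sym (negbTE (introN eqP yx)) mul0e mul0e.
  rewrite (esum_single Az)//; last 2 first.
  - by move=> y; rewrite mule_ge0 ?green_term_ge0// lee_fin.
  - by move=> y _ yx; rewrite /green_term/= (negbTE (introN eqP yx)) mul0e mule0.
  by rewrite /green_term/= !eqxx !mul1e muleA.
pose b y w := ((q x w)%:E * Nk lam n w y * (q y z)%:E)%E.
have b0 y w : (0 <= b y w)%E by apply: mule_ge0; [apply: mule_ge0|]; rewrite ?green_term_ge0 ?lee_fin.
transitivity (((lam + rr x)^-1)%:E * (\esum_(y in A) \esum_(w in A) b y w) * ((lam + rr z)^-1)%:E)%E.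
  rewrite green_term_right//; congr (_ * _)%E.
  rewrite -(esumZ cA) ?G_ge0//; last by move=> y _; exact: esum_ge0.
  apply: eq_esum => y Ay; rewrite IH// -muleA; congr (_ * _)%E.
  rewrite -esumZr ?lee_fin// => w Aw.
  by rewrite mule_ge0 ?green_term_ge0// lee_fin.
rewrite -muleA; congr (_ * _)%E; rewrite esum_exchange//.
rewrite -esumZr ?G_ge0//; last by move=> y _; exact: esum_ge0.
apply: eq_esum => w Aw; rewrite green_term_right// muleA; congr (_ * _)%E.
rewrite -(esumZ cA) ?lee_fin//; last first.
  by move=> y _; rewrite mule_ge0 ?green_term_ge0// lee_fin.
by apply: eq_esum => y _; rewrite muleA.
Qed.

(** Detailed balance carries the weight [nw] across one step: the last step is split off on one
    side, the first step on the other, and the induction does the rest. *)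
Lemma green_term_sym lam n x z : 0 <= lam -> A x -> A z ->
  ((nw x)%:E * Nk lam n x z = (nw z)%:E * Nk lam n z x)%E.
Proof.
move=> l0 Ax; elim: n z => [|n IH] z Az.
  rewrite /green_term/= [z == x]eq_sym; case: eqVneq => [->//|_].
  by rewrite !mul0e !mule0.
rewrite green_term_right// green_term_left// muleA [RHS]muleCA [RHS]muleC; congr (_ * _)%E.
rewrite -!(esumZ cA)//; last 4 first.
- by rewrite lee_fin ltW// nw_gt0.
- by move=> y Ay; rewrite mule_ge0 ?green_term_ge0// lee_fin.
- by rewrite lee_fin ltW// nw_gt0.
- by move=> y Ay; rewrite mule_ge0 ?green_term_ge0// lee_fin.
apply: eq_esum => y Ay; rewrite muleA IH// muleAC -EFinM.
by rewrite balance// EFinM -muleA.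
Qed.

Local Ltac nonneg := repeat first [by [] | by rewrite lee_fin | by rewrite lee_fin ltW |
  by apply: green_term_ge0 | apply: G_ge0 | apply: esum_ge0 => ? ? | apply: mule_ge0 ].

Definition green (lam : R) (x z : 'rV[R]_d) : \bar R := (\sum_(n <oo) Nk lam n x z)%E.

Lemma green_ge0 lam x z : 0 <= lam -> (0 <= green lam x z)%E.
Proof. by move=> l0; apply: nneseries_ge0 => n _ _; exact: green_term_ge0. Qed.

Lemma laplace_green lam x y : 0 < lam -> A x -> A y ->
  (\int[leb]_(t in half_line) ((expR (- (lam * t)))%:E * p t x y) = green lam x y)%E.
Proof. by move=> l0 Ax Ay; rewrite (laplace_trans_prob cA q_ge0 rateA Ax (law Ax)). Qed.

Lemma trans_ge0 t x y : (0 <= p t x y)%E.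
Proof. exact: trans_prob_ge0. Qed.

Lemma trans_mass t x : 0 <= t -> A x -> (\esum_(y in A) p t x y = 1)%E.
Proof. by move=> t0 Ax; exact: (trans_prob_mass cA q_ge0 rateA Ax (law Ax) (nonexpl Ax)). Qed.

Lemma trans_le1 t x y : 0 <= t -> A x -> A y -> (p t x y <= 1)%E.
Proof. by move=> t0 Ax Ay; exact: (trans_prob_le1 cA q_ge0 rateA Ax (law Ax) (nonexpl Ax)). Qed.

Lemma trans_fin t x y : 0 <= t -> A x -> A y -> p t x y \is a fin_num.
Proof.
move=> t0 Ax Ay; rewrite ge0_fin_numE ?trans_ge0// (le_lt_trans (trans_le1 t0 Ax Ay))//.
exact: ltry.
Qed.

Lemma measurable_trans x y : A x -> measurable_fun setT (fun t => p t x y).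
Proof. by move=> Ax; exact: (measurable_trans_prob (law Ax)). Qed.

Lemma green_le lam x y : 0 < lam -> A x -> A y -> (green lam x y <= (lam^-1)%:E)%E.
Proof.
move=> l0 Ax Ay; rewrite -laplace_green// -integral_expR//; apply: ge0_le_integral => //.
- exact: measurable_half_line.
- by move=> t _; rewrite mule_ge0 ?trans_ge0// lee_fin expR_ge0.
- apply: measurable_funTS; apply: emeasurable_funM; last exact: measurable_trans.
  by apply/measurable_EFinP; exact: measurable_expRM.
- by apply/measurable_EFinP; apply: measurable_funTS; exact: measurable_expRM.
- move=> t; rewrite half_lineE => t0; rewrite -[leRHS]mule1 lee_wpmul2l ?lee_fin ?expR_ge0//.
  exact: trans_le1.
Qed.

Lemma green_fin lam x y : 0 < lam -> A x -> A y -> green lam x y \is a fin_num.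
Proof.
move=> l0 Ax Ay; rewrite ge0_fin_numE ?green_ge0 ?(ltW l0)//.
by rewrite (le_lt_trans (green_le l0 Ax Ay))// ltry.
Qed.

Lemma green_sym lam x z : 0 < lam -> A x -> A z ->
  ((nw x)%:E * green lam x z = (nw z)%:E * green lam z x)%E.
Proof.
move=> l0 Ax Az; rewrite /green -!nneseriesZl.
- by apply: eq_eseriesr => n _; exact: (green_term_sym n (ltW l0)).
- by move=> n _; exact: green_term_ge0 (ltW l0).
- by move=> n _; exact: green_term_ge0 (ltW l0).
Qed.

(** A non-negative supersolution dominates every partial sum of the series defining [green], by
    induction on the number of terms. With possibly unbounded rates this replaces the uniqueness of
    solutions. *)
Lemma green_minimal lam (h v : 'rV[R]_d -> \bar R) : 0 < lam ->
  (forall x, 0 <= h x)%E -> (forall x, 0 <= v x)%E ->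
  (forall x, A x -> ((lam + rr x)^-1)%:E * (h x + \esum_(y in A) ((q x y)%:E * v y)) <= v x)%E ->
  forall x, A x -> (\esum_(z in A) (green lam x z * h z) <= v x)%E.
Proof.
move=> l0 h0 v0 hv x Ax; have l0' := ltW l0.
pose T n x := (\esum_(z in A) (Nk lam n x z * h z))%E.
have T_ge0 n y : (0 <= T n y)%E.
  by apply: esum_ge0 => z _; rewrite mule_ge0// green_term_ge0.
have T0 y : A y -> T 0%N y = (((lam + rr y)^-1)%:E * h y)%E.
  move=> Ay; rewrite /T (esum_single Ay).
  - by rewrite /green_term/= eqxx mul1e.
  - by move=> z; rewrite mule_ge0 ?green_term_ge0.
  - by move=> z _ zy; rewrite /green_term/= eq_sym (negbTE (introN eqP zy)) !mul0e.
have TS n y : A y -> T n.+1 y = (((lam + rr y)^-1)%:E * \esum_(w in A) ((q y w)%:E * T n w))%E.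
  move=> Ay; rewrite /T.
  transitivity (\esum_(z in A) (((lam + rr y)^-1)%:E * \esum_(w in A) ((q y w)%:E * (Nk lam n w z * h z))))%E.
    apply: eq_esum => z Az; rewrite green_term_left// -muleA; congr (_ * _)%E.
    rewrite -esumZr//; last by move=> w _; rewrite mule_ge0 ?green_term_ge0// lee_fin.
    by apply: eq_esum => w _; rewrite -muleA.
  rewrite (esumZ cA) ?G_ge0//; last first.
    by move=> z _; nonneg.
  congr (_ * _)%E; rewrite esum_exchange; last first.
    by move=> z w; nonneg.
  apply: eq_esum => w _; rewrite (esumZ cA) ?lee_fin// => z _.
  by rewrite mule_ge0 ?green_term_ge0.
have partial m : forall y, A y -> (\sum_(n < m) T n y <= v y)%E.
  elim: m => [|m IH] y Ay; first by rewrite big_ord0.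
  rewrite big_ord_recl T0//=; apply: le_trans (hv y Ay).
  under eq_bigr do rewrite TS//.
  rewrite -ge0_sume_distrr; last first.
    by move=> n _; apply: esum_ge0 => w _; rewrite mule_ge0// lee_fin.
  rewrite -ge0_muleDr//; last first.
    by apply: sume_ge0 => n _; apply: esum_ge0 => w _; rewrite mule_ge0// lee_fin.
  rewrite lee_wpmul2l ?G_ge0// leeD2l// -esum_sum; last first.
    by move=> w n _ _; rewrite mule_ge0// lee_fin.
  apply: le_esum => w Aw; rewrite -ge0_sume_distrr//.
  by rewrite lee_wpmul2l ?lee_fin// IH.
have -> : (\esum_(z in A) (green lam x z * h z) = \sum_(n <oo) T n x)%E.
  rewrite nneseries_esumT// /T esum_exchange; last first.
    by move=> n z; rewrite mule_ge0 ?green_term_ge0.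
  apply: eq_esum => z _; rewrite muleC /green nneseries_esumT; last first.
    by move=> n; exact: green_term_ge0.
  rewrite -!nneseries_esumT; last 2 first.
  - by move=> n; rewrite mule_ge0 ?green_term_ge0.
  - by move=> n; exact: green_term_ge0.
  rewrite -!ge0_integral_count; last 2 first.
  - by move=> n; rewrite mule_ge0 ?green_term_ge0.
  - by move=> n; exact: green_term_ge0.
  rewrite -ge0_integralZl//; last by move=> n _; exact: green_term_ge0.
  by apply: eq_integral => n _; rewrite muleC.
apply: lime_le; first by apply: is_cvg_nneseries => n _ _.
by apply: nearW => m; rewrite big_mkord; exact: partial.
Qed.

Lemma green_equation lam z x : 0 < lam -> A x -> A z ->
  ((lam + rr x)%:E * green lam x z =
   ((x == z)%:R)%:E + \esum_(y in A) ((q x y)%:E * green lam y z))%E.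
Proof.
move=> l0 Ax Az; have l0' := ltW l0.
have lr : 0 < lam + rr x by rewrite ltr_pwDl.
have -> : (green lam x z = Nk lam 0 x z + \sum_(n <oo) Nk lam n.+1 x z)%E.
  have N0 n : (0 <= Nk lam n x z)%E by exact: green_term_ge0.
  rewrite /green nneseries_recl// -(@nneseries_addn _ (fun n => Nk lam n x z) 1%N)//.
  by congr (_ + _)%E; apply: eq_eseriesr => n _; rewrite addn1.
have -> : (\sum_(n <oo) Nk lam n.+1 x z = ((lam + rr x)^-1)%:E * \esum_(y in A) ((q x y)%:E * green lam y z))%E.
  under eq_eseriesr do rewrite green_term_left//.
  rewrite nneseriesZl; last first.
    by move=> n _; apply: esum_ge0 => y _; rewrite mule_ge0 ?green_term_ge0// lee_fin.
  congr (_ * _)%E; rewrite nneseries_esumT; last first.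
    by move=> n; apply: esum_ge0 => y _; rewrite mule_ge0 ?green_term_ge0// lee_fin.
  rewrite esum_exchange; last by move=> n y; rewrite mule_ge0 ?green_term_ge0// lee_fin.
  apply: eq_esum => y _; rewrite -nneseries_esumT; last first.
    by move=> n; rewrite mule_ge0 ?green_term_ge0// lee_fin.
  by rewrite nneseriesZl// => n _; exact: green_term_ge0.
rewrite ge0_muleDr ?green_term_ge0//; last first.
  by rewrite mule_ge0 ?G_ge0//; apply: esum_ge0 => y _; rewrite mule_ge0 ?green_ge0// lee_fin.
rewrite [X in (_ + X)%E]muleA -[X in (_ + X * _)%E]EFinM mulfV ?gt_eqF// mul1e; congr (_ + _)%E.
rewrite /green_term/= -!EFinM; case: eqVneq => [<-|_]; congr EFin.
  by rewrite mul1r mulfV// gt_eqF.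
by rewrite mul0r mulr0.
Qed.

(** Both inequalities come from minimality. With [u] the Green function at [lam] and [v] the
    right-hand side, [u] solves the equation of which [v] is the minimal solution, so [v <= u];
    conversely [v <= u] makes [v] a supersolution of the equation of which [u] is the minimal
    solution. *)
Lemma resolvent_identity lam mu x z : 0 < lam -> lam < mu -> A x -> A z ->
  (green lam x z = green mu x z +
    (mu - lam)%:E * \esum_(y in A) (green mu x y * green lam y z))%E.
Proof.
move=> l0 lm Ax Az; have m0 : 0 < mu by exact: lt_trans lm.
have ml0 : (0 <= (mu - lam)%:E)%E by rewrite lee_fin subr_ge0 ltW.
pose u x := green lam x z; pose delta x : \bar R := ((x == z)%:R)%:E.
pose h x := (delta x + (mu - lam)%:E * u x)%E.
have u0 y : (0 <= u y)%E by exact: green_ge0 (ltW l0).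
have d0 y : (0 <= delta y)%E by rewrite lee_fin.
have h0 y : (0 <= h y)%E by rewrite adde_ge0// mule_ge0.
pose v x := (\esum_(y in A) (green mu x y * h y))%E.
have v0 y : (0 <= v y)%E.
  by apply: esum_ge0 => w _; rewrite mule_ge0// green_ge0// ltW.
have vE y : A y -> v y = (green mu y z + (mu - lam)%:E * \esum_(w in A) (green mu y w * green lam w z))%E.
  move=> Ay; rewrite /v /h; under eq_esum => w Aw.
    rewrite ge0_muleDr ?mule_ge0// muleCA; over.
  rewrite esumD; last 2 first.
  - by move=> w _; rewrite mule_ge0// green_ge0// ltW.
  - by move=> w _; rewrite !mule_ge0// green_ge0// ltW.
  rewrite (esum_single Az) ?eqxx ?mule1.
  - rewrite /delta eqxx mule1 (esumZ cA)// => w _.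
    by rewrite mule_ge0// green_ge0// ltW.
  - by move=> w; rewrite mule_ge0// green_ge0// ltW.
  - by move=> w _ wz; rewrite /delta (negbTE (introN eqP wz)) mule0.
have vu y : A y -> (v y <= u y)%E.
  move=> Ay; apply: (green_minimal m0 h0 u0) => // w Aw.
  have lr : 0 < mu + rr w by rewrite ltr_pwDl.
  rewrite /h addeAC -green_equation// -/(u w).
  have uf : u w \is a fin_num by exact: green_fin.
  move: (u w) uf => [r| |]// _; rewrite -[((lam + rr w)%:E * _)%E]EFinM -[((mu - lam)%:E * _)%E]EFinM -EFinD -EFinM lee_fin.
  by rewrite -mulrDl mulrA (_ : (mu + rr w)^-1 * _ = 1) ?mul1r//; field; rewrite gt_eqF.
have vf y : A y -> v y \is a fin_num.
  move=> Ay; rewrite ge0_fin_numE// (le_lt_trans (vu y Ay))//.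
  by rewrite -ge0_fin_numE// green_fin.
suff uv : (u x <= v x)%E.
  by rewrite -vE//; apply/eqP; rewrite eq_le uv vu.
have := green_minimal l0 d0 v0.
have -> : (u x = \esum_(w in A) (green lam x w * delta w))%E.
  rewrite (esum_single Az) ?/delta ?eqxx ?mule1//.
  - by move=> w; rewrite mule_ge0 ?green_ge0 ?(ltW l0)// lee_fin.
  - by move=> w _ wz; rewrite (negbTE (introN eqP wz)) mule0.
apply => // y Ay.
have lr : 0 < lam + rr y by rewrite ltr_pwDl.
have veq : ((mu + rr y)%:E * v y = h y + \esum_(w in A) ((q y w)%:E * v w))%E.
  rewrite /v -(esumZ cA)//; last 2 first.
  - by rewrite lee_fin addr_ge0// ltW.
  - by move=> w _; rewrite mule_ge0// green_ge0// ltW.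
  under eq_esum => w Aw.
    rewrite muleA green_equation// ge0_muleDl ?lee_fin//; last first.
      by apply: esum_ge0 => a _; rewrite mule_ge0 ?green_ge0 ?(ltW m0)// lee_fin.
    over.
  rewrite esumD; last 2 first.
  - by move=> w _; rewrite mule_ge0// lee_fin.
  - move=> w _; rewrite mule_ge0//; apply: esum_ge0 => a _.
    by rewrite mule_ge0 ?green_ge0 ?(ltW m0)// lee_fin.
  congr (_ + _)%E.
    rewrite (esum_single Ay) ?eqxx ?mul1e//.
    - by move=> w; rewrite mule_ge0// lee_fin.
    - by move=> w _ wy; rewrite eq_sym (negbTE (introN eqP wy)) mul0e.
  under eq_esum => w Aw.
    rewrite -esumZr//; last first.
      by move=> a _; rewrite mule_ge0 ?green_ge0 ?(ltW m0)// lee_fin.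
    over.
  rewrite esum_exchange; last first.
    by move=> w a; rewrite !mule_ge0 ?green_ge0 ?(ltW m0)// lee_fin.
  apply: eq_esum => a _; rewrite -(esumZ cA) ?lee_fin//.
    by apply: eq_esum => w _; rewrite muleA.
  by move=> w _; rewrite mule_ge0 ?green_ge0 ?(ltW m0).
(* The source of [v] contains [(mu - lam) u], which is at least [(mu - lam) v]; subtracting the
   latter moves the equation of [v] from [mu] to [lam]. *)
have key : (delta y + \esum_(w in A) ((q y w)%:E * v w) <= (lam + rr y)%:E * v y)%E.
  have vf' := vf y Ay.
  have : ((lam + rr y)%:E * v y + (mu - lam)%:E * v y = h y + \esum_(w in A) ((q y w)%:E * v w))%E.
    rewrite -veq -(fineK vf') -!EFinM -EFinD -mulrDl; congr (EFin (_ * _)); ring.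
  move=> E; have fin : ((mu - lam)%:E * v y)%E \is a fin_num by rewrite fin_numM.
  by rewrite -(leeD2rE _ _ fin) E /h addeAC leeD2r// leeD2l// lee_wpmul2l// vu.
apply: (le_trans (lee_wpmul2l _ key)); first by rewrite lee_fin invr_ge0 ltW.
by rewrite muleA -EFinM mulVf ?gt_eqF// mul1e.
Qed.

Definition expect (t : R) (g : 'rV[R]_d -> R) (x : 'rV[R]_d) : \bar R :=
  (\esum_(y in A) (p t x y * (g y)%:E))%E.

Lemma expect_ge0 t g x : (forall y, 0 <= g y) -> (0 <= expect t g x)%E.
Proof. by move=> g0; apply: esum_ge0 => y _; rewrite mule_ge0 ?trans_ge0// lee_fin. Qed.

Lemma expect_le t (g : 'rV[R]_d -> R) K x : 0 <= t -> A x ->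
  (forall y, A y -> 0 <= g y <= K) -> (expect t g x <= K%:E)%E.
Proof.
move=> t0 Ax gK; have K0 : 0 <= K by have /andP[g0 g1] := gK x Ax; exact: le_trans g1.
rewrite -[leRHS]mul1e -(trans_mass t0 Ax) -esumZr ?lee_fin//.
  apply: le_esum => y Ay; rewrite lee_wpmul2l ?trans_ge0// lee_fin.
  by have /andP[] := gK y Ay.
by move=> y _; exact: trans_ge0.
Qed.

Lemma expect_fin t (g : 'rV[R]_d -> R) K x : 0 <= t -> A x ->
  (forall y, 0 <= g y <= K) -> expect t g x \is a fin_num.
Proof.
move=> t0 Ax gK; rewrite ge0_fin_numE.
  by rewrite (le_lt_trans (expect_le (K := K) t0 Ax _)) ?ltry// => y _; exact: gK.
by apply: expect_ge0 => y; have /andP[] := gK y.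
Qed.

Lemma measurable_expect g x : A x -> (forall y, 0 <= g y) ->
  measurable_fun setT (fun t => expect t g x).
Proof.
move=> Ax g0; apply: (measurable_fun_esum x) => //.
  by move=> y Ay; apply: emeasurable_funM => //; exact: measurable_trans.
by move=> y t _; rewrite mule_ge0 ?trans_ge0// lee_fin.
Qed.

(** On [[t, t + delta)] all the laws [p s x] dominate a common measure [c] of mass at least
    [1 - e1]. The expectations then all lie between the sum of [c * g] and this sum plus
    [K * e1]. *)
Lemma expect_right_continuous (g : 'rV[R]_d -> R) K x : A x -> (forall y, 0 <= g y <= K) ->
  right_continuous_half_line (fun t => fine (expect t g x)).
Proof.
move=> Ax gK t t0 eta eta0.
have g0 y : 0 <= g y by have /andP[] := gK y.
have K0 : 0 <= K by have /andP[g1 g2] := gK x; exact: le_trans g2.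
pose e1 := eta / (K + 1).
have K1 : 0 < K + 1 by rewrite ltr_pwDr.
have e10 : 0 < e1 by rewrite divr_gt0.
have [delta d0 [c [c0 c1 cp]]] :=
  trans_prob_right_continuous cA q_ge0 rateA Ax (law Ax) (nonexpl Ax) t0 e10.
exists delta => // s sd; have s0 : 0 <= s by have /andP[] := sd => h _; exact: le_trans h.
have cf r : t <= r < t + delta -> 0 <= r -> (\esum_(y in A) (c y * (g y)%:E) <= expect r g x)%E /\
    (expect r g x <= \esum_(y in A) (c y * (g y)%:E) + eta%:E)%E.
  move=> rd r0; split.
    by apply: le_esum => y Ay; rewrite lee_wpmul2r ?lee_fin// cp.
  have cle y : A y -> (c y <= 1)%E.
    by move=> Ay; apply: le_trans (cp r rd y) _; exact: trans_le1.
  have cfin y : A y -> c y \is a fin_num.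
    by move=> Ay; rewrite ge0_fin_numE// (le_lt_trans (cle y Ay))// ltry.
  pose b y := (p r x y - c y)%E.
  have b0 y : A y -> (0 <= b y)%E by move=> Ay; rewrite sube_ge0 ?cfin ?orbT// cp.
  have pE y : A y -> p r x y = (c y + b y)%E.
    by move=> Ay; rewrite /b addeC subeK// cfin.
  have mass : (1 = \esum_(y in A) c y + \esum_(y in A) b y)%E.
    rewrite -esumD//.
    by rewrite -(trans_mass r0 Ax); apply: eq_esum => y /pE.
  have ble : (\esum_(y in A) b y <= e1%:E)%E.
    have sc : \esum_(y in A) c y \is a fin_num.
      rewrite ge0_fin_numE ?esum_ge0// (@le_lt_trans _ _ 1%E) ?ltry//.
      by rewrite mass leeDl// esum_ge0.
    rewrite -(leeD2lE _ _ sc) -mass.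
    rewrite -(fineK sc) -EFinD lee_fin; move: c1; rewrite -(fineK sc) -EFinB lee_fin; lra.
  rewrite /expect.
  have -> : (\esum_(y in A) (p r x y * (g y)%:E) =
      \esum_(y in A) (c y * (g y)%:E) + \esum_(y in A) (b y * (g y)%:E))%E.
    rewrite -esumD; last 2 first.
    - by move=> y Ay; rewrite mule_ge0 ?lee_fin.
    - by move=> y Ay; rewrite mule_ge0 ?lee_fin ?b0.
    by apply: eq_esum => y Ay; rewrite pE// ge0_muleDl// b0.
  rewrite leeD2l//.
  apply: (@le_trans _ _ (\esum_(y in A) (b y * K%:E))%E).
    apply: le_esum => y Ay; rewrite lee_wpmul2l ?b0// lee_fin; by have /andP[] := gK y.
  rewrite esumZr ?lee_fin//; apply: (le_trans (lee_wpmul2r _ ble)); first by rewrite lee_fin.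
  by rewrite -EFinM lee_fin /e1 mulrAC ler_pdivrMr// ler_wpM2l ?(ltW eta0)// lerDl.
have tt : t <= t < t + delta by rewrite lexx ltrDl.
have [t1 t2] := cf t tt t0.
have [s1 s2] := cf s sd s0.
have ft := expect_fin t0 Ax gK; have fs := expect_fin s0 Ax gK.
have fc : (\esum_(y in A) (c y * (g y)%:E))%E \is a fin_num.
  rewrite ge0_fin_numE; last by apply: esum_ge0 => y _; rewrite mule_ge0// lee_fin.
  by rewrite (le_lt_trans t1)// -ge0_fin_numE// expect_ge0.
move: t1 t2 s1 s2; rewrite -(fineK ft) -(fineK fs) -(fineK fc) -!EFinD !lee_fin /=.
by move=> h1 h2 h3 h4; rewrite ler_norml; apply/andP; split; lra.
Qed.

Lemma expect_indic t x z : A x -> A z -> expect t (fun y => (y == z)%:R) x = p t x z.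
Proof.
move=> Ax Az; rewrite /expect (esum_single Az).
- by rewrite eqxx mule1.
- by move=> y; rewrite mule_ge0 ?trans_ge0// lee_fin.
- by move=> y _ yz; rewrite (negbTE (introN eqP yz)) mule0.
Qed.

Lemma bounded_meas_expect (g : 'rV[R]_d -> R) K x : A x -> (forall y, 0 <= g y <= K) ->
  bounded_meas (fun t => fine (expect t g x)) K.
Proof.
move=> Ax gK; have g0 y : 0 <= g y by have /andP[] := gK y.
split.
  by apply: measurable_funTS; apply: measurableT_comp => //; exact: measurable_expect.
move=> s s0; rewrite ger0_norm ?fine_ge0 ?expect_ge0//.
rewrite -lee_fin fineK; last exact: (expect_fin s0 Ax gK).
by apply: expect_le => // y _.
Qed.

Lemma lap_expect (g : 'rV[R]_d -> R) K x lam : 0 < lam -> A x -> (forall y, 0 <= g y <= K) ->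
  ((lap (fun t => fine (expect t g x)) lam)%:E = \esum_(y in A) (green lam x y * (g y)%:E))%E.
Proof.
move=> l0 Ax gK; have g0 y : 0 <= g y by have /andP[] := gK y.
rewrite /lap /Rintegral fineK; last first.
  by apply: integrable_fin_num => //; exact: (integrable_lap (bounded_meas_expect Ax gK)).
transitivity (\int[leb]_(t in half_line)
   (\esum_(y in A) ((expR (- (lam * t)))%:E * p t x y * (g y)%:E)))%E.
  apply: eq_integral => t; rewrite inE/= in_itv/= andbT => t0.
  rewrite EFinM fineK ?(expect_fin t0 Ax gK)// /expect -(esumZ cA) ?lee_fin ?expR_ge0//.
    by apply: eq_esum => y _; rewrite muleA.
  by move=> y _; rewrite mule_ge0 ?trans_ge0// lee_fin.
have m1 y : A y -> measurable_fun setT (fun t => (expR (- (lam * t)))%:E * p t x y)%E.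
  move=> Ay; apply: emeasurable_funM; last exact: measurable_trans.
  by apply/measurable_EFinP; exact: measurable_expRM.
rewrite (integral_esum x)//; last 3 first.
- exact: measurable_half_line.
- by move=> y Ay; apply: measurable_funTS; apply: emeasurable_funM => //; exact: m1.
- by move=> y t _; rewrite !mule_ge0 ?trans_ge0 ?lee_fin ?expR_ge0.
apply: eq_esum => y Ay; rewrite ge0_integralZr ?laplace_green ?lee_fin//.
- exact: measurable_half_line.
- by apply: measurable_funTS; exact: m1.
- by move=> t _; rewrite mule_ge0 ?trans_ge0 ?lee_fin ?expR_ge0.
Qed.

Let indic01 (z y : 'rV[R]_d) : 0 <= ((y == z)%:R : R) <= 1.
Proof. by case: (y == z); rewrite /= ?lexx ?ler01. Qed.

Lemma lap_trans x z lam : 0 < lam -> A x -> A z ->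
  (lap (fun t => fine (p t x z)) lam)%:E = green lam x z.
Proof.
move=> l0 Ax Az; have := lap_expect l0 Ax (indic01 z).
have -> : (fun t => fine (expect t (fun y => (y == z)%:R) x)) = (fun t => fine (p t x z)).
  by apply/funext => t; rewrite expect_indic.
move=> ->; rewrite (esum_single Az).
- by rewrite eqxx mule1.
- by move=> y; rewrite mule_ge0 ?green_ge0 ?(ltW l0)// lee_fin.
- by move=> y _ yz; rewrite (negbTE (introN eqP yz)) mule0.
Qed.

Lemma bounded_meas_trans x z : A x -> A z -> bounded_meas (fun t => fine (p t x z)) 1.
Proof.
move=> Ax Az; have := bounded_meas_expect Ax (indic01 z).
have -> : (fun t => fine (expect t (fun y => (y == z)%:R) x)) = (fun t => fine (p t x z)) => //.
by apply/funext => t; rewrite expect_indic.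
Qed.

Lemma trans_right_continuous x z : A x -> A z ->
  right_continuous_half_line (fun t => fine (p t x z)).
Proof.
move=> Ax Az; have := expect_right_continuous Ax (indic01 z).
have -> : (fun t => fine (expect t (fun y => (y == z)%:R) x)) = (fun t => fine (p t x z)) => //.
by apply/funext => t; rewrite expect_indic.
Qed.

Lemma right_continuousZ (G : R -> R) c : right_continuous_half_line G ->
  right_continuous_half_line (fun t => c * G t).
Proof.
move=> rG t t0 eta eta0; have c1 : 0 < `|c| + 1 by rewrite ltr_pwDr.
have [delta d0 H] := rG t t0 (eta / (`|c| + 1)) ltac:(by rewrite divr_gt0).
exists delta => // s sd; rewrite -mulrBr normrM.
have := H s sd; rewrite ler_pdivlMr// => h.
by apply: le_trans h; rewrite mulrC ler_wpM2l// lerDl.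
Qed.

Lemma bounded_measZ (G : R -> R) M c : bounded_meas G M -> bounded_meas (fun t => c * G t) (`|c| * M).
Proof. by move=> bG; apply: bounded_measM => //; exact: bounded_meas_cst. Qed.

Lemma bounded_meas_weaken (G : R -> R) M N : M <= N -> bounded_meas G M -> bounded_meas G N.
Proof. by move=> MN [mG GM]; split => // s s0; apply: le_trans MN; exact: GM. Qed.

(** The symmetry of the Green functions, transferred by uniqueness of the Laplace transform. *)
Lemma trans_sym t x z : 0 <= t -> A x -> A z ->
  ((nw x)%:E * p t x z = (nw z)%:E * p t z x)%E.
Proof.
move=> t0 Ax Az; rewrite -(fineK (trans_fin t0 Ax Az)) -(fineK (trans_fin t0 Az Ax)) -!EFinM.
congr EFin; pose N := Num.max `|nw x| `|nw z|.
have b1 := bounded_measZ (nw x) (bounded_meas_trans Ax Az).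
have b2 := bounded_measZ (nw z) (bounded_meas_trans Az Ax).
apply: (@lap_uniq_half_line R (fun t => nw x * fine (p t x z)) (fun t => nw z * fine (p t z x)) N 0) => //.
- by apply: bounded_meas_weaken b1; rewrite mulr1 le_max lexx.
- by apply: bounded_meas_weaken b2; rewrite mulr1 le_max lexx orbT.
- by apply: right_continuousZ; exact: trans_right_continuous.
- by apply: right_continuousZ; exact: trans_right_continuous.
move=> a _ a0; rewrite (lapZ _ (bounded_meas_trans Ax Az) a0) (lapZ _ (bounded_meas_trans Az Ax) a0).
apply: EFin_inj; rewrite !EFinM !lap_trans//; exact: green_sym.
Qed.

(** In the double integral the time [u] receives the weight [1 - expR (- (a * u))] by Tonelli's
    theorem. This is the Laplace transform in [t] of the tail of the Laplace integral, to be
    compared with the resolvent identity. *)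
Lemma integral_expR_after lam a x z : 0 < lam -> 0 < a -> A x -> A z ->
  (a%:E * \int[leb]_(t in half_line) ((expR (- (a * t)))%:E *
     \int[leb]_(u in half_line) (((t < u)%R%:R)%:E * ((expR (- (lam * u)))%:E * p u x z)))
   + green (lam + a) x z = green lam x z)%E.
Proof.
move=> l0 a0 Ax Az.
have mh : measurable (half_line : set R) := @measurable_half_line R.
pose f (w : R * R) : \bar R := ((expR (- (a * w.1)) * \1_half_line w.1)%:E *
   (((w.1 < w.2)%R%:R * (expR (- (lam * w.2)) * \1_half_line w.2))%:E * p w.2 x z))%E.
have m1 : measurable_fun setT (fun w : R * R => \1_half_line w.1 : R).
  exact: (measurableT_comp (measurable_indic mh) measurable_fst).
have m2 : measurable_fun setT (fun w : R * R => \1_half_line w.2 : R).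
  exact: (measurableT_comp (measurable_indic mh) measurable_snd).
have mp : measurable_fun setT (fun w : R * R => p w.2 x z).
  exact: (measurableT_comp (measurable_trans z Ax) measurable_snd).
have mf : measurable_fun setT f.
  apply: emeasurable_funM.
    apply/measurable_EFinP; apply: measurable_funM => //.
    exact: (measurableT_comp (measurable_expRM a) measurable_fst).
  apply: emeasurable_funM => //; apply/measurable_EFinP; apply: measurable_funM.
    by apply: measurable_natr_bool; exact: measurable_fun_ltr.
  apply: measurable_funM => //.
  exact: (measurableT_comp (measurable_expRM lam) measurable_snd).
have f0 w : (0 <= f w)%E.
  by rewrite !mule_ge0 ?trans_ge0// lee_fin !mulr_ge0 ?expR_ge0.
have mu1 : measurable_fun half_line (fun u => ((expR (- (lam * u)))%:E * p u x z)%E).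
  apply: measurable_funTS; apply: emeasurable_funM; last exact: measurable_trans.
  by apply/measurable_EFinP; exact: measurable_expRM.
have -> : (\int[leb]_(t in half_line) ((expR (- (a * t)))%:E *
     \int[leb]_(u in half_line) (((t < u)%R%:R)%:E * ((expR (- (lam * u)))%:E * p u x z))) =
   \int[leb]_t \int[leb]_u f (t, u))%E.
  rewrite integral_mkcond; apply: eq_integral => t _; rewrite patchE.
  rewrite /f/=; case: ifPn => th; last first.
    by rewrite integral0_eq// => u _; rewrite indicE (negbTE th) mulr0 mul0e.
  rewrite indicE th mulr1 -ge0_integralZl//; last 2 first.
  - apply: emeasurable_funM => //; apply/measurable_EFinP; apply: measurable_natr_bool.
    by apply: measurable_funTS; exact: measurable_fun_ltr.
  - by move=> u _; rewrite !mule_ge0 ?trans_ge0// lee_fin expR_ge0.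
  rewrite integral_mkcond; apply: eq_integral => u _; rewrite patchE indicE.
  case: ifPn => uh; last by rewrite !mulr0 mul0e mule0.
  by rewrite mulr1 EFinM -muleA.
rewrite (@fubini_tonelli _ _ _ _ _ lebesgue_measure lebesgue_measure f)//.
have -> : (\int[leb]_u \int[leb]_t f (t, u) =
   \int[leb]_(u in half_line) (((1 - expR (- (a * u))) / a)%:E * ((expR (- (lam * u)))%:E * p u x z)))%E.
  rewrite [RHS]integral_mkcond; apply: eq_integral => u _; rewrite patchE.
  case: ifPn => uh; last first.
    rewrite integral0_eq// => t _; rewrite /f/= [\1_half_line u]indicE (negbTE uh).
    by rewrite !mulr0 mul0e mule0.
  move: (uh); rewrite inE half_lineE => u0.
  transitivity (\int[leb]_(t in half_line) ((expR (- (a * t)) * (0 <= t < u)%R%:R)%:E *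
      ((expR (- (lam * u)))%:E * p u x z)))%E.
    rewrite [RHS]integral_mkcond; apply: eq_integral => t _; rewrite patchE /f/= !indicE uh.
    case: ifPn => th; last by rewrite mulr0 mul0e.
    move: (th); rewrite inE half_lineE => t0; rewrite t0/= !mulr1 !EFinM -!muleA.
    by [].
  rewrite ge0_integralZr//.
  - by rewrite integral_expR_itv// mulr0 oppr0 expR0.
  - apply/measurable_EFinP; apply: measurable_funTS; apply: measurable_funM.
      exact: measurable_expRM.
    apply: measurable_natr_bool; apply: measurable_and; first exact: measurable_fun_ler.
    exact: measurable_fun_ltr.
  - by rewrite mule_ge0 ?trans_ge0// lee_fin expR_ge0.
have k0 u : 0 <= u -> 0 <= (1 - expR (- (a * u))) / a.
  by move=> u0; rewrite divr_ge0 ?(ltW a0)// subr_ge0 -expR0 ler_expR oppr_le0 mulr_ge0 ?(ltW a0).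
have mk : measurable_fun setT (fun u : R => ((1 - expR (- (a * u))) / a)%:E).
  apply/measurable_EFinP; apply: measurable_funM => //; apply: measurable_funB => //.
  exact: measurable_expRM.
rewrite -ge0_integralZl ?lee_fin ?(ltW a0)//; last 2 first.
- by apply: emeasurable_funM => //; apply: measurable_funTS.
- by move=> u; rewrite half_lineE => u0; rewrite !mule_ge0 ?trans_ge0 ?lee_fin ?k0 ?expR_ge0.
have la0 : 0 < lam + a by rewrite addr_gt0.
rewrite -(laplace_green la0 Ax Az) -(laplace_green l0 Ax Az) -ge0_integralD//; last 4 first.
- by move=> u; rewrite half_lineE => u0; rewrite !mule_ge0 ?trans_ge0 ?lee_fin ?k0 ?expR_ge0 ?(ltW a0).
- by apply: measurable_funeM; apply: emeasurable_funM => //; apply: measurable_funTS.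
- by move=> u _; rewrite mule_ge0 ?trans_ge0// lee_fin expR_ge0.
- apply: measurable_funTS; apply: emeasurable_funM; last exact: measurable_trans.
  by apply/measurable_EFinP; exact: measurable_expRM.
apply: eq_integral => u; rewrite inE half_lineE => u0.
rewrite -(fineK (trans_fin u0 Ax Az)) -!EFinM -EFinD; congr EFin.
have -> : - ((lam + a) * u) = - (lam * u) + - (a * u) by ring.
by rewrite expRD; field; exact: lt0r_neq0.
Qed.

Lemma right_continuousM (G H : R -> R) K N : bounded_meas G K -> bounded_meas H N ->
  right_continuous_half_line G -> right_continuous_half_line H ->
  right_continuous_half_line (fun t => G t * H t).
Proof.
move=> [_ GK] [_ HN] rG rH t t0 eta eta0.
have K0 : 0 <= K by apply: le_trans (GK 0 _).
have N0 : 0 <= N by apply: le_trans (HN 0 _).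
have e1 : 0 < eta / (K + N + 1) by rewrite divr_gt0// ltr_pwDr// addr_ge0.
have [d1 d10 H1] := rG t t0 _ e1; have [d2 d20 H2] := rH t t0 _ e1.
exists (Num.min d1 d2); first by rewrite lt_min d10.
move=> s /andP[ts sd]; have s0 : 0 <= s by exact: le_trans ts.
have /H1 h1 : t <= s < t + d1 by rewrite ts (lt_le_trans sd)// lerD2l ge_min lexx.
have /H2 h2 : t <= s < t + d2 by rewrite ts (lt_le_trans sd)// lerD2l ge_min lexx orbT.
have -> : G s * H s - G t * H t = G s * (H s - H t) + H t * (G s - G t) by ring.
apply: (le_trans (ler_normD _ _)); rewrite !normrM.
apply: (@le_trans _ _ (K * (eta / (K + N + 1)) + N * (eta / (K + N + 1)))).
  by rewrite lerD// ler_pM// ?GK ?HN.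
rewrite -mulrDl mulrCA ger_pMr// ler_pdivrMr ?mul1r ?lerDl//.
by rewrite ltr_pwDr// addr_ge0.
Qed.

Lemma right_continuous_expR (lam : R) : 0 < lam ->
  right_continuous_half_line (fun t => expR (- (lam * t))).
Proof.
move=> l0 t t0 eta eta0; exists (eta / lam); first by rewrite divr_gt0.
move=> s /andP[ts sd]; have s0 := le_trans t0 ts.
rewrite ler0_norm ?subr_le0 ?ler_expR ?lerN2 ?ler_pM2l// opprB.
have -> : expR (- (lam * s)) = expR (- (lam * t)) * expR (- (lam * (s - t))).
  by rewrite -expRD; congr expR; ring.
rewrite -[X in X - _]mulr1 -mulrBr.
have e1 : 1 - expR (- (lam * (s - t))) <= eta.
  have := expR_ge1Dx (- (lam * (s - t))).
  have : lam * (s - t) < eta by rewrite -ltr_pdivlMl// ltrBlDl mulrC.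
  lra.
have e2 : 0 <= 1 - expR (- (lam * (s - t))).
  by rewrite subr_ge0 -expR0 ler_expR oppr_le0 mulr_ge0 ?(ltW l0)// subr_ge0.
apply: le_trans e1; rewrite ler_piMl// -expR0 ler_expR oppr_le0 mulr_ge0//.
exact: ltW.
Qed.

Lemma bounded_meas_expRM (lam : R) : 0 <= lam -> bounded_meas (fun t => expR (- (lam * t))) 1.
Proof.
move=> l0; split; first by apply: measurable_funTS; exact: measurable_expRM.
move=> s s0; rewrite ger0_norm ?expR_ge0// -expR0 ler_expR oppr_le0 mulr_ge0//.
Qed.

(** Real-valued version on [A], zero elsewhere; through it the lemmas on bounded real functions
    apply to transition probabilities and Green functions. *)
Let onA (g : 'rV[R]_d -> \bar R) y : R := if y \in A then fine (g y) else 0.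

Let onA_bound g K : 0 <= K -> (forall y, A y -> 0 <= g y <= K%:E)%E -> forall y, 0 <= onA g y <= K.
Proof.
move=> K0 gK y; rewrite /onA; case: ifPn => [|_]; last by rewrite lexx.
rewrite inE => /gK /andP[g0 g1]; rewrite fine_ge0//= -lee_fin fineK//.
by rewrite ge0_fin_numE// (le_lt_trans g1)// ltry.
Qed.

Let onAE g K y : (forall y, A y -> 0 <= g y <= K%:E)%E -> A y -> ((onA g y)%:E = g y)%E.
Proof.
move=> gK Ay; rewrite /onA mem_set// fineK//; have /andP[g0 g1] := gK y Ay.
by rewrite ge0_fin_numE// (le_lt_trans g1)// ltry.
Qed.

Definition tail_laplace lam x z (t : R) : \bar R :=
  (\int[leb]_(u in half_line) (((t < u)%R%:R)%:E * ((expR (- (lam * u)))%:E * p u x z)))%E.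

Let m_after (lam : R) x z : A x -> measurable_fun setT (fun u : R => ((expR (- (lam * u)))%:E * p u x z)%E).
Proof.
move=> Ax; apply: emeasurable_funM; last exact: measurable_trans.
by apply/measurable_EFinP; exact: measurable_expRM.
Qed.

Let m_step (t : R) : measurable_fun setT (fun u : R => ((t < u)%R%:R)%:E : \bar R).
Proof. by apply/measurable_EFinP/measurable_natr_bool/measurable_fun_ltr. Qed.

Lemma tail_laplace_ge0 lam x z t : (0 <= tail_laplace lam x z t)%E.
Proof. by apply: integral_ge0 => u _; rewrite !mule_ge0 ?trans_ge0// lee_fin expR_ge0. Qed.

Lemma tail_laplace_le lam x z t : 0 < lam -> A x -> A z -> (tail_laplace lam x z t <= (lam^-1)%:E)%E.
Proof.
move=> l0 Ax Az; apply: le_trans (green_le l0 Ax Az); rewrite -laplace_green//.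
apply: ge0_le_integral => //.
- exact: measurable_half_line.
- by move=> u _; rewrite !mule_ge0 ?trans_ge0// lee_fin expR_ge0.
- by apply: measurable_funTS; apply: emeasurable_funM; [exact: m_step|exact: m_after].
- by apply: measurable_funTS; exact: m_after.
- move=> u _; rewrite -[leRHS]mul1e lee_wpmul2r ?mule_ge0 ?trans_ge0 ?lee_fin ?expR_ge0//.
  by case: (_ < _); rewrite ?ler01.
Qed.

Lemma tail_laplace_fin lam x z t : 0 < lam -> A x -> A z -> tail_laplace lam x z t \is a fin_num.
Proof.
move=> l0 Ax Az; rewrite ge0_fin_numE ?tail_laplace_ge0//.
by rewrite (le_lt_trans (tail_laplace_le t l0 Ax Az))// ltry.
Qed.

Lemma measurable_tail_laplace lam x z : A x -> measurable_fun setT (tail_laplace lam x z).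
Proof.
move=> Ax.
pose f (w : R * R) : \bar R := (((w.1 < w.2)%R%:R * \1_half_line w.2)%:E *
   ((expR (- (lam * w.2)))%:E * p w.2 x z))%E.
have mf : measurable_fun setT f.
  apply: emeasurable_funM.
    apply/measurable_EFinP; apply: measurable_funM.
      by apply: measurable_natr_bool; exact: measurable_fun_ltr.
    exact: (measurableT_comp (measurable_indic (@measurable_half_line R)) measurable_snd).
  exact: (measurableT_comp (m_after lam z Ax) measurable_snd).
have f0 w : (0 <= f w)%E.
  by rewrite !mule_ge0 ?trans_ge0// lee_fin ?mulr_ge0 ?expR_ge0.
have -> : tail_laplace lam x z = (fun t => \int[leb]_u f (t, u))%E.
  apply/funext => t; rewrite /tail_laplace integral_mkcond; apply: eq_integral => u _.
  rewrite patchE /f/= indicE; case: ifPn => _; first by rewrite mulr1.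
  by rewrite mulr0 mul0e.
have := @measurable_fun_fubini_tonelli_F _ _ _ _ R lebesgue_measure f mf f0.
by [].
Qed.

(** The integrand is at most one, so [tail_laplace] varies by at most [s - t] between [t] and
    [s]. *)
Lemma tail_laplace_right_continuous lam x z : 0 < lam -> A x -> A z ->
  right_continuous_half_line (fun t => fine (tail_laplace lam x z t)).
Proof.
move=> l0 Ax Az t t0 eta eta0; exists eta => // s /andP[ts st].
have D : (tail_laplace lam x z t <= tail_laplace lam x z s + (s - t)%:E)%E.
  have -> : ((s - t)%:E = \int[leb]_(u in half_line) (\1_(`]t, s]%classic : set R) u)%:E)%E.
    have L : lebesgue_measure (`]t, s]%classic : set R) = (s - t)%:E.
      rewrite lebesgue_measure_itv/= lte_fin; case: ltP => [_|st']; first by rewrite EFinB.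
      by congr EFin; apply/eqP; rewrite eq_sym subr_eq0 eq_le ts st'.
    rewrite integral_indic//; last exact: measurable_half_line.
    rewrite -L; congr (lebesgue_measure _); apply/esym/setIidPl => u /=; rewrite in_itv/= => /andP[tu _]; rewrite half_lineE.
    exact: (le_trans t0 (ltW tu)).
  rewrite -ge0_integralD//; last 4 first.
  - exact: measurable_half_line.
  - by move=> u _; rewrite !mule_ge0 ?trans_ge0// lee_fin expR_ge0.
  - by apply: measurable_funTS; apply: emeasurable_funM; [exact: m_step|exact: m_after].
  - by apply: measurable_funTS; apply/measurable_EFinP; exact: measurable_indic.
  apply: ge0_le_integral => //.
  - exact: measurable_half_line.
  - by move=> u _; rewrite !mule_ge0 ?trans_ge0// lee_fin expR_ge0.
  - by apply: measurable_funTS; apply: emeasurable_funM; [exact: m_step|exact: m_after].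
  - apply: measurable_funTS; apply: emeasurable_funD.
      by apply: emeasurable_funM; [exact: m_step|exact: m_after].
    by apply/measurable_EFinP; exact: measurable_indic.
  move=> u; rewrite half_lineE => u0.
  case: (ltP s u) => su; first by rewrite (le_lt_trans ts su) leeDl// lee_fin.
  case: (ltP t u) => tu; last by rewrite !mul0e add0e lee_fin.
  rewrite mul0e add0e mul1e indicE mem_set; last by rewrite /= in_itv/= tu.
  rewrite -[leRHS]mule1.
  apply: lee_pmul; rewrite ?trans_ge0 ?trans_le1 ?lee_fin ?expR_ge0//.
  by rewrite -expR0 ler_expR oppr_le0 mulr_ge0 ?(ltW l0).
have D2 : (tail_laplace lam x z s <= tail_laplace lam x z t)%E.
  apply: ge0_le_integral => //.
  - exact: measurable_half_line.
  - by move=> u _; rewrite !mule_ge0 ?trans_ge0// lee_fin expR_ge0.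
  - by apply: measurable_funTS; apply: emeasurable_funM; [exact: m_step|exact: m_after].
  - by apply: measurable_funTS; apply: emeasurable_funM; [exact: m_step|exact: m_after].
  move=> u _; rewrite lee_wpmul2r ?mule_ge0 ?trans_ge0 ?lee_fin ?expR_ge0//.
  by case: (ltP s u) => [su|_]; rewrite ?(le_lt_trans ts su).
move: D D2; rewrite -(fineK (tail_laplace_fin t l0 Ax Az)) -(fineK (tail_laplace_fin s l0 Ax Az)).
rewrite -EFinD !lee_fin/= => D D2; rewrite ler0_norm ?subr_le0//; lra.
Qed.

(** The Markov property at time [t], integrated over the later times. Both sides are
    right-continuous in [t]; their Laplace transforms at [a] are computed by [integral_expR_after]
    and by [lap_expect] at [lam + a], and agree by [resolvent_identity]. *)
Lemma tail_laplaceE lam x z t : 0 < lam -> A x -> A z -> 0 <= t ->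
  (tail_laplace lam x z t = (expR (- (lam * t)))%:E * \esum_(y in A) (p t x y * green lam y z))%E.
Proof.
move=> l0 Ax Az t0; pose g := onA (fun y => green lam y z).
have li0 : 0 <= lam^-1 by rewrite invr_ge0 ltW.
have gK0 y : A y -> (0 <= green lam y z <= (lam^-1)%:E)%E.
  by move=> Ay; rewrite green_ge0 ?(ltW l0)//= green_le.
have gK := onA_bound li0 gK0.
have gE y : A y -> ((g y)%:E = green lam y z)%E := onAE gK0.
have -> : (\esum_(y in A) (p t x y * green lam y z) = expect t g x)%E.
  by apply: eq_esum => y Ay; rewrite gE.
rewrite -(fineK (tail_laplace_fin t l0 Ax Az)) -(fineK (expect_fin t0 Ax gK)) -EFinM; congr EFin.
have bE := bounded_meas_expect Ax gK.
have b2 := bounded_measM (bounded_meas_expRM (ltW l0)) bE.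
have b1 : bounded_meas (fun t => fine (tail_laplace lam x z t)) (1 * lam^-1).
  split; first by apply: measurable_funTS; apply: measurableT_comp => //; exact: measurable_tail_laplace.
  move=> s s0; rewrite ger0_norm ?fine_ge0 ?tail_laplace_ge0// mul1r -lee_fin fineK ?tail_laplace_fin//.
  exact: tail_laplace_le.
apply: (lap_uniq_half_line (a0 := 0) b1 b2) => //.
- exact: tail_laplace_right_continuous.
- apply: (right_continuousM (bounded_meas_expRM (ltW l0)) bE (right_continuous_expR l0)).
  exact: expect_right_continuous gK.
move=> a _ a0; have la0 : 0 < lam + a by rewrite addr_gt0.
have -> : lap (fun t => expR (- (lam * t)) * fine (expect t g x)) a = lap (fun t => fine (expect t g x)) (lam + a).
  by apply: eq_Rintegral => s _; rewrite mulrA -expRD; congr (expR _ * _); ring.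
apply: EFin_inj; rewrite (lap_expect la0 Ax gK).
have -> : ((lap (fun t => fine (tail_laplace lam x z t)) a)%:E =
  \int[leb]_(t in half_line) ((expR (- (a * t)))%:E * tail_laplace lam x z t))%E.
  rewrite /lap /Rintegral fineK; last first.
    by apply: integrable_fin_num => //; exact: (integrable_lap b1).
  by apply: eq_integral => s _; rewrite EFinM fineK// tail_laplace_fin.
have E1 := integral_expR_after l0 a0 Ax Az; rewrite -/(tail_laplace lam x z _) in E1.
have E2 := resolvent_identity l0 (_ : lam < lam + a) Ax Az.
rewrite ltrDl a0 in E2; have {}E2 := E2 isT; rewrite addrAC subrr add0r in E2.
have gf : green (lam + a) x z \is a fin_num by exact: green_fin.
have gf' : green lam x z \is a fin_num by exact: green_fin.
have : (a%:E * \int[leb]_(t in half_line) ((expR (- (a * t)))%:E * tail_laplace lam x z t) =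
   a%:E * \esum_(y in A) (green (lam + a) x y * (g y)%:E))%E.
  transitivity (green lam x z - green (lam + a) x z)%E.
    by rewrite -E1 addeK.
  rewrite E2 [X in (X - _)%E]addeC addeK//; congr (_ * _)%E.
  by apply: eq_esum => y Ay; rewrite gE.
move/(congr1 (fun w => (a^-1)%:E * w)%E).
by rewrite !muleA -!EFinM mulVf ?gt_eqF// !mul1e.
Qed.

(** For fixed [t] the two sides are compared as functions of [s], their Laplace transforms being
    equal by [tail_laplaceE]. *)
Lemma chapman_kolmogorov t s x z : 0 <= t -> 0 <= s -> A x -> A z ->
  (p (t + s) x z = \esum_(y in A) (p t x y * p s y z))%E.
Proof.
move=> t0 s0 Ax Az; pose h := onA (fun y => p t y x).
have nx0 := nw_gt0 Ax.
have hK0 y : A y -> (0 <= p t y x <= 1%:E)%E by move=> Ay; rewrite trans_ge0 trans_le1.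
have hK := onA_bound ler01 hK0.
have hE y : A y -> ((h y)%:E = p t y x)%E := onAE hK0.
have symE (u : 'rV[R]_d -> \bar R) (v : 'rV[R]_d -> \bar R) :
    (forall y, A y -> 0 <= u y)%E -> (forall y, A y -> 0 <= v y)%E ->
    (forall y, A y -> (nw y)%:E * u y = (nw z)%:E * v y)%E ->
    (\esum_(y in A) (p t x y * u y) = ((nw z / nw x)%:E * \esum_(y in A) (v y * (h y)%:E)))%E.
  move=> u0 v0 uv.
  have -> : (nw z / nw x)%:E = ((nw x)^-1%:E * (nw z)%:E)%E by rewrite -EFinM mulrC.
  rewrite -muleA -(esumZ cA)//; last 2 first.
  - by rewrite lee_fin ltW// nw_gt0.
  - by move=> y Ay; rewrite mule_ge0 ?v0// lee_fin; have /andP[] := hK y.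
  rewrite -(esumZ cA)//; last 2 first.
  - by rewrite lee_fin invr_ge0 ltW.
  - move=> y Ay; rewrite !mule_ge0 ?v0 ?lee_fin ?(ltW (nw_gt0 Az))//.
    by have /andP[] := hK y.
  apply: eq_esum => y Ay; rewrite hE// [((nw z)%:E * _)%E]muleA -uv//.
  rewrite [((nw y)%:E * _ * _)%E]muleAC -trans_sym// !muleA -EFinM mulVf ?gt_eqF// mul1e.
  by [].
have -> : (\esum_(y in A) (p t x y * p s y z) = (nw z / nw x * fine (expect s h z))%:E)%E.
  rewrite EFinM fineK ?(expect_fin s0 Az hK)// -(symE (fun y => p s y z))//.
    by move=> y _; exact: trans_ge0.
  by move=> y _; exact: trans_ge0.
  by move=> y Ay; rewrite trans_sym.
rewrite -(fineK (trans_fin _ Ax Az)) ?addr_ge0//; congr EFin.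
have bE := bounded_meas_expect Az hK.
have bH := bounded_measZ (nw z / nw x) bE.
have bG : bounded_meas (fun s => fine (p (t + s) x z)) 1.
  have [_ H] := bounded_meas_trans Ax Az; split.
    apply: measurable_funTS; apply: measurableT_comp => //.
    apply: (measurableT_comp (measurable_trans z Ax)).
    exact: measurable_funD.
  by move=> u u0; apply: H; rewrite addr_ge0.
pose N := Num.max 1 (`|nw z / nw x| * 1).
apply: (@lap_uniq_half_line R (fun s => fine (p (t + s) x z)) (fun s => nw z / nw x * fine (expect s h z)) N 0) => //.
- by apply: bounded_meas_weaken bG; rewrite le_max lexx.
- by apply: bounded_meas_weaken bH; rewrite le_max lexx orbT.
- move=> u u0 eta eta0.
  have [|delta d0 H] := trans_right_continuous Ax Az (_ : 0 <= t + u) eta0; first by rewrite addr_ge0.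
  by exists delta => // v /andP[v1 v2]; apply: H; rewrite lerD2l v1 -addrA ltrD2l.
- by apply: right_continuousZ; exact: expect_right_continuous hK.
move=> lam _ l0; rewrite (lapZ _ bE l0); apply: EFin_inj.
rewrite EFinM (lap_expect l0 Az hK) -(symE (fun y => green lam y z)); last 3 first.
- by move=> y _; exact: green_ge0 (ltW l0).
- by move=> y _; exact: green_ge0 (ltW l0).
- by move=> y Ay; rewrite green_sym.
have := tail_laplaceE l0 Ax Az t0; rewrite /tail_laplace -integral_half_line_shift//; last 2 first.
- exact: m_after.
- by move=> u; rewrite mule_ge0 ?trans_ge0// lee_fin expR_ge0.
move=> E.
have -> : ((lap (fun s => fine (p (t + s) x z)) lam)%:E =
   (expR (lam * t))%:E * \int[leb]_(s in half_line) ((expR (- (lam * (s + t))))%:E * p (s + t) x z))%E.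
  rewrite /lap /Rintegral fineK; last first.
    by apply: integrable_fin_num => //; exact: (integrable_lap bG).
  rewrite -ge0_integralZl//; last 3 first.
  - exact: measurable_half_line.
  - apply: measurable_funTS; apply: (measurableT_comp (m_after lam z Ax)).
    exact: measurable_funD.
  - by move=> u _; rewrite mule_ge0 ?trans_ge0// lee_fin expR_ge0.
  apply: eq_integral => u; rewrite inE/= in_itv/= andbT => u0.
  rewrite EFinM fineK ?trans_fin ?addr_ge0// muleA -EFinM -expRD addrC; congr ((expR _)%:E * _)%E.
  ring.
by rewrite E muleA -EFinM -expRD subrr expR0 mul1e.
Qed.

End reversible_chain.

(** * Averages over boxes *)

Section lattice_action.
Context {R : realType} {d : nat} {dO : measure_display} {Omega : measurableType dO}.
Variables (k : group_kind) (theta : 'rV[R]_d -> Omega -> Omega).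
Hypothesis theta_act : group_action k theta.
Variable P : probability Omega R.
Hypothesis stat : stationary_ergodic k theta P.
Local Open Scope ereal_scope.

Lemma measurable_group_set : measurable (group_set k : set 'rV[R]_d).
Proof.
case: k => /=; first exact: measurableT.
apply: countable_measurable_rV.
apply: (@sub_countable _ _ _ [set (\row_i (f i)%:~R)%R | f in [set: {ffun 'I_d -> int}]]).
  apply: subset_card_le => g /= gZ.
  exists [ffun i => Num.floor (g ord0 i)] => //.
  apply/rowP => i; rewrite mxE ffunE; apply/esym/eqP; rewrite eq_sym -intrEfloor; exact: gZ.
exact: (sub_countable (card_image_le _ _) (countableP _)).
Qed.

Lemma measurable_theta g : group_set k g -> measurable_fun setT (theta g).
Proof.
move=> gk; have [_ _ mth] := theta_act.
have mk : measurable ((group_set k : set 'rV[R]_d) `*` [set: Omega]).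
  by apply: measurableX => //; exact: measurable_group_set.
apply: (measurable_comp (F := (group_set k : set 'rV[R]_d) `*` [set: Omega])
   (f := fun p : 'rV[R]_d * Omega => theta p.1 p.2) (g := fun w => (g, w)) mk _ mth).
  by move=> _ [w _ <-].
exact: pair1_measurable.
Qed.

Lemma integral_theta g (f : Omega -> \bar R) : group_set k g ->
  measurable_fun setT f -> (forall w, 0 <= f w) -> \int[P]_w f (theta g w) = \int[P]_w f w.
Proof.
move=> gk mf f0.
have E : \int[pushforward_measure P (measurable_theta gk)]_w f w = \int[P]_w f w.
  by apply: eq_measure_integral => A mA _; exact: (stat.1 g gk A mA).
rewrite -E /pushforward_measure ge0_integral_pushforward//.
exact: measurable_theta.
Qed.

Section lattice_points.
Variable N : nat.
Local Notation box := {ffun 'I_d -> 'I_N}.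

(** Integer vectors belong to the group in both cases, so the same covering serves R^d and Z^d. *)
Definition box_vec (g : box) : 'rV[R]_d := (\row_i (g i)%:R)%R.

Lemma group_box_vec g : group_set k (box_vec g).
Proof. by case: k => //= i; rewrite mxE rpred_nat. Qed.

Lemma card_box : (#|{: box}|%:R = N%:R ^+ d :> R)%R.
Proof. by rewrite card_ffun !card_ord natrX. Qed.

Lemma integral_box_sum (f : Omega -> \bar R) : measurable_fun setT f -> (forall w, 0 <= f w) ->
  \int[P]_w (\sum_(g : box) f (theta (box_vec g) w)) = (N%:R ^+ d)%R%:E * \int[P]_w f w.
Proof.
move=> mf f0; rewrite ge0_integral_sum//; last first.
  move=> g; exact: (measurableT_comp mf (measurable_theta (group_box_vec g))).
rewrite (eq_bigr (fun=> 1%:E * \int[P]_w f w)) => [|g _]; last first.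
  by rewrite mul1e integral_theta//; exact: group_box_vec.
rewrite -ge0_sume_distrl//.
by rewrite sumEFin sumr_const -card_box.
Qed.

Lemma measurable_box_sum (f : Omega -> \bar R) : measurable_fun setT f -> (forall w, 0 <= f w) ->
  measurable_fun setT (fun w => \sum_(g : box) f (theta (box_vec g) w)).
Proof.
move=> mf f0; apply: emeasurable_sum => g _.
exact: (measurableT_comp mf (measurable_theta (group_box_vec g))).
Qed.

End lattice_points.

(** The factor 3 per step of the induction: multiplying by [1 + x] adds [x] and [x ^ 2 * 3 ^ n] to
    [x * 3 ^ n], and both are at most [x * 3 ^ n]. *)
Lemma pow1D_small (x : R) n : (0 <= x <= 1)%R -> ((1 + x) ^+ n <= 1 + x * 3%:R ^+ n)%R.
Proof.
move=> /andP[x0 x1]; elim: n => [|n IH]; first by rewrite !expr0 mulr1 lerDl.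
rewrite exprSr; apply: (@le_trans _ _ ((1 + x * 3%:R ^+ n) * (1 + x))%R).
  by rewrite ler_wpM2r// addr_ge0.
rewrite exprSr; set y := (3%:R ^+ n)%R.
have y1 : (1 <= y)%R by rewrite exprn_ege1// ler1n.
have : (x * (x * y) <= 1 * (x * y))%R by rewrite ler_wpM2r// mulr_ge0// (le_trans _ y1).
have : (x * 1 <= x * y)%R by rewrite ler_wpM2l.
lra.
Qed.

(** * Covering most of a box by good tiles *)

Section covering.
Variables (p q : 'I_d -> nat).
Hypothesis p_gt0 : forall i, (0 < p i)%N.
Hypothesis q_gt0 : forall i, (0 < q i)%N.
Variable G : nat -> set Omega.
Hypothesis mG : forall n, measurable (G n).
Hypothesis Gfull : forall N0, P (\bigcup_(n in [set n | (N0 <= n)%N]) G n) = 1.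

Definition scales (N0 M : nat) : set Omega :=
  \bigcup_(n in [set n | (N0 <= n <= M)%N]) G n.

Lemma measurable_scales N0 M : measurable (scales N0 M).
Proof. exact: bigcup_measurable. Qed.

(** Continuity of the probability along the increasing sets [scales N0 M]. A bounded range of scales
    is needed for the boundary of the box to be negligible. *)
Lemma pick_scale N0 (delta : R) : (0 < delta)%R ->
  exists2 M, (N0 <= M)%N & P (~` scales N0 M) <= delta%:E.
Proof.
move=> d0.
have nd : nondecreasing_seq (scales N0).
  move=> m n mn; apply/subsetPset => w [j /= /andP[Nj jm] Gw].
  by exists j => //=; rewrite Nj (leq_trans jm).
have mU : measurable (\bigcup_M scales N0 M).
  by apply: bigcup_measurable => M _; exact: measurable_scales.
have U1 : P (\bigcup_M scales N0 M) = 1.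
  apply/eqP; rewrite eq_le probability_le1//=.
  rewrite -[leLHS](Gfull N0); apply: le_measure; rewrite ?inE.
  - exact: bigcup_measurable.
  - by [].
  - by move=> w [n /= Nn Gw]; exists n => //; exists n => //=; rewrite Nn/=.
have cvg : (fun M => P (scales N0 M)) @ \oo --> (1 : \bar R).
  by rewrite -U1; exact: (nondecreasing_cvg_mu (mu := P) (measurable_scales N0) mU nd).
have : (fun M => P (~` scales N0 M)) @ \oo --> 0.
  have -> : (fun M => P (~` scales N0 M)) = (fun M => 1 - P (scales N0 M)).
    by apply/funext => M; rewrite probability_setC//; exact: measurable_scales.
  rewrite -(subee (x := 1))//; apply: cvgeB => //; exact: cvg_cst.
move/fine_cvgP => [fin] /cvgrPdist_le /(_ _ d0) near_d.
have [M _ HM] : \forall M \near \oo, (N0 <= M)%N /\ P (~` scales N0 M) <= delta%:E.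
  near=> M; split; first by near: M; exact: nbhs_infty_ge.
  have f : P (~` scales N0 M) \is a fin_num by near: M.
  rewrite -(fineK f) lee_fin.
  have : (`|0 - fine (P (~` scales N0 M))| <= delta)%R by near: M.
  by rewrite sub0r normrN ger0_norm// fine_ge0.
by exists M; have [] := HM M (leqnn M).
Unshelve. all: by end_near. Qed.

Local Notation kap := ((2 ^+ d)^-1 : R)%R.
Local Notation side := (\sum_i (p i + q i))%N.

Definition boundary_frac (N M : nat) : R := ((M * side)%:R / N%:R)%R.

(** The earlier rounds, given by the induction, use scales at least [N1], chosen huge compared with
    the bound [M0] on the scales of the round added last; [tiling_round] then multiplies the
    uncovered part by [1 - kap]. The uncovered number depends on choices made for each [w], hence
    the measurable majorant [X], which can be integrated. *)
Lemma multi_round (rho : R) j N0 : (0 < rho)%R -> (0 < N0)%N -> exists M, forall N, (0 < N)%N ->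
  (forall i, M * (p i + q i) <= N)%N -> exists X : Omega -> R,
  [/\ measurable_fun setT X, forall w, (0 <= X w)%R,
     \int[P]_w (X w)%:E <= (((1 - kap) ^+ j + j%:R * (2 * rho + boundary_frac N M)) * N%:R ^+ d)%R%:E &
     forall w, exists Q : {set {set {ffun 'I_d -> 'I_N}}},
     [/\ finset.trivIset Q, finset.set0 \notin Q,
       (forall A, A \in Q -> exists2 m, (N0 <= m)%N & exists2 g, g \in inner N p q m &
         A = tile p q m g /\ G m (theta (box_vec g) w)) &
       (N%:R ^+ d - #|finset.cover Q|%:R <= X w)%R]].
Proof.
move=> rho0; elim: j N0 => [|j IH] N0 N00.
  exists 0%N => N N_gt0 _; exists (fun=> (N%:R ^+ d)%R); split.
  - exact: measurable_cst.
  - by move=> w; rewrite exprn_ge0.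
  - by rewrite integral_cst//= probability_setT mule1 expr0 mul0r addr0 mul1r.
  - move=> w; exists finset.set0; split.
    + by apply/finset.trivIsetP => A B; rewrite finset.inE.
    + by rewrite finset.inE.
    + by move=> A; rewrite finset.inE.
    + by rewrite lerBlDr lerDl.
have [M0 N0M0 PM0] := pick_scale N0 rho0.
(* Chosen so that [(1 + x1) ^ d <= 1 + rho], by [pow1D_small]. *)
pose x1 : R := (Num.min 1 (rho / 3%:R ^+ d))%R.
have x10 : (0 < x1)%R by rewrite lt_min ltr01 divr_gt0// exprn_gt0.
pose N1 := maxn N0 (Num.bound (M0%:R / x1))%R.
have N10 : (0 < N1)%N by rewrite (leq_trans N00)// leq_maxl.
have M0N1 : (M0%:R / N1%:R <= x1)%R.
  rewrite ler_pdivrMr ?ltr0n// -ler_pdivrMl// mulrC.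
  apply: (le_trans (ltW (archi_boundP _))); first by rewrite divr_ge0// ltW.
  by rewrite ler_nat leq_maxr.
have ratio : ((1 + M0%:R / N1%:R) ^+ d <= 1 + rho)%R.
  apply: (@le_trans _ _ ((1 + x1) ^+ d)%R).
    by rewrite lerXn2r ?nnegrE ?addr_ge0 ?divr_ge0 ?(ltW x10)// lerD2l.
  apply: (le_trans (pow1D_small _ _)); first by rewrite (ltW x10)/= ge_min lexx.
  rewrite lerD2l -ler_pdivlMr ?exprn_gt0//; by rewrite ge_min lexx orbT.
have [M1 HM1] := IH N1 N10.
exists (maxn M0 M1) => N N_gt0 MN.
have bM m : (m <= maxn M0 M1)%N -> (boundary_frac N m <= boundary_frac N (maxn M0 M1))%R.
  move=> h; rewrite ler_wpM2r ?invr_ge0// ler_nat; exact: leq_mul.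
have [|X1 [mX1 X10 iX1 cX1]] := HM1 N N_gt0.
  by move=> i; apply: leq_trans (MN i); rewrite leq_mul2r leq_maxr orbT.
pose B := ~` scales N0 M0.
have mB : measurable B by apply: measurableC; exact: measurable_scales.
(* The number of points of the box at which no scale between [N0] and [M0] is good. By stationarity
   its mean is at most [rho * N ^ d]. *)
pose S w : \bar R := \sum_(g : {ffun 'I_d -> 'I_N}) (\1_B (theta (box_vec g) w))%:E.
have m1B : measurable_fun setT (fun w => (\1_B w)%:E : \bar R).
  by apply/measurable_EFinP; exact: measurable_indic.
have mS : measurable_fun setT S by apply: (measurable_box_sum N m1B) => w; rewrite lee_fin.
have SE w : S w = (\sum_(g : {ffun 'I_d -> 'I_N}) \1_B (theta (box_vec g) w))%R%:E by rewrite -sumEFin.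
have S0 w : 0 <= S w by rewrite sume_ge0// => g _; rewrite lee_fin.
have k01 : (0 <= 1 - kap)%R.
  by rewrite subr_ge0 invf_le1 ?exprn_gt0// exprn_ege1// ler1n.
have k1 : (1 - kap <= 1)%R by rewrite lerBlDr lerDl invr_ge0 exprn_ge0.
pose c : R := (boundary_frac N M0 * N%:R ^+ d + rho * N%:R ^+ d)%R.
have c0 : (0 <= c)%R.
  by rewrite addr_ge0// mulr_ge0 ?exprn_ge0 ?(ltW rho0)// divr_ge0.
have iS : \int[P]_w S w <= (rho * N%:R ^+ d)%R%:E.
  rewrite (integral_box_sum _ m1B)//.
  rewrite integral_indic// setIT mulrC EFinM lee_wpmul2l// lee_fin exprn_ge0//.
exists (fun w => (1 - kap) * X1 w + (c + fine (S w)))%R; split.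
- apply: measurable_funD; first exact: measurable_funM.
  by apply: measurable_funD => //; exact: measurableT_comp.
- by move=> w; rewrite addr_ge0// ?mulr_ge0// addr_ge0// fine_ge0.
- under eq_integral => w _.
    rewrite 2!EFinD fineK ?SE// -SE EFinM; over.
  rewrite ge0_integralD//; last 4 first.
  + by move=> w _; rewrite mule_ge0 ?lee_fin.
  + by apply: measurable_funeM; apply/measurable_EFinP.
  + by move=> w _; rewrite adde_ge0 ?lee_fin.
  + by apply: emeasurable_funD.
  rewrite ge0_integralZl//; last 2 first.
  + by apply/measurable_EFinP.
  + by move=> w _; rewrite lee_fin.
  rewrite ge0_integralD//.
  rewrite integral_cst//= probability_setT mule1.
  apply: (@le_trans _ _ ((1 - kap)%:E *
    (((1 - kap) ^+ j + j%:R * (2 * rho + boundary_frac N M1)) * N%:R ^+ d)%R%:E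
     + (c%:E + (rho * N%:R ^+ d)%R%:E))).
    by rewrite leeD ?leeD// lee_wpmul2l// lee_fin.
  rewrite -EFinM -!EFinD lee_fin /c.
  have Nd : (0 <= N%:R ^+ d :> R)%R by rewrite exprn_ge0.
  set b := boundary_frac N (maxn M0 M1).
  have b0 : (boundary_frac N M0 <= b)%R by rewrite bM// leq_maxl.
  have b1 : (boundary_frac N M1 <= b)%R by rewrite bM// leq_maxr.
  have b00 : (0 <= boundary_frac N M1)%R by rewrite divr_ge0.
  set y := (j%:R * (2 * rho + boundary_frac N M1))%R.
  have y0 : (0 <= y)%R by rewrite mulr_ge0// addr_ge0// mulr_ge0// ltW.
  have uy : ((1 - kap) * y <= j%:R * (2 * rho + b))%R.
    apply: (@le_trans _ _ (1 * y)%R); first by rewrite ler_wpM2r.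
    by rewrite mul1r ler_wpM2l// lerD2l.
  apply: (@le_trans _ _ (((1 - kap) ^+ j.+1 + (1 - kap) * y + (boundary_frac N M0 + rho + rho)) * N%:R ^+ d)%R).
    by apply: eq_leW; rewrite exprS; ring.
  rewrite ler_wpM2r// -addrA lerD2l -[j.+1]addn1 natrD [X in (_ <= X)%R]mulrDl mul1r.
  by apply: lerD uy _; lra.
- move=> w; have [Q [tQ Q0 QT cQ]] := cX1 w.
  pose n (g : {ffun 'I_d -> 'I_N}) := xget 0%N [set n | (N0 <= n <= M0)%N /\ G n (theta (box_vec g) w)].
  pose D : {set {ffun 'I_d -> 'I_N}} := [set g | `[< B (theta (box_vec g) w) >]]%SET.
  pose C : {set {ffun 'I_d -> 'I_N}} := [set g in inner N p q M0 | g \notin D]%SET.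
  have CP g : g \in C -> [/\ (N0 <= n g <= M0)%N, G (n g) (theta (box_vec g) w) & g \in inner N p q M0].
    rewrite !finset.inE => /andP[gI /asboolPn nB].
    have [j' jN Gj] : scales N0 M0 (theta (box_vec g) w) by apply: contrapT.
    by have [] := @xgetPex _ 0%N [set n | (N0 <= n <= M0)%N /\ G n (theta (box_vec g) w)] (ex_intro _ j' (conj jN Gj)).
  have [] := @tiling_round d N p q p_gt0 q_gt0 R rho N1 M0 (ltW rho0) ratio N10 Q C n tQ Q0.
  + move=> A /QT[m Nm [g gI [-> _]]]; exists m => //; by exists g.
  + move=> g /CP[/andP[n1 n2] _ gI]; split; first by rewrite (leq_trans N00)//.
    by apply: (fintype.subsetP (inner_leq _ _ _ n2)).
  move=> Q' [tQ' Q'0 Q'T cQ']; exists Q'; split=> //.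
    move=> A /Q'T[/QT[m Nm [g gI [AE Gm]]]|[g /CP[/andP[n1 n2] Gg gI] ->]].
      exists m; first by apply: leq_trans Nm; exact: leq_maxl.
      by exists g.
    exists (n g) => //; exists g => //.
    by apply: (fintype.subsetP (inner_leq _ _ _ n2)).
  apply: (le_trans cQ'); rewrite -addrA lerD//; first by rewrite ler_wpM2l.
  rewrite /c [X in (_ <= X)%R]addrAC lerD2r.
  have sub : (#|finset.setC C| <= #|finset.setC (inner N p q M0)| + #|D|)%N.
    apply: leq_trans (leq_card_setU _ _).1; apply/subset_leq_card/fintype.subsetP => g.
    rewrite !finset.inE negb_and negbK; by [].
  have := @card_inner d N p q R M0 N_gt0.
  move: sub; rewrite -(ler_nat R) natrD => sub ci; apply: (le_trans sub).
  rewrite lerD//.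
    by apply: ci => i; apply: leq_trans (MN i); rewrite leq_mul2r leq_maxl orbT.
  rewrite SE/= -sum1_card natr_sum big_mkcond/=; apply: ler_sum => g _.
  rewrite finset.inE indicE; case: asboolP => h; last by [].
  by rewrite mem_set.
Qed.

Lemma covering_expectation (eta : R) : (0 < eta)%R -> exists2 N, (0 < N)%N & exists X : Omega -> R,
  [/\ measurable_fun setT X, forall w, (0 <= X w)%R,
     \int[P]_w (X w)%:E <= (eta * N%:R ^+ d)%R%:E &
     forall w, exists Q : {set {set {ffun 'I_d -> 'I_N}}},
     [/\ finset.trivIset Q,
       (forall A, A \in Q -> exists2 m, (0 < m)%N & exists2 g, g \in inner N p q m &
         A = tile p q m g /\ G m (theta (box_vec g) w)) &
       (N%:R ^+ d - #|finset.cover Q|%:R <= X w)%R]].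
Proof.
move=> eta0.
have k01 : (0 <= 1 - kap)%R.
  by rewrite subr_ge0 invf_le1 ?exprn_gt0// exprn_ege1// ler1n.
have k1 : (`|1 - kap| < 1)%R.
  by rewrite ger0_norm// ltrBlDr ltrDl invr_gt0 exprn_gt0.
have [j Hj] : exists j, ((1 - kap) ^+ j <= eta / 2)%R.
  have := cvg_expr k1; move/cvgrPdist_le => /(_ (eta / 2)%R) []; first by rewrite divr_gt0.
  move=> j _ H; exists j; have := H j (leqnn j).
  by rewrite sub0r normrN ger0_norm// exprn_ge0.
(* With [boundary_frac N M <= 2 * rho] the [j] rounds lose at most [j * (4 * rho) <= eta / 2]; the
   other half is the geometric term. *)
pose rho := (eta / (8 * j.+1%:R))%R.
have rho0 : (0 < rho)%R by rewrite divr_gt0// mulr_gt0.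
have [M HM] := @multi_round rho j 1 rho0 isT.
pose N := (maxn 1 (maxn (M * side) (Num.bound ((M * side)%:R / (2 * rho))%R)))%N.
have N0 : (0 < N)%N by rewrite leq_max.
have MN i : (M * (p i + q i) <= N)%N.
  apply: (@leq_trans (M * side)); last by rewrite !leq_max leqnn orbT.
  by rewrite leq_mul2l (bigD1 i)//= leq_addr orbT.
have bN : (boundary_frac N M <= 2 * rho)%R.
  rewrite ler_pdivrMr ?ltr0n// -ler_pdivrMl ?mulr_gt0// mulrC.
  apply: (le_trans (ltW (archi_boundP _))); first by rewrite divr_ge0// mulr_ge0 ?(ltW rho0).
  by rewrite ler_nat !leq_max leqnn !orbT.
have [X [mX X0 iX cX]] := HM N N0 MN.
exists N => //; exists X; split=> //.
- apply: (le_trans iX); rewrite lee_fin ler_wpM2r ?exprn_ge0//.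
  have : (j%:R * (2 * rho + boundary_frac N M) <= j.+1%:R * (4 * rho))%R.
    apply: ler_pM => //; first exact: (addr_ge0 (mulr_ge0 _ (ltW rho0)) (divr_ge0 _ _)).
      by rewrite ler_nat.
    lra.
  have -> : (j.+1%:R * (4 * rho) = eta / 2)%R by rewrite /rho; field.
  lra.
- move=> w; have [Q [tQ _ QT cQ]] := cX w; by exists Q.
Qed.

End covering.

(** * Averages that are often large or small, against the mean *)

Section box_averages.
Variables (p q : 'I_d -> nat).
Hypothesis p_gt0 : forall i, (0 < p i)%N.
Hypothesis q_gt0 : forall i, (0 < q i)%N.
Variables (alpha : nat -> Omega -> R) (xi : Omega -> R) (Ostar : set Omega).
Hypothesis m_alpha : forall n, measurable_fun setT (alpha n).
Hypothesis m_xi : measurable_fun setT xi.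
Hypothesis xi_ge0 : forall w, (0 <= xi w)%R.
Hypothesis mOstar : measurable Ostar.
Hypothesis POstar : P Ostar = 1.
Hypothesis alphaE : forall w N n (g : {ffun 'I_d -> 'I_N}), Ostar w -> g \in inner N p q n ->
  alpha n (theta (box_vec g) w) = (\sum_(h in tile p q n g) xi (theta (box_vec h) w))%R.

Local Notation vol n := ((n%:R ^+ d * (tile_volume p q)%:R) : R)%R.

(** Disjoint tiles of average above [c] cover all but a fraction [eta] of the box in mean, so the
    total over the box exceeds [c * N ^ d] up to that loss, while its expectation is [N ^ d] times
    the mean of [xi] by stationarity. *)
Lemma frequently_large_average (c : R) : (0 <= c)%R ->
  (forall N0, P (\bigcup_(n in [set n | (N0 <= n)%N]) [set w | c * vol n < alpha n w]%R) = 1) ->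
  c%:E <= \int[P]_w (xi w)%:E.
Proof.
move=> c0 full.
have mG n : measurable [set w | c * vol n < alpha n w]%R.
  rewrite -[X in measurable X]setTI.
  exact: (measurable_fun_ltr (measurable_cst _) (m_alpha n)).
have m_exi : measurable_fun setT (EFin \o xi) by exact/measurable_EFinP.
suff H (eta : R) : (0 < eta)%R -> c%:E <= \int[P]_w (xi w)%:E + (c * eta)%R%:E.
  apply/lee_addgt0Pr => e e0.
  have := H (e / (c + 1))%R; rewrite divr_gt0 ?ltr_pwDr// => /(_ isT) /le_trans; apply.
  by rewrite leeD2l// lee_fin mulrCA ger_pMr// ler_pdivrMr ?ltr_pwDr// mul1r lerDl.
move=> eta0; have [N N0 [X [mX X0 iX cX]]] := covering_expectation p_gt0 q_gt0 mG full eta0.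
have NN : (0 < N%:R ^+ d :> R)%R by rewrite exprn_gt0// ltr0n.
pose Sm w : \bar R := \sum_(h : {ffun 'I_d -> 'I_N}) (xi (theta (box_vec h) w))%:E.
have mS : measurable_fun setT Sm by apply: (measurable_box_sum N m_exi) => w; rewrite lee_fin.
have S0 w : 0 <= Sm w by rewrite sume_ge0// => g _; rewrite lee_fin.
have key w : Ostar w -> (c * N%:R ^+ d)%R%:E <= Sm w + c%:E * (X w)%:E.
  move=> Ow; have [Q [tQ QT cQ]] := cX w.
  rewrite /Sm sumEFin -EFinM -EFinD lee_fin.
  have h1 : (\sum_(h in finset.cover Q) xi (theta (box_vec h) w) <=
      \sum_(h : {ffun 'I_d -> 'I_N}) xi (theta (box_vec h) w))%R.
    rewrite [leRHS](bigID (mem (finset.cover Q)))/= lerDl.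
    by apply: sumr_ge0 => h _.
  have h2 : (c * #|finset.cover Q|%:R <= \sum_(h in finset.cover Q) xi (theta (box_vec h) w))%R.
    rewrite (finset.big_trivIset _ tQ)/=.
    have -> : #|finset.cover Q| = (\sum_(A in Q) #|A|)%N by apply/eqP; rewrite eq_sym.
    rewrite natr_sum mulr_sumr; apply: ler_sum => A AQ.
    have [m m0 [g gI [-> gG]]] := QT A AQ.
    by rewrite -alphaE// card_tile// natrM natrX; exact: ltW.
  have : (c * (N%:R ^+ d - #|finset.cover Q|%:R) <= c * X w)%R by rewrite ler_wpM2l.
  by rewrite mulrBr; lra.
have mX' : measurable_fun setT (fun w => (X w)%:E) by exact/measurable_EFinP.
have : \int[P]_w (c * N%:R ^+ d)%R%:E <= \int[P]_w (Sm w + c%:E * (X w)%:E).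
  apply: ae_ge0_le_integral => //.
  - by move=> w _; rewrite lee_fin mulr_ge0// ltW.
  - by move=> w _; rewrite adde_ge0// mule_ge0 ?lee_fin.
  - by apply: emeasurable_funD => //; exact: measurable_funeM.
  exists (~` Ostar); split; first exact: measurableC.
    by have := probability_setC P mOstar; rewrite POstar subee.
  by move=> w /= nH Ow; apply: nH => _; exact: key.
rewrite integral_cst//= probability_setT mule1 ge0_integralD//; last 2 first.
- by move=> w _; rewrite mule_ge0 ?lee_fin.
- exact: measurable_funeM.
rewrite ge0_integralZl//; last by move=> w _; rewrite lee_fin.
rewrite (integral_box_sum _ m_exi); last by move=> w; rewrite lee_fin.
move=> H; have {}H : (c * N%:R ^+ d)%R%:E <= (N%:R ^+ d)%R%:E * \int[P]_w (xi w)%:E + (c * (eta * N%:R ^+ d))%R%:E.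
  by apply: (le_trans H); rewrite leeD2l// EFinM lee_wpmul2l.
case: (\int[P]_w (xi w)%:E) H => [r| |].
- rewrite -EFinM -EFinD !lee_fin => H; rewrite -(ler_pM2r NN) mulrDl.
  by apply: (le_trans H); rewrite mulrA [(N%:R ^+ d * r)%R]mulrC.
- by move=> _; rewrite addye// leey.
- by rewrite mulrNy gtr0_sg// mul1e addNye leeNy_eq.
Qed.

(** Here the uncovered points could carry a large mass, so [xi] is truncated at [L]: they then
    contribute at most [L] each. The truncation is removed at the end by monotone convergence. *)
Lemma frequently_small_average (c : R) : (0 <= c)%R ->
  (forall N0, P (\bigcup_(n in [set n | (N0 <= n)%N]) [set w | alpha n w < c * vol n]%R) = 1) ->
  \int[P]_w (xi w)%:E <= c%:E.
Proof.
move=> c0 full.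
have mG n : measurable [set w | alpha n w < c * vol n]%R.
  rewrite -[X in measurable X]setTI.
  exact: (measurable_fun_ltr (m_alpha n) (measurable_cst _)).
pose xiL (L : nat) w : R := Num.min (xi w) L%:R.
have xiL0 L w : (0 <= xiL L w)%R by rewrite /xiL le_min xi_ge0/=.
have m_xiL L : measurable_fun setT (fun w => (xiL L w)%:E).
  by apply/measurable_EFinP; apply: measurable_minr => //; exact: measurable_cst.
suff H L : \int[P]_w (xiL L w)%:E <= c%:E.
  have nd w : setT w -> {homo (fun L => (xiL L w)%:E) : m n / (m <= n)%N >-> m <= n}.
    by move=> _ m n mn; rewrite lee_fin /xiL le_min ge_min lexx/= ge_min ler_nat mn orbT.
  have := @cvg_monotone_convergence _ _ _ P setT measurableT (fun L w => (xiL L w)%:E) m_xiL _ nd.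
  have -> : (fun x => limn (fun L => (xiL L x)%:E)) = (fun w => (xi w)%:E).
    apply/funext => w; apply/cvg_lim => //; apply: cvg_near_cst.
    near=> L; congr EFin; rewrite /xiL; apply/min_idPl.
    apply: (le_trans (ltW (archi_boundP (xi_ge0 w)))); rewrite ler_nat.
    by near: L; exact: nbhs_infty_ge.
  move=> /(_ (fun L w _ => _)) cvg.
  have {}cvg : (fun L => \int[P]_w (xiL L w)%:E) @ \oo --> \int[P]_w (xi w)%:E.
    by apply: cvg => L w; rewrite lee_fin.
  rewrite -(cvg_lim _ cvg)//; apply: lime_le; first by apply/cvg_ex; exists (\int[P]_w (xi w)%:E).
  by apply: nearW => L; exact: H.
suff K (eta : R) : (0 < eta)%R -> \int[P]_w (xiL L w)%:E <= (c + L%:R * eta)%R%:E.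
  apply/lee_addgt0Pr => e e0.
  have := K (e / (L%:R + 1))%R; rewrite divr_gt0 ?ltr_pwDr// => /(_ isT) /le_trans; apply.
  rewrite -EFinD lee_fin lerD2l mulrCA ger_pMr// ler_pdivrMr ?mul1r ?lerDl//.
move=> eta0; have [N N0 [X [mX X0 iX cX]]] := covering_expectation p_gt0 q_gt0 mG full eta0.
have NN : (0 < N%:R ^+ d :> R)%R by rewrite exprn_gt0// ltr0n.
pose Sm w : \bar R := \sum_(h : {ffun 'I_d -> 'I_N}) (xiL L (theta (box_vec h) w))%:E.
have mS : measurable_fun setT Sm by apply: (measurable_box_sum N (m_xiL L)) => w; rewrite lee_fin.
have S0 w : 0 <= Sm w by rewrite sume_ge0// => g _; rewrite lee_fin.
have key w : Ostar w -> Sm w <= (c * N%:R ^+ d)%R%:E + L%:R%:E * (X w)%:E.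
  move=> Ow; have [Q [tQ QT cQ]] := cX w.
  rewrite /Sm sumEFin -EFinM -EFinD lee_fin.
  rewrite (bigID (mem (finset.cover Q)))/=; apply: lerD.
    apply: (@le_trans _ _ (c * #|finset.cover Q|%:R)%R); last first.
      by rewrite ler_wpM2l// -(card_box N) ler_nat max_card.
    rewrite (finset.big_trivIset _ tQ)/=.
    have -> : #|finset.cover Q| = (\sum_(A in Q) #|A|)%N by apply/eqP; rewrite eq_sym.
    rewrite natr_sum mulr_sumr; apply: ler_sum => A AQ.
    have [m m0 [g gI [-> gG]]] := QT A AQ.
    apply: (@le_trans _ _ (\sum_(h in tile p q m g) xi (theta (box_vec h) w)))%R.
      by apply: ler_sum => h _; rewrite ge_min lexx.
    by rewrite -alphaE// card_tile// natrM natrX; exact: ltW.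
  apply: (@le_trans _ _ (\sum_(h | h \notin finset.cover Q) L%:R)%R).
    by apply: ler_sum => h _; rewrite ge_min lexx orbT.
  rewrite sumr_const -[leLHS]mulr_natr ler_wpM2l//; apply: le_trans cQ.
  rewrite -(card_box N) -(cardC (mem (finset.cover Q))) natrD addrAC subrr add0r.
  by rewrite ler_nat; apply/eq_leq/eq_card => h; rewrite !inE.
have mX' : measurable_fun setT (fun w => (X w)%:E) by exact/measurable_EFinP.
have : \int[P]_w Sm w <= \int[P]_w ((c * N%:R ^+ d)%R%:E + L%:R%:E * (X w)%:E).
  apply: ae_ge0_le_integral => //.
  - by move=> w _; rewrite adde_ge0// ?mule_ge0 ?lee_fin ?mulr_ge0 ?(ltW NN).
  - by apply: emeasurable_funD => //; exact: measurable_funeM.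
  exists (~` Ostar); split; first exact: measurableC.
    by have := probability_setC P mOstar; rewrite POstar subee.
  by move=> w /= nH Ow; apply: nH => _; exact: key.
rewrite (integral_box_sum _ (m_xiL L)); last by move=> w; rewrite lee_fin.
rewrite ge0_integralD//; last 3 first.
- by move=> w _; rewrite lee_fin mulr_ge0// ltW.
- by move=> w _; rewrite mule_ge0 ?lee_fin.
- exact: measurable_funeM.
rewrite integral_cst//= probability_setT mule1.
rewrite ge0_integralZl//; last by move=> w _; rewrite lee_fin.
move=> H; have {}H : (N%:R ^+ d)%R%:E * \int[P]_w (xiL L w)%:E <= (c * N%:R ^+ d)%R%:E + (L%:R * (eta * N%:R ^+ d))%R%:E.
  by apply: (le_trans H); rewrite leeD2l// EFinM lee_wpmul2l// lee_fin.
case: (\int[P]_w (xiL L w)%:E) H => [r| |].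
- rewrite -EFinM -EFinD !lee_fin => H; rewrite -(ler_pM2r NN) mulrDl.
  by rewrite mulrC; apply: (le_trans H); rewrite mulrA.
- by rewrite mulry gtr0_sg// mul1e -EFinD leye_eq.
- by rewrite leNye.
Unshelve. all: by end_near. Qed.

End box_averages.

End lattice_action.

(** * Parallelepipeds along the columns of V and their mass *)

Section trapezoid.
Context {R : realType}.

(** Rises from 0 at [a - 1 / k] to 1 at [a] and comes down from 1 at [b - 1 / k] to 0 at [b], when
    the interval is long enough. The asymmetry makes the limit the indicator of the half-open
    interval, closed at [a]. *)
Definition trapezoid (k : nat) (a b y : R) : R :=
  Num.max 0 (Num.min 1 (Num.min (1 + k%:R * (y - a)) (k%:R * (b - y)))).

Lemma trapezoid01 k (a b y : R) : 0 <= trapezoid k a b y <= 1.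
Proof. by rewrite /trapezoid le_max lexx/= ge_max ler01/= ge_min lexx. Qed.

Lemma continuous_trapezoid k (a b : R) : continuous (trapezoid k a b).
Proof.
move=> y; apply: (@continuous_max R R (cst 0) _ y); first exact: cst_continuous.
apply: (@continuous_min R R (cst 1) _ y); first exact: cst_continuous.
apply: (@continuous_min R R (fun y => 1 + k%:R * (y - a)) (fun y => k%:R * (b - y)) y).
  apply: cvgD; first exact: cvg_cst.
  apply: cvgM; first exact: cvg_cst.
  by apply: cvgB; [exact: cvg_id|exact: cvg_cst].
apply: cvgM; first exact: cvg_cst.
by apply: cvgB; [exact: cvg_cst|exact: cvg_id].
Qed.

Lemma trapezoid_out k (a b y : R) : (0 < k)%N -> trapezoid k a b y != 0 -> a - 1 <= y <= b.
Proof.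
move=> k0; apply: contraNT; rewrite negb_and -!ltNge /trapezoid => H.
have kR : 1 <= k%:R :> R by rewrite ler1n.
apply/eqP; apply/max_idPl; rewrite !ge_min; case/orP: H => H.
  have ay : 1 <= a - y by lra.
  have : 1 * (a - y) <= k%:R * (a - y) by rewrite ler_wpM2r// (le_trans ler01).
  by move=> h; apply/orP; right; apply/orP; left; lra.
apply/orP; right; apply/orP; right; rewrite pmulr_rle0 ?subr_le0 ?(ltW H)//.
exact: lt_le_trans kR.
Qed.

Lemma trapezoid_cvg (a b y : R) : trapezoid k a b y @[k --> \oo] --> ((a <= y < b)%R%:R : R).
Proof.
have [ya|ya] := ltP y a.
  apply: cvg_near_cst; near=> k; rewrite /trapezoid; apply/max_idPl; rewrite !ge_min.
  apply/orP; right; apply/orP; left.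
  have : (a - y)^-1 <= k%:R.
    apply: (le_trans (ltW (archi_boundP _))); first by rewrite invr_ge0 subr_ge0 ltW.
    by rewrite ler_nat; near: k; exact: nbhs_infty_ge.
  by rewrite -[X in X <= _]mul1r ler_pdivrMr ?subr_gt0// => h; nra.
have [yb|yb] := ltP y b.
  apply: cvg_near_cst; near=> k; rewrite /trapezoid/=.
  have h1 : 1 <= 1 + k%:R * (y - a) by rewrite lerDl mulr_ge0// subr_ge0.
  have h2 : 1 <= k%:R * (b - y).
    have : (b - y)^-1 <= k%:R.
      apply: (le_trans (ltW (archi_boundP _))); first by rewrite invr_ge0 subr_ge0 ltW.
      by rewrite ler_nat; near: k; exact: nbhs_infty_ge.
    by rewrite -[X in X <= _]mul1r ler_pdivrMr ?subr_gt0.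
  rewrite (min_idPl _); last by rewrite le_min h1.
  by apply/max_idPr.
apply: cvg_near_cst; near=> k; rewrite /trapezoid/=; apply/max_idPl; rewrite !ge_min.
by apply/orP; right; apply/orP; right; rewrite mulr_ge0_le0// subr_le0.
Unshelve. all: by end_near. Qed.

End trapezoid.

Section parallelepipeds.
Context {R : realType} {d : nat}.
Variable V : 'M[R]_d.
Hypothesis V_inv : V \in unitmx.
Implicit Types (a b : 'I_d -> R) (x : 'rV[R]_d).

Definition vcoord x (i : 'I_d) : R := mulmv (invmx V) x ord0 i.

(** Half-open like [cell V], so that integer translates of the unit box tile the space exactly and
    no mass on faces is lost or counted twice. *)
Definition vbox a b : set 'rV[R]_d := [set x | forall i, a i <= vcoord x i < b i].

Lemma vcoordE x i : vcoord x i = \sum_j x ord0 j * invmx V i j.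
Proof. by rewrite /vcoord /mulmv mxE; apply: eq_bigr => j _; rewrite mxE. Qed.

Lemma vcoordK x : mulmv V (\row_i vcoord x i) = x.
Proof.
have -> : \row_i vcoord x i = mulmv (invmx V) x by apply/rowP => i; rewrite mxE.
by rewrite /mulmv -mulmxA -trmx_mul mulmxV// trmx1 mulmx1.
Qed.

Lemma vcoord_mulmv x i : vcoord (mulmv V x) i = x ord0 i.
Proof. by rewrite /vcoord /mulmv -mulmxA -trmx_mul mulVmx// trmx1 mulmx1. Qed.

Lemma vcoordD x y i : vcoord (x + y) i = vcoord x i + vcoord y i.
Proof. by rewrite /vcoord /mulmv mulmxDl mxE. Qed.

Lemma vcoordZ c x i : vcoord (c *: x) i = c * vcoord x i.
Proof. by rewrite /vcoord /mulmv -scalemxAl mxE. Qed.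

Lemma continuous_vcoord i : continuous (fun x => vcoord x i).
Proof.
have -> : (fun x => vcoord x i) = (fun x => \sum_(j <- index_enum 'I_d) x ord0 j * invmx V i j).
  by apply/funext => x; rewrite vcoordE.
elim: (index_enum _) => [|j s IH] x.
  have -> : (fun x : 'rV[R]_d => \sum_(j <- [::]) x ord0 j * invmx V i j) = cst 0.
    by apply/funext => y; rewrite big_nil.
  exact: cst_continuous.
rewrite (_ : (fun x : 'rV[R]_d => \sum_(j <- _ :: _) _) =
   (fun x : 'rV[R]_d => x ord0 j * invmx V i j + \sum_(j <- s) x ord0 j * invmx V i j)); last first.
  by apply/funext => y; rewrite big_cons.
apply: (@continuousD _ R^o 'rV[R]_d (fun x => x ord0 j * invmx V i j)); last exact: IH.
apply: (@continuousM _ 'rV[R]_d (fun x => x ord0 j) (cst (invmx V i j))).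
  exact: coord_continuous.
exact: cst_continuous.
Qed.

Lemma measurable_vbox a b : measurable (vbox a b).
Proof.
have -> : vbox a b = \bigcap_(i in [set: 'I_d]) ((fun x => vcoord x i) @^-1` `[a i, b i[%classic).
  apply/seteqP; split => [x H i _|x H i]; first by rewrite /= in_itv/=; exact: H.
  by have := H i I; rewrite /= in_itv.
apply: fin_bigcap_measurable => // i _; rewrite -[X in measurable X]setTI.
by apply: (continuous_measurable_rV (@continuous_vcoord i)) => //; exact: measurable_itv.
Qed.

Lemma cellE : cell V = vbox (fun=> 0) (fun=> 1).
Proof.
apply/seteqP; split => x /=.
  by move=> [t [t01 ->]] i; rewrite vcoord_mulmv.
move=> H; exists (\row_i vcoord x i); split; last by rewrite vcoordK.
by move=> i; rewrite mxE.
Qed.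

Lemma vbox_tau (g : 'rV[R]_d) a b :
  tau V g @` vbox a b = vbox (fun i => a i + g ord0 i) (fun i => b i + g ord0 i).
Proof.
apply/seteqP; split => x /=.
  move=> [y Hy <-] i; rewrite /tau vcoordD vcoord_mulmv lerD2r ltrD2r; exact: Hy.
move=> H; exists (x - mulmv V g); last by rewrite /tau subrK.
move=> i; have := H i; rewrite vcoordD -scaleN1r vcoordZ vcoord_mulmv mulN1r.
by rewrite lerBrDr ltrBlDr.
Qed.

Definition vnorm : R := \sum_i \sum_j `|V i j|.

Lemma vnorm_bound x r : (forall i, `|vcoord x i| <= r) -> `|x| <= vnorm * r.
Proof.
(* In dimension zero no index is available from which to deduce [0 <= r]. *)
move=> H; have [d0|[i0 _]] : (forall i : 'I_d, False) \/ exists i : 'I_d, True.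
  by have [i|nE] := pselect (exists i : 'I_d, True); [right|left => i; apply: nE; exists i].
  have -> : x = 0 by apply/rowP => i; case: (d0 i).
  by rewrite normr0 /vnorm big1 ?mul0r// => i; case: (d0 i).
have r0 : 0 <= r by apply: le_trans (H i0).
rewrite /Num.norm/= mx_normrE bigmax_le ?mulr_ge0// => [|[i j] _/=].
  by apply: sumr_ge0 => i _; apply: sumr_ge0.
rewrite (ord1 i) -{1}(vcoordK x) /mulmv mxE; apply: (le_trans (ler_norm_sum _ _ _)).
apply: (@le_trans _ _ ((\sum_k `|V j k|) * r)).
  rewrite mulr_suml; apply: ler_sum => k _; rewrite !mxE normrM mulrC.
  by rewrite ler_wpM2l.
rewrite /vnorm [X in _ <= X * _](bigD1 j)//= mulrDl lerDl mulr_ge0// sumr_ge0// => k _.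
exact: sumr_ge0.
Qed.

Lemma vbox_bounded a b : exists r, vbox a b `<=` [set x | `|x| <= r].
Proof.
exists (vnorm * \sum_i (`|a i| + `|b i|)) => x /= H; apply: vnorm_bound => i.
rewrite (bigD1 i)//= -[leLHS]addr0 lerD//; last by apply: sumr_ge0 => j _; rewrite addr_ge0.
have /andP[h1 h2] := H i; rewrite ler_norml; apply/andP; split.
  by rewrite lerNl; apply: (@le_trans _ _ `|a i|); rewrite ?lerDl// -normrN (le_trans _ (ler_norm _))// lerN2.
by apply: (le_trans (ltW h2)); apply: (le_trans (ler_norm _)); rewrite lerDr.
Qed.

Lemma vbox_fin (mu : lfmeasure R d) a b : (mu (vbox a b) < +oo)%E.
Proof.
have [r sub] := vbox_bounded a b.
apply: (@le_lt_trans _ _ (mu [set x | `|x| <= r])); last exact: (lfm_finite mu (compact_ball_rV (r := r))).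
apply: le_measure; rewrite ?inE//; first exact: measurable_vbox.
by apply: closed_measurable_rV; apply: compact_closed => //; exact: compact_ball_rV.
Qed.

Lemma vbox_fin_num (mu : lfmeasure R d) a b : mu (vbox a b) \is a fin_num.
Proof. by rewrite ge0_fin_numE// vbox_fin. Qed.

Definition box_mass (mu : lfmeasure R d) a b : R := fine (mu (vbox a b)).

Lemma box_mass_ge0 mu a b : 0 <= box_mass mu a b.
Proof. by rewrite fine_ge0. Qed.

Lemma box_mass_le mu a b a' b' : (forall i, a' i <= a i) -> (forall i, b i <= b' i) ->
  box_mass mu a b <= box_mass mu a' b'.
Proof.
move=> aa bb; rewrite -lee_fin !fineK ?vbox_fin_num//.
apply: le_measure; rewrite ?inE; try exact: measurable_vbox.
by move=> x H i; have /andP[h1 h2] := H i; rewrite (le_trans (aa i) h1) (lt_le_trans h2 (bb i)).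
Qed.

(** The unit boxes at the points of [tile p q n g] partition the large box: the integer part of the
    coordinates of a point selects its unit box, and [inner] keeps these integers non-negative and
    below [N]. *)
Lemma box_mass_tile (mu : lfmeasure R d) N (p q : 'I_d -> nat) n (g : {ffun 'I_d -> 'I_N}) :
  g \in inner N p q n ->
  box_mass mu (fun i => (g i)%:R - (n * p i)%:R) (fun i => (g i)%:R + (n * q i)%:R) =
  \sum_(h in tile p q n g) box_mass mu (fun i => (h i)%:R) (fun i => (h i)%:R + 1).
Proof.
rewrite finset.inE => /forallP gI; apply: EFin_inj; rewrite -sumEFin [LHS]fineK ?vbox_fin_num//.
under eq_bigr do rewrite /box_mass fineK ?vbox_fin_num//.
rewrite -big_enum/= fsbig_seq ?enum_uniq//= -measure_fin_bigcup//=; last 2 first.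
- move=> h h' _ _ [x [H H']]; apply/ffunP => i; apply/val_inj => /=.
  have /andP[h1 h2] := H i; have /andP[h3 h4] := H' i.
  have := le_lt_trans h1 h4; have := le_lt_trans h3 h2.
  by rewrite !natr1 !ltr_nat; lia.
- by move=> h _; exact: measurable_vbox.
congr (mu _); apply/seteqP; split => x /=.
  move=> H.
  have hE (i : 'I_d) : exists h : 'I_N, [/\ (h%:R : R) <= vcoord x i < (h%:R : R) + 1,
      (g i <= h + n * p i)%N & (h < g i + n * q i)%N].
    have /andP[i1 i2] := gI i; have /andP[h1 h2] := H i.
    have v0 : 0 <= vcoord x i by apply: le_trans h1; rewrite subr_ge0 ler_nat.
    have t := truncn_itv v0; set m := Num.truncn (vcoord x i) in t.
    have /andP[t1 t2] := t.
    have m1 : (m < g i + n * q i)%N by rewrite -(ltr_nat R) natrD (le_lt_trans t1).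
    have m2 : (g i <= m + n * p i)%N.
      have : (g i)%:R < (m.+1 + n * p i)%:R :> R by rewrite natrD -ltrBlDr (le_lt_trans h1).
      by rewrite ltr_nat; lia.
    have mN : (m < N)%N by apply: leq_trans i2.
    by exists (Ordinal mN); split => //=; rewrite t1 natr1.
  have [h hP] := choice hE.
  exists [ffun i => h i].
    rewrite /= mem_enum finset.inE; apply/forallP => i; rewrite ffunE.
    by have [_ -> ->] := hP i.
  by move=> i; rewrite ffunE; have [] := hP i.
move=> [h]; rewrite /= mem_enum finset.inE => /forallP hT H i.
have /andP[h1 h2] := hT i; have /andP[h3 h4] := H i.
rewrite lerBlDr; apply/andP; split.
  by apply: (@le_trans _ _ ((h i)%:R + (n * p i)%:R)); rewrite -?natrD ?ler_nat// natrD lerD2r.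
by apply: (lt_le_trans h4); rewrite natr1 -natrD ler_nat.
Qed.

Section box_measurability.
Context {dO : measure_display} {Omega : measurableType dO}.
Variable mu : Omega -> lfmeasure R d.
Hypothesis mu_meas : random_measure mu.

(** The measures giving [phi] an integral above [r] form a vaguely open set, by definition of that
    topology. *)
Lemma measurable_integral_Cc phi : Cc phi ->
  measurable_fun setT (fun w => \int[mu w]_x phi x).
Proof.
move=> Cphi; apply: (measurability _ (RGenOInfty.measurableE R)) => //.
move=> _ [_ [r ->] <-]; rewrite setTI.
apply: (mu_meas (B := [set m | (\int[m]_x phi x) \in `]r, +oo[])).
apply: sub_sigma_algebra => m /=; rewrite in_itv/= andbT => rm.
exists 1%N, (fun=> phi), (\int[m]_x phi x - r); split=> // [|m' /(_ ord0)].
  by rewrite subr_gt0.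
by rewrite in_itv/= andbT ltr_distl => /andP[+ _]; rewrite opprB addrC subrK.
Qed.

Definition box_bump k a b x : R := \prod_(i <- index_enum 'I_d) trapezoid k (a i) (b i) (vcoord x i).

Lemma box_bump01 k a b x : 0 <= box_bump k a b x <= 1.
Proof.
rewrite /box_bump; elim: (index_enum _) => [|i s /andP[IH0 IH1]]; first by rewrite big_nil ler01 lexx.
rewrite big_cons; have /andP[h0 h1] := trapezoid01 k (a i) (b i) (vcoord x i).
by rewrite mulr_ge0//= mulr_ile1.
Qed.

Lemma continuous_box_bump k a b : continuous (box_bump k a b).
Proof.
rewrite /box_bump; elim: (index_enum _) => [|j s IH] x.
  have -> : (fun x : 'rV[R]_d => \prod_(i <- [::]) trapezoid k (a i) (b i) (vcoord x i)) = cst 1.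
    by apply/funext => y; rewrite big_nil.
  exact: cst_continuous.
rewrite (_ : (fun x : 'rV[R]_d => \prod_(j <- _ :: _) _) =
   (fun x => trapezoid k (a j) (b j) (vcoord x j) * \prod_(i <- s) trapezoid k (a i) (b i) (vcoord x i))); last first.
  by apply/funext => y; rewrite big_cons.
apply: (@continuousM _ 'rV[R]_d (fun x => trapezoid k (a j) (b j) (vcoord x j))); last exact: IH.
apply: (@continuous_comp _ _ _ (fun x : 'rV[R]_d => vcoord x j) (trapezoid k (a j) (b j))).
  exact: continuous_vcoord.
exact: continuous_trapezoid.
Qed.

Lemma box_bump_cvg a b x : box_bump k a b x @[k --> \oo] --> (\1_(vbox a b) x : R).
Proof.
have -> : \1_(vbox a b) x = \prod_(i <- index_enum 'I_d) ((a i <= vcoord x i < b i)%R%:R : R).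
  rewrite indicE; have [xb|xb] := boolP (x \in vbox a b).
    by move: xb; rewrite inE => H; rewrite big1// => i _; rewrite H.
  apply/esym/eqP; apply: contraNT xb => /prodf_neq0 H; rewrite inE => i.
  by have := H i isT; case: (_ && _); rewrite ?eqxx.
rewrite /box_bump; elim: (index_enum _) => [|i s IH].
  by rewrite big_nil; under eq_fun do rewrite big_nil; exact: cvg_cst.
rewrite big_cons; under eq_fun do rewrite big_cons.
by apply: cvgM => //; exact: trapezoid_cvg.
Qed.

Lemma box_bump_support a b : exists r, forall k x, (0 < k)%N -> box_bump k a b x != 0 -> `|x| <= r.
Proof.
have [r sub] := vbox_bounded (fun i => a i - 1) (fun i => b i + 1).
exists r => k x k0 nz; apply: sub => i.
have : trapezoid k (a i) (b i) (vcoord x i) != 0.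
  by move/prodf_neq0: nz => /(_ i isT); exact.
by move/(trapezoid_out k0) => /andP[-> h] /=; rewrite (le_lt_trans h)// ltrDl ltr01.
Qed.

Lemma Cc_box_bump k a b : (0 < k)%N -> Cc (box_bump k a b).
Proof.
move=> k0; split; first exact: continuous_box_bump.
have [r H] := box_bump_support a b.
exists [set x | `|x| <= r]; first exact: compact_ball_rV.
by move=> x /= nx; apply/eqP; apply: contra_notT nx; exact: H.
Qed.

(** Dominated convergence along the bumps, whose supports stay in one fixed ball. *)
Lemma measurable_box_mass a b : measurable_fun setT (fun w => box_mass (mu w) a b).
Proof.
have [r Hr] := box_bump_support a b.
apply: (@measurable_fun_cvg _ _ _ setT (fun k w => \int[mu w]_x box_bump k.+1 a b x)) => //.
  by move=> k; apply: measurable_integral_Cc; exact: Cc_box_bump.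
move=> w _.
have mB : measurable [set x : 'rV[R]_d | `|x| <= r].
  by apply: closed_measurable_rV; apply: compact_closed => //; exact: compact_ball_rV.
have [|||//||_ _ cvg] := @dominated_convergence _ _ R (mu w) setT measurableT
  (fun k x => (box_bump k.+1 a b x)%:E) (fun x => (\1_(vbox a b) x)%:E)
  (fun x => (\1_[set x : 'rV[R]_d | `|x| <= r] x)%:E).
- move=> k; apply/measurable_EFinP; apply: continuous_measurable_rV.
  exact: continuous_box_bump.
- apply/measurable_EFinP; apply: measurable_indic; exact: measurable_vbox.
- apply: aeW => x _; apply/fine_cvgP; split; first by near=> k.
  by have := @box_bump_cvg a b x; rewrite -cvg_shiftS.
- apply/integrableP; split; first by apply/measurable_EFinP/measurable_indic.
  under eq_integral do rewrite gee0_abs ?lee_fin//.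
  by rewrite integral_indic// setIT; exact: (lfm_finite (mu w) (compact_ball_rV (r := r))).
- apply: aeW => x k _ /=; have /andP[h0 h1] := box_bump01 k.+1 a b x.
  rewrite lee_fin ger0_norm// indicE; case: (boolP (_ \in _)) => //.
  move/negP => nx; rewrite leNgt; apply/negP => h; apply: nx; rewrite inE/=.
  by apply: (Hr k.+1) => //; rewrite gt_eqF.
rewrite /box_mass; move: cvg; rewrite integral_indic ?setIT//; last exact: measurable_vbox.
rewrite -[X in _ --> X -> _](fineK (vbox_fin_num _ _ _)) => /fine_cvg; exact.
Unshelve. all: by end_near. Qed.

End box_measurability.
End parallelepipeds.

(** * Invariant sets of full probability *)

Section invariant_sets.
Context {R : realType} {d : nat} {dO : measure_display} {Omega : measurableType dO}.
Variables (k : group_kind) (theta : 'rV[R]_d -> Omega -> Omega).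
Hypothesis theta_act : group_action k theta.
Variable P : probability Omega R.

Lemma group_setN (g : 'rV[R]_d) : group_set k g -> group_set k (- g).
Proof. by case: k => //= H i; rewrite mxE rpredN. Qed.

Lemma thetaK g w : group_set k g -> theta (- g) (theta g w) = w.
Proof.
by move=> gk; have [t0 tD _] := theta_act; rewrite tD ?addNr//; exact: group_setN.
Qed.

Lemma invariantP (A : set Omega) : Defs.invariant k theta A <->
  forall g w, group_set k g -> A w -> A (theta g w).
Proof.
split=> [iA g w gk Aw|H g gk]; first by rewrite -(iA g gk); exists w.
apply/seteqP; split => [_ [w Aw <-]|w Aw]; first exact: H.
exists (theta (- g) w); first by apply: H => //; exact: group_setN.
by have := thetaK w (group_setN gk); rewrite opprK.
Qed.

Lemma invariantC (A B : set Omega) : Defs.invariant k theta A -> Defs.invariant k theta B ->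
  Defs.invariant k theta (A `\` B).
Proof.
move=> /invariantP iA /invariantP iB; apply/invariantP => g w gk [Aw nB]; split; first exact: iA.
by move=> Bw; apply: nB; rewrite -(thetaK w gk); apply: iB => //; exact: group_setN.
Qed.

Lemma full_invariant_bigcapn (A : nat -> set Omega) :
  (forall i, full_invariant k P theta (A i)) -> full_invariant k P theta (\bigcap_i A i).
Proof.
move=> fA; have mA i : measurable (A i) by have [] := fA i.
have mI : measurable (\bigcap_i A i) by exact: bigcapT_measurable.
split=> //.
  apply/invariantP => g w gk H i _; have [_ /invariantP iA _] := fA i.
  by apply: iA => //; exact: H.
have : P (~` \bigcap_i A i) = 0%E.
  apply/measure_negligible; first exact: measurableC.
  rewrite setC_bigcap; apply: negligible_bigcup => i.
  have [_ _ PA] := fA i; exists (~` A i); split=> //; first exact: measurableC.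
  by have := probability_setC P (mA i); rewrite PA subee.
move=> h; have := probability_setC P (measurableC mI); rewrite setCK h sube0 => ->.
by [].
Qed.

Lemma full_invariant_bigcap (J : countType) (A : J -> set Omega) :
  (forall i, full_invariant k P theta (A i)) -> full_invariant k P theta (\bigcap_i A i).
Proof.
move=> fA; have fT : full_invariant k P theta setT.
  split; [exact: measurableT| |exact: probability_setT].
  by apply/invariantP.
have -> : \bigcap_i A i = \bigcap_n (if unpickle n is Some i then A i else setT).
  apply/seteqP; split => w H.
    by move=> n _; case: (unpickle n) => // i; exact: H.
  by move=> i _; have := H (pickle i) I; rewrite pickleK.
by apply: full_invariant_bigcapn => n; case: (unpickle n).
Qed.

Lemma full_invariantI (A B : set Omega) : full_invariant k P theta A -> full_invariant k P theta B ->
  full_invariant k P theta (A `&` B).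
Proof.
move=> fA fB; have -> : A `&` B = \bigcap_(i : bool) (if i then A else B).
  apply/seteqP; split => [w [Aw Bw] [] _ //|w H].
  by split; [exact: (H true)|exact: (H false)].
by apply: full_invariant_bigcap => -[].
Qed.

End invariant_sets.

(** * Ergodic theorem for boxes around the origin *)

Section ergodic_theorem.
Context {R : realType} {d : nat} {dO : measure_display} {Omega : measurableType dO}.
Variables (k : group_kind) (V : 'M[R]_d) (V_inv : V \in unitmx).
Variables (P : probability Omega R) (theta : 'rV[R]_d -> Omega -> Omega).
Hypothesis theta_act : group_action k theta.
Hypothesis stat : stationary_ergodic k theta P.
Variable mu : Omega -> lfmeasure R d.
Hypothesis mu_meas : random_measure mu.
Variable Ostar : set Omega.
Hypothesis Ostar_full : full_invariant k P theta Ostar.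
Hypothesis covariant : forall g w, group_set k g -> Ostar w -> forall B, measurable B ->
  mu (theta g w) B = mu w (tau V g @` B).
Variable m : R.
Hypothesis mean : (\int[P]_w mu w (cell V) = m%:E)%E.

Let mO : measurable Ostar. Proof. by have [] := Ostar_full. Qed.
Let PO : P Ostar = 1%E. Proof. by have [] := Ostar_full. Qed.
Let iO g w : group_set k g -> Ostar w -> Ostar (theta g w).
Proof. by have [_ /(invariantP theta_act) + _] := Ostar_full; apply. Qed.

Definition centred_mass (p q : 'I_d -> nat) (n : nat) (w : Omega) : R :=
  box_mass V (mu w) (fun i => - (n * p i)%:R) (fun i => (n * q i)%:R).

Let m_ge0 : 0 <= m.
Proof. by rewrite -lee_fin -mean; apply: integral_ge0. Qed.

Lemma box_mass_theta g w a b : group_set k g -> Ostar w ->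
  box_mass V (mu (theta g w)) a b =
  box_mass V (mu w) (fun i => a i + g ord0 i) (fun i => b i + g ord0 i).
Proof.
by move=> gk Ow; rewrite /box_mass covariant ?vbox_tau//; exact: measurable_vbox.
Qed.

Section fixed_shape.
Variables (p q : 'I_d -> nat).
Hypothesis p_gt0 : forall i, (0 < p i)%N.
Hypothesis q_gt0 : forall i, (0 < q i)%N.
Local Notation alpha := (centred_mass p q).
Local Notation vol n := (n%:R ^+ d * (tile_volume p q)%:R : R).

Let vol_ge0 n : 0 <= vol n.
Proof. by rewrite mulr_ge0 ?exprn_ge0. Qed.

Let tv0 : 0 < (tile_volume p q)%:R :> R.
Proof. by rewrite ltr0n tile_volume_gt0. Qed.

Lemma centred_mass_ge0 n w : 0 <= alpha n w.
Proof. exact: box_mass_ge0. Qed.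

(** As every [p i] and [q i] is at least one, raising the scale by [K] moves each face outwards by
    at least [K], which makes room for the translation. *)
Lemma centred_mass_theta_le g w n K : group_set k g -> Ostar w -> (forall i, `|g ord0 i| <= K%:R) ->
  alpha n (theta g w) <= alpha (n + K) w.
Proof.
move=> gk Ow gK; rewrite /centred_mass box_mass_theta//; apply: (box_mass_le V_inv) => i.
  have := gK i; rewrite ler_norml => /andP[+ _].
  have : (1 : R) <= (p i)%:R by rewrite ler1n.
  rewrite !natrM natrD mulrDl => p1 g1.
  have : K%:R * 1 <= K%:R * (p i)%:R :> R by rewrite ler_wpM2l.
  lra.
have := gK i; rewrite ler_norml => /andP[_].
have : (1 : R) <= (q i)%:R by rewrite ler1n.
rewrite !natrM natrD mulrDl => p1 g1.
have : K%:R * 1 <= K%:R * (q i)%:R :> R by rewrite ler_wpM2l.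
lra.
Qed.

Lemma centred_mass_tile w N n (g : {ffun 'I_d -> 'I_N}) : Ostar w -> g \in inner N p q n ->
  alpha n (theta (box_vec g) w) =
  \sum_(h in tile p q n g) box_mass V (mu (theta (box_vec h) w)) (fun=> 0) (fun=> 1).
Proof.
move=> Ow gI; rewrite /centred_mass box_mass_theta//; last exact: group_box_vec.
rewrite [RHS](eq_bigr (fun h : {ffun 'I_d -> 'I_N} => box_mass V (mu w)
    (fun i => 0 + box_vec h ord0 i) (fun i => 1 + box_vec h ord0 i))); last first.
  by move=> h _; rewrite box_mass_theta//; exact: group_box_vec.
transitivity (box_mass V (mu w) (fun i => (g i)%:R - (n * p i)%:R) (fun i => (g i)%:R + (n * q i)%:R)).
  by congr box_mass; apply/funext => i; rewrite mxE addrC.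
rewrite box_mass_tile//; apply: eq_bigr => h _.
by congr box_mass; apply/funext => i; rewrite mxE ?add0r// addrC.
Qed.

Let meanE : (\int[P]_w (box_mass V (mu w) (fun=> 0) (fun=> 1))%:E = m%:E)%E.
Proof.
by rewrite -mean; apply: eq_integral => w _; rewrite /box_mass cellE// fineK// vbox_fin_num.
Qed.

Let m_alpha n : measurable_fun setT (alpha n).
Proof. exact: measurable_box_mass. Qed.

Lemma mean_ge_frequently (c : R) : 0 <= c ->
  (forall N0, P (\bigcup_(n in [set n | (N0 <= n)%N]) [set w | c * vol n < alpha n w]) = 1%E) ->
  c <= m.
Proof.
move=> c0 full; rewrite -lee_fin -meanE.
apply: (@frequently_large_average _ _ _ _ k theta theta_act P stat p q p_gt0 q_gt0 alpha
  (fun w => box_mass V (mu w) (fun=> 0) (fun=> 1)) Ostar m_alpha _ _ mO PO _ c c0 full).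
- exact: measurable_box_mass.
- by move=> w; exact: box_mass_ge0.
- by move=> w N n g Ow gI; exact: centred_mass_tile.
Qed.

Lemma mean_le_frequently (c : R) : 0 <= c ->
  (forall N0, P (\bigcup_(n in [set n | (N0 <= n)%N]) [set w | alpha n w < c * vol n]) = 1%E) ->
  m <= c.
Proof.
move=> c0 full; rewrite -lee_fin -meanE.
apply: (@frequently_small_average _ _ _ _ k theta theta_act P stat p q p_gt0 q_gt0 alpha
  (fun w => box_mass V (mu w) (fun=> 0) (fun=> 1)) Ostar m_alpha _ _ mO PO _ c c0 full).
- exact: measurable_box_mass.
- by move=> w; exact: box_mass_ge0.
- by move=> w N n g Ow gI; exact: centred_mass_tile.
Qed.

(** The upper limit of [alpha n / vol n] exceeds [c]. The slack [j.+1%:R^-1] makes the set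
    invariant: a translation replaces [n] by [n + K], a ratio of volumes tending to one, and this is
    absorbed by passing to a larger [j]. *)
Definition often_above (c : R) : set Omega := Ostar `&` \bigcup_j \bigcap_N0
  \bigcup_(n in [set n | (N0 <= n)%N]) [set w | (c + j.+1%:R^-1) * vol n < alpha n w].

Definition often_below (c : R) : set Omega := Ostar `&` \bigcup_j \bigcap_N0
  \bigcup_(n in [set n | (N0 <= n)%N]) [set w | alpha n w < (c - j.+1%:R^-1) * vol n].

Lemma measurable_often_above c : measurable (often_above c).
Proof.
apply: measurableI => //; apply: bigcupT_measurable => j; apply: bigcapT_measurable => N0.
apply: bigcup_measurable => n _; rewrite -[X in measurable X]setTI.
exact: (measurable_fun_ltr (measurable_cst _) (m_alpha n)).
Qed.

Lemma measurable_often_below c : measurable (often_below c).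
Proof.
apply: measurableI => //; apply: bigcupT_measurable => j; apply: bigcapT_measurable => N0.
apply: bigcup_measurable => n _; rewrite -[X in measurable X]setTI.
exact: (measurable_fun_ltr (m_alpha n) (measurable_cst _)).
Qed.

Lemma power_ratio (K : nat) (a b : R) : 0 < a -> a < b ->
  exists N1, forall n, (N1 <= n)%N -> a * vol (n + K)%N <= b * vol n.
Proof.
move=> a0 ab; have b0 : 0 < b by exact: lt_trans ab.
pose delta := (b / a - 1) / 3%:R ^+ d.
have d0 : 0 < delta by rewrite divr_gt0 ?exprn_gt0// subr_gt0 ltr_pdivlMr// mul1r.
exists (maxn K.+1 (Num.bound (K%:R / delta))) => n; rewrite geq_max => /andP[Kn dn].
have n0 : 0 < n%:R :> R by rewrite ltr0n (leq_trans _ Kn).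
have x1 : K%:R / n%:R <= 1 :> R by rewrite ler_pdivrMr// mul1r ler_nat ltnW.
have xd : K%:R / n%:R <= delta.
  rewrite ler_pdivrMr// mulrC -ler_pdivrMr// (le_trans (ltW (archi_boundP _)))//.
    by rewrite divr_ge0// ltW.
  by rewrite ler_nat.
have -> : (n + K)%:R = n%:R * (1 + K%:R / n%:R) :> R.
  by rewrite mulrDr mulr1 natrD mulrCA divff ?gt_eqF// mulr1.
rewrite exprMn -!mulrA mulrCA [X in _ <= X]mulrCA ler_wpM2l ?exprn_ge0 ?(ltW n0)//.
rewrite mulrA ler_wpM2r ?(ltW tv0)// -ler_pdivlMl// [X in _ <= X]mulrC.
apply: (le_trans (pow1D_small _ _)); first by rewrite x1 divr_ge0.
by rewrite -lerBrDl -ler_pdivlMr ?exprn_gt0.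
Qed.

Lemma inv_succ_gap (j : nat) : exists i : nat, (i.+1%:R^-1 : R) < j.+1%:R^-1.
Proof. by exists j.+1; rewrite ltf_pV2 ?posrE// ltr_nat. Qed.

Lemma coord_bound (g : 'rV[R]_d) : exists K : nat, forall i, `|g ord0 i| <= K%:R.
Proof.
exists (Num.bound (\sum_i `|g ord0 i|)) => i.
apply: (le_trans _ (ltW (archi_boundP _))); last exact: sumr_ge0.
by rewrite (bigD1 i)//= lerDl sumr_ge0.
Qed.

Lemma centred_mass_theta_ge g w n K : group_set k g -> Ostar w -> (forall i, `|g ord0 i| <= K%:R) ->
  alpha n w <= alpha (n + K) (theta g w).
Proof.
move=> gk Ow gK; rewrite -[X in alpha n X](thetaK theta_act w gk).
apply: centred_mass_theta_le; [exact: group_setN|exact: iO|].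
by move=> i; rewrite mxE normrN.
Qed.

Lemma invariant_often_above c : 0 <= c -> Defs.invariant k theta (often_above c).
Proof.
move=> c0; apply/(invariantP theta_act) => g w gk [Ow [j _ Hj]]; split; first exact: iO.
have [K gK] := coord_bound g; have [i ij] := inv_succ_gap j.
have a0 : 0 < c + i.+1%:R^-1 by rewrite ltr_wpDl// invr_gt0.
have ab : c + i.+1%:R^-1 < c + j.+1%:R^-1 by rewrite ltrD2l.
have [N1 HN1] := power_ratio K a0 ab.
exists i => // N0 _; have [n /= nN Hn] := Hj (maxn N0 N1) I.
move: nN; rewrite geq_max => /andP[n0 n1].
exists (n + K)%N; first by rewrite /= (leq_trans n0)// leq_addr.
by rewrite /= (le_lt_trans (HN1 n n1))// (lt_le_trans Hn)// centred_mass_theta_ge.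
Qed.

Lemma invariant_often_below c : Defs.invariant k theta (often_below c).
Proof.
apply/(invariantP theta_act) => g w gk [Ow [j _ Hj]]; split; first exact: iO.
have [K gK] := coord_bound g; have [i ij] := inv_succ_gap j.
(* Masses are non-negative, so the level they stay strictly below is positive, as [power_ratio]
   demands. *)
have a0 : 0 < c - j.+1%:R^-1.
  have [n _ Hn] := Hj 0%N I; rewrite ltNge; apply/negP => le0.
  have := le_lt_trans (centred_mass_ge0 n w) Hn; rewrite ltNge => /negP; apply.
  by rewrite mulr_le0_ge0.
have ab : c - j.+1%:R^-1 < c - i.+1%:R^-1 by rewrite ltrD2l ltrN2.
have [N1 HN1] := power_ratio K a0 ab.
exists i => // N0 _; have [n /= nN Hn] := Hj (maxn N0 N1 + K)%N I.
have nK : n = (n - K + K)%N by rewrite subnK// (leq_trans _ nN)// leq_addl.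
have n1 : (maxn N0 N1 <= n - K)%N by move: nN; lia.
move: n1; rewrite geq_max => /andP[n0 n1].
exists (n - K)%N => //=; apply: lt_le_trans (HN1 _ n1); rewrite -nK.
by apply: le_lt_trans Hn; rewrite {2}nK; exact: centred_mass_theta_le.
Qed.

(** By ergodicity the probability is 0 or 1, and 1 would force [c <= m]. *)
Lemma often_above_null c : m < c -> P (often_above c) = 0%E.
Proof.
move=> mc; have c0 : 0 <= c by exact: le_trans (ltW mc).
have [//|P1] := stat.2 _ (measurable_often_above c) (invariant_often_above c0).
have : c <= m; last by rewrite leNgt mc.
apply: mean_ge_frequently => // N0; apply/eqP; rewrite eq_le probability_le1/=.
  rewrite -[leLHS]P1; apply: le_measure; rewrite ?inE.
  - exact: measurable_often_above.
  - apply: bigcup_measurable => n _; rewrite -[X in measurable X]setTI.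
    exact: (measurable_fun_ltr (measurable_cst _) (m_alpha n)).
  - move=> w [_ [j _ /(_ N0 I)[n nN /= H]]]; exists n => //=; apply: le_lt_trans H.
    by rewrite ler_wpM2r// lerDl.
apply: bigcup_measurable => n _; rewrite -[X in measurable X]setTI.
exact: (measurable_fun_ltr (measurable_cst _) (m_alpha n)).
Qed.

Lemma often_below_null c : c < m -> P (often_below c) = 0%E.
Proof.
move=> mc; have [c0|c0] := ltP c 0.
  have -> : often_below c = set0; last exact: measure0.
  rewrite -subset0 => w [_ [j _ /(_ 0%N I)[n _ /= H]]].
  have := le_lt_trans (centred_mass_ge0 n w) H; rewrite ltNge => /negP; apply.
  rewrite mulr_le0_ge0// subr_le0 (le_trans (ltW c0))// invr_ge0//.
have [//|P1] := stat.2 _ (measurable_often_below c) (invariant_often_below c).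
have : m <= c; last by rewrite leNgt mc.
apply: mean_le_frequently => // N0; apply/eqP; rewrite eq_le probability_le1/=.
  rewrite -[leLHS]P1; apply: le_measure; rewrite ?inE.
  - exact: measurable_often_below.
  - apply: bigcup_measurable => n _; rewrite -[X in measurable X]setTI.
    exact: (measurable_fun_ltr (m_alpha n) (measurable_cst _)).
  - move=> w [_ [j _ /(_ N0 I)[n nN /= H]]]; exists n => //=; apply: (lt_le_trans H).
    by rewrite ler_wpM2r// gerDl lerNl oppr0.
apply: bigcup_measurable => n _; rewrite -[X in measurable X]setTI.
exact: (measurable_fun_ltr (m_alpha n) (measurable_cst _)).
Qed.

Definition averaging_set : set Omega := \bigcap_j
  ((Ostar `\` often_above (m + j.+1%:R^-1)) `&` (Ostar `\` often_below (m - j.+1%:R^-1))).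

Lemma full_invariantD A : measurable A -> Defs.invariant k theta A -> P A = 0%E ->
  full_invariant k P theta (Ostar `\` A).
Proof.
move=> mA iA PA; split; first exact: measurableD.
  by apply: (invariantC theta_act) => //; have [] := Ostar_full.
rewrite measureD//; last by rewrite (le_lt_trans (probability_le1 _ _))// ltey.
rewrite [X in (X - _)%E](_ : _ = 1%E); last exact: PO.
rewrite [X in (_ - X)%E](_ : _ = 0%E) ?sube0//.
apply/eqP; rewrite eq_le measure_ge0 andbT -PA; apply: le_measure; rewrite ?inE//.
exact: measurableI.
Qed.

Lemma averaging_set_full : full_invariant k P theta averaging_set.
Proof.
apply: (full_invariant_bigcapn theta_act) => j; apply: (full_invariantI theta_act).
  apply: full_invariantD; [exact: measurable_often_above| |].
    by apply: invariant_often_above; rewrite addr_ge0.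
  by apply: often_above_null; rewrite ltrDl invr_gt0.
apply: full_invariantD; [exact: measurable_often_below|exact: invariant_often_below|].
by apply: often_below_null; rewrite gtrDl oppr_lt0 invr_gt0.
Qed.

Lemma averaging_set_cvg w : averaging_set w ->
  alpha n w / n%:R ^+ d @[n --> \oo] --> m * (tile_volume p q)%:R.
Proof.
move=> aw; apply/cvgrPdist_le => e e0.
set v := (tile_volume p q)%:R : R.
have [j jb] : exists j : nat, (j.+1%:R^-1 + j.+1%:R^-1) * v <= e.
  exists (Num.bound (2 * v / e)); set j := Num.bound _.
  have : 2 * v / e < j%:R by apply: archi_boundP; rewrite divr_ge0 ?mulr_ge0 ?(ltW tv0) ?(ltW e0).
  rewrite ltr_pdivrMr// => h.
  rewrite -mulr2n -[_ *+ 2]mulr_natl -mulrA [_^-1 * _]mulrC mulrA ler_pdivrMr// (le_trans (ltW h))//.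
  by rewrite mulrC ler_wpM2l ?(ltW e0)// ler_nat.
have [[Ow na] [_ nb]] := aw j I.
have [N1 HN1] : exists N1, forall n, (N1 <= n)%N -> alpha n w <= (m + j.+1%:R^-1 + j.+1%:R^-1) * vol n.
  apply: contrapT => nE; apply: na; split=> //; exists j => // N1 _.
  apply: contrapT => nE'; apply: nE; exists N1 => n nN; rewrite leNgt; apply/negP => h.
  by apply: nE'; exists n.
have [N2 HN2] : exists N2, forall n, (N2 <= n)%N -> (m - j.+1%:R^-1 - j.+1%:R^-1) * vol n <= alpha n w.
  apply: contrapT => nE; apply: nb; split=> //; exists j => // N2 _.
  apply: contrapT => nE'; apply: nE; exists N2 => n nN; rewrite leNgt; apply/negP => h.
  by apply: nE'; exists n.
near=> n.
have n0 : 0 < n%:R ^+ d :> R.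
  by rewrite exprn_gt0// ltr0n; near: n; exact: nbhs_infty_gt.
have h1 : alpha n w / n%:R ^+ d <= (m + j.+1%:R^-1 + j.+1%:R^-1) * v.
  rewrite ler_pdivrMr// -mulrA [v * _]mulrC; apply: HN1; near: n; exact: nbhs_infty_ge.
have h2 : (m - j.+1%:R^-1 - j.+1%:R^-1) * v <= alpha n w / n%:R ^+ d.
  rewrite ler_pdivlMr// -mulrA [v * _]mulrC; apply: HN2; near: n; exact: nbhs_infty_ge.
move: h1 h2 jb; rewrite !(mulrBl, mulrDl).
move: (alpha n w / n%:R ^+ d) (m * v) (j.+1%:R^-1 * v) => x y z h1 h2 jb.
by rewrite ler_norml; apply/andP; split; lra.
Unshelve. all: by end_near. Qed.

End fixed_shape.

(** There are countably many proportions [p] and [q], so a single invariant set of full probability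
    serves them all. The successors in [pq] parametrize the positive ones. *)
Theorem ergodic_boxes : exists E, [/\ full_invariant k P theta E, E `<=` Ostar &
  forall w, E w -> forall p q : 'I_d -> nat, (forall i, 0 < p i)%N -> (forall i, 0 < q i)%N ->
    centred_mass p q n w / n%:R ^+ d @[n --> \oo] --> m * (tile_volume p q)%:R].
Proof.
pose pq (z : {ffun 'I_d -> nat} * {ffun 'I_d -> nat}) := (fun i => (z.1 i).+1, fun i => (z.2 i).+1).
exists (\bigcap_z averaging_set (pq z).1 (pq z).2); split.
- by apply: (full_invariant_bigcap theta_act) => z; exact: averaging_set_full.
- by move=> w /(_ ([ffun=> 0%N], [ffun=> 0%N]) I) /(_ 0%N I) [[]].
- move=> w Ew p q p0 q0.
  have -> : p = (pq ([ffun i => (p i).-1], [ffun i => (q i).-1])).1.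
    by apply/funext => i; rewrite /= ffunE prednK.
  have -> : q = (pq ([ffun i => (p i).-1], [ffun i => (q i).-1])).2.
    by apply/funext => i; rewrite /= ffunE prednK.
  by apply: averaging_set_cvg => //; exact: Ew.
Qed.

End ergodic_theorem.

(** * The semigroup of the walk *)

Section symmetric_kernel.
Context {R : realType} {d : nat}.
Variables (A : set 'rV[R]_d) (K : 'rV[R]_d -> 'rV[R]_d -> \bar R) (nw : 'rV[R]_d -> R).
Hypothesis cA : countable A.
Hypothesis K_ge0 : forall x y, (0 <= K x y)%E.
Hypothesis K_mass : forall x, A x -> (\esum_(y in A) K x y = 1)%E.
Hypothesis nw_gt0 : forall x, A x -> 0 < nw x.
Hypothesis K_sym : forall x y, A x -> A y -> ((nw x)%:E * K x y = (nw y)%:E * K y x)%E.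
Variable M : {measure set 'rV[R]_d -> \bar R}.
Hypothesis integralM : forall h : 'rV[R]_d -> \bar R, measurable_fun setT h ->
  (forall x, 0 <= h x)%E -> (\int[M]_x h x = \esum_(x in A) ((nw x)%:E * h x))%E.
Implicit Types (f g h u v : 'rV[R]_d -> R).

Definition kexp g x : \bar R := (\esum_(y in A) (K x y * (g y)%:E))%E.

Lemma kexp_ge0 g x : (forall y, 0 <= g y) -> (0 <= kexp g x)%E.
Proof. by move=> g0; apply: esum_ge0 => y _; rewrite mule_ge0// lee_fin. Qed.

Let esumZr' (c : \bar R) (a : 'rV[R]_d -> \bar R) : (0 <= c)%E -> (forall x, A x -> 0 <= a x)%E ->
  (\esum_(x in A) (a x * c) = (\esum_(x in A) a x) * c)%E.
Proof.
by move=> c0 a0; under eq_esum do rewrite muleC; rewrite (esumZ cA)// muleC.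
Qed.

Lemma kexp_cst c x : 0 <= c -> A x -> kexp (fun=> c) x = c%:E.
Proof. by move=> c0 Ax; rewrite /kexp esumZr' ?lee_fin// K_mass// mul1e. Qed.

Lemma kexp_le f g x : (forall y, 0 <= f y) -> (forall y, f y <= g y) -> (kexp f x <= kexp g x)%E.
Proof. by move=> f0 fg; apply: le_esum => y _; rewrite lee_wpmul2l// lee_fin. Qed.

Lemma kexp_bound g c x : A x -> (forall y, 0 <= g y <= c) -> (kexp g x <= c%:E)%E.
Proof.
move=> Ax gc; have c0 : 0 <= c by have /andP[h1 h2] := gc x; exact: le_trans h2.
by rewrite -(kexp_cst c0 Ax); apply: kexp_le => y; have /andP[] := gc y.
Qed.

Lemma kexp_fin g c x : A x -> (forall y, 0 <= g y <= c) -> kexp g x \is a fin_num.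
Proof.
move=> Ax gc; rewrite ge0_fin_numE; first by rewrite (le_lt_trans (kexp_bound Ax gc))// ltry.
by apply: kexp_ge0 => y; have /andP[] := gc y.
Qed.

Lemma kexpD f g x : (forall y, 0 <= f y) -> (forall y, 0 <= g y) ->
  (kexp (fun y => f y + g y)%R x = kexp f x + kexp g x)%E.
Proof.
move=> f0 g0; rewrite /kexp -esumD; last 2 first.
- by move=> y _; rewrite mule_ge0// lee_fin.
- by move=> y _; rewrite mule_ge0// lee_fin.
by apply: eq_esum => y _; rewrite EFinD ge0_muleDr// lee_fin.
Qed.

Lemma kexp_sym g h : (forall y, 0 <= g y) -> (forall y, 0 <= h y) ->
  (\esum_(x in A) ((nw x)%:E * (kexp g x * (h x)%:E)) =
   \esum_(x in A) ((nw x)%:E * ((g x)%:E * kexp h x)))%E.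
Proof.
move=> g0 h0; have n0 x : A x -> (0 <= (nw x)%:E)%E by move=> Ax; rewrite lee_fin ltW// nw_gt0.
(* The exchange of sums asks for terms that are non-negative everywhere, while [nw] is positive only
   on [A]; hence the absolute value. *)
transitivity (\esum_(x in A) \esum_(y in A) (`|(nw x)%:E| * K x y * (g y)%:E * (h x)%:E))%E.
  apply: eq_esum => x Ax; rewrite /kexp -esumZr' ?lee_fin//; last first.
    by move=> y _; rewrite mule_ge0// lee_fin.
  rewrite -(esumZ cA) ?n0//; last by move=> y _; rewrite !mule_ge0// lee_fin.
  by apply: eq_esum => y _; rewrite gee0_abs ?n0// !muleA.
rewrite esum_exchange; last by move=> x y; rewrite !mule_ge0 ?lee_fin.
apply: eq_esum => y Ay; rewrite /kexp -(esumZ cA) ?lee_fin//; last first.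
  by move=> x _; rewrite mule_ge0// lee_fin.
rewrite -(esumZ cA) ?n0//; last by move=> x _; rewrite !mule_ge0// lee_fin.
apply: eq_esum => x Ax; rewrite gee0_abs ?n0// K_sym//.
by rewrite -!muleA; congr (_ * _)%E; rewrite muleCA.
Qed.

Definition pos f y : R := Num.max (f y) 0.
Definition neg f y : R := Num.max (- f y) 0.

Lemma pos_ge0 f y : 0 <= pos f y. Proof. by rewrite le_max lexx orbT. Qed.
Lemma neg_ge0 f y : 0 <= neg f y. Proof. by rewrite le_max lexx orbT. Qed.
Lemma posB f y : f y = pos f y - neg f y.
Proof. by rewrite /pos /neg; case: (leP (f y) 0); case: (leP (- f y) 0); lra. Qed.
Lemma posD f y : `|f y| = pos f y + neg f y.
Proof.
rewrite /pos /neg; case: (leP 0 (f y)) => h.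
  by rewrite ger0_norm// (max_idPr _) ?addr0// oppr_le0.
by rewrite ltr0_norm// (max_idPl _) ?add0r// oppr_ge0 ltW.
Qed.
Lemma pos_le f y : pos f y <= `|f y|. Proof. by rewrite posD lerDl neg_ge0. Qed.
Lemma neg_le f y : neg f y <= `|f y|. Proof. by rewrite posD lerDr pos_ge0. Qed.
Lemma pos_bound f c : (forall y, `|f y| <= c) -> forall y, 0 <= pos f y <= c.
Proof. by move=> fc y; rewrite pos_ge0 (le_trans (pos_le _ _)). Qed.
Lemma neg_bound f c : (forall y, `|f y| <= c) -> forall y, 0 <= neg f y <= c.
Proof. by move=> fc y; rewrite neg_ge0 (le_trans (neg_le _ _)). Qed.
Lemma pos_id f : (forall y, 0 <= f y) -> pos f = f.
Proof. by move=> f0; apply/funext => y; apply/max_idPl. Qed.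
Lemma neg_0 f : (forall y, 0 <= f y) -> neg f = cst 0.
Proof. by move=> f0; apply/funext => y; apply/max_idPr; rewrite oppr_le0. Qed.

(** Positive and negative parts go through separate sums of non-negative terms. The value 0 off [A]
    gives a countable support, hence measurability for every [f]. *)
Definition kop f x : R := if x \in A then fine (kexp (pos f) x) - fine (kexp (neg f) x) else 0.

Lemma measurable_kop f : measurable_fun setT (kop f).
Proof.
apply: (measurable_fun_countable_support (A := A) (t := (0 : R))) => // x nA.
by rewrite /kop memNset.
Qed.

Lemma kop_out f x : ~ A x -> kop f x = 0.
Proof. by move=> nA; rewrite /kop memNset. Qed.

Lemma kop_nonneg f x : (forall y, 0 <= f y) -> A x -> kop f x = fine (kexp f x).
Proof.
move=> f0 Ax; rewrite /kop mem_set// pos_id// neg_0//.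
by rewrite (kexp_cst (lexx 0) Ax)/= subr0.
Qed.

Section bounded.
Variables (f : 'rV[R]_d -> R) (c : R).
Hypothesis fc : forall y, `|f y| <= c.

Let pc := pos_bound fc.
Let nc := neg_bound fc.
Let ac y : 0 <= `|f y| <= c. Proof. by rewrite normr_ge0 fc. Qed.
Let c0 : 0 <= c. Proof. exact: le_trans (fc 0). Qed.

Lemma kop_posneg x : kop f x = kop (pos f) x - kop (neg f) x.
Proof.
have [Ax|nA] := pselect (A x); last by rewrite !kop_out// subr0.
rewrite {1}/kop mem_set// !(kop_nonneg _ Ax)//; [exact: neg_ge0|exact: pos_ge0].
Qed.

Lemma kop_norm x : `|kop f x| <= kop (fun y => `|f y|) x.
Proof.
have [Ax|nA] := pselect (A x); last by rewrite !kop_out// normr0.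
rewrite [X in _ <= X](kop_nonneg _ Ax)// kop_posneg !(kop_nonneg _ Ax); [|exact: neg_ge0|exact: pos_ge0].
have -> : (fun y => `|f y|) = (fun y => pos f y + neg f y) by apply/funext => y; exact: posD.
rewrite kexpD; [|exact: pos_ge0|exact: neg_ge0].
rewrite fineD ?(kexp_fin Ax pc) ?(kexp_fin Ax nc)//.
have := fine_ge0 (kexp_ge0 x (pos_ge0 f)); have := fine_ge0 (kexp_ge0 x (neg_ge0 f)).
move: (fine _) (fine _) => a b a0 b0; rewrite ler_norml; apply/andP; split; lra.
Qed.

Lemma kop_abs_bound x : kop (fun y => `|f y|) x <= c.
Proof.
have [Ax|nA] := pselect (A x); last by rewrite kop_out.
by rewrite (kop_nonneg _ Ax)// -lee_fin fineK ?(kexp_fin Ax ac)// kexp_bound.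
Qed.

Lemma kop_bound x : `|kop f x| <= c.
Proof. exact: le_trans (kop_norm x) (kop_abs_bound x). Qed.

(* Jensen, from 2 a s <= a^2 + s^2 with a the mean *)
Lemma kop_sqr x : kop f x ^+ 2 <= kop (fun y => f y ^+ 2) x.
Proof.
have [Ax|nA] := pselect (A x); last by rewrite !kop_out// expr0n.
set a := kop (fun y => `|f y|) x.
have aE : a%:E = kexp (fun y => `|f y|) x by rewrite /a (kop_nonneg _ Ax)// fineK// (kexp_fin Ax ac).
have a0 : 0 <= a by rewrite -lee_fin aE kexp_ge0.
have sc y : 0 <= f y ^+ 2 <= c ^+ 2 by rewrite sqr_ge0 -real_normK ?num_real// lerXn2r ?nnegrE.
have s0 y : 0 <= f y ^+ 2 by exact: sqr_ge0.
apply: (@le_trans _ _ (a ^+ 2)).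
  by rewrite -real_normK ?num_real// lerXn2r ?nnegrE//; exact: kop_norm.
rewrite (kop_nonneg s0 Ax) -lee_fin fineK ?(kexp_fin Ax sc)//.
have H : (kexp (fun y => `|f y| * (2 * a))%R x <= kexp (fun y => a ^+ 2 + f y ^+ 2)%R x)%E.
  apply: kexp_le => y; first by rewrite !mulr_ge0.
  by have := sqr_ge0 (a - `|f y|); rewrite sqrrB real_normK ?num_real// -mulr_natl; lra.
rewrite kexpD// in H; last by move=> y; exact: sqr_ge0.
rewrite (kexp_cst (sqr_ge0 a) Ax) in H.
have E : kexp (fun y => `|f y| * (2 * a)) x = (a * (2 * a))%:E.
  rewrite EFinM aE /kexp; under eq_esum do rewrite EFinM muleA.
  rewrite esumZr' ?lee_fin ?mulr_ge0// => y _; by rewrite mule_ge0// lee_fin.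
rewrite E in H; rewrite -(leeD2lE _ _ (x := (a ^+ 2)%:E))//; apply: le_trans H.
by rewrite -EFinD lee_fin; lra.
Qed.

End bounded.

Lemma kop_ge0 f x : (forall y, 0 <= f y) -> 0 <= kop f x.
Proof.
move=> f0; have [Ax|nA] := pselect (A x); last by rewrite kop_out.
by rewrite kop_nonneg// fine_ge0// kexp_ge0.
Qed.

Lemma integral_kop_mul f h c : (forall y, 0 <= f y <= c) -> (forall y, 0 <= h y) -> measurable_fun setT h ->
  (\int[M]_x (kop f x * h x)%:E = \esum_(x in A) ((nw x)%:E * (kexp f x * (h x)%:E)))%E.
Proof.
move=> fc h0 mh; have f0 y : 0 <= f y by have /andP[] := fc y.
rewrite integralM.
- by apply: eq_esum => x Ax; rewrite kop_nonneg// EFinM fineK// (kexp_fin Ax fc).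
- by apply/measurable_EFinP; apply: measurable_funM => //; exact: measurable_kop.
- by move=> x; rewrite lee_fin mulr_ge0 ?kop_ge0.
Qed.

Lemma integral_kop_sym f h c : (forall y, 0 <= f y <= c) -> (forall y, 0 <= h y <= c) ->
  measurable_fun setT f -> measurable_fun setT h ->
  (\int[M]_x (kop f x * h x)%:E = \int[M]_x (f x * kop h x)%:E)%E.
Proof.
move=> fc hc mf mh; have f0 y : 0 <= f y by have /andP[] := fc y.
have h0 y : 0 <= h y by have /andP[] := hc y.
rewrite (integral_kop_mul fc h0 mh) kexp_sym//.
under [RHS]eq_integral do rewrite mulrC.
rewrite (integral_kop_mul hc f0 mf); apply: eq_esum => x _; congr (_ * _)%E; exact: muleC.
Qed.

(** Symmetry tested against the constant 1, which the kernel preserves. *)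
Lemma integral_kop f c : (forall y, 0 <= f y <= c) -> measurable_fun setT f ->
  (\int[M]_x (kop f x)%:E = \int[M]_x (f x)%:E)%E.
Proof.
move=> fc mf; have c0 : 0 <= c by have /andP[h1 h2] := fc 0; exact: le_trans h2.
have f0 y : 0 <= f y by have /andP[] := fc y.
have f1 y : 0 <= f y <= c + 1 by have /andP[-> h] := fc y; rewrite (le_trans h)// lerDl.
have o1 (y : 'rV[R]_d) : 0 <= (cst 1 : 'rV[R]_d -> R) y <= c + 1 by rewrite /= ler01 lerDr.
transitivity (\int[M]_x (kop f x * cst 1 x)%:E)%E.
  by apply: eq_integral => x _; rewrite mulr1.
rewrite (integral_kop_sym f1 o1)//.
rewrite !integralM//.
- apply: eq_esum => x Ax; congr (_ * _)%E; rewrite (kop_nonneg _ Ax)//.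
  by rewrite /cst (kexp_cst ler01 Ax)/= mulr1.
- by apply/measurable_EFinP.
- by apply/measurable_EFinP; apply: measurable_funM => //; exact: measurable_kop.
- by move=> x; rewrite lee_fin mulr_ge0// kop_ge0.
Qed.

(** Jensen's inequality pointwise, then conservation of the mass of the square. *)
Lemma integral_kop_sqr f c : (forall y, `|f y| <= c) -> measurable_fun setT f ->
  (\int[M]_x (kop f x ^+ 2)%:E <= \int[M]_x (f x ^+ 2)%:E)%E.
Proof.
move=> fc mf.
have sc y : 0 <= f y ^+ 2 <= c ^+ 2.
  by rewrite sqr_ge0 -real_normK ?num_real// lerXn2r ?nnegrE// (le_trans _ (fc y)).
rewrite -(integral_kop sc); last exact: measurable_funX.
apply: ge0_le_integralT => x; first by rewrite lee_fin sqr_ge0.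
by rewrite lee_fin; exact: kop_sqr fc x.
Qed.

Lemma kop_Lfun2 f c : (forall y, `|f y| <= c) -> f \in Lfun M 2%:E -> kop f \in Lfun M 2%:E.
Proof.
move=> fc /Lfun2P[mf f2]; apply/Lfun2P; split; first exact: measurable_kop.
exact: le_lt_trans (integral_kop_sqr fc mf) f2.
Qed.

Lemma pos_Lfun2 f : f \in Lfun M 2%:E -> pos f \in Lfun M 2%:E.
Proof.
move=> /Lfun2P[mf f2]; apply/Lfun2P; split.
  by apply: measurable_maxr => //; exact: measurable_cst.
apply: le_lt_trans f2; apply: ge0_le_integralT => x; rewrite lee_fin ?sqr_ge0//.
by rewrite -[leRHS]real_normK ?num_real// lerXn2r ?nnegrE ?pos_ge0// pos_le.
Qed.

Lemma neg_Lfun2 f : f \in Lfun M 2%:E -> neg f \in Lfun M 2%:E.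
Proof.
move=> /Lfun2P[mf f2]; apply/Lfun2P; split.
  by apply: measurable_maxr; [exact: measurableT_comp|exact: measurable_cst].
apply: le_lt_trans f2; apply: ge0_le_integralT => x; rewrite lee_fin ?sqr_ge0//.
by rewrite -[leRHS]real_normK ?num_real// lerXn2r ?nnegrE ?neg_ge0// neg_le.
Qed.

Lemma Rintegral_mul_posneg (u1 u2 v1 v2 : 'rV[R]_d -> R) :
  u1 \in Lfun M 2%:E -> u2 \in Lfun M 2%:E -> v1 \in Lfun M 2%:E -> v2 \in Lfun M 2%:E ->
  \int[M]_x ((u1 x - u2 x) * (v1 x - v2 x)) =
  (\int[M]_x (u1 x * v1 x) - \int[M]_x (u1 x * v2 x)) -
  (\int[M]_x (u2 x * v1 x) - \int[M]_x (u2 x * v2 x)).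
Proof.
move=> a1 a2 b1 b2.
have i11 := Lfun2_mulP a1 b1; have i12 := Lfun2_mulP a1 b2.
have i21 := Lfun2_mulP a2 b1; have i22 := Lfun2_mulP a2 b2.
rewrite -!RintegralB//; last 2 first.
- exact: (integrableB measurableT i11 i12).
- exact: (integrableB measurableT i21 i22).
by apply: eq_Rintegral => x _; ring.
Qed.

Lemma Rintegral_kop_sym f h c : (forall y, `|f y| <= c) -> (forall y, `|h y| <= c) ->
  f \in Lfun M 2%:E -> h \in Lfun M 2%:E ->
  \int[M]_x (kop f x * h x) = \int[M]_x (f x * kop h x).
Proof.
move=> fc hc f2 h2.
have pf := pos_bound fc.
have nf := neg_bound fc.
have ph := pos_bound hc.
have nh := neg_bound hc.
have b (g : 'rV[R]_d -> R) : (forall y, 0 <= g y <= c) -> forall y, `|g y| <= c.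
  by move=> gc y; have /andP[g0 g1] := gc y; rewrite ger0_norm.
have S u v : (forall y, 0 <= u y <= c) -> (forall y, 0 <= v y <= c) -> u \in Lfun M 2%:E -> v \in Lfun M 2%:E ->
    \int[M]_x (kop u x * v x) = \int[M]_x (u x * kop v x).
  move=> uc vc /Lfun2P[mu _] /Lfun2P[mv _].
  by rewrite /Rintegral (integral_kop_sym uc vc mu mv).
have [pf2 nf2] := (pos_Lfun2 f2, neg_Lfun2 f2); have [ph2 nh2] := (pos_Lfun2 h2, neg_Lfun2 h2).
transitivity (\int[M]_x ((kop (pos f) x - kop (neg f) x) * (pos h x - neg h x))).
  by apply: eq_Rintegral => x _; rewrite -kop_posneg -posB.
transitivity (\int[M]_x ((pos f x - neg f x) * (kop (pos h) x - kop (neg h) x))); last first.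
  by apply: eq_Rintegral => x _; rewrite -kop_posneg -posB.
rewrite !Rintegral_mul_posneg//; try by [apply: (kop_Lfun2 (b _ _))].
  by rewrite !S.
all: by apply: (@kop_Lfun2 _ c) => //; exact: b.
Qed.

End symmetric_kernel.

(** * Bounded midpoint-convex functions on the half-line *)

Section convex_decay.
Context {R : realType}.

(** By convexity the decrease of [F] over an interval of length [h] only grows when the interval
    moves to the left. More than [u / h] consecutive intervals fit between 0 and [u + h], and their
    decreases add up to at most [B]. *)
Lemma midpoint_convex_decay (F : R -> R) (B u h : R) :
  (forall x k, 0 <= x -> 0 <= k -> 2 * F (x + k) <= F x + F (x + 2 * k)) ->
  (forall x, 0 <= x -> 0 <= F x <= B) -> 0 < u -> 0 < h ->
  F u - F (u + h) <= B * h / u.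
Proof.
move=> cvx FB u0 h0.
pose N := Num.truncn (u / h).
have [N1 N2] : N%:R * h <= u /\ u < N.+1%:R * h.
  have /andP[n1 n2] : N%:R <= u / h < N.+1%:R by apply: truncn_itv; rewrite divr_ge0 ?(ltW u0) ?(ltW h0).
  by rewrite -ler_pdivlMr// -ltr_pdivrMr.
have S n : n%:R * h <= u -> n.+1%:R * (F u - F (u + h)) <= F (u - n%:R * h) - F (u + h).
  have dec m : m%:R * h <= u -> F u - F (u + h) <= F (u - m%:R * h) - F (u - m%:R * h + h).
    elim: m => [|m IH] hm; first by rewrite mul0r subr0.
    have hm' : m%:R * h <= u by apply: le_trans hm; rewrite ler_wpM2r ?(ltW h0)// ler_nat.
    apply: (le_trans (IH hm')).
    have x0 : 0 <= u - m.+1%:R * h by rewrite subr_ge0.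
    have := cvx _ _ x0 (ltW h0).
    have -> : u - m.+1%:R * h + h = u - m%:R * h by rewrite -natr1; ring.
    have -> : u - m.+1%:R * h + 2 * h = u - m%:R * h + h by rewrite -natr1; ring.
    lra.
  elim: n => [|n IH] hn; first by rewrite mul1r mul0r subr0.
  have hn' : n%:R * h <= u by apply: le_trans hn; rewrite ler_wpM2r ?(ltW h0)// ler_nat.
  have := IH hn'; have := dec _ hn.
  have -> : u - n.+1%:R * h + h = u - n%:R * h by rewrite -natr1; ring.
  by rewrite -[n.+2%:R]natr1 mulrDl mul1r; lra.
have := S N N1.
have /andP[_ b1] : 0 <= F (u - N%:R * h) <= B by apply: FB; rewrite subr_ge0.
have /andP[b2 _] : 0 <= F (u + h) <= B by apply: FB; rewrite addr_ge0// ltW.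
have B0 : 0 <= B by have /andP[x1 x2] := FB 0 (lexx 0); exact: le_trans x2.
move=> H; rewrite ler_pdivlMr//.
have [D0|D0] := ltP (F u - F (u + h)) 0.
  by rewrite (@le_trans _ _ 0)//; [rewrite mulr_le0_ge0// ltW|rewrite mulr_ge0// ltW].
apply: (@le_trans _ _ ((F u - F (u + h)) * (N.+1%:R * h))).
  by rewrite ler_wpM2l// ltW.
by rewrite mulrA ler_wpM2r ?(ltW h0)// mulrC (le_trans H)//; lra.
Qed.

(** An increase over one step would be repeated, at least as large, over each following step,
    against the bound [B]. *)
Lemma midpoint_convex_nonincr (F : R -> R) (B u h : R) :
  (forall x k, 0 <= x -> 0 <= k -> 2 * F (x + k) <= F x + F (x + 2 * k)) ->
  (forall x, 0 <= x -> 0 <= F x <= B) -> 0 <= u -> 0 <= h -> F (u + h) <= F u.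
Proof.
move=> cvx FB u0 h0; rewrite leNgt; apply/negP => D0.
have up (n : nat) : n%:R * (F (u + h) - F u) <= F (u + n%:R * h) - F u /\
    F (u + h) - F u <= F (u + n.+1%:R * h) - F (u + n%:R * h).
  elim: n => [|n [IH1 IH2]]; first by rewrite !mul0r addr0 subrr mul1r.
  split; first by rewrite -{1}natr1 mulrDl mul1r; lra.
  have x0 : 0 <= u + n%:R * h by rewrite addr_ge0// mulr_ge0.
  have := cvx _ _ x0 h0.
  have -> : u + n%:R * h + h = u + n.+1%:R * h by rewrite -natr1; ring.
  have -> : u + n%:R * h + 2 * h = u + n.+2%:R * h by rewrite -[n.+2%:R]natr1 -natr1; ring.
  lra.
have /andP[Fu0 _] := FB u u0; have D : 0 < F (u + h) - F u by rewrite subr_gt0.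
have [n nB] : exists n : nat, B < n%:R * (F (u + h) - F u).
  exists (Num.bound (B / (F (u + h) - F u))); rewrite -ltr_pdivrMr//; apply: archi_boundP.
  by rewrite divr_ge0 ?(ltW D)//; have /andP[x1 x2] := FB u u0; exact: le_trans x2.
have [] := up n; have /andP[_] := FB (u + n%:R * h) ltac:(by rewrite addr_ge0// mulr_ge0).
by move=> h1 h2 _; move: nB; lra.
Qed.

End convex_decay.

Lemma lap_linear4 (R : realType) (a1 a2 a3 a4 : R -> R) K1 K2 K3 K4 (l : R) : 0 < l ->
  bounded_meas a1 K1 -> bounded_meas a2 K2 -> bounded_meas a3 K3 -> bounded_meas a4 K4 ->
  lap (fun s => (a1 s + (-1) * a2 s) + (-1) * (a3 s + (-1) * a4 s)) l =
    (lap a1 l - lap a2 l) - (lap a3 l - lap a4 l) /\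
  bounded_meas (fun s => (a1 s + (-1) * a2 s) + (-1) * (a3 s + (-1) * a4 s))
    ((K1 + `|-1| * K2) + `|-1| * (K3 + `|-1| * K4)).
Proof.
move=> l0 b1 b2 b3 b4; have B1 := bounded_measD b1 (bounded_measZ (-1) b2).
have B2 := bounded_measD b3 (bounded_measZ (-1) b4).
split; last exact: bounded_measD B1 (bounded_measZ (-1) B2).
rewrite (lapD B1 (bounded_measZ (-1) B2) l0) (lapZ _ B2 l0) (lapD b1 (bounded_measZ (-1) b2) l0).
by rewrite (lapD b3 (bounded_measZ (-1) b4) l0) (lapZ _ b2 l0) (lapZ _ b4 l0) !mulN1r.
Qed.

(** * Semigroup and resolvent in L^2 *)

Section reversible_semigroup.
Context {R : realType} {d : nat} {dX : measure_display} {Xi : measurableType dX}.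
Variables (Y : nat -> Xi -> 'rV[R]_d) (S : nat -> Xi -> R).
Variables (A : set 'rV[R]_d) (q : 'rV[R]_d -> 'rV[R]_d -> R).
Hypothesis cA : countable A.
Hypothesis q_ge0 : forall x y, 0 <= q x y.
Hypothesis rateA : forall x, A x -> (0 < total_rate A q x < +oo)%E.
Variable Q : 'rV[R]_d -> probability Xi R.
Hypothesis law : forall x, A x -> walk_law Y S A q (Q x) x.
Hypothesis nonexpl : forall x, A x -> non_explosive S (Q x).
Variable nw : 'rV[R]_d -> R.
Hypothesis nw_gt0 : forall x, A x -> 0 < nw x.
Hypothesis balance : forall x y, A x -> A y -> nw x * q x y = nw y * q y x.
Variable M : {measure set 'rV[R]_d -> \bar R}.
Hypothesis integralM : forall h : 'rV[R]_d -> \bar R, measurable_fun setT h ->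
  (forall x, 0 <= h x)%E -> (\int[M]_x h x = \esum_(x in A) ((nw x)%:E * h x))%E.
Implicit Types (f g h u v : 'rV[R]_d -> R).

Let p t x y := trans_prob Y S (Q x) t y.
Let p_ge0 t x y : (0 <= p t x y)%E. Proof. exact: trans_prob_ge0. Qed.
Let p_mass t : 0 <= t -> forall x, A x -> (\esum_(y in A) p t x y = 1)%E.
Proof. by move=> t0 x Ax; exact: (trans_mass cA q_ge0 rateA law nonexpl t0 Ax). Qed.
Let p_sym t : 0 <= t -> forall x y, A x -> A y -> ((nw x)%:E * p t x y = (nw y)%:E * p t y x)%E.
Proof.
by move=> t0 x y Ax Ay; exact: (trans_sym cA q_ge0 rateA law nonexpl nw_gt0 balance t0 Ax Ay).
Qed.

Definition sgr t f : 'rV[R]_d -> R := kop A (p t) f.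

Lemma integral_walk_sgr t f c x : 0 <= t -> (forall y, `|f y| <= c) -> A x ->
  \int[Q x]_xi f (walk Y S t xi) = sgr t f x.
Proof.
move=> t0 fc Ax.
have pc := pos_bound fc.
have nc := neg_bound fc.
rewrite /Rintegral integralE.
have -> : (fun xi => (f (walk Y S t xi))%:E)^\+%E = (fun xi => (pos f (walk Y S t xi))%:E).
  by apply/funext => xi; rewrite funeposE EFin_max.
have -> : (fun xi => (f (walk Y S t xi))%:E)^\-%E = (fun xi => (neg f (walk Y S t xi))%:E).
  by apply/funext => xi; rewrite funenegE -EFinN EFin_max.
rewrite (integral_walk cA q_ge0 rateA Ax (law Ax) (nonexpl Ax) (g := EFin \o pos f) t0); last first.
  by move=> y; rewrite lee_fin pos_ge0.
rewrite (integral_walk cA q_ge0 rateA Ax (law Ax) (nonexpl Ax) (g := EFin \o neg f) t0); last first.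
  by move=> y; rewrite lee_fin neg_ge0.
rewrite fineB; first by rewrite /sgr /kop mem_set.
  exact: (kexp_fin cA (p_ge0 t) (p_mass t0) Ax pc).
exact: (kexp_fin cA (p_ge0 t) (p_mass t0) Ax nc).
Qed.

Lemma sgr_bound t f c : 0 <= t -> (forall y, `|f y| <= c) -> forall x, `|sgr t f x| <= c.
Proof. move=> t0 fc x; exact: (kop_bound cA (p_ge0 t) (p_mass t0) fc). Qed.

Lemma sgr_Lfun2 t f c : 0 <= t -> (forall y, `|f y| <= c) -> f \in Lfun M 2%:E -> sgr t f \in Lfun M 2%:E.
Proof. move=> t0; exact: (kop_Lfun2 cA (p_ge0 t) (p_mass t0) nw_gt0 (p_sym t0) integralM). Qed.

Lemma integral_sgr_sqr t f c : 0 <= t -> (forall y, `|f y| <= c) -> measurable_fun setT f ->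
  (\int[M]_x (sgr t f x ^+ 2)%:E <= \int[M]_x (f x ^+ 2)%:E)%E.
Proof. move=> t0; exact: (integral_kop_sqr cA (p_ge0 t) (p_mass t0) nw_gt0 (p_sym t0) integralM). Qed.

Lemma sgr_comp t s u c : 0 <= t -> 0 <= s -> (forall y, 0 <= u y <= c) ->
  sgr t (sgr s u) = sgr (t + s) u.
Proof.
move=> t0 s0 uc; have u0 y : 0 <= u y by have /andP[] := uc y.
have ts0 : 0 <= t + s by rewrite addr_ge0.
have su0 y : 0 <= sgr s u y by apply: (kop_ge0 cA (p_ge0 s) (p_mass s0)).
apply/funext => x; have [Ax|nA] := pselect (A x); last by rewrite /sgr !kop_out.
rewrite /sgr (kop_nonneg cA (p_ge0 t) (p_mass t0) su0 Ax) (kop_nonneg cA (p_ge0 _) (p_mass ts0) u0 Ax).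
congr fine; rewrite /kexp.
transitivity (\esum_(y in A) \esum_(z in A) (p t x y * (p s y z * (u z)%:E)))%E.
  apply: eq_esum => y Ay; rewrite (esumZ cA)//; last by move=> z _; rewrite mule_ge0// lee_fin.
  congr (_ * _)%E; rewrite /sgr (kop_nonneg cA (p_ge0 s) (p_mass s0) u0 Ay) fineK//.
  exact: (kexp_fin cA (p_ge0 s) (p_mass s0) Ay uc).
rewrite esum_exchange; last by move=> y z; rewrite !mule_ge0// lee_fin.
apply: eq_esum => z Az; rewrite [p (t + s) x z](chapman_kolmogorov cA q_ge0 rateA law nonexpl nw_gt0 balance t0 s0 Ax Az).
rewrite muleC -(esumZ cA) ?lee_fin//; last by move=> y _; exact: (mule_ge0 (p_ge0 _ _ _) (p_ge0 _ _ _)).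
by apply: eq_esum => y _; rewrite muleA muleC.
Qed.

Lemma integral_sgr_sgr t s u v c : 0 <= t -> 0 <= s -> (forall y, 0 <= u y <= c) -> (forall y, 0 <= v y <= c) ->
  measurable_fun setT v ->
  (\int[M]_x (sgr s u x * sgr t v x)%:E = \int[M]_x (sgr (s + t) u x * v x)%:E)%E.
Proof.
move=> t0 s0 uc vc mv.
have suc y : 0 <= sgr s u y <= c.
  rewrite (kop_ge0 cA (p_ge0 s) (p_mass s0))/=; last by move=> z; have /andP[] := uc z.
  apply: (le_trans (ler_norm _)); apply: sgr_bound => // z.
  by have /andP[u0 u1] := uc z; rewrite ger0_norm.
transitivity (\int[M]_x (sgr t v x * sgr s u x)%:E)%E; first by apply: eq_integral => x _; rewrite mulrC.
rewrite (integral_kop_sym cA (p_ge0 t) (p_mass t0) nw_gt0 (p_sym t0) integralM vc suc mv); last first.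
  exact: measurable_kop.
apply: eq_integral => x _; rewrite -/(sgr t (sgr s u)) (sgr_comp t0 s0 uc) addrC.
by rewrite mulrC.
Qed.

Lemma sgr_posneg t f x : 0 <= t -> sgr t f x = sgr t (pos f) x - sgr t (neg f) x.
Proof. by move=> t0; rewrite /sgr; exact: (kop_posneg cA (p_ge0 t) (p_mass t0)). Qed.

Section square_integrable.
Variables (f : 'rV[R]_d -> R) (c : R).
Hypothesis fc : forall y, `|f y| <= c.
Hypothesis f2 : f \in Lfun M 2%:E.

Let pc := pos_bound fc.
Let nc := neg_bound fc.
Let b g : (forall y, 0 <= g y <= c) -> forall y, `|g y| <= c.
Proof. by move=> gc y; have /andP[g0 g1] := gc y; rewrite ger0_norm. Qed.
Let p2 := pos_Lfun2 f2.
Let n2 := neg_Lfun2 f2.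

(** Symmetry moves one operator onto the other and Chapman-Kolmogorov merges them. It is proved for
    non-negative functions and extended by bilinearity. *)
Lemma Rintegral_sgr_sgr t s : 0 <= t -> 0 <= s ->
  \int[M]_x (sgr s f x * sgr t f x) = \int[M]_x (sgr (s + t) f x * f x).
Proof.
move=> t0 s0; have st0 : 0 <= s + t by rewrite addr_ge0.
have E u v : (forall y, 0 <= u y <= c) -> (forall y, 0 <= v y <= c) -> v \in Lfun M 2%:E ->
    \int[M]_x (sgr s u x * sgr t v x) = \int[M]_x (sgr (s + t) u x * v x).
  by move=> uc vc /Lfun2P[mv _]; rewrite /Rintegral (integral_sgr_sgr t0 s0 uc vc mv).
transitivity (\int[M]_x ((sgr s (pos f) x - sgr s (neg f) x) * (sgr t (pos f) x - sgr t (neg f) x))).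
  by apply: eq_Rintegral => x _; rewrite -!sgr_posneg.
transitivity (\int[M]_x ((sgr (s + t) (pos f) x - sgr (s + t) (neg f) x) * (pos f x - neg f x))); last first.
  by apply: eq_Rintegral => x _; rewrite -sgr_posneg// -posB.
have sp := sgr_Lfun2 s0 (b pc) p2; have sn := sgr_Lfun2 s0 (b nc) n2.
have tp := sgr_Lfun2 t0 (b pc) p2; have tn := sgr_Lfun2 t0 (b nc) n2.
have up := sgr_Lfun2 st0 (b pc) p2; have un := sgr_Lfun2 st0 (b nc) n2.
rewrite (Rintegral_mul_posneg sp sn tp tn) (Rintegral_mul_posneg up un p2 n2).
by rewrite (E _ _ pc pc p2) (E _ _ pc nc n2) (E _ _ nc pc p2) (E _ _ nc nc n2).
Qed.

(** With [F u] the pairing of [sgr u f] and [f], the left-hand side is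
    [F (2 s) - 2 F (2 s + h) + F (2 s + 2 h)]. Non-negativity of such expressions is the midpoint
    convexity of [F]; monotonicity then drops one difference, and [midpoint_convex_decay] at [2 s]
    bounds the other. *)
Lemma sgr_modulus (s h : R) : 0 < s -> 0 < h ->
  \int[M]_x ((sgr s f x - sgr (s + h) f x) ^+ 2) <= (\int[M]_x (f x ^+ 2)) * h / (2 * s).
Proof.
move=> s0 h0; have [F FE] : exists F : R -> R, forall u : R, F u = \int[M]_x (sgr u f x * f x).
  by exists (fun u : R => \int[M]_x (sgr u f x * f x)).
have sq (u v : R) : 0 <= u -> 0 <= v ->
    \int[M]_x ((sgr u f x - sgr v f x) ^+ 2) = F (u + u) - F (u + v) - (F (v + u) - F (v + v)).
  move=> u0 v0; have U := sgr_Lfun2 u0 fc f2; have W := sgr_Lfun2 v0 fc f2.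
  under eq_Rintegral do rewrite expr2.
  rewrite (Rintegral_mul_posneg U W U W).
  by rewrite !FE (Rintegral_sgr_sgr u0 u0) (Rintegral_sgr_sgr v0 u0) (Rintegral_sgr_sgr u0 v0) (Rintegral_sgr_sgr v0 v0).
have FB (u : R) : 0 <= u -> 0 <= F u <= \int[M]_x (f x ^+ 2).
  move=> u0; have u20 : 0 <= u / 2 by rewrite divr_ge0.
  have U := sgr_Lfun2 u0 fc f2; apply/andP; split.
    rewrite FE {1}[u]splitr -(Rintegral_sgr_sgr u20 u20).
    by under eq_Rintegral do rewrite -expr2; exact: Rintegral_sqr_ge0.
  rewrite FE; apply: (le_trans (ler_norm _)); apply: (le_trans (cauchy_schwarz U f2)).
  have /Lfun2P[mf _] := f2.
  apply: (@le_trans _ _ (Num.sqrt (\int[M]_x (f x ^+ 2)) * Num.sqrt (\int[M]_x (f x ^+ 2)))).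
    rewrite ler_wpM2r ?sqrtr_ge0// ler_sqrt ?Rintegral_sqr_ge0//.
    by rewrite -lee_fin !Rintegral_sqr//; exact: (integral_sgr_sqr u0 fc mf).
  by rewrite -expr2 sqr_sqrtr// Rintegral_sqr_ge0.
have cvx (x k : R) : 0 <= x -> 0 <= k -> 2 * F (x + k) <= F x + F (x + 2 * k).
  move=> x0 k0; have x20 : 0 <= x / 2 by rewrite divr_ge0.
  have xk : 0 <= x / 2 + k by rewrite addr_ge0.
  have : 0 <= \int[M]_z ((sgr (x / 2) f z - sgr (x / 2 + k) f z) ^+ 2) by exact: Rintegral_sqr_ge0.
  rewrite sq//.
  have -> : x / 2 + x / 2 = x by rewrite -splitr.
  have -> : x / 2 + (x / 2 + k) = x + k by rewrite addrA -splitr.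
  have -> : x / 2 + k + x / 2 = x + k by rewrite addrAC -splitr.
  have -> : x / 2 + k + (x / 2 + k) = x + 2 * k by field.
  lra.
have sh0 : 0 <= s + h by rewrite addr_ge0// ltW.
rewrite sq ?(ltW s0)//.
have s20 : 0 < 2 * s by rewrite mulr_gt0.
have := midpoint_convex_decay cvx FB s20 h0.
have := midpoint_convex_nonincr cvx FB (_ : 0 <= 2 * s + h) (ltW h0).
move/(_ ltac:(by rewrite addr_ge0 ?(ltW s20) ?(ltW h0))).
have -> : s + s = 2 * s by ring.
have -> : s + (s + h) = 2 * s + h by ring.
have -> : s + h + s = 2 * s + h by ring.
have -> : s + h + (s + h) = 2 * s + h + h by ring.
move: (\int[M]_x (f x ^+ 2) * h / (2 * s)) => B; lra.
Qed.

End square_integrable.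

Section laplace.
Variable lam : R.
Hypothesis lam0 : 0 < lam.

Let G x y := (lam%:E * green A q lam x y)%E.
Let G_ge0 x y : (0 <= G x y)%E.
Proof. by rewrite mule_ge0 ?lee_fin ?(ltW lam0)//; exact: (green_ge0 A q_ge0 _ _ (ltW lam0)). Qed.

Definition rsv f x : R := lap (fun s => sgr s f x) lam.

Lemma bounded_meas_sgr f c x : (forall y, `|f y| <= c) -> bounded_meas (fun s => sgr s f x) c.
Proof.
move=> fc; split; last by move=> s s0; exact: sgr_bound.
have pc := pos_bound fc.
have nc := neg_bound fc.
have [Ax|nA] := pselect (A x); last first.
  rewrite (_ : (fun s => _) = cst 0); first exact: measurable_cst.
  by apply/funext => s; rewrite /sgr kop_out.
have [m1 _] := bounded_meas_expect cA q_ge0 rateA law nonexpl Ax pc.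
have [m2 _] := bounded_meas_expect cA q_ge0 rateA law nonexpl Ax nc.
rewrite (_ : (fun s => sgr s f x) = (fun s => fine (expect Y S A Q s (pos f) x)) \- (fun s => fine (expect Y S A Q s (neg f) x))).
  exact: measurable_funB.
by apply/funext => s; rewrite /sgr /kop mem_set.
Qed.

Lemma rsv_nonneg f c x : (forall y, 0 <= f y <= c) -> A x -> (lam * rsv f x)%:E = kexp A G f x.
Proof.
move=> fc Ax; have f0 y : 0 <= f y by have /andP[] := fc y.
have <- : lap (fun s => fine (expect Y S A Q s f x)) lam = rsv f x.
  apply: eq_Rintegral => s; rewrite inE/= in_itv/= andbT => s0.
  by rewrite /sgr (kop_nonneg cA (p_ge0 s) (p_mass s0) f0 Ax).
rewrite EFinM (lap_expect cA q_ge0 rateA law nonexpl lam0 Ax fc) -(esumZ cA) ?lee_fin ?(ltW lam0)//.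
  by apply: eq_esum => y _; rewrite muleA.
by move=> y _; rewrite mule_ge0 ?lee_fin//; exact: (green_ge0 A q_ge0 _ _ (ltW lam0)).
Qed.

Let G_mass x : A x -> (\esum_(y in A) G x y = 1)%E.
Proof.
move=> Ax; have oc (y : 'rV[R]_d) : 0 <= (cst 1 : 'rV[R]_d -> R) y <= 1 by rewrite /= ler01 lexx.
have := rsv_nonneg oc Ax; rewrite /kexp; under eq_esum do rewrite mule1.
move=> <-; congr EFin.
have -> : rsv (cst 1) x = lap (fun=> 1) lam.
  apply: eq_Rintegral => s; rewrite inE/= in_itv/= andbT => s0; congr (_ * _).
  rewrite /sgr (kop_nonneg cA (p_ge0 s) (p_mass s0) _ Ax) ?/cst//.
  by rewrite (kexp_cst cA (p_ge0 s) (p_mass s0) ler01 Ax).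
by rewrite lap1// mulfV// gt_eqF.
Qed.

Let G_sym x y : A x -> A y -> ((nw x)%:E * G x y = (nw y)%:E * G y x)%E.
Proof.
move=> Ax Ay; rewrite /G muleCA [RHS]muleCA; congr (_ * _)%E.
exact: (green_sym cA q_ge0 nw_gt0 balance lam0 Ax Ay).
Qed.

Lemma rsv_posneg f c x : (forall y, `|f y| <= c) -> rsv f x = rsv (pos f) x + (-1) * rsv (neg f) x.
Proof.
move=> fc.
have pc y : `|pos f y| <= c by rewrite ger0_norm ?pos_ge0// (le_trans (pos_le _ _)).
have nc y : `|neg f y| <= c by rewrite ger0_norm ?neg_ge0// (le_trans (neg_le _ _)).
rewrite /rsv -(lapZ _ (bounded_meas_sgr x nc) lam0).
rewrite -(lapD (bounded_meas_sgr x pc) (bounded_measZ (-1) (bounded_meas_sgr x nc)) lam0).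
apply: eq_Rintegral => s; rewrite inE/= in_itv/= andbT => s0.
by rewrite sgr_posneg// mulN1r.
Qed.

(** The normalized resolvent is the operator of the kernel [lam * green], which is also of mass one
    and symmetric. All the results on symmetric kernels thus apply to it. *)
Lemma rsv_kop f c x : (forall y, `|f y| <= c) -> lam * rsv f x = kop A G f x.
Proof.
move=> fc; have [Ax|nA] := pselect (A x); last first.
  rewrite kop_out// /rsv (_ : (fun s => _) = fun=> 0).
    by rewrite /lap; under eq_Rintegral do rewrite mulr0; rewrite Rintegral_cst// mul0r mulr0.
  by apply/funext => s; rewrite /sgr kop_out.
have pc := pos_bound fc.
have nc := neg_bound fc.
rewrite (rsv_posneg x fc).
by rewrite mulrDr mulrCA mulN1r /kop mem_set// -(rsv_nonneg pc Ax) -(rsv_nonneg nc Ax)/=.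
Qed.

Lemma rsv_out f x : ~ A x -> rsv f x = 0.
Proof.
move=> nA; rewrite /rsv (_ : (fun s => _) = fun=> 0).
  by rewrite /lap; under eq_Rintegral do rewrite mulr0; rewrite Rintegral_cst// mul0r.
by apply/funext => s; rewrite /sgr kop_out.
Qed.

Lemma measurable_rsv f : measurable_fun setT (rsv f).
Proof.
apply: (measurable_fun_countable_support (A := A) (t := (0 : R))) => // x nA.
exact: rsv_out.
Qed.

Lemma rsv_ge0 f x : (forall y, 0 <= f y) -> 0 <= rsv f x.
Proof.
move=> f0; rewrite /rsv /lap; apply: Rintegral_ge0 => s; rewrite /= in_itv/= andbT => s0.
by rewrite mulr_ge0 ?expR_ge0//; exact: (kop_ge0 cA (p_ge0 s) (p_mass s0)).
Qed.

Lemma Lfun2_scale f k : f \in Lfun M 2%:E -> (fun x => k * f x) \in Lfun M 2%:E.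
Proof.
move=> /Lfun2P[mf f2]; apply/Lfun2P; split; first exact: measurable_funM.
have -> : (\int[M]_x ((k * f x) ^+ 2)%:E = (k ^+ 2)%:E * \int[M]_x (f x ^+ 2)%:E)%E.
  rewrite -ge0_integralZl//.
  - by apply: eq_integral => x _; rewrite exprMn EFinM.
  - by apply/measurable_EFinP; exact: measurable_funX.
  - by move=> x _; rewrite lee_fin sqr_ge0.
  - by rewrite lee_fin sqr_ge0.
by rewrite lte_mul_pinfty// lee_fin sqr_ge0.
Qed.

Lemma rsv_Lfun2 f c : (forall y, `|f y| <= c) -> f \in Lfun M 2%:E -> rsv f \in Lfun M 2%:E.
Proof.
move=> fc f2; have := Lfun2_scale lam^-1 (kop_Lfun2 cA G_ge0 G_mass nw_gt0 G_sym integralM fc f2).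
suff -> : (fun x => lam^-1 * kop A G f x) = rsv f by [].
by apply/funext => x; rewrite -(rsv_kop x fc) mulKf// gt_eqF.
Qed.

Lemma integral_rsv f c : (forall y, 0 <= f y <= c) -> measurable_fun setT f ->
  (\int[M]_x (lam * rsv f x)%:E = \int[M]_x (f x)%:E)%E.
Proof.
move=> fc mf; rewrite -(integral_kop cA G_ge0 G_mass nw_gt0 G_sym integralM fc mf).
apply: eq_integral => x _; rewrite (@rsv_kop f c)// => y.
by have /andP[f0 f1] := fc y; rewrite ger0_norm.
Qed.

Lemma Rintegral_rsv_sym f h c : (forall y, `|f y| <= c) -> (forall y, `|h y| <= c) ->
  f \in Lfun M 2%:E -> h \in Lfun M 2%:E ->
  \int[M]_x (lam * rsv f x * h x) = \int[M]_x (f x * (lam * rsv h x)).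
Proof.
move=> fc hc f2 h2.
under eq_Rintegral do rewrite (rsv_kop _ fc).
under [RHS]eq_Rintegral do rewrite (rsv_kop _ hc).
exact: (Rintegral_kop_sym cA G_ge0 G_mass nw_gt0 G_sym integralM fc hc f2 h2).
Qed.

Lemma rsv_norm f c x : (forall y, `|f y| <= c) -> `|lam * rsv f x| <= lam * rsv (fun y => `|f y|) x.
Proof.
move=> fc; have fc' y : `| `|f y| | <= c by rewrite normr_id.
have := kop_norm cA G_ge0 G_mass fc x.
by rewrite -(rsv_kop x fc) -(rsv_kop x fc').
Qed.

Lemma sgr_ge0 t f x : (forall y, 0 <= f y) -> 0 <= sgr t f x.
Proof.
move=> f0; rewrite /sgr /kop; case: ifPn => // _.
rewrite [X in _ - fine X](_ : _ = 0%E) ?subr0 ?fine_ge0//.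
  by apply: (kexp_ge0 _ (p_ge0 t)) => y; exact: pos_ge0.
by rewrite /kexp esum1// => y _; rewrite neg_0// mule0.
Qed.

Section fubini.
Variables (f g : 'rV[R]_d -> R) (c : R).
Hypothesis fc : forall y, 0 <= f y <= c.
Hypothesis g0 : forall y, 0 <= g y.
Hypothesis f2 : f \in Lfun M 2%:E.
Hypothesis g2 : g \in Lfun M 2%:E.

Let fa y : `|f y| <= c. Proof. by have /andP[h0 h1] := fc y; rewrite ger0_norm. Qed.
Let f0 y : 0 <= f y. Proof. by have /andP[] := fc y. Qed.

Lemma integral_sgr_mul s : 0 <= s -> ((\int[M]_x (sgr s f x * g x))%:E =
  \esum_(x in A) ((nw x)%:E * (sgr s f x * g x)%:E))%E.
Proof.
move=> s0; have := Lfun2_mulP (sgr_Lfun2 s0 fa f2) g2 => ig.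
rewrite /Rintegral fineK; last exact: integrable_fin_num.
rewrite integralM//; first by case/integrableP: ig.
by move=> x; rewrite lee_fin mulr_ge0//; apply: (kop_ge0 cA (p_ge0 s) (p_mass s0)).
Qed.

Lemma bounded_meas_integral_sgr : bounded_meas (fun s => \int[M]_x (sgr s f x * g x))
  (Num.sqrt (\int[M]_x (f x ^+ 2)) * Num.sqrt (\int[M]_x (g x ^+ 2))).
Proof.
have /Lfun2P[mf _] := f2.
split; last first.
  move=> s s0; have U := sgr_Lfun2 s0 fa f2.
  apply: (le_trans (cauchy_schwarz U g2)).
  rewrite ler_wpM2r ?sqrtr_ge0// ler_sqrt ?Rintegral_sqr_ge0//.
  by rewrite -lee_fin !Rintegral_sqr//; exact: (integral_sgr_sqr s0 fa mf).
have E : {in (half_line : set R), (fun s => fine (\esum_(x in A) ((nw x)%:E * (expect Y S A Q s f x * (g x)%:E)))%E) =1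
    (fun s => \int[M]_x (sgr s f x * g x))}.
  move=> s; rewrite inE half_lineE => s0; rewrite -[RHS]/(fine (_%:E)) integral_sgr_mul//.
  congr fine; apply: eq_esum => x Ax; congr (_ * _)%E; rewrite EFinM; congr (_ * _)%E.
  rewrite /sgr (kop_nonneg cA (p_ge0 s) (p_mass s0) f0 Ax) fineK//.
  exact: (kexp_fin cA (p_ge0 s) (p_mass s0) Ax fc).
refine (@eq_measurable_fun _ _ _ _ _ _ _ E _).
apply: measurable_funTS; apply: measurableT_comp => //.
apply: (measurable_fun_esum (0 : 'rV[R]_d)) => //.
  move=> x Ax; apply: measurable_funeM; apply: emeasurable_funM => //.
  exact: (measurable_expect cA law Ax f0).
move=> x s Ax; rewrite !mule_ge0 ?lee_fin ?(ltW (nw_gt0 Ax))//.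
exact: expect_ge0.
Qed.

(** Tonelli's theorem between the time and the atoms, all terms being non-negative; signs are dealt
    with afterwards by splitting both functions. *)
Lemma lap_integral_sgr_nonneg :
  lap (fun s => \int[M]_x (sgr s f x * g x)) lam = \int[M]_x (rsv f x * g x).
Proof.
have /Lfun2P[mg _] := g2.
suff E : ((lap (fun s => \int[M]_x (sgr s f x * g x)) lam)%:E = \int[M]_x (rsv f x * g x)%:E)%E.
  by rewrite /Rintegral -E.
rewrite /lap {1}/Rintegral fineK; last first.
  by apply: integrable_fin_num => //; exact: (integrable_lap bounded_meas_integral_sgr).
have mh : measurable (half_line : set R) := @measurable_half_line R.
have bs x := bounded_meas_sgr x fa.
transitivity (\int[lebesgue_measure]_(s in half_line)
   (\esum_(x in A) ((nw x * g x)%:E * (expR (- (lam * s)) * sgr s f x)%:E)))%E.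
  apply: eq_integral => s; rewrite inE/= in_itv/= andbT => s0.
  rewrite EFinM integral_sgr_mul// -(esumZ cA) ?lee_fin ?expR_ge0//.
    by apply: eq_esum => x _; rewrite -!EFinM; congr EFin; ring.
  move=> x Ax; rewrite -EFinM lee_fin !mulr_ge0 ?(ltW (nw_gt0 Ax))//.
  exact: (kop_ge0 cA (p_ge0 s) (p_mass s0)).
have mx x : measurable_fun (half_line : set R) (fun s => (expR (- (lam * s)) * sgr s f x)%:E).
  apply/measurable_EFinP; apply: measurable_funM; last by have [] := bs x.
  by apply: measurable_funTS; exact: measurable_expRM.
have ge0x x (s : R) : half_line s -> (0 <= (expR (- (lam * s)) * sgr s f x)%:E)%E.
  by rewrite half_lineE => s0; rewrite lee_fin mulr_ge0 ?expR_ge0//; apply: (kop_ge0 cA (p_ge0 s) (p_mass s0)).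
rewrite (integral_esum (0 : 'rV[R]_d)) //; last 2 first.
- by move=> x Ax; apply: measurable_funeM; exact: mx.
- move=> x s Ax; rewrite -EFinM lee_fin !mulr_ge0 ?expR_ge0 ?sgr_ge0//.
  exact: ltW (nw_gt0 Ax).
have grb x : `|rsv f x * g x| = rsv f x * g x by rewrite ger0_norm// mulr_ge0// rsv_ge0.
rewrite integralM.
- apply: eq_esum => x Ax.
  rewrite (_ : \int[lebesgue_measure]_(s in half_line) _ = (nw x * g x)%:E *
     \int[lebesgue_measure]_(s in half_line) (expR (- (lam * s)) * sgr s f x)%:E)%E.
    rewrite /rsv /lap /Rintegral.
    have : (\int[lebesgue_measure]_(s in half_line) (expR (- (lam * s)) * sgr s f x)%:E \is a fin_num)%E.
      by apply: integrable_fin_num => //; exact: (integrable_lap (bs x)).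
    move: (\int[_]_(_ in _) _)%E => I If; rewrite -(fineK If) -!EFinM; congr EFin.
    by rewrite -mulrA [g x * _]mulrC.
  rewrite ge0_integralZl//; [exact: mx| |].
    by move=> s; exact: ge0x.
  by rewrite lee_fin mulr_ge0// (ltW (nw_gt0 Ax)).
- by apply/measurable_EFinP; apply: measurable_funM => //; exact: measurable_rsv.
- by move=> x; rewrite lee_fin mulr_ge0// rsv_ge0.
Qed.

End fubini.

Lemma lap_integral_sgr f g c :
  (forall y, `|f y| <= c) -> f \in Lfun M 2%:E -> g \in Lfun M 2%:E ->
  lap (fun s => \int[M]_x (sgr s f x * g x)) lam = \int[M]_x (rsv f x * g x) /\
  bounded_meas (fun s => \int[M]_x (sgr s f x * g x))
    (Num.sqrt (\int[M]_x (f x ^+ 2)) * Num.sqrt (\int[M]_x (g x ^+ 2))).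
Proof.
move=> fc f2 g2; have /Lfun2P[mf _] := f2.
have pc := pos_bound fc.
have nc := neg_bound fc.
have b h : (forall y, 0 <= h y <= c) -> forall y, `|h y| <= c.
  by move=> hc y; have /andP[h0 h1] := hc y; rewrite ger0_norm.
have [p2 n2] := (pos_Lfun2 f2, neg_Lfun2 f2).
have [q2 m2] := (pos_Lfun2 g2, neg_Lfun2 g2).
have alt (a1 a2 a3 a4 : R) : a1 - a2 - (a3 - a4) = a1 + (-1) * a2 + (-1) * (a3 + (-1) * a4) by ring.
have congr4 (a1 a2 a3 a4 b1 b2 b3 b4 : R) : a1 = b1 -> a2 = b2 -> a3 = b3 -> a4 = b4 ->
  a1 - a2 - (a3 - a4) = b1 - b2 - (b3 - b4) by move=> -> -> -> ->.
pose I (u v : 'rV[R]_d -> R) s := \int[M]_x (sgr s u x * v x).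
have IE s : 0 <= s -> \int[M]_x (sgr s f x * g x) =
   (I (pos f) (pos g) s + (-1) * I (pos f) (neg g) s) +
   (-1) * (I (neg f) (pos g) s + (-1) * I (neg f) (neg g) s).
  move=> s0; transitivity (\int[M]_x ((sgr s (pos f) x - sgr s (neg f) x) * (pos g x - neg g x))).
    by apply: eq_Rintegral => x _; rewrite -sgr_posneg// -posB.
  refine (etrans _ (alt _ _ _ _)).
  exact: (Rintegral_mul_posneg (sgr_Lfun2 s0 (b _ pc) p2) (sgr_Lfun2 s0 (b _ nc) n2) q2 m2).
have bpp := bounded_meas_integral_sgr pc (pos_ge0 g) p2 q2.
have bpn := bounded_meas_integral_sgr pc (neg_ge0 g) p2 m2.
have bnp := bounded_meas_integral_sgr nc (pos_ge0 g) n2 q2.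
have bnn := bounded_meas_integral_sgr nc (neg_ge0 g) n2 m2.
have [lE [K [mE _]]] : lap (fun s => (I (pos f) (pos g) s + (-1) * I (pos f) (neg g) s) +
    (-1) * (I (neg f) (pos g) s + (-1) * I (neg f) (neg g) s)) lam =
    (\int[M]_x (rsv (pos f) x * pos g x) - \int[M]_x (rsv (pos f) x * neg g x)) -
    (\int[M]_x (rsv (neg f) x * pos g x) - \int[M]_x (rsv (neg f) x * neg g x)) /\
    exists K, bounded_meas (fun s => (I (pos f) (pos g) s + (-1) * I (pos f) (neg g) s) +
    (-1) * (I (neg f) (pos g) s + (-1) * I (neg f) (neg g) s)) K.
  have [h1 h2] := lap_linear4 lam0 bpp bpn bnp bnn; split; last by eexists; exact: h2.
  rewrite [LHS]h1; apply: congr4.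
  - exact: lap_integral_sgr_nonneg pc (pos_ge0 g) p2 q2.
  - exact: lap_integral_sgr_nonneg pc (neg_ge0 g) p2 m2.
  - exact: lap_integral_sgr_nonneg nc (pos_ge0 g) n2 q2.
  - exact: lap_integral_sgr_nonneg nc (neg_ge0 g) n2 m2.
split.
  transitivity (lap (fun s => (I (pos f) (pos g) s + (-1) * I (pos f) (neg g) s) +
   (-1) * (I (neg f) (pos g) s + (-1) * I (neg f) (neg g) s)) lam).
    by apply: eq_Rintegral => s; rewrite inE/= in_itv/= andbT => s0; rewrite IE.
  rewrite lE -(Rintegral_mul_posneg (rsv_Lfun2 (b _ pc) p2) (rsv_Lfun2 (b _ nc) n2) q2 m2).
  by apply: eq_Rintegral => x _; rewrite (rsv_posneg x fc) mulN1r -posB.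
split; last first.
  move=> s s0; have U := sgr_Lfun2 s0 fc f2.
  apply: (le_trans (cauchy_schwarz U g2)).
  rewrite ler_wpM2r ?sqrtr_ge0// ler_sqrt ?Rintegral_sqr_ge0//.
  by rewrite -lee_fin !Rintegral_sqr//; exact: (integral_sgr_sqr s0 fc mf).
have E : {in (half_line : set R), (fun s => (I (pos f) (pos g) s + (-1) * I (pos f) (neg g) s) +
   (-1) * (I (neg f) (pos g) s + (-1) * I (neg f) (neg g) s)) =1 (fun s => \int[M]_x (sgr s f x * g x))}.
  by move=> s; rewrite inE half_lineE => s0; rewrite IE.
exact: (@eq_measurable_fun _ _ _ _ _ _ _ E mE).
Qed.

End laplace.

End reversible_semigroup.

(** * Diffusive rescaling of the walk *)

Section rescaled_chain.
Context {R : realType} {d : nat} {dX : measure_display} {Xi : measurableType dX}.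
Variables (Y : nat -> Xi -> 'rV[R]_d) (S : nat -> Xi -> R).
Variables (m : lfmeasure R d) (q : 'rV[R]_d -> 'rV[R]_d -> R).
Variable Q : 'rV[R]_d -> probability Xi R.
Hypothesis atomic_m : purely_atomic m.
Hypothesis q_ge0 : forall x y, 0 <= q x y.
Hypothesis rateA : forall x, atoms m x -> (0 < total_rate (atoms m) q x < +oo)%E.
Hypothesis law : forall x, atoms m x -> walk_law Y S (atoms m) q (Q x) x.
Hypothesis nonexpl : forall x, atoms m x -> non_explosive S (Q x).
Hypothesis balance : forall x y, atoms m x -> atoms m y -> (m [set x] * (q x y)%:E = m [set y] * (q y x)%:E)%E.
Variable e : R.
Hypothesis e0 : 0 < e.

Let eN0 : e != 0. Proof. by rewrite gt_eqF. Qed.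
Let eV x : e *: (e^-1 *: x) = x :> 'rV[R]_d. Proof. by rewrite scalerA divff// scale1r. Qed.
Let Ve x : e^-1 *: (e *: x) = x :> 'rV[R]_d. Proof. by rewrite scalerA mulVf// scale1r. Qed.

(** The rescaled walk is again given by a jump chain and holding times: positions are multiplied by
    [e], times by [e ^ 2], rates by [e ^- 2] and weights by [e ^ d]. All the above therefore applies
    at each scale, with balance preserved. *)
Definition rescaled_chain n xi := e *: Y n xi.
Definition rescaled_holding n xi := e ^+ 2 * S n xi.
Definition rescaled_atoms : set 'rV[R]_d := [set z | atoms m (e^-1 *: z)].
Definition rescaled_rate x y := e ^- 2 * q (e^-1 *: x) (e^-1 *: y).
Definition rescaled_start x := Q (e^-1 *: x).
Definition rescaled_weight x := e ^+ d * fine (m [set e^-1 *: x]).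

Let Ye := rescaled_chain.
Let Se := rescaled_holding.
Let Ae := rescaled_atoms.
Let qe := rescaled_rate.
Let Qe := rescaled_start.
Let nw := rescaled_weight.

Let bijA : set_bij (atoms m) Ae (fun x => e *: x).
Proof.
split=> [x Ax|x y _ _ /(congr1 (fun z => e^-1 *: z))|x Ax].
- by rewrite /Ae /rescaled_atoms/= Ve.
- by rewrite !Ve.
- by exists (e^-1 *: x).
Qed.

Lemma countable_rescaled_atoms : countable Ae.
Proof.
have -> : Ae = (fun x => e *: x) @` atoms m.
  apply/seteqP; split => [x Ax|_ [x Ax <-]]; first by exists (e^-1 *: x).
  by rewrite /Ae /rescaled_atoms/= Ve.
exact: (sub_countable (card_image_le _ _) (countable_atoms atomic_m)).
Qed.

Lemma rescaled_rate_ge0 x y : 0 <= qe x y.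
Proof. by rewrite mulr_ge0// invr_ge0 exprn_ge0// ltW. Qed.

Let e2 : 0 < e ^- 2. Proof. by rewrite invr_gt0 exprn_gt0. Qed.

Lemma rescaled_total_rate x : (total_rate Ae qe x = (e ^- 2)%:E * total_rate (atoms m) q (e^-1 *: x))%E.
Proof.
rewrite /total_rate (@reindex_esum _ _ _ _ _ _ _ bijA) -(esumZ (countable_atoms atomic_m)) ?lee_fin ?ltW//.
- by apply: eq_esum => y _; rewrite /qe /rescaled_rate Ve EFinM.
- by move=> y _; rewrite lee_fin.
Qed.

Lemma rescaled_total_rate_fin x : Ae x -> (0 < total_rate Ae qe x < +oo)%E.
Proof.
move=> Ax; rewrite rescaled_total_rate; have /andP[h0 h1] := rateA Ax.
rewrite mule_gt0 ?lte_fin//=.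
by rewrite lte_mul_pinfty ?lee_fin ?ltW//.
Qed.

Lemma rescaled_exit_rate x : Ae x ->
  fine (total_rate Ae qe x) = e ^- 2 * fine (total_rate (atoms m) q (e^-1 *: x)).
Proof.
move=> Ax; rewrite rescaled_total_rate fineM//.
by have /andP[h0 h1] := rateA Ax; rewrite ge0_fin_numE// ltW.
Qed.

Lemma rescaled_walk_law x : Ae x -> walk_law Ye Se Ae qe (Qe x) x.
Proof.
move=> Ax; have [mY mS lawx] := law Ax; split => [n|n|n y s Ay s0].
- have -> : Ye n = (fun z => e *: z) \o Y n by [].
  by apply: measurableT_comp => //; exact: measurable_scale.
- exact: measurable_funM.
have := lawx n (fun i => e^-1 *: y i) (fun i => e ^- 2 * s i) Ay.
rewrite (_ : [set xi | _] = [set xi | (forall i, (i <= n)%N -> Ye i xi = y i) /\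
                    (forall i, (i < n)%N -> s i < Se i xi)]).
  move=> ->; last by move=> i; rewrite mulr_ge0// ltW.
  rewrite (inj_eq (can_inj eV)); congr EFin; congr (_ * _); apply: eq_bigr => i _.
  rewrite !rescaled_exit_rate// /qe /rescaled_rate.
  rewrite -[e ^- 2 * q _ _ / _]mulf_div divff ?mul1r ?gt_eqF//.
  by congr (expR (- _) * _); rewrite mulrCA mulrA.
apply/seteqP; split => xi [h1 h2]; split => i ni.
- by rewrite /Ye /rescaled_chain h1.
- by have := h2 i ni; rewrite [e ^- 2 * _]mulrC ltr_pdivrMr ?exprn_gt0// mulrC.
- by rewrite -(h1 i ni) /Ye /rescaled_chain Ve.
- by have := h2 i ni; rewrite /Se /rescaled_holding [e ^- 2 * _]mulrC ltr_pdivrMr ?exprn_gt0// mulrC.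
Qed.

Lemma rescaled_jump_time n xi : jump_time Se n xi = e ^+ 2 * jump_time S n xi.
Proof. by rewrite /jump_time mulr_sumr. Qed.

Lemma rescaled_non_explosive x : Ae x -> non_explosive Se (Qe x).
Proof.
move=> Ax; apply: filterS (nonexpl Ax) => xi h.
rewrite (_ : jump_time Se ^~ xi = (fun n => e ^+ 2 * jump_time S n xi)).
  apply/cvgryPge => K; move/cvgryPge: h => /(_ (K / e ^+ 2)); apply: filterS => n.
  by rewrite ler_pdivrMr ?exprn_gt0// mulrC.
by apply/funext => n; exact: rescaled_jump_time.
Qed.

Lemma rescaled_walkE t xi : walk Ye Se t xi = e *: walk Y S (e ^- 2 * t) xi.
Proof.
rewrite /walk /Ye /rescaled_chain; congr (_ *: Y (xget _ _) _).
apply/funext => n; apply/propext => /=; rewrite !rescaled_jump_time.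
by rewrite [e ^- 2 * t]mulrC ler_pdivlMr ?exprn_gt0// ltr_pdivrMr ?exprn_gt0// ![e ^+ 2 * _]mulrC.
Qed.

Let mfin x : (m [set x] \is a fin_num)%E.
Proof. by rewrite ge0_fin_numE// measure_set1_fin. Qed.

Lemma rescaled_weight_gt0 x : Ae x -> 0 < nw x.
Proof.
by move=> Ax; rewrite mulr_gt0 ?exprn_gt0// fine_gt0// Ax/= measure_set1_fin.
Qed.

Lemma rescaled_balance x y : Ae x -> Ae y -> nw x * qe x y = nw y * qe y x.
Proof.
move=> Ax Ay; have := balance Ax Ay; rewrite -(fineK (mfin (e^-1 *: x))) -(fineK (mfin (e^-1 *: y))).
rewrite -!EFinM => -[E]; rewrite /nw /rescaled_weight /qe /rescaled_rate.
by rewrite mulrACA E mulrACA.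
Qed.

Lemma integral_rescaled (h : 'rV[R]_d -> \bar R) : measurable_fun setT h -> (forall x, 0 <= h x)%E ->
  (\int[rescaled m e]_x h x = (e ^+ d)%:E * \int[m]_x h (e *: x)%R)%E.
Proof.
move=> mh h0; rewrite /rescaled ge0_integral_mscale//= ger0_norm ?ltW// /pushforward_measure ge0_integral_pushforward//.
exact: measurable_scale.
Qed.

Lemma integral_rescaled_atoms (h : 'rV[R]_d -> \bar R) : measurable_fun setT h -> (forall x, 0 <= h x)%E ->
  (\int[rescaled m e]_x h x = \esum_(x in Ae) ((nw x)%:E * h x))%E.
Proof.
move=> mh h0; rewrite integral_rescaled// (integral_atomic atomic_m)//; last first.
  by apply: (measurableT_comp mh); exact: measurable_scale.
rewrite (@reindex_esum _ _ _ _ _ _ _ bijA) -(esumZ (countable_atoms atomic_m)) ?lee_fin ?exprn_ge0 ?ltW//.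
- by apply: eq_esum => x _; rewrite /nw /rescaled_weight Ve EFinM fineK// muleA.
- by move=> x _; rewrite mule_ge0.
Qed.

End rescaled_chain.

(** The properties shared by the semigroup at a fixed time and by [lam] times the resolvent:
    domination of the modulus, conservation of mass, stability of L^2 and symmetry. The [L^1]
    convergence rests on them alone for the prelimit operators. *)
Definition markov_operator {R : realType} {d : nat} (M : {measure set 'rV[R]_d -> \bar R})
    (T : ('rV[R]_d -> R) -> 'rV[R]_d -> R) : Prop :=
  forall f c, (forall x, `|f x| <= c) ->
  [/\ measurable_fun setT (T f),
      forall x, `|T f x| <= T (fun y => `|f y|) x,
      (forall x, 0 <= f x) -> measurable_fun setT f ->
        (\int[M]_x (T f x)%:E = \int[M]_x (f x)%:E)%E,
      f \in Lfun M 2%:E -> T f \in Lfun M 2%:E &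
      f \in Lfun M 2%:E -> forall h, (forall x, `|h x| <= c) -> h \in Lfun M 2%:E ->
        \int[M]_x (T f x * h x) = \int[M]_x (f x * T h x)].

(** * Operators of the rescaled walk *)

Section walk_operators.
Context {R : realType} {d : nat} {dO dX : measure_display}
  {Omega : measurableType dO} {Xi : measurableType dX}.
Variables (mu : Omega -> lfmeasure R d) (r : Omega -> 'rV[R]_d -> 'rV[R]_d -> R)
  (Y : nat -> Xi -> 'rV[R]_d) (S : nat -> Xi -> R)
  (Q : Omega -> 'rV[R]_d -> probability Xi R) (w : Omega).
Let m := mu w.
Hypothesis atomic_m : purely_atomic m.
Hypothesis r_ge0 : forall x y, 0 <= r w x y.
Hypothesis rateA : forall x, atoms m x -> (0 < total_rate (atoms m) (r w) x < +oo)%E.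
Hypothesis law : forall x, atoms m x -> walk_law Y S (atoms m) (r w) (Q w x) x.
Hypothesis nonexpl : forall x, atoms m x -> non_explosive S (Q w x).
Hypothesis balance : forall x y, atoms m x -> atoms m y -> (m [set x] * (r w x y)%:E = m [set y] * (r w y x)%:E)%E.
Variable e : R.
Hypothesis e0 : 0 < e.
Implicit Types (f g h : 'rV[R]_d -> R).

Let M := rescaled m e.
Let Ye := rescaled_chain Y e.
Let Se := rescaled_holding S e.
Let Ae := rescaled_atoms m e.
Let qe := rescaled_rate (r w) e.
Let Qe := rescaled_start (Q w) e.
Let nw := rescaled_weight m e.

Let cA : countable Ae := countable_rescaled_atoms atomic_m e0.
Let q0 : forall x y, 0 <= qe x y := rescaled_rate_ge0 r_ge0 e0.
Let rA : forall x, Ae x -> (0 < total_rate Ae qe x < +oo)%E.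
Proof. by move=> x; exact: rescaled_total_rate_fin. Qed.
Let lawe : forall x, Ae x -> walk_law Ye Se Ae qe (Qe x) x.
Proof. by move=> x; exact: rescaled_walk_law. Qed.
Let nonexple : forall x, Ae x -> non_explosive Se (Qe x).
Proof. by move=> x; exact: rescaled_non_explosive. Qed.
Let nw0 : forall x, Ae x -> 0 < nw x.
Proof. by move=> x; exact: rescaled_weight_gt0. Qed.
Let bal : forall x y, Ae x -> Ae y -> nw x * qe x y = nw y * qe y x.
Proof. by move=> x y; exact: rescaled_balance. Qed.
Let intM : forall h : 'rV[R]_d -> \bar R, measurable_fun setT h -> (forall x, 0 <= h x)%E ->
  (\int[M]_x h x = \esum_(x in Ae) ((nw x)%:E * h x))%E.
Proof. by move=> h; exact: integral_rescaled_atoms. Qed.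

Local Notation U := (walk_semigroup mu Y S Q e w).
Local Notation V := (walk_resolvent mu Y S Q e w).

Lemma walk_semigroupE t f c : 0 <= t -> (forall y, `|f y| <= c) -> U t f = sgr Ye Se Ae Qe t f.
Proof.
move=> t0 fc; apply/funext => z; rewrite /walk_semigroup; case: asboolP => Az; last first.
  by rewrite /sgr kop_out.
rewrite -(integral_walk_sgr cA q0 rA lawe nonexple t0 fc Az).
by apply: eq_Rintegral => xi _; rewrite rescaled_walkE.
Qed.

Lemma walk_resolventE lam f c : (forall y, `|f y| <= c) -> V lam f = rsv Ye Se Ae Qe lam f.
Proof.
move=> fc; apply/funext => z; rewrite /walk_resolvent /rsv /lap.
by apply: eq_Rintegral => s; rewrite inE/= in_itv/= andbT => s0; rewrite (walk_semigroupE s0 fc).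
Qed.

Let nfc f c : (forall y, `|f y| <= c) -> forall y, `| `|f y| | <= c.
Proof. by move=> fc y; rewrite normr_id. Qed.

Lemma walk_semigroup_markov t : 0 <= t -> markov_operator M (U t).
Proof.
move=> t0 f c fc; have p0 := fun x => trans_prob_ge0 Ye Se (Qe x) t.
have pm x (Ax : Ae x) := trans_mass cA q0 rA lawe nonexple t0 Ax.
have ps x y (Ax : Ae x) (Ay : Ae y) := trans_sym cA q0 rA lawe nonexple nw0 bal t0 Ax Ay.
split.
- rewrite (walk_semigroupE t0 fc); exact: (@measurable_kop _ _ _ (fun x => trans_prob Ye Se (Qe x) t) cA f).
- move=> x; rewrite (walk_semigroupE t0 fc) (walk_semigroupE t0 (nfc fc)).
  exact: (kop_norm cA p0 pm fc).
- move=> f0 mf; have fc' y : 0 <= f y <= c by rewrite f0/= -(ger0_norm (f0 y)).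
  by rewrite (walk_semigroupE t0 fc); exact: (integral_kop cA p0 pm nw0 ps intM fc' mf).
- move=> f2; rewrite (walk_semigroupE t0 fc); exact: (kop_Lfun2 cA p0 pm nw0 ps intM fc f2).
- move=> f2 h hc h2; rewrite (walk_semigroupE t0 fc) (walk_semigroupE t0 hc).
  exact: (Rintegral_kop_sym cA p0 pm nw0 ps intM fc hc f2 h2).
Qed.

Lemma walk_resolvent_markov lam : 0 < lam -> markov_operator M (fun f x => lam * V lam f x).
Proof.
move=> l0 f c fc; split.
- rewrite (walk_resolventE lam fc); apply: measurable_funM => //.
  exact: (measurable_rsv _ _ cA).
- move=> x; rewrite (walk_resolventE lam fc) (walk_resolventE lam (nfc fc)).
  exact: (rsv_norm cA q0 rA lawe nonexple l0 x fc).
- move=> f0 mf; have fc' y : 0 <= f y <= c by rewrite f0/= -(ger0_norm (f0 y)).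
  rewrite (walk_resolventE lam fc).
  exact: (integral_rsv cA q0 rA lawe nonexple nw0 bal intM l0 fc' mf).
- move=> f2; rewrite (walk_resolventE lam fc); apply: Lfun2_scale.
  exact: (rsv_Lfun2 cA q0 rA lawe nonexple nw0 bal intM l0 fc f2).
- move=> f2 h hc h2; rewrite (walk_resolventE lam fc) (walk_resolventE lam hc).
  exact: (Rintegral_rsv_sym cA q0 rA lawe nonexple nw0 bal intM l0 fc hc f2 h2).
Qed.

Lemma integral_walk_semigroup_sqr t f c : 0 <= t -> (forall y, `|f y| <= c) -> measurable_fun setT f ->
  (\int[M]_x (U t f x ^+ 2)%:E <= \int[M]_x (f x ^+ 2)%:E)%E.
Proof.
move=> t0 fc mf; rewrite (walk_semigroupE t0 fc).
exact: (integral_sgr_sqr cA q0 rA lawe nonexple nw0 bal intM t0 fc mf).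
Qed.

Lemma walk_semigroup_modulus (s h : R) f c : 0 < s -> 0 < h -> (forall y, `|f y| <= c) -> f \in Lfun M 2%:E ->
  \int[M]_x ((U s f x - U (s + h) f x) ^+ 2) <= (\int[M]_x (f x ^+ 2)) * h / (2 * s).
Proof.
move=> s0 h0 fc f2; have sh : 0 <= s + h by rewrite addr_ge0 ?ltW.
rewrite (walk_semigroupE (ltW s0) fc) (walk_semigroupE sh fc).
exact: (sgr_modulus cA q0 rA lawe nonexple nw0 bal intM fc f2 s0 h0).
Qed.

Lemma lap_walk_semigroup lam f g c : 0 < lam -> (forall y, `|f y| <= c) ->
  f \in Lfun M 2%:E -> g \in Lfun M 2%:E ->
  lap (fun s => \int[M]_x (U s f x * g x)) lam = \int[M]_x (V lam f x * g x) /\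
  bounded_meas (fun s => \int[M]_x (U s f x * g x))
    (Num.sqrt (\int[M]_x (f x ^+ 2)) * Num.sqrt (\int[M]_x (g x ^+ 2))).
Proof.
move=> l0 fc f2 g2; have [h1 [h2 h3]] := lap_integral_sgr cA q0 rA lawe nonexple nw0 bal intM l0 fc f2 g2.
have E : {in (half_line : set R), (fun s => \int[M]_x (sgr Ye Se Ae Qe s f x * g x)) =1
   (fun s => \int[M]_x (U s f x * g x))}.
  by move=> s; rewrite inE half_lineE => s0; rewrite (walk_semigroupE s0 fc).
split.
  rewrite (walk_resolventE lam fc) -h1 /lap; apply: eq_Rintegral => s hs.
  by rewrite E.
split; first exact: (@eq_measurable_fun _ _ _ _ _ _ _ E h2).
by move=> s s0; rewrite (walk_semigroupE s0 fc); exact: h3.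
Qed.

End walk_operators.

(** * Vague convergence *)

Section lebesgue_affine.
Context {R : realType}.
Local Notation leb := (@lebesgue_measure R).

Lemma measurable_affine (s c : R) :
  measurable_fun setT (fun x : measurableTypeR R => s * (x : R) + c : measurableTypeR R).
Proof. by apply: measurable_funD => //; exact: measurable_funM. Qed.

Lemma lebesgue_measure_affine (s c : R) (A : set R) : 0 < s -> measurable A ->
  (leb ((fun x => (s * x + c)%R) @^-1` A) = (s^-1)%:E * leb A)%E.
Proof.
move=> s0 mA.
suff H : leb A = mscale (NngNum (ltW s0)) (pushforward_measure leb (measurable_affine s c)) A.
  by rewrite H /mscale/= muleA -EFinM mulVf ?gt_eqF// mul1e.
apply: lebesgue_measure_unique => // X [[a b] _ <-].
transitivity (s%:E * leb ((fun x => (s * x + c)%R) @^-1` `]a, b]))%E; last by [].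
have -> : (fun x => s * x + c) @^-1` `]a, b] = `](a - c) / s, (b - c) / s]%classic.
  apply/seteqP; split=> x /=; by rewrite !in_itv/= ltr_pdivrMr// ler_pdivlMr// ltrBlDr lerBrDr [x * s]mulrC.
rewrite !lebesgue_measure_itv/= !lte_fin ltr_pM2r ?invr_gt0// ltrD2r; case: ifP => [_|_]; last by rewrite mule0.
by rewrite -EFinD -EFinM; congr EFin; field; rewrite gt_eqF.
Qed.

Definition affine_tuple (s : R) n (g t : n.-tuple R) : n.-tuple R :=
  [tuple s * tnth t i + tnth g i | i < n].

Lemma measurable_affine_tuple s n g : measurable_fun setT (@affine_tuple s n g).
Proof.
apply/measurable_fun_tnthP => i.
rewrite (_ : _ \o _ = (fun t => s * tnth t i + tnth g i)).
  by apply: measurable_funD => //; apply: measurable_funM => //; exact: measurable_tnth.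
by apply/funext => t /=; rewrite tnth_mktuple.
Qed.

Lemma affine_tuple_snoc s n (g : n.+1.-tuple R) (p : n.-tuple R * R) :
  affine_tuple s g (tuple_snoc p) =
  tuple_snoc (affine_tuple s [tuple of behead g] p.1, s * p.2 + thead g).
Proof.
have S (q : n.-tuple R * R) (j : 'I_n) : tnth (tuple_snoc q) (lift ord0 j) = tnth q.1 j.
  by rewrite !(tnth_nth 0).
apply: eq_from_tnth => i; rewrite tnth_mktuple.
case: (unliftP ord0 i) => [j ->|->]; last by rewrite !(tnth_nth 0)/= /thead (tnth_nth 0).
by rewrite !S tnth_mktuple; congr (_ + _); rewrite !(tnth_nth 0)/= nth_behead.
Qed.

(** Induction on the dimension by sections, each coordinate contributing a factor [s^-1]. *)
Lemma lebesgue_tuple_affine s n (g : n.-tuple R) (A : set (n.-tuple R)) : 0 < s -> measurable A ->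
  (lebesgue_tuple n (affine_tuple s g @^-1` A) = (s ^- n)%:E * lebesgue_tuple n A)%E.
Proof.
move=> s0; elim: n g A => [|n IH] g A mA.
  rewrite expr0 invr1 mul1e /=; congr (\d_ _ _).
  by apply/seteqP; split => t /=; rewrite [affine_tuple _ _ _]tuple0 [t]tuple0.
rewrite /= /pushforward_measure/= /pushforward /product_measure1.
set B := (@tuple_snoc R n) @^-1` A.
have mB : measurable B by rewrite -[B]setTI; exact: measurable_tuple_snoc.
pose gb := [tuple of behead g].
have sB (x : n.-tuple R) : lebesgue_measure (xsection (@tuple_snoc R n @^-1` (affine_tuple s g @^-1` A)) x) =
    ((s^-1)%:E * lebesgue_measure (xsection B (affine_tuple s gb x)))%E.
  rewrite -(lebesgue_measure_affine (thead g) s0); last exact: measurable_xsection.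
  congr (lebesgue_measure _); apply/seteqP; split => t /=.
    by rewrite /xsection/= !inE/= affine_tuple_snoc.
  by rewrite /xsection/= !inE/= affine_tuple_snoc.
have mS : measurable_fun setT (fun x => lebesgue_measure (xsection B x)).
  exact: measurable_fun_xsection.
transitivity (\int[lebesgue_tuple n]_x ((s^-1)%:E * lebesgue_measure (xsection B (affine_tuple s gb x))))%E.
  by apply: eq_integral => x _ /=; rewrite sB.
rewrite ge0_integralZl//; last 2 first.
- exact: (measurableT_comp mS (measurable_affine_tuple s gb)).
- by rewrite lee_fin invr_ge0 ltW.
have E : (\int[pushforward_measure (lebesgue_tuple n) (measurable_affine_tuple s gb)]_x lebesgue_measure (xsection B x) =
  (s ^- n)%:E * \int[lebesgue_tuple n]_x lebesgue_measure (xsection B x))%E.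
  have sn : 0 <= s ^- n by rewrite invr_ge0 exprn_ge0// ltW.
  rewrite -(@ge0_integral_mscale _ _ _ _ _ measurableT (NngNum sn))//.
  by apply: eq_measure_integral => C mC _; exact: IH.
rewrite /pushforward_measure ge0_integral_pushforward// in E; last exact: measurable_affine_tuple.
by rewrite [X in (_ * X)%E]E muleA -EFinM exprS invfM.
Qed.

Lemma lebesgue_rV_affine d s (g : 'rV[R]_d) (A : set 'rV[R]_d) : 0 < s -> measurable A ->
  (lebesgue_rV d ((fun x : 'rV[R]_d => (s *: x + g)%R) @^-1` A) = (s ^- d)%:E * lebesgue_rV d A)%E.
Proof.
move=> s0 mA; rewrite /lebesgue_rV /pushforward_measure/= /pushforward.
rewrite -(lebesgue_tuple_affine [tuple g ord0 i | i < d] s0); last first.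
  by rewrite -[X in measurable X]setTI; exact: measurable_row_of_tuple.
congr (lebesgue_tuple d _); apply/seteqP; split => t /=; congr A; apply/rowP => i;
  by rewrite !mxE !tnth_mktuple.
Qed.

Lemma lebesgue_rV_scale d s (A : set 'rV[R]_d) : 0 < s -> measurable A ->
  (lebesgue_rV d ((fun x : 'rV[R]_d => (s *: x)%R) @` A) = (s ^+ d)%:E * lebesgue_rV d A)%E.
Proof.
move=> s0 mA; have := @lebesgue_rV_affine d s^-1 0 A; rewrite invr_gt0 => /(_ s0 mA).
rewrite exprVn invrK => <-; congr (lebesgue_rV d _); apply/seteqP; split => x /=.
  by move=> [y Ay <-]; rewrite addr0 scalerA mulVf ?gt_eqF// scale1r.
by rewrite addr0 => Ax; exists (s^-1 *: x) => //; rewrite scalerA divff ?gt_eqF// scale1r.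
Qed.

Lemma lebesgue_rV_translate d (g : 'rV[R]_d) (A : set 'rV[R]_d) : measurable A ->
  lebesgue_rV d ((fun x => x + g) @` A) = lebesgue_rV d A.
Proof.
move=> mA; have := @lebesgue_rV_affine d 1 (- g) A ltr01 mA.
rewrite expr1n invr1 mul1e => <-; congr (lebesgue_rV d _); apply/seteqP; split => x /=.
  by move=> [y Ay <-]; rewrite scale1r addrK.
by rewrite scale1r => Ax; exists (x - g) => //; rewrite subrK.
Qed.

End lebesgue_affine.

(** * Cutting boxes and their volume *)

Section box_decomposition.
Context {R : realType} {d : nat}.
Variable V : 'M[R]_d.
Hypothesis V_inv : V \in unitmx.
Implicit Types (a b : 'I_d -> R) (x : 'rV[R]_d) (i j : 'I_d).

Definition update (T : Type) (f : 'I_d -> T) i (c : T) : 'I_d -> T := fun j => if j == i then c else f j.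

Lemma update_same (T : Type) (f : 'I_d -> T) i c : update f i c i = c.
Proof. by rewrite /update eqxx. Qed.

Lemma update_other (T : Type) (f : 'I_d -> T) i j c : j != i -> update f i c j = f j.
Proof. by rewrite /update => /negbTE ->. Qed.

Lemma vbox_split (m : {measure set 'rV[R]_d -> \bar R}) a b i c : a i <= c -> c <= b i ->
  (m (vbox V a b) = m (vbox V a (update b i c)) + m (vbox V (update a i c) b))%E.
Proof.
move=> ac cb; rewrite -measureU; [|exact: measurable_vbox|exact: measurable_vbox|].
  congr (m _); apply/seteqP; split => x /=.
    move=> H; have [xc|cx] := ltP (vcoord V x i) c; [left|right] => j; have := H j;
      by rewrite /update; case: eqP => // -> /andP[h1 h2]; rewrite ?h1 ?h2 ?andbT.
  case=> H j; have := H j; rewrite /update; case: eqP => // -> /andP[h1 h2].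
    by rewrite h1 (lt_le_trans h2).
  by rewrite h2 (le_trans ac).
apply/seteqP; split => x //= -[/(_ i) + /(_ i)]; rewrite !update_same => /andP[_ h1] /andP[h2 _].
by have := lt_le_trans h1 h2; rewrite ltxx.
Qed.

Lemma lebesgue_vbox_shift a b (g : 'rV[R]_d) :
  lebesgue_rV d (vbox V (fun i => a i + g ord0 i) (fun i => b i + g ord0 i)) = lebesgue_rV d (vbox V a b).
Proof. by rewrite -vbox_tau// lebesgue_rV_translate//; exact: measurable_vbox. Qed.

Lemma lebesgue_vbox_scale a b (s : R) : 0 < s ->
  lebesgue_rV d (vbox V (fun i => s * a i) (fun i => s * b i)) = ((s ^+ d)%:E * lebesgue_rV d (vbox V a b))%E.
Proof.
move=> s0; rewrite -lebesgue_rV_scale//; last exact: measurable_vbox.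
congr (lebesgue_rV d _); apply/seteqP; split => x /=.
  move=> H; exists (s^-1 *: x); last by rewrite scalerA divff ?gt_eqF// scale1r.
  by move=> i; rewrite vcoordZ mulrC ler_pdivlMr// ltr_pdivrMr// ![_ * s]mulrC.
by move=> [y H <-] i; rewrite vcoordZ ler_pM2l// ltr_pM2l//.
Qed.

(** Induction on the sum of the sides: a slab of width one is cut off along a side longer than one,
    until only translates of [cell V] remain. This relates the volume to that of the cell without a
    determinant. *)
Lemma lebesgue_vbox_nat (a : 'I_d -> R) (k : 'I_d -> nat) : (forall i, (0 < k i)%N) ->
  lebesgue_rV d (vbox V a (fun i => a i + (k i)%:R)) = ((\prod_i (k i)%:R)%:E * lebesgue_rV d (cell V))%E.
Proof.
have [n] := ubnP (\sum_i k i)%N; elim: n a k => // n IH a k kn k0.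
have [k1|] := pselect (forall i, (k i <= 1)%N).
  have E i : k i = 1%N by apply/eqP; rewrite eqn_leq k1 k0.
  rewrite big1 ?mul1e; last by move=> i _; rewrite E.
  rewrite cellE// -(lebesgue_vbox_shift (fun=> 0) (fun=> 1) (\row_i a i)).
  by congr (lebesgue_rV d (vbox V _ _)); apply/funext => i; rewrite mxE ?E ?add0r// addrC.
move=> /existsNP[i /negP]; rewrite -ltnNge => ki.
have S : (k i = (k i).-1 + 1)%N by rewrite addn1 prednK.
have kn' c : (0 < c < k i)%N -> (\sum_j update k i c j < n)%N.
  move=> /andP[c0 ck]; rewrite -ltnS; apply: leq_trans kn; rewrite ltnS.
  rewrite (bigD1 i)//= [X in (_ < X)%N](bigD1 i)//= update_same.
  rewrite [X in (c + X < _)%N](eq_bigr k); last by move=> j ji; rewrite update_other.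
  by rewrite ltn_add2r.
have P c : (0 < c)%N -> \prod_j (update k i c j)%:R = c%:R * \prod_(j | j != i) (k j)%:R :> R.
  move=> c0; rewrite (bigD1 i)//= update_same; congr (_ * _); apply: eq_bigr => j ji.
  by rewrite update_other.
have up0 c : (0 < c)%N -> forall j, (0 < update k i c j)%N.
  by move=> c0 j; rewrite /update; case: ifP.
have k10 : (0 < (k i).-1)%N by rewrite -ltnS prednK// (ltn_trans _ ki).
rewrite (@vbox_split _ _ _ i (a i + 1)); last 2 first.
- by rewrite lerDl.
- by rewrite lerD2l ler1n.
rewrite (_ : update (fun j => a j + (k j)%:R) i (a i + 1) = (fun j => a j + (update k i 1 j)%:R)); last first.
  by apply/funext => j; rewrite /update; case: eqP => // ->.
rewrite [X in (_ + lebesgue_rV d (vbox V _ X))%E](_ : _ = (fun j => update a i (a i + 1) j + (update k i (k i).-1 j)%:R)); last first.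
  apply/funext => j; rewrite /update; case: eqP => // ->.
  by rewrite {1}S natrD addrAC addrA.
rewrite !IH//; last 4 first.
- by have h : (0 < (k i).-1 < k i)%N; [rewrite k10 ltn_predL k0|exact: kn' h].
- exact: up0.
- exact: kn'.
- exact: up0.
rewrite !P// [in RHS](bigD1 i)//= -ge0_muleDl ?lee_fin ?mulr_ge0 ?prodr_ge0//.
by rewrite -EFinD -mulrDl; congr ((_ * _)%:E * _)%E; rewrite [in RHS]S natrD addrC.
Qed.

Lemma coord_le_norm x j : `|x ord0 j| <= `|x|.
Proof. by rewrite [leRHS]mx_normrE; exact: (le_trans _ (le_bigmax _ _ (ord0, j))). Qed.

Lemma vcoord_le_norm x i : `|vcoord V x i| <= vnorm (invmx V) * `|x|.
Proof.
rewrite vcoordE; apply: (le_trans (ler_norm_sum _ _ _)).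
rewrite (@le_trans _ _ (\sum_j `|invmx V i j| * `|x|))//.
  by apply: ler_sum => j _; rewrite normrM mulrC ler_wpM2l// coord_le_norm.
rewrite -mulr_suml ler_wpM2r// /vnorm [leRHS](bigD1 i)//= lerDl; apply: sumr_ge0 => k _.
by apply: sumr_ge0.
Qed.

Lemma vnorm_ge0 : 0 <= vnorm (invmx V).
Proof. by apply: sumr_ge0 => k _; apply: sumr_ge0. Qed.

Hypothesis cell_fin : (lebesgue_rV d (cell V) < +oo)%E.

(** A compact set fits in a box made of finitely many translates of the cell. Lebesgue measure
    thereby becomes a [lfmeasure], so that the lemmas on [box_mass] apply to it. *)
Lemma lebesgue_rV_compact (K : set 'rV[R]_d) : compact K -> (lebesgue_rV d K < +oo)%E.
Proof.
move=> cK; have [r KB] : exists r, forall x, K x -> `|x| <= r.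
  have [M [Mr KM]] := compact_bounded cK; exists (M + 1) => x Kx; apply: (KM (M + 1)) => //.
  by rewrite ltrDl.
pose N := (Num.bound (vnorm (invmx V) * `|r|)).+1.
have KN : K `<=` vbox V (fun=> - N%:R) (fun i => - N%:R + (N + N)%:R).
  move=> x Kx i; rewrite natrD addKr.
  have h : `|vcoord V x i| < N%:R.
    apply: (le_lt_trans (vcoord_le_norm x i)); apply: (@le_lt_trans _ _ (vnorm (invmx V) * `|r|)).
      by rewrite ler_wpM2l ?vnorm_ge0// (le_trans (KB x Kx))// ler_norm.
    apply: (lt_le_trans (archi_boundP _)); last by rewrite ler_nat.
    by rewrite mulr_ge0// vnorm_ge0.
  by move: h; rewrite ltr_norml => /andP[/ltW -> ->].
have mK : measurable K by apply: closed_measurable_rV; apply: compact_closed => //; exact: norm_hausdorff.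
apply: (@le_lt_trans _ _ (lebesgue_rV d (vbox V (fun=> - N%:R) (fun i => - N%:R + (N + N)%:R)))).
  by apply: le_measure KN; rewrite inE//; exact: measurable_vbox.
rewrite lebesgue_vbox_nat// lte_mul_pinfty// ?lee_fin; first exact: prodr_ge0.
Qed.

End box_decomposition.

(** * From boxes around the origin to arbitrary boxes *)

Section box_averages.
Context {R : realType} {d : nat}.
Variable V : 'M[R]_d.
Hypothesis V_inv : V \in unitmx.
Hypothesis cell_fin : (lebesgue_rV d (cell V) < +oo)%E.

Definition lebesgue_lfmeasure : lfmeasure R d := LFMeasure (lebesgue_rV_compact V_inv cell_fin).

Local Notation volume := (box_mass V lebesgue_lfmeasure).

Lemma box_mass_split (m : lfmeasure R d) (a b : 'I_d -> R) i c : a i <= c -> c <= b i ->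
  box_mass V m a b = box_mass V m a (update b i c) + box_mass V m (update a i c) b.
Proof.
by move=> ac cb; rewrite /box_mass (vbox_split V m ac cb) fineD// (vbox_fin_num V_inv).
Qed.

Lemma volume_scale (a b : 'I_d -> R) s : 0 < s ->
  volume (fun i => s * a i) (fun i => s * b i) = s ^+ d * volume a b.
Proof.
by move=> s0; rewrite /box_mass/= lebesgue_vbox_scale// fineM// (vbox_fin_num V_inv lebesgue_lfmeasure).
Qed.

Variables (m : lfmeasure R d) (c : R).
Hypothesis centred : forall p q : 'I_d -> nat, (forall i, 0 < p i)%N -> (forall i, 0 < q i)%N ->
  box_mass V m (fun i => - (n * p i)%:R) (fun i => (n * q i)%:R) / n%:R ^+ d @[n --> \oo] -->
  c * volume (fun i => - (p i)%:R) (fun i => (q i)%:R).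

Lemma trunc_ratio (k : nat) : ((Num.truncn s + k)%N%:R / s : R) @[s --> +oo] --> (1 : R).
Proof.
apply/cvgrPdist_le => eta eta0; near=> s.
have s0 : 0 < s by near: s; exact: nbhs_pinfty_gt.
have /andP[h1 h2] := truncn_itv (ltW s0).
have -> : 1 - (Num.truncn s + k)%N%:R / s = (s - (Num.truncn s + k)%N%:R) / s.
  by rewrite mulrBl divff ?gt_eqF.
rewrite normrM [`|s^-1|]gtr0_norm ?invr_gt0// ler_pdivrMr//.
apply: (@le_trans _ _ (k.+1%:R)).
  rewrite natrD ler_norml; move: h2; rewrite -natr1 -[k.+1%:R]natr1 => h2.
  have k0 : 0 <= k%:R :> R by [].
  by apply/andP; split; lra.
rewrite -ler_pdivrMl//; near: s; exact: nbhs_pinfty_ge.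
Unshelve. all: by end_near. Qed.

Lemma trunc_infty (k : nat) : (Num.truncn s + k)%N @[s --> (+oo : set_system R)] --> \oo.
Proof.
apply/cvgnyPge => N; near=> s.
have s0 : 0 <= s by near: s; exact: nbhs_pinfty_ge.
rewrite (leq_trans _ (leq_addr _ _))// -(ler_nat R).
have : N%:R <= s by near: s; exact: nbhs_pinfty_ge.
by rewrite -truncn_ge_nat// ler_nat.
Unshelve. all: by end_near. Qed.

(** Monotonicity of the mass squeezes the real scale [s] between its integer part and the next
    integer, whose ratios to [s] tend to one. *)
Lemma centred_real (p q : 'I_d -> nat) : (forall i, 0 < p i)%N -> (forall i, 0 < q i)%N ->
  box_mass V m (fun i => s * - (p i)%:R) (fun i => s * (q i)%:R) / s ^+ d @[s --> +oo] -->
  c * volume (fun i => - (p i)%:R) (fun i => (q i)%:R).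
Proof.
move=> p0 q0; set L := c * _.
pose a n := box_mass V m (fun i => - (n * p i)%:R) (fun i => (n * q i)%:R).
have lim k : (a (Num.truncn s + k)%N / (Num.truncn s + k)%N%:R ^+ d) * ((Num.truncn s + k)%N%:R / s) ^+ d
    @[s --> (+oo : set_system R)] --> L.
  rewrite (_ : L = L * 1 ^+ d); last by rewrite expr1n mulr1.
  apply: cvgM.
    exact: (cvg_comp _ (fun n => a n / n%:R ^+ d) (@trunc_infty k) (centred p0 q0)).
  exact: (cvg_comp _ _ (@trunc_ratio k) (@exprn_continuous R d 1)).
apply: (squeeze_cvgr _ (lim 0%N) (lim 1%N)); near=> s.
have s1 : 1 <= s by near: s; exact: nbhs_pinfty_ge.
have s0 : 0 < s by exact: lt_le_trans s1.
have /andP[h1 h2] := truncn_itv (ltW s0).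
have t0 : (0 < Num.truncn s)%N by rewrite -(ltr_nat R) (lt_le_trans ltr01)// -[1]/(1%:R) ler_nat truncn_gt0.
have simp k : (0 < k)%N -> (a k / k%:R ^+ d) * (k%:R / s) ^+ d = a k / s ^+ d.
  by move=> k0; rewrite expr_div_n mulrA divfK// expf_neq0// pnatr_eq0 -lt0n.
rewrite !simp ?addn0// ?addn1//; apply/andP; split; rewrite ler_pM2r ?invr_gt0 ?exprn_gt0//; apply: box_mass_le => // i.
- by rewrite mulrN lerN2 natrM ler_wpM2r.
- by rewrite natrM ler_wpM2r.
- by rewrite mulrN lerN2 natrM ler_wpM2r// ltW.
- by rewrite natrM ler_wpM2r// ltW.
Unshelve. all: by end_near. Qed.

Let sbox (al be : 'I_d -> int) s := box_mass V m (fun i => s * (al i)%:~R) (fun i => s * (be i)%:~R).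
Let ivol (al be : 'I_d -> int) := volume (fun i => (al i)%:~R) (fun i => (be i)%:~R).

Let scale_update (al : 'I_d -> int) i z (s : R) :
  (fun j => s * (update al i z j)%:~R) = update (fun j => s * (al j)%:~R) i (s * z%:~R).
Proof. by apply/funext => j; rewrite /update; case: eqP. Qed.

Let intr_update (al : 'I_d -> int) i z :
  (fun j => (update al i z j)%:~R) = update (fun j => (al j)%:~R : R) i z%:~R.
Proof. by apply/funext => j; rewrite /update; case: eqP. Qed.

Let split_cvg (al be : 'I_d -> int) i z : (al i <= z)%R -> (z <= be i)%R ->
  (forall s : R, 0 <= s -> sbox al be s = sbox al (update be i z) s + sbox (update al i z) be s) /\
  ivol al be = ivol al (update be i z) + ivol (update al i z) be.
Proof.
move=> az zb; split => [s s0|].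
  by rewrite /sbox !scale_update; apply: box_mass_split; rewrite ler_wpM2l// ler_int.
by rewrite /ivol !intr_update; apply: box_mass_split; rewrite ler_int.
Qed.

(* A box that does not contain the origin is a difference of boxes that straddle it in one more coordinate. *)
Lemma box_average (al be : 'I_d -> int) : (forall i, al i != 0) -> (forall i, be i != 0) ->
  (forall i, al i < be i)%R ->
  box_mass V m (fun i => s * (al i)%:~R) (fun i => s * (be i)%:~R) / s ^+ d @[s --> +oo] -->
  c * volume (fun i => (al i)%:~R) (fun i => (be i)%:~R).
Proof.
(* Induction on the number of coordinates in which the box does not have the origin strictly
   inside. *)
have [n] := ubnP #|[set i | ~~ (al i < 0 < be i)%R]%SET|; elim: n al be => // n IH al be.
rewrite ltnS => leN a0 b0 ab.
have [ok|] := pselect (forall i, (al i < 0 < be i)%R).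
  have aE i : (al i)%:~R = - (`|al i|%N)%:R :> R.
    have /andP[h _] := ok i; rewrite -[in LHS](opprK (al i)) -(ltz0_abs h) mulrNz; congr (- _).
  have bE i : (be i)%:~R = (`|be i|%N)%:R :> R.
    by have /andP[_ h] := ok i; rewrite -[in LHS](gtz0_abs h).
  rewrite (_ : (fun s => _) = (fun s => box_mass V m (fun i => s * - (`|al i|%N)%:R) (fun i => s * (`|be i|%N)%:R) / s ^+ d)); last first.
    by apply/funext => s; congr (box_mass _ _ _ _ / _); apply/funext => i; rewrite ?aE ?bE.
  rewrite (_ : (fun i => (al i)%:~R) = (fun i => - (`|al i|%N)%:R)); last by apply/funext.
  rewrite (_ : (fun i => (be i)%:~R) = (fun i => (`|be i|%N)%:R)); last by apply/funext.
  by apply: centred_real => i; rewrite absz_gt0.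
move=> /existsNP[i /negP bad].
have smaller (al' be' : 'I_d -> int) : (forall j, j != i -> al' j = al j /\ be' j = be j) ->
    (al' i < 0 < be' i)%R -> (#|[set j | ~~ (al' j < 0 < be' j)%R]%SET| < n)%N.
  move=> same ok; apply: leq_trans leN; apply: proper_card; apply/properP; split.
    apply/fintype.subsetP => j; rewrite !finset.inE; have [->|ji] := eqVneq j i; first by rewrite ok.
    by have [-> ->] := same j ji.
  by exists i; rewrite finset.inE// ok.
have fin (al' be' al2 be2 : 'I_d -> int) :
    sbox al' be' s / s ^+ d @[s --> +oo] --> c * ivol al' be' ->
    sbox al2 be2 s / s ^+ d @[s --> +oo] --> c * ivol al2 be2 ->
    (forall s : R, 0 <= s -> sbox al' be' s = sbox al2 be2 s + sbox al be s) ->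
    ivol al' be' = ivol al2 be2 + ivol al be ->
    sbox al be s / s ^+ d @[s --> +oo] --> c * ivol al be.
  move=> h1 h2 eS eV; have -> : c * ivol al be = c * ivol al' be' - c * ivol al2 be2.
    by rewrite eV mulrDr addrC addKr.
  apply: cvg_trans (cvgB h1 h2); apply: near_eq_cvg; near=> s.
  have s0 : 0 <= s by near: s; exact: nbhs_pinfty_ge.
  change (sbox al' be' s / s ^+ d - sbox al2 be2 s / s ^+ d = sbox al be s / s ^+ d).
  by rewrite (eS s s0) mulrDl addrAC subrr add0r.
have [ai|ai] := ltP 0%R (al i).
  (* The box lies on the positive side in coordinate [i]: it is the box from [-1] to [be i] minus
     the box from [-1] to [al i], and both straddle the origin there. *)
  have h : (update al i (-1) i <= al i)%R by rewrite update_same; lia.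
  have [e1 e2] := split_cvg h (ltW (ab i)).
  have uu : update (update al i (-1)) i (al i) = al.
    by apply/funext => j; rewrite /update; case: eqP => // ->.
  rewrite uu in e1 e2.
  apply: (fin _ _ _ _ _ _ e1 e2); apply: IH.
  - by apply: smaller => [j ji|]; [rewrite !update_other|rewrite !update_same; have := ab i; lia].
  - by move=> j; rewrite /update; case: ifP.
  - exact: b0.
  - by move=> j; rewrite /update; case: eqP => // ->; have := ab i; lia.
  - by apply: smaller => [j ji|]; [rewrite !update_other|rewrite !update_same; lia].
  - by move=> j; rewrite /update; case: ifP.
  - by move=> j; rewrite /update; case: ifP => _; [exact: a0|exact: b0].
  - by move=> j; rewrite /update; case: eqP => // _; lia.
have bi : (be i < 0)%R by move: bad; rewrite negb_and -!leNgt; have := a0 i; have := b0 i; lia.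
(* On the negative side, the box from [al i] to [1] minus the box from [be i] to [1]. *)
have h : (be i <= update be i 1 i)%R by rewrite update_same; lia.
have [e1 e2] := split_cvg (ltW (ab i)) h.
have uu : update (update be i 1) i (be i) = be.
  by apply/funext => j; rewrite /update; case: eqP => // ->.
rewrite uu addrC in e2; rewrite uu in e1.
have e1' s : 0 <= s -> sbox al (update be i 1) s = sbox (update al i (be i)) (update be i 1) s + sbox al be s.
  by move=> s0; rewrite e1// addrC.
apply: (fin _ _ _ _ _ _ e1' e2); apply: IH.
- by apply: smaller => [j ji|]; [rewrite !update_other|rewrite !update_same; have := ab i; lia].
- exact: a0.
- by move=> j; rewrite /update; case: ifP.
- by move=> j; rewrite /update; case: eqP => // ->; have := ab i; lia.
- by apply: smaller => [j ji|]; [rewrite !update_other|rewrite !update_same; lia].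
- by move=> j; rewrite /update; case: ifP => _; [exact: b0|exact: a0].
- by move=> j; rewrite /update; case: ifP.
- by move=> j; rewrite /update; case: eqP => // _; lia.
Unshelve. all: by end_near. Qed.

End box_averages.

(** * Riemann sums on grids *)

Section vague_convergence.
Context {R : realType} {d : nat}.
Implicit Types (phi : 'rV[R]_d -> R) (x y : 'rV[R]_d).

(** Compactness handles a ball of radius [r + 1]; beyond it, points at distance less than one both
    lie outside the ball of radius [r], where [phi] is at most [eta / 2]. *)
Lemma uniform_continuity phi : continuous phi ->
  (forall eta : R, 0 < eta -> exists r : R, forall x, r < `|x| -> `|phi x| <= eta) ->
  forall eta : R, 0 < eta -> exists2 delta : R, 0 < delta & forall x y, `|x - y| < delta -> `|phi x - phi y| <= eta.
Proof.
move=> cphi small eta eta0.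
have eta2 : 0 < eta / 2 by rewrite divr_gt0.
have [r rP] := small _ eta2.
have /compact_near_coveringP nc := @compact_ball_rV R d (r + 1).
have : \forall delta \near (0 : R)^'+, [set x : 'rV[R]_d | `|x| <= r + 1] `<=`
    [set x | forall y, `|x - y| < delta -> `|phi x - phi y| <= eta].
  apply: nc => x _.
  have /cvgrPdist_lt/(_ _ eta2) := cphi x.
  move=> /nbhs_ballP[rho /= rho0 H].
  exists ([set z | `|x - z| < rho / 2], [set delta | 0 < delta < rho / 2]).
    split => /=; first by apply/nbhs_ballP; exists (rho / 2); [rewrite /= divr_gt0|rewrite -ball_normE].
    by near=> z; apply/andP; split; near: z; [exact: nbhs_right_gt|apply: nbhs_right_lt; rewrite divr_gt0].
  move=> [z delta] /= [xz /andP[d0 dr]] y zy.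
  have h1 : `|phi x - phi z| < eta / 2.
    by apply: H; rewrite -ball_normE/= (lt_le_trans xz)// ler_pdivrMr// ler_pMr// ler1n.
  have h2 : `|phi x - phi y| < eta / 2.
    apply: H; rewrite -ball_normE/= [rho]splitr (le_lt_trans (ler_distD z _ _))// ltrD//.
    exact: lt_trans zy dr.
  rewrite [eta]splitr (le_trans (ler_distD (phi x) _ _))// lerD// ?ltW//.
  by rewrite distrC.
move=> h; have [delta [[h1 h2] h3]] := filter_ex (filterI (filterI h (nbhs_right_gt 0)) (nbhs_right_lt (@ltr01 R))).
exists delta => // x y xy.
have [xr|xr] := leP `|x| (r + 1); first exact: h1.
rewrite [eta]splitr (le_trans (ler_normB _ _))// lerD// rP//.
  by rewrite (lt_trans _ xr)// ltrDl.
rewrite -(ltrD2r 1) (lt_le_trans xr)//.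
rewrite -[x](subrK y) (le_trans (ler_normD _ _))// addrC lerD2l ltW//.
exact: lt_trans xy h3.
Unshelve. all: by end_near. Qed.

Lemma integrable_indic_fin (nu : {measure set 'rV[R]_d -> \bar R}) (A : set 'rV[R]_d) : measurable A ->
  (nu A < +oo)%E -> nu.-integrable setT (EFin \o (\1_A : 'rV[R]_d -> R)).
Proof.
move=> mA fA; apply/integrableP; split; first by apply/measurable_EFinP; exact: measurable_indic.
rewrite (eq_integral (fun x => (\1_A x)%:E)) ?integral_indic ?setIT// => x _.
by rewrite /= ger0_norm.
Qed.

Lemma Cc_small phi : Cc phi -> forall eta : R, 0 < eta -> exists r : R, forall x, r < `|x| -> `|phi x| <= eta.
Proof.
move=> [_ [K cK K0]] eta eta0; have [M [Mr KM]] := compact_bounded cK; exists (M + 1) => x Mx.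
rewrite K0 ?normr0 ?ltW// => Kx; have := KM (M + 1); rewrite ltrDl ltr01 => /(_ isT x Kx)/=.
by rewrite leNgt Mx.
Qed.

Lemma Cc_support phi : Cc phi -> exists r : R, forall x, r < `|x| -> phi x = 0.
Proof.
move=> [_ [K cK K0]]; have [M [Mr KM]] := compact_bounded cK; exists (M + 1) => x Mx.
apply: K0 => Kx; have := KM (M + 1); rewrite ltrDl ltr01 => /(_ isT x Kx)/=.
by rewrite leNgt Mx.
Qed.

Lemma Cc_bounded phi : Cc phi -> exists c : R, forall x, `|phi x| <= c.
Proof.
move=> cphi; have [cp _] := cphi; have [r r0] := Cc_support cphi.
have cb : compact (phi @` [set x | `|x| <= r]).
  by apply: continuous_compact; [exact: continuous_subspaceT|exact: compact_ball_rV].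
have [M [Mr KM]] := compact_bounded cb; exists (Num.max 0 (M + 1)) => x.
have [xr|xr] := leP `|x| r; last by rewrite r0// normr0 le_max lexx.
by rewrite le_max (KM (M + 1)) ?orbT ?ltrDl//; exists x.
Qed.

Variable V : 'M[R]_d.
Hypothesis V_inv : V \in unitmx.

Section grid.
Variables (H : R) (K : nat).
Hypothesis H0 : 0 < H.
Let N := (K.*2.+1)%N.
Let h := H / N%:R.
Let N0 : 0 < N%:R :> R. Proof. by rewrite ltr0n. Qed.
Let h0 : 0 < h. Proof. by rewrite divr_gt0. Qed.

(* Odd multiples of h, so that no side of the grid goes through the origin. *)
Definition grid_lo (g : {ffun 'I_d -> 'I_N}) (i : 'I_d) : int := (g i).*2%:Z - N%:Z.
Definition grid_hi (g : {ffun 'I_d -> 'I_N}) (i : 'I_d) : int := (g i).*2.+2%:Z - N%:Z.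
Definition grid_box g := vbox V (fun i => h * (grid_lo g i)%:~R) (fun i => h * (grid_hi g i)%:~R).
Definition grid_point g : 'rV[R]_d := mulmv V (\row_i (h * (grid_lo g i)%:~R)).
Let big_box := vbox V (fun=> - H) (fun=> H).

Lemma grid_lo_neq0 g i : grid_lo g i != 0. Proof. by rewrite /grid_lo /N; lia. Qed.
Lemma grid_hi_neq0 g i : grid_hi g i != 0. Proof. by rewrite /grid_hi /N; lia. Qed.
Lemma grid_lo_hi g i : (grid_lo g i < grid_hi g i)%R. Proof. by rewrite /grid_hi /grid_lo; lia. Qed.

Let pos_coord x i := (vcoord V x i / h + N%:R) / 2.

Let loE g i : (grid_lo g i)%:~R = 2 * (g i)%:R - N%:R :> R.
Proof. by rewrite /grid_lo rmorphB/= -!pmulrn -mul2n natrM. Qed.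

Let hiE g i : (grid_hi g i)%:~R = 2 * (g i)%:R + 2 - N%:R :> R.
Proof.
rewrite -addrA addrCA -loE addrC; have -> : grid_hi g i = grid_lo g i + 2 by rewrite /grid_hi /grid_lo; lia.
by rewrite rmorphD.
Qed.

Let grid_boxE g x : grid_box g x <-> forall i, (g i)%:R <= pos_coord x i < (g i).+1%:R.
Proof.
rewrite /grid_box /vbox /pos_coord /=; split => E i; have := E i; move: (vcoord V x i) => u;
rewrite loE hiE -[(g i).+1%:R]natr1 ler_pdivlMr// ltr_pdivrMr// -lerBlDr -ltrBrDr ler_pdivlMr// ltr_pdivrMr//;
move=> /andP[e1 e2]; apply/andP; split; lra.
Qed.

Let big_boxE x : big_box x <-> forall i, 0 <= pos_coord x i < N%:R.
Proof.
have HE : H = h * N%:R by rewrite divfK// gt_eqF.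
rewrite /big_box /vbox /pos_coord/=; split => E i; have := E i; move: (vcoord V x i) => u;
rewrite HE ler_pdivlMr// ltr_pdivrMr// mul0r -lerBlDr -ltrBrDr ler_pdivlMr// ltr_pdivrMr// => /andP[e1 e2];
apply/andP; split; lra.
Qed.

Lemma grid_partition x : \sum_g \1_(grid_box g) x = \1_big_box x :> R.
Proof.
have [Bx|nBx] := pselect (big_box x); last first.
  rewrite indicE memNset// big1// => g _; rewrite indicE memNset// => /grid_boxE Q; apply: nBx.
  apply/big_boxE => i; have /andP[h1 h2] := Q i; rewrite (le_trans _ h1)// (lt_le_trans h2)//.
  by rewrite ler_nat ltn_ord.
have B := (big_boxE x).1 Bx.
have tN i : (Num.truncn (pos_coord x i) < N)%N by rewrite truncn_lt_nat; have /andP[] := B i.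
pose g0 := [ffun i => Ordinal (tN i)] : {ffun 'I_d -> 'I_N}.
have Q0 : grid_box g0 x.
  by apply/grid_boxE => i; rewrite ffunE/=; apply: truncn_itv; have /andP[] := B i.
rewrite (bigD1 g0)//= !indicE !mem_set// big1 ?addr0// => g gg0.
rewrite indicE memNset// => /grid_boxE Q; move: gg0; apply/negP/negPn/eqP/ffunP => i.
rewrite ffunE; apply/val_inj => /=; apply/esym/truncn_def; exact: Q.
Qed.

Lemma grid_point_near g x : grid_box g x -> `|x - grid_point g| <= vnorm V * (2 * h).
Proof.
move=> Q; apply: (vnorm_bound V_inv) => i; rewrite vcoordD -scaleN1r vcoordZ /grid_point vcoord_mulmv// mxE mulN1r.
have /andP[h1 h2] := Q i; move: h1 h2; move: (vcoord V x i) => u.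
have -> : (grid_hi g i)%:~R = (grid_lo g i)%:~R + 2 :> R.
  by rewrite hiE loE; ring.
move: (grid_lo g i)%:~R => v h1 h2; rewrite ger0_norm ?subr_ge0//; nra.
Qed.

Variables (nu : {measure set 'rV[R]_d -> \bar R}) (phi : 'rV[R]_d -> R) (eta : R).
Hypothesis nu_fin : (nu big_box < +oo)%E.
Hypothesis cphi : continuous phi.
Hypothesis phi_out : forall x, ~ big_box x -> phi x = 0.
Hypothesis eta0 : 0 <= eta.
Hypothesis osc : forall x y, `|x - y| <= vnorm V * (2 * h) -> `|phi x - phi y| <= eta.

(** The step function on the grid differs from [phi] by at most [eta] on the big box. The estimate
    holds for every measure finite on that box, so the same grid serves the rescaled measures and
    Lebesgue measure. *)
Lemma grid_sum_error : nu.-integrable setT (EFin \o phi) /\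
  `|\int[nu]_x phi x - \sum_g phi (grid_point g) * fine (nu (grid_box g))| <= eta * fine (nu big_box).
Proof.
have mB : measurable big_box by exact: measurable_vbox.
have mQ g : measurable (grid_box g) by exact: measurable_vbox.
have QB g : grid_box g `<=` big_box.
  move=> x /grid_boxE Q; apply/big_boxE => i; have /andP[h1 h2] := Q i.
  by rewrite (le_trans _ h1)// (lt_le_trans h2)// ler_nat ltn_ord.
have Qfin g : (nu (grid_box g) < +oo)%E.
  by apply: le_lt_trans nu_fin; apply: le_measure (QB g); rewrite inE.
have mphi : measurable_fun setT phi by exact: continuous_measurable_rV.
have i1 A : measurable A -> (nu A < +oo)%E -> nu.-integrable setT (EFin \o (\1_A : 'rV[R]_d -> R)).
  exact: integrable_indic_fin.
pose psi x := \sum_g phi (grid_point g) * (\1_(grid_box g) x : R).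
have psiE : EFin \o psi = (fun x => \sum_g (phi (grid_point g))%:E * (\1_(grid_box g) x)%:E)%E.
  by apply/funext => x; rewrite /= /psi -sumEFin.
have ipsi : nu.-integrable setT (EFin \o psi).
  by rewrite psiE; apply: integrable_sum => // g _; apply: integrableZl => //; exact: i1.
have close x : `|phi x - psi x| <= eta * (\1_big_box x : R).
  have [Bx|nBx] := pselect (big_box x); last first.
    rewrite phi_out// indicE memNset// mulr0 /psi big1 ?subr0 ?normr0// => g _.
    by rewrite indicE memNset ?mulr0// => /QB.
  have -> : phi x - psi x = \sum_g (phi x - phi (grid_point g)) * (\1_(grid_box g) x : R).
    under eq_bigr do rewrite mulrBl.
    by rewrite sumrB -mulr_sumr grid_partition indicE mem_set// mulr1.
  rewrite -grid_partition mulr_sumr (le_trans (ler_norm_sum _ _ _))//; apply: ler_sum => g _.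
  rewrite normrM [`|\1_ _ _|]ger0_norm//; have [Qx|nQx] := pselect (grid_box g x).
    by rewrite ler_wpM2r// osc// grid_point_near.
  by rewrite indicE memNset// !mulr0.
have iB : nu.-integrable setT (EFin \o (fun x => eta * (\1_big_box x : R))).
  by apply: (@integrableZl _ _ _ _ _ measurableT eta (EFin \o \1_big_box)); exact: i1.
have mpsi : measurable_fun setT psi by case/integrableP: ipsi => /measurable_EFinP.
have idiff : nu.-integrable setT (EFin \o (fun x => phi x - psi x)).
  apply: le_integrable iB => //=.
    by apply/measurable_EFinP; exact: measurable_funB.
  by move=> x _; rewrite lee_fin [`|eta * _|]ger0_norm ?mulr_ge0.
have iphi : nu.-integrable setT (EFin \o phi).
  have := integrableD measurableT idiff ipsi.
  suff -> : EFin \o phi = ((EFin \o (fun x => (phi x - psi x)%R)) \+ (EFin \o psi))%E by [].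
  by apply/funext => x; rewrite /= -EFinD subrK.
split=> //.
have intpsi : \int[nu]_x psi x = \sum_g phi (grid_point g) * fine (nu (grid_box g)).
  rewrite /Rintegral (_ : (\int[nu]_x (psi x)%:E = (\sum_g phi (grid_point g) * fine (nu (grid_box g)))%:E)%E)//.
  rewrite -[LHS]/(\int[nu]_x (EFin \o psi) x)%E psiE integral_sum//; last first.
    by move=> g; apply: integrableZl => //; exact: i1.
  rewrite -sumEFin; apply: eq_bigr => g _; rewrite integralZl//; last exact: i1.
  by rewrite integral_indic// setIT EFinM fineK// ge0_fin_numE.
rewrite -intpsi -RintegralB//; apply: (le_trans (le_normr_Rintegral _ idiff)) => //.
have intB : \int[nu]_x (eta * (\1_big_box x : R)) = eta * fine (nu big_box).
  rewrite RintegralZl//; last exact: i1.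
  by congr (_ * _); rewrite /Rintegral integral_indic// setIT.
rewrite -intB; apply: le_Rintegral => //.
apply: le_integrable idiff => //=.
  by apply/measurable_EFinP; apply: measurableT_comp => //; exact: measurable_funB.
by move=> x _; rewrite lee_fin normr_id.
Qed.

End grid.
Hypothesis cell_fin : (lebesgue_rV d (cell V) < +oo)%E.
Local Notation volume := (box_mass V (lebesgue_lfmeasure V_inv cell_fin)).
Variables (m : lfmeasure R d) (c : R).
Hypothesis c0 : 0 <= c.
Hypothesis centred : forall p q : 'I_d -> nat, (forall i, 0 < p i)%N -> (forall i, 0 < q i)%N ->
  box_mass V m (fun i => - (n * p i)%:R) (fun i => (n * q i)%:R) / n%:R ^+ d @[n --> \oo] -->
  c * volume (fun i => - (p i)%:R) (fun i => (q i)%:R).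

Lemma rescaled_vbox (e : R) a b : 0 < e -> (rescaled m e (vbox V a b) =
  (e ^+ d * box_mass V m (fun i => e^-1 * a i) (fun i => e^-1 * b i))%:E)%E.
Proof.
move=> e0; rewrite (_ : rescaled m e _ = ((`|e| ^+ d)%:E * m ((fun x => e *: x) @^-1` vbox V a b))%E)//.
rewrite ger0_norm ?ltW// /box_mass EFinM fineK ?vbox_fin_num//; congr (_ * m _)%E; apply/seteqP; split => x /= E i; have := E i;
by rewrite vcoordZ ler_pdivrMl// ltr_pdivlMl.
Qed.

Lemma rescaled_vbox_fin (e : R) a b : 0 < e -> (rescaled m e (vbox V a b) < +oo)%E.
Proof. by move=> e0; rewrite rescaled_vbox// ltry. Qed.

(** The average over boxes of integer proportions, read at the scale [h / e]. *)
Lemma rescaled_box_cvg (h : R) (al be : 'I_d -> int) : 0 < h -> (forall i, al i != 0) -> (forall i, be i != 0) ->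
  (forall i, al i < be i)%R ->
  fine (rescaled m e (vbox V (fun i => h * (al i)%:~R) (fun i => h * (be i)%:~R))) @[e --> 0^'+] -->
  c * volume (fun i => h * (al i)%:~R) (fun i => h * (be i)%:~R).
Proof.
move=> h0 a0 b0 ab; rewrite volume_scale// mulrCA.
have he : h / e @[e --> (0 : R)^'+] --> +oo.
  apply/cvgryPge => A; near=> e.
  have e0 : 0 < e by near: e; exact: nbhs_right_gt.
  have A0 : 0 < `|A| + 1 by rewrite ltr_wpDl.
  apply: (@le_trans _ _ (`|A| + 1)); first by rewrite ler_wpDr// ler_norm.
  rewrite ler_pdivlMr// ltW// -ltr_pdivlMl//.
  near: e; apply: nbhs_right_lt.
  by rewrite mulr_gt0 ?invr_gt0// ltr_wpDl.
have lim := cvg_comp _ _ he (box_average centred a0 b0 ab).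
apply: cvg_trans (cvgM (cvg_cst (h ^+ d)) lim); apply: near_eq_cvg; near=> e.
have e0 : 0 < e by near: e; exact: nbhs_right_gt.
rewrite rescaled_vbox//= exprMn exprVn invfM invrK.
rewrite (_ : (fun i => h / e * (al i)%:~R) = (fun i => e^-1 * (h * (al i)%:~R))); last first.
  by apply/funext => i; rewrite mulrA [e^-1 * _]mulrC.
rewrite (_ : (fun i => h / e * (be i)%:~R) = (fun i => e^-1 * (h * (be i)%:~R))); last first.
  by apply/funext => i; rewrite mulrA [e^-1 * _]mulrC.
move: (box_mass _ _ _ _) => X; have hd0 : h ^+ d != 0 by rewrite expf_neq0// gt_eqF.
by rewrite mulrCA mulVKf// mulrC.
Unshelve. all: by end_near. Qed.

Theorem vague_cvg phi : Cc phi ->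
  \int[rescaled m e]_x phi x @[e --> 0^'+] --> c * \int[lebesgue_rV d]_x phi x.
Proof.
move=> Cphi; have [r r0] := Cc_support Cphi; have cphi := Cphi.1.
pose v := vnorm (invmx V).
pose H := v * `|r| + 1.
have H0 : 0 < H by rewrite ltr_pwDr// mulr_ge0// vnorm_ge0.
pose B := vbox V (fun=> - H) (fun=> H).
have out x : ~ B x -> phi x = 0.
  move=> nB; apply: r0; rewrite ltNge; apply/negP => xr; apply: nB => i.
  have : `|vcoord V x i| < H.
    rewrite (le_lt_trans (vcoord_le_norm V x i))// /H ltr_pwDr// ler_wpM2l ?vnorm_ge0//.
    by rewrite (le_trans xr)// ler_norm.
  by rewrite ltr_norml => /andP[/ltW -> ->].
have Bfin (nu : lfmeasure R d) : (nu B < +oo)%E by exact: vbox_fin.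
have cvgB : fine (rescaled m e B) @[e --> 0^'+] --> c * volume (fun=> - H) (fun=> H).
  have := @rescaled_box_cvg H (fun=> -1) (fun=> 1) H0 (fun=> isT) (fun=> isT) (fun=> isT).
  by rewrite (_ : (fun _ : 'I_d => H * (-1)%:~R) = fun=> - H) 1?(_ : (fun _ : 'I_d => H * 1%:~R) = fun=> H)//;
    apply/funext => i; rewrite ?mulrN1z ?mulrN ?mulr1.
set vB := volume (fun=> - H) (fun=> H) in cvgB.
have vB0 : 0 <= vB by exact: box_mass_ge0.
apply/cvgrPdist_le => eps eps0.
(* Makes the two Riemann sum errors, [eta * (c * vB + 1)] and [c * (eta * vB)], add up to
   [eps / 2]. *)
pose eta := eps / 2 / (2 * (c * vB) + 1).
have den : 0 < 2 * (c * vB) + 1 by rewrite ltr_wpDl// !mulr_ge0.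
have eta0 : 0 < eta by rewrite !divr_gt0.
have [delta d0 dP] := uniform_continuity cphi (Cc_small Cphi) eta0.
pose K := Num.bound (vnorm V * 2 * H / delta).
pose N := (K.*2.+1)%N; pose h := H / N%:R.
have hd : vnorm V * (2 * h) < delta.
  have -> : vnorm V * (2 * h) = vnorm V * 2 * H / N%:R by rewrite /h; ring.
  rewrite ltr_pdivrMr ?ltr0n// [ltRHS]mulrC -ltr_pdivrMr//.
  have v0 : 0 <= vnorm V * 2 * H / delta.
    apply: divr_ge0; last exact: ltW.
    apply: mulr_ge0; last exact: ltW.
    by apply: mulr_ge0 => //; apply: sumr_ge0 => ? _; apply: sumr_ge0.
  by rewrite (lt_le_trans (archi_boundP v0))// ler_nat /N -/K; lia.
have osc x y : `|x - y| <= vnorm V * (2 * h) -> `|phi x - phi y| <= eta.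
  by move=> xy; apply: dP; exact: le_lt_trans hd.
pose F e := \sum_(g : {ffun 'I_d -> 'I_N}) phi (grid_point H g) * fine (rescaled m e (grid_box H g)).
pose G := \sum_(g : {ffun 'I_d -> 'I_N}) phi (grid_point H g) * fine (lebesgue_rV d (grid_box H g)).
have FG : F e @[e --> 0^'+] --> c * G.
  rewrite /G mulr_sumr; apply: cvg_big => [|g _]; [exact: add_continuous|]; rewrite mulrCA; apply: cvgM; first exact: cvg_cst.
  apply: rescaled_box_cvg; rewrite ?divr_gt0 ?ltr0n//.
  - by move=> i; exact: grid_lo_neq0.
  - by move=> i; exact: grid_hi_neq0.
  - by move=> i; exact: grid_lo_hi.
have /cvgrPdist_le cvgB' := cvgB.
have /cvgrPdist_le FG' := FG.
have [_ eL] := grid_sum_error H0 (Bfin (lebesgue_lfmeasure V_inv cell_fin)) cphi out (ltW eta0) osc.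
near=> e.
have e0 : 0 < e by near: e; exact: nbhs_right_gt.
have [_ eM] := grid_sum_error H0 (rescaled_vbox_fin _ _ e0) cphi out (ltW eta0) osc.
have b1 : fine (rescaled m e B) <= c * vB + 1.
  rewrite -lerBlDl (le_trans (ler_norm _))// distrC.
  by near: e; exact: (cvgB' _ ltr01).
have b2 : `|c * G - F e| <= eps / 2.
  by near: e; apply: FG'; rewrite divr_gt0.
have b3 : eta * (c * vB + 1) + c * (eta * vB) + eps / 2 = eps.
  rewrite /eta; field; rewrite gt_eqF//.
have final (IL IM Fe G' nB : R) : `|IL - G'| <= eta * vB -> `|IM - Fe| <= eta * nB -> nB <= c * vB + 1 ->
    `|c * G' - Fe| <= eps / 2 -> `|c * IL - IM| <= eps.
  move=> fL fM f1 f2; rewrite -b3.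
  have -> : c * IL - IM = c * (IL - G') + (c * G' - Fe) - (IM - Fe) by ring.
  apply: (le_trans (ler_normB _ _)); rewrite -addrA [leRHS]addrC.
  apply: lerD; last by rewrite (le_trans fM)// ler_wpM2l// ltW.
  apply: (le_trans (ler_normD _ _)); apply: lerD => //.
  by rewrite normrM ger0_norm// ler_wpM2l.
exact: (final _ _ _ _ _ eL eM b1 b2).
Unshelve. all: by end_near. Qed.

End vague_convergence.

(** * Polynomial decay and mass at infinity *)

Section decaying_functions.
Context {R : realType} {d : nat}.
Variable V : 'M[R]_d.
Hypothesis V_inv : V \in unitmx.
Implicit Types (x : 'rV[R]_d) (h : 'rV[R]_d -> R) (C L K eta : R) (nu : {measure set 'rV[R]_d -> \bar R}).

(** The sup norm is at most the Euclidean one, so a bound by the Euclidean weight with a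
    non-negative exponent implies one by [decay]. Negative exponents also occur, as growing
    weights. *)
Definition decay (g : R) x : R := (1 + `|x|) `^ (- g).

Definition cube (L : R) : set 'rV[R]_d := vbox V (fun=> - L) (fun=> L).

Lemma measurable_cube L : measurable (cube L).
Proof. exact: measurable_vbox. Qed.

Lemma decay_gt0 g x : 0 < decay g x.
Proof. by rewrite powR_gt0// ltr_pwDl. Qed.

Lemma decay_ge0 g x : 0 <= decay g x. Proof. exact/ltW/decay_gt0. Qed.

Lemma decay_le (g b : R) x : 0 <= g -> 0 < b -> b <= 1 + `|x| -> decay g x <= b `^ (- g).
Proof.
move=> g0 b0 bx; have p := lt_le_trans b0 bx.
by rewrite /decay !powRN lef_pV2 ?posrE ?powR_gt0//; apply: ge0_ler_powR => //; rewrite nnegrE ltW.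
Qed.

Lemma decay_le1 g x : 0 <= g -> decay g x <= 1.
Proof. by move=> g0; rewrite (le_trans (decay_le g0 ltr01 _)) ?powR1// lerDl. Qed.

Lemma continuous_decay g : continuous (decay g).
Proof.
move=> x; rewrite /decay.
have -> : (fun y : 'rV[R]_d => (1 + `|y|) `^ (- g)) = (fun u => expR (- g * ln u)) \o (fun y => 1 + `|y|).
  apply/funext => y /=; rewrite /powR gt_eqF// ltr_pwDl//.
apply: continuous_comp.
  by apply: (@continuousD _ R^o 'rV[R]_d (fun=> 1) (fun y => `|y|)); [exact: cst_continuous|exact: norm_continuous].
apply: continuous_comp; last exact: continuous_expR.
apply: continuousM; first exact: cst_continuous.
by apply: continuous_ln; rewrite ltr_pwDl.
Qed.

Lemma measurable_decay g : measurable_fun setT (decay g).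
Proof. by apply: continuous_measurable_rV; exact: continuous_decay. Qed.

Lemma cube_ball n : cube (2 ^+ n) `<=` [set x | `|x| <= vnorm V * 2 ^+ n].
Proof.
move=> x H; apply: (vnorm_bound V_inv) => i; have /andP[h1 h2] := H i.
by rewrite ler_norml h1 ltW.
Qed.

Lemma ball_cube (r : R) : 0 <= r -> [set x | `|x| <= r] `<=` cube (vnorm (invmx V) * r + 1).
Proof.
move=> r0 x xr i; have : `|vcoord V x i| < vnorm (invmx V) * r + 1.
  rewrite (le_lt_trans (vcoord_le_norm V x i))// ltr_pwDr// ler_wpM2l ?vnorm_ge0//.
by rewrite ltr_norml => /andP[/ltW -> ->].
Qed.

Section tail.
Variable g : R.
Hypothesis dg : d%:R < g.
Let g0 : 0 <= g. Proof. by rewrite ltW// (le_lt_trans _ dg). Qed.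
Let v1 := vnorm (invmx V) + 1.
Let v10 : 0 < v1. Proof. by rewrite ltr_pwDr// vnorm_ge0. Qed.

Definition tail_ratio : R := 2 ^+ d * 2 `^ (- g).
Definition tail_constant : R := v1^-1 `^ (- g) * 2 ^+ d / (1 - tail_ratio).

Lemma tail_ratio_lt1 : 0 < tail_ratio < 1.
Proof.
rewrite /tail_ratio -powR_mulrn// -powRD; last by apply/implyP => _.
rewrite powR_gt0//=; have -> : d%:R - g = - (g - d%:R) by rewrite opprB.
rewrite powRN invf_lt1 ?powR_gt0//.
have gd : 0 < g - d%:R by rewrite subr_gt0.
have := @gt0_ltr_powR R _ gd 1 2; rewrite !nnegrE => /(_ ler01 (ler0n _ 2)); rewrite ltr1n => /(_ isT).
by rewrite powR1.
Qed.

Lemma tail_constant_ge0 : 0 <= tail_constant.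
Proof.
have /andP[_ r1] := tail_ratio_lt1.
by rewrite /tail_constant divr_ge0 ?subr_ge0 ?(ltW r1)// mulr_ge0// powR_ge0.
Qed.

Let a (k : nat) : R := (2 ^+ k / v1) `^ (- g).

Let aE k : a k = v1^-1 `^ (- g) * (2 `^ (- g)) ^+ k.
Proof.
rewrite /a powRM ?exprn_ge0 ?invr_ge0 ?ltW// mulrC; congr (_ * _).
elim: k => [|k IH]; first by rewrite !expr0 powR1.
by rewrite !exprS powRM ?exprn_ge0// IH.
Qed.

(** The point lies between two consecutive dyadic cubes. Outside the inner one some coordinate along
    [V] is at least [2 ^ (n + j)], and coordinates are at most [v1] times [1 + |x|]. *)
Lemma decay_dyadic n x : ~ cube (2 ^+ n) x ->
  exists j, cube (2 ^+ (n + j).+1) x /\ decay g x <= a (n + j).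
Proof.
move=> nx.
have ex : exists k, `[< cube (2 ^+ k) x >].
  pose r := vnorm (invmx V) * `|x| + 1.
  have r0 : 0 <= r by rewrite addr_ge0// mulr_ge0// vnorm_ge0.
  exists (Num.bound r); apply/asboolP => i.
  have := ball_cube (normr_ge0 x) (lexx `|x|) i; rewrite -/r => /andP[h1 h2].
  have h : r <= 2 ^+ Num.bound r.
    rewrite (le_trans (ltW (archi_boundP r0)))// -natrX ler_nat.
    exact/ltnW/ltn_expl.
  by rewrite (le_trans _ h1) ?lerN2//= (lt_le_trans h2).
have mono (k l : nat) : (k <= l)%N -> cube (2 ^+ k) `<=` cube (2 ^+ l).
  move=> kl y H i; have /andP[h1 h2] := H i.
  have h : 2 ^+ k <= 2 ^+ l :> R by rewrite ler_weXn2l// ler1n.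
  by rewrite (le_trans _ h1) ?lerN2//= (lt_le_trans h2).
have [k /asboolP kx kmin] := ex_minnP ex.
have nk : (n < k)%N by rewrite ltnNge; apply/negP => kn; apply: nx; exact: (mono k).
exists (k.-1 - n)%N; have -> : (n + (k.-1 - n))%N = k.-1 by rewrite subnKC// -ltnS prednK// (leq_ltn_trans _ nk).
rewrite prednK ?(leq_ltn_trans _ nk)//; split => //.
have : ~ cube (2 ^+ k.-1) x.
  by move/asboolP/kmin; rewrite -ltnS prednK ?ltnn// (leq_ltn_trans _ nk).
move=> /existsNP[i /negP]; rewrite negb_and -leNgt -ltNge => out.
have big : 2 ^+ k.-1 <= `|vcoord V x i|.
  by case/orP: out => h; [rewrite ler_normr lerNr (ltW h) orbT|rewrite ler_normr h].
apply: decay_le => //; first by rewrite divr_gt0.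
rewrite ler_pdivrMr// (le_trans big)// (le_trans (vcoord_le_norm V x i))// mulrC.
apply: ler_pM => //; rewrite ?vnorm_ge0 ?lerDl// lerDr//.
Qed.

Variables (nu : {measure set 'rV[R]_d -> \bar R}) (K : R).
Hypothesis K0 : 0 <= K.
Hypothesis nu_cube : forall L, 1 <= L -> (nu (cube L) <= (K * L ^+ d)%:E)%E.

(** On the shell of index [k] the weight is at most [a (n + k)] and the mass at most
    [K * (2 ^ (n + k).+1) ^ d]. The products form a geometric series of ratio [tail_ratio], which is
    below one because [d < g]. *)
Lemma tail_integral n :
  (\int[nu]_x (decay g x * \1_(~` cube (2 ^+ n)) x)%:E <= (tail_constant * K * tail_ratio ^+ n)%:E)%E.
Proof.
have /andP[r0 r1] := tail_ratio_lt1.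
have ma k : measurable_fun setT (fun x => (a (n + k) * \1_(cube (2 ^+ (n + k).+1)) x)%:E).
  by apply/measurable_EFinP; apply: measurable_funM => //; apply: measurable_indic; exact: measurable_cube.
have a0 k x : (0 <= (a (n + k) * \1_(cube (2 ^+ (n + k).+1)) x)%:E)%E.
  by rewrite lee_fin mulr_ge0// powR_ge0.
apply: (@le_trans _ _ (\int[nu]_x \sum_(k <oo) (a (n + k) * \1_(cube (2 ^+ (n + k).+1)) x)%:E)%E).
  apply: ge0_le_integralT.
    by move=> x; rewrite lee_fin mulr_ge0// decay_ge0.
  move=> x; rewrite indicE; have [cx|nx] := pselect (cube (2 ^+ n) x).
    by rewrite memNset ?mulr0; [apply: nneseries_ge0|apply].
  rewrite mem_set// mulr1; have [j [cj aj]] := decay_dyadic nx.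
  apply: le_trans (nneseries_lim_ge j.+1 _) => //.
  rewrite big_nat_recr//= (@le_trans _ _ (a (n + j))%:E) ?lee_fin//.
  by rewrite [X in (_ <= _ + X)%E](_ : _ = (a (n + j))%:E) ?leeDr ?sume_ge0// indicE mem_set// mulr1.
rewrite integral_nneseries//.
set C := v1^-1 `^ (- g) * 2 ^+ d * K * tail_ratio ^+ n.
have C0 : 0 <= C by rewrite !mulr_ge0 ?powR_ge0 ?exprn_ge0 ?(ltW r0).
have term k : (\int[nu]_x (a (n + k) * \1_(cube (2 ^+ (n + k).+1)) x)%:E <= (C * tail_ratio ^+ k)%:E)%E.
  under eq_integral do rewrite EFinM.
  rewrite ge0_integralZl//; last 2 first.
  - by apply/measurable_EFinP; apply: measurable_indic; exact: measurable_cube.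
  - by rewrite lee_fin powR_ge0.
  rewrite integral_indic ?setIT//; last exact: measurable_cube.
  apply: (@le_trans _ _ ((a (n + k))%:E * (K * (2 ^+ (n + k).+1) ^+ d)%:E)%E).
    rewrite lee_wpmul2l ?lee_fin ?powR_ge0//; apply: nu_cube.
    by rewrite exprn_ege1// ler1n.
  rewrite -EFinM lee_fin aE /C /tail_ratio.
  have -> : (2 ^+ (n + k).+1) ^+ d = 2 ^+ d * (2 ^+ d) ^+ (n + k) :> R.
    by rewrite exprS exprMn exprAC.
  rewrite !exprMn !exprD; apply: eq_leW; ring.
apply: lime_le; first by apply: is_cvg_nneseries => k _ _; apply: integral_ge0.
near=> N; apply: (@le_trans _ _ (\sum_(0 <= k < N) (C * tail_ratio ^+ k)%:E)%E).
  by apply: lee_sum => k _; exact: term.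
rewrite sumEFin lee_fin.
have := congr1 (fun u : R^nat => u N) (geometric_seriesE C (negbT (lt_eqF r1))) => /= GE.
rewrite [leLHS]GE /tail_constant.
have -> : v1^-1 `^ (- g) * 2 ^+ d / (1 - tail_ratio) * K * tail_ratio ^+ n = C * 1 / (1 - tail_ratio).
  by rewrite /C; ring.
rewrite ler_wpM2r ?invr_ge0 ?subr_ge0 ?(ltW r1)// ler_wpM2l// gerBl.
by rewrite exprn_ge0// ltW.
Unshelve. all: by end_near. Qed.

Lemma integral_decay : (\int[nu]_x (decay g x)%:E <= ((1 + tail_constant) * K)%:E)%E.
Proof.
have mc := measurable_cube 1.
have m1 A : measurable A -> measurable_fun setT (fun x => (decay g x * \1_A x)%:E).
  move=> mA; apply/measurable_EFinP; apply: measurable_funM; first exact: measurable_decay.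
  exact: measurable_indic.
have -> : (\int[nu]_x (decay g x)%:E =
    \int[nu]_x ((decay g x * \1_(cube 1) x)%:E + (decay g x * \1_(~` cube 1) x)%:E))%E.
  apply: eq_integral => x _; rewrite -EFinD -mulrDr; congr EFin.
  have [cx|nx] := pselect (cube 1 x).
    by rewrite !indicE mem_set// memNset ?addr0 ?mulr1//; apply.
  by rewrite !indicE memNset// mem_set// add0r mulr1.
rewrite ge0_integralD//; last 4 first.
- by move=> x _; rewrite lee_fin mulr_ge0// decay_ge0.
- exact: m1.
- by move=> x _; rewrite lee_fin mulr_ge0// decay_ge0.
- by apply: m1; exact: measurableC.
rewrite mulrDl mul1r EFinD; apply: leeD; last by have := tail_integral 0; rewrite !expr0 mulr1.
apply: (@le_trans _ _ (\int[nu]_x (\1_(cube 1) x)%:E)%E).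
  apply: ge0_le_integralT => x; first by rewrite lee_fin mulr_ge0// decay_ge0.
  by rewrite lee_fin ler_piMl// decay_le1.
rewrite integral_indic// setIT; have := nu_cube (lexx 1).
by rewrite expr1n mulr1.
Qed.

End tail.
Definition growth (nu : {measure set 'rV[R]_d -> \bar R}) (K : R) : Prop :=
  forall L, 1 <= L -> (nu (cube L) <= (K * L ^+ d)%:E)%E.

Definition cutoff (L : R) x : R := Num.max 0 (Num.min 1 (L + 1 - `|x|)).

Lemma cutoff01 L x : 0 <= cutoff L x <= 1.
Proof. by rewrite /cutoff le_max lexx/= ge_max ler01 ge_min lexx. Qed.

Lemma cutoff1 L x : `|x| <= L -> cutoff L x = 1.
Proof.
move=> xL; rewrite /cutoff (min_idPl _); last by lra.
by apply/max_idPr.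
Qed.

Lemma cutoff0 L x : L + 1 <= `|x| -> cutoff L x = 0.
Proof.
move=> xL; apply/max_idPl; rewrite ge_min; apply/orP; right; lra.
Qed.

Lemma continuous_cutoff L : continuous (cutoff L).
Proof.
move=> x; rewrite /cutoff.
apply: (@continuous_max R _ (fun=> 0) (fun y => Num.min 1 (L + 1 - `|y|)) x); first exact: cst_continuous.
apply: (@continuous_min R _ (fun=> 1) (fun y => L + 1 - `|y|) x); first exact: cst_continuous.
apply: (@continuousB _ R^o 'rV[R]_d (fun=> L + 1) (fun y => `|y|)); first exact: cst_continuous.
exact: norm_continuous.
Qed.

Lemma Cc_cutoffM h L : continuous h -> Cc (fun x => h x * cutoff L x).
Proof.
move=> ch; split.
  by move=> x; apply: (@continuousM _ 'rV[R]_d h (cutoff L) x); [exact: ch|exact: continuous_cutoff].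
exists [set x | `|x| <= L + 1]; first exact: compact_ball_rV.
by move=> x /negP; rewrite -ltNge => /ltW/cutoff0 ->; rewrite mulr0.
Qed.

Section vague_extension.
Hypothesis cell_fin : (lebesgue_rV d (cell V) < +oo)%E.
Local Notation volume := (box_mass V (lebesgue_lfmeasure V_inv cell_fin)).

Lemma lebesgue_growth : exists2 K, 0 <= K & growth (lebesgue_rV d) K.
Proof.
exists (volume (fun=> -1) (fun=> 1)); first exact: box_mass_ge0.
move=> L L1; have L0 : 0 < L by exact: lt_le_trans L1.
rewrite /cube (_ : (fun=> - L) = (fun i : 'I_d => L * -1)); last by apply/funext => i; rewrite mulrN1.
rewrite [X in vbox V _ X](_ : (fun=> L) = (fun i : 'I_d => L * 1)); last by apply/funext => i; rewrite mulr1.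
rewrite (lebesgue_vbox_scale V)// mulrC EFinM /box_mass fineK//.
exact: (vbox_fin_num V_inv (lebesgue_lfmeasure V_inv cell_fin)).
Qed.

Variables (m : lfmeasure R d) (c : R).
Hypothesis c0 : 0 <= c.
Hypothesis centred : forall p q : 'I_d -> nat, (forall i, 0 < p i)%N -> (forall i, 0 < q i)%N ->
  box_mass V m (fun i => - (n * p i)%:R) (fun i => (n * q i)%:R) / n%:R ^+ d @[n --> \oo] -->
  c * volume (fun i => - (p i)%:R) (fun i => (q i)%:R).

(** The mass of [cube L] at scale [e] is [e ^ d] times that of [cube (L / e)] for the original
    measure. For [L >= 1] and small [e] only large values of [L / e] matter, where the average is
    already within one of its limit. *)
Lemma rescaled_growth : exists K e1, [/\ 0 <= K, 0 < e1 & forall e, 0 < e -> e <= e1 -> growth (rescaled m e) K].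
Proof.
pose v := volume (fun=> - 1%:R) (fun=> 1%:R).
have /cvgrPdist_le/(_ _ ltr01) := @centred_real _ _ V V_inv cell_fin m c centred (fun=> 1%N) (fun=> 1%N) (fun=> isT) (fun=> isT).
rewrite -/v => -[s0 [_ H]].
have v0 : 0 <= v by exact: box_mass_ge0.
pose s1 := Num.max 1 (s0 + 1).
have s10 : 0 < s1 by rewrite lt_max ltr01.
exists (c * v + 1), s1^-1; split; [by rewrite addr_ge0// mulr_ge0|by rewrite invr_gt0|].
move=> e e0 ee L L1; have L0 : 0 < L by exact: lt_le_trans L1.
pose s := L / e.
have ss : s0 < s.
  apply: (@lt_le_trans _ _ s1); first by rewrite lt_max ltrDl ltr01 orbT.
  rewrite ler_pdivlMr// (le_trans _ L1)// mulrC -ler_pdivlMr// div1r//.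
have s00 : 0 < s by rewrite divr_gt0.
have := H s ss; rewrite distrC => /(le_trans (ler_norm _)); rewrite lerBlDl ler_pdivrMr ?exprn_gt0// => Hs.
rewrite /cube rescaled_vbox// lee_fin.
rewrite (_ : (fun i => e^-1 * - L) = (fun i : 'I_d => s * - 1%:R)); last first.
  by apply/funext => i; rewrite mulrN mulrN1 mulrC.
rewrite (_ : (fun i => e^-1 * L) = (fun i : 'I_d => s * 1%:R)); last first.
  by apply/funext => i; rewrite mulr1 mulrC.
rewrite mulrC -ler_pdivlMr ?exprn_gt0//; apply: (le_trans Hs).
by rewrite /s expr_div_n mulrA.
Qed.

Lemma rescaled_decay_mass (g : R) : d%:R < g -> exists B, [/\ 0 <= B,
  \forall e \near 0^'+, (\int[rescaled m e]_x (decay g x)%:E <= B%:E)%E,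
  (\int[lebesgue_rV d]_x (decay g x)%:E <= B%:E)%E &
  forall e, 0 < e -> (\int[rescaled m e]_x (decay g x)%:E < +oo)%E].
Proof.
move=> dg; have g0 : 0 <= g by rewrite ltW// (le_lt_trans _ dg).
have [K [e1 [K0 e10 gr]]] := rescaled_growth.
have [Kl Kl0 gl] := lebesgue_growth.
have tc := tail_constant_ge0 dg.
have T0 : 0 <= 1 + tail_constant g by rewrite addr_ge0.
have small e : 0 < e -> e <= e1 -> (\int[rescaled m e]_x (decay g x)%:E <= ((1 + tail_constant g) * K)%:E)%E.
  by move=> e0 ee; exact: (integral_decay dg K0 (gr e e0 ee)).
exists ((1 + tail_constant g) * (K + Kl)); split.
- by rewrite mulr_ge0// addr_ge0.
- near=> e.
  have e0 : 0 < e by near: e; exact: nbhs_right_gt.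
  have ee : e <= e1 by near: e; exact: nbhs_right_le.
  by rewrite (le_trans (small e e0 ee))// lee_fin ler_wpM2l// lerDl.
- by rewrite (le_trans (integral_decay dg Kl0 gl))// lee_fin ler_wpM2l// lerDr.
(* For [e] above [e1] the weight at [e x] is at most the weight at [e1 x], whose integral is already
   known to be finite. *)
move=> e e0; have [ee|/ltW ee] := leP e e1; first by rewrite (le_lt_trans (small e e0 ee))// ltry.
have md : measurable_fun setT (fun x : 'rV[R]_d => (decay g x)%:E) by apply/measurable_EFinP; exact: measurable_decay.
have p0 (x : 'rV[R]_d) : (0 <= (decay g x)%:E)%E by rewrite lee_fin decay_ge0.
have E1 := integral_rescaled m e10 md p0; have E2 := integral_rescaled m e0 md p0.
have := small e1 e10 (lexx _); rewrite E1 E2 => le1.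
have fin1 : (\int[m]_x (decay g (e1 *: x))%:E < +oo)%E.
  have -> : (\int[m]_x (decay g (e1 *: x))%:E = (e1 ^- d)%:E * ((e1 ^+ d)%:E * \int[m]_x (decay g (e1 *: x))%:E))%E.
    by rewrite muleA -EFinM mulVf ?mul1e// gt_eqF// exprn_gt0.
  by rewrite lte_mul_pinfty ?lee_fin ?invr_ge0 ?exprn_ge0 ?(ltW e10)// (le_lt_trans le1)// ltry.
have fin2 : (\int[m]_x (decay g (e *: x))%:E < +oo)%E; last first.
  by apply: (lte_mul_pinfty _ _ fin2); rewrite // lee_fin exprn_ge0// ltW.
apply: le_lt_trans fin1; apply: ge0_le_integralT => [y|x]; first exact: p0.
rewrite lee_fin [leRHS]/decay.
apply: decay_le; [exact: g0|by rewrite ltr_pwDl|].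
by rewrite lerD2l !normrZ !gtr0_norm// ler_wpM2r.
Unshelve. all: by end_near.
Qed.

End vague_extension.
End decaying_functions.

(** * Brownian motion *)

Section density.
Context {d} {T : measurableType d} {R : realType}.
Variables (mu nu : {measure set T -> \bar R}) (p : T -> R).
Hypothesis p0 : forall x, 0 <= p x.
Hypothesis mp : measurable_fun setT (EFin \o p).
Hypothesis nuE : forall A, measurable A -> (nu A = \int[mu]_(x in A) (p x)%:E)%E.
Import HBNNSimple.
Local Open Scope ereal_scope.

Let density_nnsfun (h : {nnsfun T >-> R}) : \int[nu]_x (h x)%:E = \int[mu]_x ((h x)%:E * (p x)%:E).
Proof.
have mh (r : R) : measurable (h @^-1` [set r]) by exact: measurable_funPTI.
under [LHS]eq_integral do rewrite fimfunE -fsumEFin//.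
rewrite [LHS]ge0_integral_fsum//; last 2 first.
  - by move=> r; exact/measurable_EFinP/measurableT_comp.
  - by move=> n x _; rewrite EFinM nnfun_muleindic_ge0.
under [RHS]eq_integral.
  move=> x xD; rewrite fimfunE -fsumEFin// muleC ge0_mule_fsumr; last first.
    by move=> r; rewrite EFinM nnfun_muleindic_ge0.
  over.
rewrite [RHS]ge0_integral_fsum//; last 2 first.
  - move=> r; apply: emeasurable_funM => //; apply/measurable_EFinP; exact: measurableT_comp.
  - move=> n x _; apply: mule_ge0; first by rewrite lee_fin.
    by rewrite EFinM nnfun_muleindic_ge0.
apply: eq_fsbigr => r _.
have [r0|r0] := ltP r 0%R.
  have h0 x : \1_(h @^-1` [set r]) x = 0%R :> R.
    by rewrite indicE memNset// => /= hr; have : (0 <= h x)%R by []; rewrite hr leNgt r0.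
  by rewrite !integral0_eq// => x _; rewrite h0 mulr0 ?mule0.
under eq_integral do rewrite EFinM.
rewrite ge0_integralZl//; last exact/measurable_EFinP/measurable_indic.
rewrite integral_indic// setIT nuE// integral_mkcond.
under [RHS]eq_integral do rewrite EFinM muleCA.
rewrite [RHS]ge0_integralZl//; last 2 first.
- by apply: emeasurable_funM => //; apply/measurable_EFinP/measurable_indic.
- by move=> x _; apply: mule_ge0; rewrite lee_fin.
congr (_ * _); apply: eq_integral => x _; rewrite patchE indicE.
by case: ifPn => _; rewrite ?mule1 ?mule0.
Qed.

Lemma ge0_integral_density (f : T -> \bar R) : measurable_fun setT f -> (forall x, 0 <= f x) ->
  \int[nu]_x f x = \int[mu]_x (f x * (p x)%:E).
Proof.
move=> mf f0; pose f_ := nnsfun_approx measurableT mf.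
transitivity (limn (fun n => \int[nu]_x (f_ n x)%:E)).
  rewrite -monotone_convergence//=.
  - apply: eq_integral => x xD; apply/esym/cvg_lim => //=.
    exact: cvg_nnsfun_approx.
  - by move=> n; apply: measurableT_comp.
  - by move=> n x _; rewrite lee_fin.
  - by move=> x _ a b ab; rewrite lee_fin//; exact/lefP/nd_nnsfun_approx.
transitivity (limn (fun n => \int[mu]_x ((f_ n x)%:E * (p x)%:E))).
  by congr (limn _); apply/funext => n; exact: density_nnsfun.
rewrite -monotone_convergence//=.
- apply: eq_integral => x xD; apply/cvg_lim => //.
  by apply: cvgeZr => //; exact: cvg_nnsfun_approx.
- by move=> n; apply: emeasurable_funM => //; exact/measurable_EFinP.
- by move=> n x _; apply: mule_ge0; rewrite lee_fin.
- move=> x _ a b ab; apply: lee_wpmul2r; first by rewrite lee_fin.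
  by rewrite lee_fin; exact/lefP/nd_nnsfun_approx.
Qed.

End density.

Section normal_moments.
Context {R : realType}.

(** Completing the square: [expR (u * x)] times the density of mean 0 is [expR (u ^ 2 * v / 2)]
    times the density of mean [u * v] and the same variance. *)
Lemma normal_exponential_moment (nu : {measure set (measurableTypeR R) -> \bar R}) (v u : R) : 0 < v ->
  (forall A, measurable A -> nu A = normal_prob 0 (Num.sqrt v) A) ->
  (\int[nu]_x (expR (u * x))%:E = (expR (u ^+ 2 * v / 2))%:E)%E.
Proof.
move=> v0 nuE; have s0 : Num.sqrt v != 0 by rewrite gt_eqF// sqrtr_gt0.
rewrite (@ge0_integral_density _ _ _ lebesgue_measure _ (normal_pdf 0 (Num.sqrt v))); last 5 first.
- by move=> x; exact: normal_pdf_ge0.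
- by apply/measurable_EFinP; exact: measurable_normal_pdf.
- exact: nuE.
- by apply/measurable_EFinP; apply: measurableT_comp => //; exact: mulrl_measurable.
- by move=> x; rewrite lee_fin expR_ge0.
transitivity ((expR (u ^+ 2 * v / 2))%:E * \int[lebesgue_measure]_x (normal_pdf (u * v) (Num.sqrt v) x)%:E)%E.
  have mpdf : measurable_fun setT (fun x => (normal_pdf (u * v) (Num.sqrt v) x)%:E).
    by apply/measurable_EFinP; exact: measurable_normal_pdf.
  have pdf0 x : setT x -> (0 <= (normal_pdf (u * v) (Num.sqrt v) x)%:E)%E.
    by rewrite lee_fin normal_pdf_ge0.
  have e0 : (0 <= (expR (u ^+ 2 * v / 2))%:E)%E by rewrite lee_fin expR_ge0.
  have E := ge0_integralZl lebesgue_measure measurableT mpdf pdf0 e0.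
  transitivity (\int[lebesgue_measure]_x ((expR (u ^+ 2 * v / 2))%:E * (normal_pdf (u * v) (Num.sqrt v) x)%:E))%E; last exact: E.
  apply: eq_integral => x _; rewrite !normal_pdfE// -!EFinM; congr EFin.
  rewrite mulrCA [RHS]mulrCA; congr (_ * _); rewrite /normal_fun -!expRD; congr expR.
  rewrite sqr_sqrtr ?(ltW v0)//; field; rewrite gt_eqF//.
by rewrite integral_normal_pdf mule1.
Qed.

Lemma centred_normal_exponential d (B : measurableType d) (PB : probability B R) (Z : B -> R) (v u : R) :
  0 <= v -> measurable_fun setT (Z : B -> measurableTypeR R) ->
  (forall A, measurable A -> PB [set b | A (Z b)] = centred_normal v A) ->
  (\int[PB]_b (expR (u * Z b))%:E = (expR (u ^+ 2 * v / 2))%:E)%E.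
Proof.
move=> v0 mZ law.
have me : measurable_fun setT (fun x : R => (expR (u * x))%:E).
  by apply/measurable_EFinP; apply: measurableT_comp => //; exact: mulrl_measurable.
have -> : (\int[PB]_b (expR (u * Z b))%:E = \int[pushforward_measure PB mZ]_x (expR (u * x))%:E)%E.
  rewrite /pushforward_measure ge0_integral_pushforward//.
have [vE|vn] := eqVneq v 0.
  rewrite (eq_measure_integral \d_(0 : measurableTypeR R)); last first.
    by move=> A mA _; transitivity (centred_normal v A); [exact: law|rewrite /centred_normal vE eqxx].
  by rewrite integral_dirac// diracT mul1e vE !mulr0 mul0r.
have v1 : 0 < v by rewrite lt0r vn.
apply: normal_exponential_moment => // A mA.
by transitivity (centred_normal v A); [exact: law|rewrite /centred_normal (negbTE vn)].
Qed.

End normal_moments.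

Section linv_domination.
Context {R : realType}.

(* Weighting by exp(s) shifts the Laplace variable by 1. *)
Lemma linv_exp_bound (t : R) : 0 < t -> exists N, forall n, (N <= n)%N -> forall (G : R -> R) (K B : R),
  bounded_meas G K -> 0 <= B -> (forall s, 0 <= s -> `|G s| <= B * expR s) ->
  `|linv t n (lap G)| <= B * (2 / expR (- t)).
Proof.
move=> t0; set u := expR (- t).
have u0 : 0 < u by exact: expR_gt0.
have u1 : u < 1 by rewrite -expR0 ltr_expR oppr_lt0.
have q0 : 0 < u / (1 - u) by rewrite divr_gt0// subr_gt0.
exists (Num.bound (2 / (u / (1 - u)))) => n Nn G K B bG B0 GB.
set a := kernel_pt t n.
have aE : a = n.+1%:R * (u / (1 - u)) by [].
(* The normalizations at [a - 1] and [a] have ratio [(a + n) / (a - 1)]. As [a + n.+1 = a / u] and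
   [a - 1 >= a / 2], it is at most [2 / u]. *)
have a2 : 2 <= a.
  rewrite aE -ler_pdivrMr// ltW//; apply: lt_le_trans (archi_boundP _) _; first by rewrite divr_ge0// ltW.
  by rewrite ler_nat (leq_trans Nn).
have a10 : 0 < a - 1 by lra.
have a0 : 0 < a by lra.
pose I := lapdiff n (@GRing.inv R).
have [I10 I1E] : 0 < I (a - 1) /\ I (a - 1 + 1) = (a - 1) / (a - 1 + n.+1%:R) * I (a - 1) := lapdiff_inv n a10.
have [I0 _] : 0 < I a /\ _ := lapdiff_inv n a0.
rewrite subrK in I1E.
pose k (s : R) : R := (1 - expR (- s)) ^+ n.
pose G1 s := expR (- s) * G s.
have bG1 : bounded_meas G1 B.
  have [mG _] := bG; split; first by apply: measurable_funM => //; have [] := @bounded_meas_expR R.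
  move=> s s0; rewrite /G1 normrM (ger0_norm (expR_ge0 _)) mulrC -ler_pdivlMr ?expR_gt0//.
  by rewrite expRN invrK; exact: GB.
have bk1 : bounded_meas k 1.
  have := bounded_meas_expM n (bounded_meas_cst (1 : R)); rewrite normr1.
  by have -> : (fun s => (1 - expR (- s)) ^+ n * 1) = k by apply/funext => s; rewrite mulr1.
have lapk b : 0 < b -> lap k b = I b.
  move=> b0; rewrite /I (eq_lapdiff n b0 (fun x x0 => esym (lap1 x0))).
  rewrite (lapdiffE n (bounded_meas_cst 1) b0); congr lap.
  by apply/funext => s; rewrite mulr1.
have bkG1 := bounded_meas_expM n bG1.
have E : lapdiff n (lap G) a = lap (fun s => k s * G1 s) (a - 1).
  rewrite (lapdiffE n bG a0); apply: eq_Rintegral => s _.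
  have -> : expR (- (a * s)) = expR (- ((a - 1) * s)) * expR (- s).
    by rewrite -expRD; congr expR; ring.
  by rewrite /k /G1; ring.
have up : `|lap (fun s => k s * G1 s) (a - 1)| <= B * I (a - 1).
  have main s : 0 <= s -> `|k s * G1 s| <= B * k s.
    move=> s0; have k0 : 0 <= k s.
      by rewrite exprn_ge0// subr_ge0 -expR0 ler_expR oppr_le0.
    by rewrite normrM (ger0_norm k0) mulrC ler_wpM2r//; have [_] := bG1; apply.
  rewrite -(lapk _ a10) ler_norml; apply/andP; split.
    have := lap_le (bounded_measZ (- B) bk1) bkG1 a10.
    rewrite (lapZ _ bk1 a10) mulNr; apply => s s0.
    by rewrite mulNr; have := main s s0; rewrite ler_norml => /andP[].
  have := lap_le bkG1 (bounded_measZ B bk1) a10.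
  rewrite (lapZ _ bk1 a10); apply => s s0.
  by rewrite (le_trans (ler_norm _))// main.
rewrite /linv -/a -/I E normrM normfV (gtr0_norm I0) ler_pdivrMr// (le_trans up)// -mulrA ler_wpM2l//.
rewrite I1E mulrA -[leLHS]mul1r ler_wpM2r ?(ltW I10)//.
have n0 : 0 < n.+1%:R :> R by rewrite ltr0n.
rewrite mulrA ler_pdivlMr; last by lra.
rewrite mul1r mulrAC ler_pdivlMr//.
move: aE; move: (n.+1%:R) n0 => N N0 aE.
have h : a * (1 - u) = N * u by rewrite aE; field; rewrite gt_eqF//; lra.
nra.
Qed.

End linv_domination.

Definition bounded_uniform {R : realType} {d : nat} (c : R) (f : 'rV[R]_d -> R) : Prop :=
  (forall x, `|f x| <= c) /\
  forall eta : R, 0 < eta -> exists2 delta : R, 0 < delta & forall x y, `|x - y| < delta -> `|f x - f y| <= eta.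

Lemma bounded_uniform_continuous {R : realType} {d : nat} (c : R) (f : 'rV[R]_d -> R) :
  bounded_uniform c f -> continuous f.
Proof.
move=> [_ uf] x; have E := @cvgrPdist_le _ R^o 'rV[R]_d (nbhs x) _ f (f x); apply/E => eta eta0; have [delta d0 dP] := uf eta eta0.
by apply/nbhs_ballP; exists delta => // y; rewrite -ball_normE => xy; exact: dP.
Qed.

Section decay_class.
Context {R : realType} {d : nat}.
Implicit Types (f : 'rV[R]_d -> R) (x y : 'rV[R]_d).

Definition decay_class (b C : R) f : Prop := continuous f /\ forall x, `|f x| <= C * decay b x.

Lemma decay_class_ge0 b C f : decay_class b C f -> 0 <= C.
Proof.
move=> [_ /(_ 0) h]; have := le_trans (normr_ge0 _) h.
by rewrite pmulr_lge0 ?decay_gt0.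
Qed.

Lemma decayM (g b : R) x : decay g x * decay b x = decay (g + b) x.
Proof. by rewrite /decay -powRD ?opprD//; apply/implyP => _; rewrite gt_eqF// ltr_pwDl. Qed.

Lemma small_power (p A eta : R) : 0 < p -> 0 <= A -> 0 < eta ->
  exists2 L, 0 <= L & A * (1 + L) `^ (- p) <= eta.
Proof.
move=> p0 A0 eta0; have Ae : 0 <= A / eta by rewrite divr_ge0// ltW.
have B1 : 1 <= 1 + A / eta by rewrite lerDl.
have B0 := lt_le_trans ltr01 B1.
exists ((1 + A / eta) `^ p^-1 - 1).
  have pp : 0 <= p^-1 by rewrite invr_ge0 ltW.
  by have := ler_powR B1 pp; rewrite powRr0 subr_ge0.
rewrite addrC subrK -powRrM mulrN mulVf ?gt_eqF// powRN powRr1 ?(ltW B0)// ler_pdivrMr//.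
by rewrite mulrDr mulr1 mulrCA mulfV ?gt_eqF// mulr1 lerDr ltW.
Qed.

Lemma decay_bounded_uniform b C f : 0 < b -> decay_class b C f -> bounded_uniform C f.
Proof.
move=> b0 fC; have C0 := decay_class_ge0 fC; have [cf fD] := fC; split=> [x|].
  by rewrite (le_trans (fD x))// ler_piMr// decay_le1// ltW.
apply: uniform_continuity => // eta eta0; have [L L0 LP] := small_power b0 C0 eta0.
exists L => x /ltW Lx; apply: le_trans (fD x) (le_trans _ LP).
rewrite ler_wpM2l// decay_le ?(ltW b0)// ?lerD2l//.
by rewrite ltr_pwDl.
Qed.

(** Outside the ball of radius [L] the quotient of [1 + |x|] by [1 + L] is at least one. A loss of
    [p] in the exponent of decay is thus exchanged for a small factor [(1 + L) ^ (- p)]. *)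
Lemma cutoff_tail (p L : R) x : 0 <= p -> 0 <= L -> 1 - cutoff L x <= (1 + L) `^ (- p) * decay (- p) x.
Proof.
move=> p0 L0; have L1 : 0 < 1 + L by rewrite ltr_pwDl.
have [xL|Lx] := leP `|x| L; first by rewrite cutoff1// subrr mulr_ge0 ?powR_ge0.
apply: (@le_trans _ _ 1); first by rewrite lerBlDr lerDl; have /andP[] := cutoff01 L x.
rewrite /decay opprK powRN mulrC ler_pdivlMr ?powR_gt0// mul1r.
by apply: ge0_ler_powR; rewrite // ?nnegrE ?addr_ge0// lerD2l ltW.
Qed.

Lemma cutoff_decay (b L : R) : 0 <= b -> 0 <= L -> decay_class b ((1 + (L + 1)) `^ b) (cutoff L).
Proof.
move=> b0 L0; split=> [|x]; first exact: continuous_cutoff.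
have /andP[c0 c1] := cutoff01 L x; rewrite ger0_norm//.
have [Lx|xL] := leP (L + 1) `|x|; first by rewrite cutoff0// mulr_ge0 ?powR_ge0.
apply: (le_trans c1); rewrite /decay powRN ler_pdivlMr ?powR_gt0 ?ltr_pwDl// mul1r.
by apply: ge0_ler_powR; rewrite // ?nnegrE ?addr_ge0// lerD2l ltW.
Qed.

Lemma cutoff_bounded_uniform L : 0 <= L -> bounded_uniform 1 (@cutoff R d L).
Proof.
move=> L0; have [_ u] := decay_bounded_uniform ltr01 (cutoff_decay ler01 L0); split=> // x.
by have /andP[c0 c1] := cutoff01 L x; rewrite ger0_norm.
Qed.

Lemma cocutoff_bounded_uniform L : 0 <= L -> bounded_uniform 1 (fun x => 1 - @cutoff R d L x).
Proof.
move=> L0; have [_ u] := cutoff_bounded_uniform L0; split=> [x|eta eta0].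
  by have /andP[c0 c1] := cutoff01 L x; rewrite ger0_norm ?subr_ge0// lerBlDr lerDl.
have [delta d0 dP] := u eta eta0; exists delta => // x y /dP.
by rewrite (_ : 1 - _ - _ = - (cutoff L x - cutoff L y)) ?normrN//; ring.
Qed.

(** What the limit must satisfy in the [L^1] argument, for the Brownian semigroup and for [lam]
    times its resolvent: stability of the decay classes, with a constant linear in the bound, and
    preservation of constants, tested on cutoffs. *)
Definition limit_operator (T : ('rV[R]_d -> R) -> 'rV[R]_d -> R) : Prop :=
  (forall b, exists2 K, 0 <= K & forall C c f, bounded_uniform c f -> decay_class b C f -> decay_class b (C * K) (T f)) /\
  (forall L x, 0 <= L -> T (fun y => 1 - cutoff L y) x = 1 - T (cutoff L) x).

End decay_class.

Lemma lap_bound {R : realType} (G : R -> R) M lam : bounded_meas G M -> 0 < lam -> `|lap G lam| <= M / lam.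
Proof.
move=> bG l0; have cE c : lap (fun=> c) lam = c / lam.
  by rewrite -(lap1 l0) -(lapZ c (bounded_meas_cst (1 : R)) l0); congr (lap _ _); apply/funext => s; rewrite mulr1.
have [_ GM] := bG; rewrite ler_norml -mulNr -!cE; apply/andP; split.
  apply: (lap_le (bounded_meas_cst (- M)) bG l0) => s s0.
  by have := GM s s0; rewrite ler_norml => /andP[].
apply: (lap_le bG (bounded_meas_cst M) l0) => s s0.
by have := GM s s0; rewrite ler_norml => /andP[].
Qed.

(** * Decay and continuity for the Brownian semigroup *)

Section brownian_bounds.
Context {R : realType} {d : nat} {dB : measure_display} {B : measurableType dB}.
Variables (PB : probability B R) (W : R -> B -> 'rV[R]_d) (Sigma : 'M[R]_d).
Hypothesis bm : brownian PB W Sigma.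
Hypothesis psd : forall a, 0 <= dot a (mulmv Sigma a).
Implicit Types (f : 'rV[R]_d -> R) (x y : 'rV[R]_d).
Local Notation P := (brownian_semigroup PB W).
Local Notation Rl := (brownian_resolvent PB W).

Let mW t : 0 <= t -> measurable_fun setT (W t). Proof. by case: bm => + _ _ _ _; apply. Qed.
Let W0 : {ae PB, forall b, W 0 b = 0}. Proof. by case: bm. Qed.

Let mass1 (c : R) : \int[PB]_b c = c.
Proof. by rewrite Rintegral_cst// [X in fine X](probability_setT PB) mulr1. Qed.

Let mcoord (i : 'I_d) : measurable_fun setT (fun x : 'rV[R]_d => x ord0 i).
Proof. by apply: continuous_measurable_rV => x; exact: coord_continuous. Qed.

Let mshift x : measurable_fun setT (fun y : 'rV[R]_d => x + y).
Proof.
apply: measurable_to_rV => U oU; apply: open_measurable_rV; apply: open_comp => // y _.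
by apply: continuousD; [exact: cst_continuous|].
Qed.

Let mfW f t x : continuous f -> 0 <= t -> measurable_fun setT (fun b => f (x + W t b)).
Proof.
move=> cf t0; apply: (measurableT_comp (continuous_measurable_rV cf)).
exact: (measurableT_comp (mshift x) (mW t0)).
Qed.

Let m_increment s t : 0 <= s -> 0 <= t -> measurable_fun setT (fun b => `|W t b - W s b|).
Proof.
move=> s0 t0; pose F (l : seq ('I_1 * 'I_d)) b := \big[Num.max/0]_(i <- l) `|(W t b - W s b) i.1 i.2|.
have mF l : measurable_fun setT (F l).
  elim: l => [|i l IH].
    have -> : F [::] = cst 0 by apply/funext => b; rewrite /F big_nil.
    exact: measurable_cst.
  have -> : F (i :: l) = (fun b => Num.max `|W t b ord0 i.2 - W s b ord0 i.2| (F l b)).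
    by apply/funext => b; rewrite /F big_cons !mxE (ord1 i.1).
  apply: measurable_maxr => //; apply: measurableT_comp => //.
  by apply: measurable_funB; apply: (measurableT_comp (mcoord i.2)); exact: mW.
have -> : (fun b => `|W t b - W s b|) = F (index_enum ('I_1 * 'I_d)%type) by apply/funext => b; rewrite [LHS]mx_normrE.
exact: mF.
Qed.

Let m_norm t : 0 <= t -> measurable_fun setT (fun b => `|W t b|).
Proof.
move=> t0; apply: (measurableT_comp _ (mW t0)); apply: continuous_measurable_rV => x.
exact: norm_continuous.
Qed.

Let spread (i : 'I_d) := dot (delta_mx ord0 i) (mulmv Sigma (delta_mx ord0 i)).

Let dot_delta (i : 'I_d) x : dot (delta_mx ord0 i) x = x ord0 i.
Proof.
rewrite /dot (bigD1 i)//= mxE !eqxx mul1r big1 ?addr0// => j ji.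
by rewrite mxE (negbTE ji) andbF mul0r.
Qed.

(** The trace of [Sigma], a common bound for the variances of the coordinates at time one. *)
Definition total_variance : R := \sum_i spread i.

Lemma total_variance_ge0 : 0 <= total_variance.
Proof. by apply: sumr_ge0 => i _; exact: psd. Qed.

Lemma increment_exponential (s t u : R) i : 0 <= s <= t ->
  (\int[PB]_b (expR (u * (W t b ord0 i - W s b ord0 i)))%:E = (expR (u ^+ 2 * ((t - s) * spread i) / 2))%:E)%E.
Proof.
move=> st; have /andP[s0 st1] := st; apply: centred_normal_exponential.
- by rewrite mulr_ge0 ?subr_ge0// psd.
- apply: measurable_funB; apply: (measurableT_comp (mcoord i)); apply: mW => //.
  exact: le_trans st1.
move=> A mA; case: bm => _ _ _ _ /(_ s t st (delta_mx ord0 i) A mA) <-.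
by congr (PB _); apply/seteqP; split => b /=; rewrite dot_delta !mxE.
Qed.

(** The sup norm is controlled by the exponentials of the coordinates and of their opposites; the
    term 1 keeps the logarithm of the right-hand side non-negative. *)
Lemma expR_norm_le (u : R) x : 0 < u ->
  expR (u * `|x|) <= 1 + \sum_i (expR (u * x ord0 i) + expR ((- u) * x ord0 i)).
Proof.
move=> u0; set T := 1 + _.
have s0 : 0 <= \sum_i (expR (u * x ord0 i) + expR ((- u) * x ord0 i)).
  by apply: sumr_ge0 => i _; rewrite addr_ge0 ?expR_ge0.
have T1 : 1 <= T by rewrite lerDl.
have T0 : 0 < T by exact: lt_le_trans T1.
rewrite -[leRHS](lnK (_ : T \in Num.pos)) ?posrE// ler_expR mulrC -ler_pdivlMr//.
rewrite [leLHS]mx_normrE bigmax_le ?divr_ge0 ?ln_ge0 ?(ltW u0)// => -[i j] _ /=.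
rewrite (ord1 i) ler_pdivlMr// -ler_expR lnK ?posrE//.
have hj : expR (u * x ord0 j) + expR ((- u) * x ord0 j) <= T.
  rewrite /T (bigD1 j)//= ler_wpDl// lerDl; apply: sumr_ge0 => k _.
  by rewrite addr_ge0 ?expR_ge0.
rewrite mulrC; apply: le_trans hj; case: (leP 0 (x ord0 j)) => xj.
  by rewrite -/ord0 (ger0_norm xj) lerDl expR_ge0.
by rewrite -/ord0 (ltr0_norm xj) mulNr mulrN lerDr expR_ge0.
Qed.

Lemma increment_norm_exponential (s t u : R) : 0 <= s <= t -> 0 < u ->
  (\int[PB]_b (expR (u * `|W t b - W s b|))%:E <=
   (1 + 2 * d%:R * expR (u ^+ 2 * ((t - s) * total_variance) / 2))%:E)%E.
Proof.
move=> st u0; have /andP[s0 st1] := st; have t0 := le_trans s0 st1.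
have mE (v : R) (i : 'I_d) : measurable_fun setT (fun b => (expR (v * (W t b ord0 i - W s b ord0 i)))%:E).
  apply/measurable_EFinP; apply: measurableT_comp => //; apply: measurable_funM => //.
  by apply: measurable_funB; apply: (measurableT_comp (mcoord i)); exact: mW.
apply: (@le_trans _ _ (\int[PB]_b (1%:E + \sum_(i < d) ((expR (u * (W t b ord0 i - W s b ord0 i)))%:E +
    (expR ((- u) * (W t b ord0 i - W s b ord0 i)))%:E)))%E).
  apply: ge0_le_integralT => b; first by rewrite lee_fin expR_ge0.
  rewrite sumEFin -EFinD lee_fin (le_trans (expR_norm_le _ u0))//.
  by rewrite lerD2l; apply: ler_sum => i _; rewrite !mxE.
rewrite ge0_integralD//; last 2 first.
- by move=> b _; apply: sume_ge0 => i _; rewrite adde_ge0// lee_fin expR_ge0.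
- by apply: emeasurable_sum => i; apply: emeasurable_funD; exact: mE.
rewrite integral_cst// [X in (_ * X)%E](probability_setT PB) mule1 EFinD leeD2lE// ge0_integral_sum//; last 2 first.
- by move=> i; apply: emeasurable_funD; exact: mE.
- by move=> i b _; rewrite adde_ge0// lee_fin expR_ge0.
rewrite (_ : 2 * d%:R * _ = \sum_(i < d) (2 * expR (u ^+ 2 * ((t - s) * total_variance) / 2))); last first.
  by rewrite sumr_const card_ord -mulr_natr; ring.
rewrite -sumEFin; apply: lee_sum => i _.
rewrite ge0_integralD//; [|by move=> b _; rewrite lee_fin expR_ge0..].
rewrite !increment_exponential// sqrrN -EFinD lee_fin -mulr2n -[leLHS]mulr_natl ler_wpM2l//.
rewrite ler_expR ler_wpM2r// ler_wpM2l ?sqr_ge0// ler_wpM2l ?subr_ge0//.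
by rewrite /total_variance (bigD1 i)//= lerDl; apply: sumr_ge0 => j _; exact: psd.
Qed.

Lemma semigroup_bound f c t x : continuous f -> (forall y, `|f y| <= c) -> 0 <= t ->
  PB.-integrable setT (EFin \o (fun b => f (x + W t b))) /\ `|P t f x| <= c.
Proof.
move=> cf fc t0; have ic : PB.-integrable setT (EFin \o (fun _ : B => c)) by exact: finite_measure_integrable_cst.
have i : PB.-integrable setT (EFin \o (fun b => f (x + W t b))).
  apply: le_integrable ic => //=; first by apply/measurable_EFinP; exact: mfW.
  by move=> b _; rewrite lee_fin (le_trans (fc _))// ler_norm.
split => //; apply: (le_trans (le_normr_Rintegral _ i)) => //.
have -> : c = \int[PB]_b c by rewrite mass1.
apply: le_Rintegral => //.
by have := integrable_abse i; apply: eq_integrable.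
Qed.

Lemma semigroupB f g c t x : continuous f -> continuous g -> (forall y, `|f y| <= c) -> (forall y, `|g y| <= c) -> 0 <= t ->
  P t (fun y => f y - g y) x = P t f x - P t g x.
Proof.
move=> cf cg fc gc t0; rewrite /brownian_semigroup RintegralB//.
- by have [] := semigroup_bound x cf fc t0.
- by have [] := semigroup_bound x cg gc t0.
Qed.

Lemma semigroup_cst (c : R) t x : P t (fun=> c) x = c.
Proof. exact: mass1. Qed.

Lemma semigroup_modulus_space f c t (delta eta : R) : bounded_uniform c f -> 0 <= t ->
  (forall x y, `|x - y| < delta -> `|f x - f y| <= eta) ->
  forall x y, `|x - y| < delta -> `|P t f x - P t f y| <= eta.
Proof.
move=> uf t0 fd x y xy; have cf := bounded_uniform_continuous uf; have [fc _] := uf.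
have [i1 _] := semigroup_bound x cf fc t0; have [i2 _] := semigroup_bound y cf fc t0.
rewrite /brownian_semigroup -RintegralB//.
have i := integrableB measurableT i1 i2.
apply: (le_trans (le_normr_Rintegral _ i)) => //.
have -> : eta = \int[PB]_b eta by rewrite mass1.
apply: le_Rintegral => //.
- by have := integrable_abse i; apply: eq_integrable.
- exact: finite_measure_integrable_cst.
move=> b _; apply: fd.
by have -> : x + W t b - (y + W t b) = x - y by rewrite opprD addrACA subrr addr0.
Qed.

Lemma semigroup0 f x : continuous f -> P 0 f x = f x.
Proof.
move=> cf; rewrite /brownian_semigroup.
transitivity (\int[PB]_b f x); last by rewrite mass1.
rewrite /Rintegral; congr fine; apply: ae_eq_integral => //.
- by apply/measurable_EFinP; exact: mfW.
- by apply: filterS W0 => b Wb _ /=; rewrite Wb addr0.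
Qed.

(** A power is dominated by an exponential of small rate [u], whose moments grow like the
    exponential of [u ^ 2 * t] times half a variance. The rate [kap] is arbitrary so that it can be
    taken below the parameter of a resolvent. *)
Lemma moment_bound (g kap : R) : 0 <= g -> 0 < kap -> exists2 K, 0 <= K & forall t, 0 <= t ->
  (\int[PB]_b ((1 + `|W t b|) `^ g)%:E <= (K * expR (kap * t))%:E)%E.
Proof.
move=> g0 k0; have tv0 := total_variance_ge0.
(* With [u <= 1] and [u * (total_variance + 1) <= 2 * kap], the exponent
   [u ^ 2 * total_variance / 2] is at most [kap]. *)
pose u := Num.min 1 (2 * kap / (total_variance + 1)).
have u0 : 0 < u by rewrite lt_min ltr01 divr_gt0 ?mulr_gt0// ltr_wpDl.
have u1 : u <= 1 by rewrite ge_min lexx.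
have uk : u ^+ 2 * total_variance / 2 <= kap.
  have h : u * (total_variance + 1) <= 2 * kap.
    by rewrite -ler_pdivlMr ?ltr_wpDl// ge_min lexx orbT.
  rewrite expr2; nra.
(* [A] comes from [ln y <= y] at [y = u * (1 + s) / G], multiplied by [G]; the shift by one makes
   [G] positive. *)
pose G := g + 1; pose A := expR (u - G * ln (u / G)).
have G0 : 0 < G by rewrite ltr_wpDl.
have pw (s : R) : 0 <= s -> (1 + s) `^ g <= A * expR (u * s).
  move=> s0; have s10 : 0 < 1 + s by rewrite ltr_pwDl.
  apply: (@le_trans _ _ ((1 + s) `^ G)); first by rewrite ler_powR ?lerDl.
  rewrite /powR gt_eqF// /A -expRD ler_expR.
  have y0 : 0 < u / G * (1 + s) by rewrite mulr_gt0// divr_gt0.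
  have h : ln (u / G) + ln (1 + s) <= u / G * (1 + s).
    rewrite -lnM ?posrE ?divr_gt0// -ler_expR lnK ?posrE//.
    by rewrite (le_trans _ (expR_ge1Dx _))// lerDr.
  have h2 : G * (ln (u / G) + ln (1 + s)) <= G * (u / G * (1 + s)) by apply: ler_wpM2l => //; exact: ltW.
  have e : G * (u / G * (1 + s)) = u + u * s by field; rewrite gt_eqF.
  by rewrite e in h2; lra.
exists (A * (1 + 2 * d%:R)); first by rewrite mulr_ge0 ?expR_ge0// addr_ge0// mulr_ge0.
move=> t t0.
have mN : measurable_fun setT (fun b => `|W t b - W 0 b|).
  exact: m_increment.
have st : 0 <= (0 : R) <= t by rewrite lexx.
apply: (@le_trans _ _ (\int[PB]_b (A%:E * (expR (u * `|W t b - W 0 b|))%:E))%E).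
  apply: (@le_trans _ _ (\int[PB]_b (A%:E * (expR (u * `|W t b|))%:E))%E).
    by apply: ge0_le_integralT => b; rewrite -?EFinM lee_fin ?powR_ge0// pw.
  apply: eq_leW; apply: ae_eq_integral => //.
  - by apply: measurable_funeM; apply/measurable_EFinP; apply: measurableT_comp => //; apply: measurable_funM => //; exact: m_norm.
  - by apply: measurable_funeM; apply/measurable_EFinP; apply: measurableT_comp => //; apply: measurable_funM => //; exact: m_increment.
  - by apply: filterS W0 => b Wb _ /=; rewrite Wb subr0.
have AZ := @ge0_integralZl _ _ _ PB setT measurableT (fun b => (expR (u * `|W t b - W 0 b|))%:E).
rewrite AZ ?lee_fin ?expR_ge0//; last first.
  by apply/measurable_EFinP; apply: measurableT_comp => //; apply: measurable_funM => //.
apply: (@le_trans _ _ (A%:E * (1 + 2 * d%:R * expR (u ^+ 2 * ((t - 0) * total_variance) / 2))%:E)%E).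
  by rewrite lee_wpmul2l ?lee_fin ?expR_ge0// increment_norm_exponential.
rewrite -EFinM lee_fin -[leRHS]mulrA ler_wpM2l ?expR_ge0// subr0 [leRHS]mulrDl mul1r.
have ee : expR (u ^+ 2 * (t * total_variance) / 2) <= expR (kap * t).
  rewrite ler_expR (_ : _ / 2 = u ^+ 2 * total_variance / 2 * t); last by ring.
  exact: ler_wpM2r.
apply: lerD; last by rewrite ler_wpM2l.
by rewrite -expR0 ler_expR mulr_ge0// ltW.
Qed.

(** Peetre's inequality: [1 + |x|] and [1 + |x + y|] differ at most by the factor [1 + |y|], in both
    directions, so the weight at [x + W t] is the weight at [x] up to the power [|g|] of
    [1 + |W t|]. The sign of [g] is free. *)
Lemma semigroup_decay (g kap : R) : 0 < kap -> exists2 K, 0 <= K & forall t f C x, 0 <= t -> continuous f ->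
  0 <= C -> (forall y, `|f y| <= C * decay g y) -> `|P t f x| <= C * decay g x * (K * expR (kap * t)).
Proof.
move=> k0; have [K K0 KP] := moment_bound (normr_ge0 g) k0; exists K => // t f C x t0 cf C0 fC.
have prod1 (a b e : R) : 0 <= b -> 0 <= e -> a <= b + e -> 1 + a <= (1 + b) * (1 + e).
  by move=> b0 e0 h; have := mulr_ge0 b0 e0; lra.
have key b : `|f (x + W t b)| <= C * decay g x * (1 + `|W t b|) `^ `|g|.
  rewrite (le_trans (fC _))// -mulrA ler_wpM2l// /decay.
  set X := 1 + `|x|; set w := 1 + `|W t b|; set Z := 1 + `|x + W t b|.
  have X1 : 1 <= X by rewrite lerDl.
  have w1 : 1 <= w by rewrite lerDl.
  have Z1 : 1 <= Z by rewrite lerDl.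
  have X0 := lt_le_trans ltr01 X1; have w0 := lt_le_trans ltr01 w1; have Z0 := lt_le_trans ltr01 Z1.
  have h1 : X <= Z * w.
    have h : `|x| <= `|x + W t b| + `|W t b| by rewrite -{1}(addrK (W t b) x) ler_normB.
    exact: (prod1 _ _ _ (normr_ge0 _) (normr_ge0 _) h).
  have h2 : Z <= X * w.
    exact: (prod1 _ _ _ (normr_ge0 _) (normr_ge0 _) (ler_normD x (W t b))).
  have ZW := mulr_gt0 Z0 w0; have XW := mulr_gt0 X0 w0.
  have [gg|gg] := leP 0 g.
    rewrite !powRN (ger0_norm gg) [leRHS]mulrC ler_pdivlMr ?powR_gt0// mulrC ler_pdivrMr ?powR_gt0//.
    rewrite [leRHS]mulrC -powRM ?(ltW Z0) ?(ltW w0)//.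
    by apply: ge0_ler_powR; rewrite ?nnegrE ?(ltW X0) ?(ltW ZW).
  rewrite (ltr0_norm gg) -powRM ?(ltW X0) ?(ltW w0)//; by apply: ge0_ler_powR; rewrite ?nnegrE ?oppr_ge0 ?(ltW gg) ?(ltW Z0) ?(ltW XW).
have D0 : 0 <= C * decay g x by rewrite mulr_ge0// decay_ge0.
have i : (\int[PB]_b `|(f (x + W t b))%:E| <= (C * decay g x * (K * expR (kap * t)))%:E)%E.
  apply: (@le_trans _ _ (\int[PB]_b ((C * decay g x)%:E * ((1 + `|W t b|) `^ `|g|)%:E))%E).
    by apply: ge0_le_integralT => b //; rewrite -EFinM /= lee_fin.
  have AZ := @ge0_integralZl _ _ _ PB setT measurableT (fun b => ((1 + `|W t b|) `^ `|g|)%:E).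
  rewrite AZ ?lee_fin//; last first.
    apply/measurable_EFinP; apply: (measurableT_comp (measurable_powR _)).
    by apply: measurable_funD => //; exact: m_norm.
  by rewrite [leRHS]EFinM lee_wpmul2l ?lee_fin// KP.
have fi : PB.-integrable setT (EFin \o (fun b => f (x + W t b))).
  apply/integrableP; split; first by apply/measurable_EFinP; exact: mfW.
  by rewrite (le_lt_trans i)// ltry.
rewrite -lee_fin; apply: le_trans i; rewrite /brownian_semigroup /Rintegral.
rewrite -abse_EFin fineK; last exact: integrable_fin_num.
by apply: le_abse_integral => //; apply/measurable_EFinP; exact: mfW.
Qed.

(** Uniform continuity handles increments below [delta]; larger ones are bounded through an
    exponential moment. *)
Lemma semigroup_modulus_time f c (eta : R) : bounded_uniform c f -> 0 < eta ->
  exists2 h, 0 < h & forall s t x, 0 <= s -> s <= t -> t - s < h -> `|P s f x - P t f x| <= eta.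
Proof.
move=> uf eta0; have cf := bounded_uniform_continuous uf; have [fc mf] := uf.
have eta2 : 0 < eta / 2 by rewrite divr_gt0.
have [delta d0 dP] := mf _ eta2.
have c0 : 0 <= c by exact: le_trans (fc 0).
(* Since [expR (u * delta) >= u * delta >= T], large increments cost at most [eta / 2] once [t - s]
   is so short that the exponential moment is at most [1 + 2 * d%:R * expR 1]. *)
pose T := 2 * c * (1 + 2 * d%:R * expR 1) / (eta / 2).
have T0 : 0 <= T by rewrite divr_ge0 ?(ltW eta2)// !mulr_ge0// addr_ge0// !mulr_ge0// expR_ge0.
pose u := (T + 1) / delta.
have u0 : 0 < u by rewrite divr_gt0// ltr_wpDl.
have tv0 := total_variance_ge0.
exists (2 / (u ^+ 2 * (total_variance + 1))).
  by rewrite divr_gt0// mulr_gt0 ?exprn_gt0// ltr_wpDl.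
move=> s t x s0 st th; have t0 := le_trans s0 st.
have sst : 0 <= s <= t by rewrite s0.
have [i1 _] := semigroup_bound x cf fc s0; have [i2 _] := semigroup_bound x cf fc t0.
rewrite /brownian_semigroup -RintegralB//.
have i := integrableB measurableT i1 i2.
apply: (le_trans (le_normr_Rintegral _ i)) => //.
have e0 : 0 < expR (u * delta) by exact: expR_gt0.
have key b : `|f (x + W s b) - f (x + W t b)| <= eta / 2 + 2 * c / expR (u * delta) * expR (u * `|W t b - W s b|).
  have [small|big] := ltP `|W t b - W s b| delta.
    rewrite ler_wpDr//; first by rewrite !mulr_ge0 ?invr_ge0 ?expR_ge0.
    apply: dP; have -> : x + W s b - (x + W t b) = W s b - W t b by rewrite opprD addrACA subrr add0r.
    by rewrite distrC.
  rewrite ler_wpDl ?(ltW eta2)// (le_trans (ler_normB _ _))// (@le_trans _ _ (2 * c))//.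
    by rewrite mulr_natl mulr2n lerD.
  rewrite -mulrA ler_peMr ?mulr_ge0// mulrC -expRN -expRD -expR0 ler_expR subr_ge0.
  by rewrite ler_wpM2l// ltW.
rewrite -lee_fin /Rintegral fineK; last first.
  by apply: integrable_fin_num => //; have := integrable_abse i; apply: eq_integrable.
apply: (@le_trans _ _ (\int[PB]_b ((eta / 2)%:E + (2 * c / expR (u * delta))%:E * (expR (u * `|W t b - W s b|))%:E))%E).
  by apply: ge0_le_integralT => b; rewrite ?lee_fin// -EFinM -EFinD lee_fin.
have mN : measurable_fun setT (fun b => (expR (u * `|W t b - W s b|))%:E).
  by apply/measurable_EFinP; apply: measurableT_comp => //; apply: measurable_funM => //; exact: m_increment.
have c2 : 0 <= 2 * c / expR (u * delta) by rewrite !mulr_ge0 ?invr_ge0 ?expR_ge0.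
rewrite ge0_integralD//; [|by move=> b _; rewrite lee_fin ltW|by move=> b _; rewrite -EFinM lee_fin mulr_ge0 ?expR_ge0|exact: measurable_funeM].
rewrite integral_cst// [X in (_ * X)%E](probability_setT PB) mule1.
have AZ := @ge0_integralZl _ _ _ PB setT measurableT _ mN.
rewrite AZ ?lee_fin//.
rewrite [in leRHS](splitr eta) EFinD leeD2lE//.
apply: (@le_trans _ _ ((2 * c / expR (u * delta))%:E * (1 + 2 * d%:R * expR 1)%:E)%E).
  rewrite lee_wpmul2l ?lee_fin//; apply: (le_trans (increment_norm_exponential sst u0)).
  rewrite lee_fin lerD2l ler_wpM2l ?mulr_ge0// ler_expR.
  have hh : (t - s) * (u ^+ 2 * (total_variance + 1)) <= 2.
    by rewrite -ler_pdivlMr ?(ltW th)// mulr_gt0 ?exprn_gt0// ltr_wpDl.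
  have st0 : 0 <= (t - s) * u ^+ 2 by rewrite mulr_ge0 ?sqr_ge0// subr_ge0.
  rewrite mulrDr mulr1 mulrDr in hh.
  rewrite ler_pdivrMr// mul1r (_ : u ^+ 2 * _ = (t - s) * (u ^+ 2 * total_variance)); last by ring.
  by lra.
rewrite -EFinM lee_fin [leLHS]mulrAC ler_pdivrMr// [leRHS]mulrC -ler_pdivrMr//.
apply: (@le_trans _ _ (u * delta)); last by rewrite (le_trans _ (expR_ge1Dx _))// lerDr.
by rewrite /u divfK ?gt_eqF// -/T lerDl.
Qed.

Lemma semigroup_near f c (eta : R) : bounded_uniform c f -> 0 < eta ->
  exists2 h, 0 < h & forall s t x, 0 <= s -> 0 <= t -> `|s - t| < h -> `|P s f x - P t f x| <= eta.
Proof.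
move=> uf eta0; have [h h0 hP] := semigroup_modulus_time uf eta0; exists h => // s t x s0 t0.
have [st|/ltW ts] := leP s t.
  by rewrite distrC ger0_norm ?subr_ge0// => sth; exact: hP.
by rewrite ger0_norm ?subr_ge0// => sth; rewrite distrC; exact: hP.
Qed.

Lemma semigroup_bounded_meas f c x : bounded_uniform c f -> bounded_meas (fun s => P s f x) c.
Proof.
move=> uf; split=> [|s s0]; last by have [] := semigroup_bound x (bounded_uniform_continuous uf) uf.1 s0.
apply: subspace_continuous_measurable_fun; first exact: measurable_half_line.
apply/subspace_continuousP => t; rewrite half_lineE => t0; apply/cvgrPdist_le => eta eta0.
have [h h0 hP] := semigroup_near uf eta0.
rewrite near_withinE; apply/nbhs_ballP; exists h => // s; rewrite /ball/= => ts; rewrite half_lineE => s0.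
exact: hP.
Qed.

Lemma semigroup_limit_operator t : 0 <= t -> limit_operator (P t).
Proof.
move=> t0; split=> [b|L x L0].
  have [K K0 KP] := semigroup_decay b (ltr01 : 0 < (1 : R)).
  exists (K * expR (1 * t)) => [|C c f uf fC]; first by rewrite mulr_ge0 ?expR_ge0.
  have C0 := decay_class_ge0 fC; have [cf fD] := fC; split=> x; last first.
    by rewrite mulrAC; exact: KP.
  have E := @cvgrPdist_le _ R^o 'rV[R]_d (nbhs x) _ (P t f) (P t f x); apply/E => eta eta0.
  have [_ /(_ eta eta0)[delta d0 dP]] := uf.
  apply/nbhs_ballP; exists delta => // y; rewrite -ball_normE => xy.
  exact: (semigroup_modulus_space uf t0 dP).
have c1 y : `|@cutoff R d L y| <= 1 by have [] := @cutoff_bounded_uniform R d _ L0.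
rewrite (@semigroupB (fun=> 1) (cutoff L) 1)// ?semigroup_cst//.
- exact: cst_continuous.
- exact: continuous_cutoff.
- by move=> y; rewrite normr1.
Qed.

Lemma resolventB lam f g c c' x y : 0 < lam -> bounded_uniform c f -> bounded_uniform c' g ->
  lap (fun s => P s f x - P s g y) lam = Rl lam f x - Rl lam g y.
Proof.
move=> l0 uf ug; have bf := semigroup_bounded_meas x uf; have bg := semigroup_bounded_meas y ug.
have bg' := bounded_measM (bounded_meas_cst (-1)) bg.
rewrite (_ : (fun s => _) = (fun s => P s f x + -1 * P s g y)); last by apply/funext => s; rewrite mulN1r.
by rewrite (lapD bf bg' l0) (lapZ (-1) bg l0) mulN1r.
Qed.

Lemma resolvent_limit_operator lam : 0 < lam -> limit_operator (fun f x => lam * Rl lam f x).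
Proof.
move=> l0; have l2 : 0 < lam / 2 by rewrite divr_gt0.
split=> [b|L x L0].
  have [K K0 KP] := semigroup_decay b l2.
  exists (2 * K) => [|C c f uf fC]; first by rewrite mulr_ge0.
  have C0 := decay_class_ge0 fC; have [cf fD] := fC; split=> x; last first.
    have D0 : 0 <= C * decay b x by rewrite mulr_ge0// decay_ge0.
    have [mP bP] := semigroup_bounded_meas x uf.
    have bG : bounded_meas (fun s => expR (- (lam / 2 * s)) * P s f x) (C * decay b x * K).
      split; first by apply: measurable_funM => //; apply: measurable_funTS; exact: measurable_expRM.
      move=> s s0; rewrite normrM ger0_norm ?expR_ge0// expRN ler_pdivrMl ?expR_gt0// mulrC.
      by have := KP s f C x s0 cf C0 fD; rewrite !mulrA.
    (* Half of [lam] absorbs the growth [expR (lam / 2 * s)] of the bound on the semigroup; the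
       other half makes the integral converge. *)
    have -> : Rl lam f x = lap (fun s => expR (- (lam / 2 * s)) * P s f x) (lam / 2).
      rewrite /brownian_resolvent /lap; apply: eq_Rintegral => s _.
      by rewrite mulrA -expRD -opprD -mulrDl -splitr.
    rewrite normrM gtr0_norm// (le_trans (ler_wpM2l (ltW l0) (lap_bound bG l2)))//.
    apply: eq_leW; field; rewrite gt_eqF//.
  have E := @cvgrPdist_le _ R^o 'rV[R]_d (nbhs x) _ (fun x => lam * Rl lam f x) (lam * Rl lam f x); apply/E => eta eta0.
  have [_ /(_ eta eta0)[delta d0 dP]] := uf.
  apply/nbhs_ballP; exists delta => // y; rewrite -ball_normE => xy.
  rewrite -mulrBr -(resolventB x y l0 uf uf) normrM gtr0_norm// mulrC -ler_pdivlMr//.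
  apply: lap_bound => //; split.
    by have [m1 _] := semigroup_bounded_meas x uf; have [m2 _] := semigroup_bounded_meas y uf; exact: measurable_funB.
  by move=> s s0; exact: (semigroup_modulus_space uf s0 dP).
have u1 : bounded_uniform 1 (fun _ : 'rV[R]_d => 1 : R).
  by split=> [y|eta eta0]; [rewrite normr1|exists 1 => // y z _; rewrite subrr normr0 ltW].
have uc := @cutoff_bounded_uniform R d _ L0.
have e1 : lam * Rl lam (fun=> 1) x = 1.
  rewrite /brownian_resolvent (_ : (fun s => _) = (fun s => expR (- (lam * s)) * 1)); last first.
    by apply/funext => s; rewrite semigroup_cst.
  by rewrite -/(lap (fun=> 1) lam) lap1// mulfV// gt_eqF.
rewrite -[X in X - _]e1 -mulrBr -(resolventB x x l0 u1 uc); congr (lam * _).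
apply: eq_Rintegral => s; rewrite inE/= in_itv/= andbT => s0; congr (_ * _).
apply: (@semigroupB (fun=> 1) (cutoff L) 1) => //.
- exact: cst_continuous.
- exact: continuous_cutoff.
- exact: u1.1.
- exact: uc.1.
Qed.

Lemma linv_resolvent_cvg t f c x : 0 < t -> bounded_uniform c f ->
  linv t n (fun lam => Rl lam f x) @[n --> \oo] --> P t f x.
Proof.
move=> t0 uf; apply/cvgrPdist_le => eta eta0; have eta2 : 0 < eta / 2 by rewrite divr_gt0.
have [h h0 hP] := semigroup_near uf eta2.
have [N NP] := linv_uniform c t0 h0 eta2.
exists N => // n /= Nn; rewrite distrC [in leRHS](splitr eta).
have bG := semigroup_bounded_meas x uf.
apply: (NP n Nn (eta / 2) (P t f x) (fun s => P s f x)) => //; first exact: ltW.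
  by have [_] := bG; apply; exact: ltW.
by move=> s s0 st; apply: hP => //; exact: ltW.
Qed.

(** A bound uniform in the order [n] of the inversion, to dominate the integrals in [x] as [n]
    grows. *)
Lemma linv_resolvent_decay t f c b C : 0 < t -> bounded_uniform c f -> decay_class b C f ->
  exists N K, forall n x, (N <= n)%N -> `|linv t n (fun lam => Rl lam f x)| <= K * decay b x.
Proof.
move=> t0 uf fC; have C0 := decay_class_ge0 fC; have [cf fD] := fC.
have [K K0 KP] := semigroup_decay b (ltr01 : 0 < (1 : R)).
have [N NP] := linv_exp_bound t0.
exists N, (C * K * (2 / expR (- t))) => n x Nn; rewrite mulrAC [C * K * _]mulrAC.
apply: (NP n Nn (fun s => P s f x) c); first exact: semigroup_bounded_meas.
  by rewrite !mulr_ge0 ?decay_ge0.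
by move=> s s0; have := KP s f C x s0 cf C0 fD; rewrite mul1r !mulrA.
Qed.

End brownian_bounds.

(** * Strong convergence *)

(** Exchange of limits by a three-part estimate: the approximation [u'] may depend on [eta], but its
    error must be eventually uniform in [i]. *)
Lemma cvg_approx {R : realType} {I : Type} (F : set_system I) {FF : Filter F} (u : I -> R) (l : R) :
  (forall eta, 0 < eta -> exists u' l', [/\ u' i @[i --> F] --> l',
     \forall i \near F, `|u i - u' i| <= eta & `|l - l'| <= eta]) -> u i @[i --> F] --> l.
Proof.
move=> H; apply/cvgrPdist_le => eta eta0; have eta3 : 0 < eta / 3 by rewrite divr_gt0.
have [u' [l' [/cvgrPdist_le/(_ _ eta3) c1 c2 c3]]] := H _ eta3.
near=> i.
have h1 : `|l' - u' i| <= eta / 3 by near: i.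
have h2 : `|u i - u' i| <= eta / 3 by near: i.
have := ler_normD (l - l') (l' - u' i + (u' i - u i)); have := ler_normD (l' - u' i) (u' i - u i).
rewrite (distrC (u' i)) (_ : l - l' + _ = l - u i); last by ring.
by lra.
Unshelve. all: by end_near.
Qed.

Lemma ereal_cvg0 {R : realType} {I : Type} (F : set_system I) {FF : Filter F} (u : I -> \bar R) :
  (forall i, (0 <= u i)%E) -> (forall eta : R, 0 < eta -> \forall i \near F, (u i <= eta%:E)%E) ->
  u i @[i --> F] --> 0%E.
Proof.
move=> u0 H; apply: cvg_EFin.
  by have := H 1 ltr01; apply: filterS => i ui; rewrite ge0_fin_numE// (le_lt_trans ui)// ltry.
apply/cvgrPdist_le => eta eta0; have := H eta eta0; apply: filterS => i ui; rewrite sub0r normrN /=.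
by case: (u i) (u0 i) ui => //= x; rewrite !lee_fin => x0; rewrite ger0_norm.
Qed.

Lemma Lfun2B {R : realType} d (T : measurableType d) (nu : {measure set T -> \bar R}) (f g : T -> R) :
  f \in Lfun nu 2%:E -> g \in Lfun nu 2%:E -> (fun x => f x - g x) \in Lfun nu 2%:E.
Proof.
move=> f2 g2; have [mf _] := (Lfun2P _ _).1 f2; have [mg _] := (Lfun2P _ _).1 g2.
apply/Lfun2P; split; first exact: measurable_funB.
have i := integrableD measurableT (integrableB measurableT (Lfun2_mulP f2 f2) (integrableZl measurableT 2 (Lfun2_mulP f2 g2)))
  (Lfun2_mulP g2 g2).
have /integrableP[_] := i; apply: le_lt_trans; apply: ge0_le_integralT => x; first by rewrite lee_fin sqr_ge0.
rewrite (le_trans _ (lee_abs _))//= lee_fin; apply: eq_leW; ring.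
Qed.

(** * Integrability of decaying functions *)

Section decay_L2.
Context {R : realType} {d : nat}.
Variable nu : {measure set 'rV[R]_d -> \bar R}.
Implicit Types h : 'rV[R]_d -> R.

Lemma decay_class_measurable b C h : decay_class b C h -> measurable_fun setT h.
Proof. by move=> [ch _]; exact: continuous_measurable_rV. Qed.

Lemma decay_class_sqr b C h : decay_class b C h -> decay_class (2 * b) (C ^+ 2) (fun x => h x ^+ 2).
Proof.
move=> [ch hC]; split=> [x|x].
  by rewrite /continuous_at; under eq_fun do rewrite expr2; apply: (@continuousM _ 'rV[R]_d h h x); exact: ch.
rewrite normrX (le_trans (lerXn2r 2 _ _ (hC x)))// ?nnegrE ?(le_trans _ (hC x))//.
by rewrite exprMn expr2 [decay b x ^+ 2]expr2 decayM mulrDl mul1r.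
Qed.

Lemma decay_class_sqr_le b C h : decay_class b C h ->
  (\int[nu]_x (h x ^+ 2)%:E <= (C ^+ 2)%:E * \int[nu]_x (decay (2 * b) x)%:E)%E.
Proof.
move=> hC; have C0 := decay_class_ge0 hC; have [_ hs] := decay_class_sqr hC.
have md : measurable_fun setT (fun x : 'rV[R]_d => (decay (2 * b) x)%:E) by apply/measurable_EFinP; exact: measurable_decay.
have ZE := @ge0_integralZl _ _ _ nu setT measurableT _ md (C ^+ 2)%:E.
rewrite -ZE; first last.
- by rewrite lee_fin sqr_ge0.
- by move=> x _; rewrite lee_fin decay_ge0.
apply: ge0_le_integralT => x; first by rewrite lee_fin sqr_ge0.
by rewrite -EFinM lee_fin (le_trans (ler_norm _))// hs.
Qed.

Lemma decay_class_L2 b C h : decay_class b C h -> (\int[nu]_x (decay (2 * b) x)%:E < +oo)%E ->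
  h \in Lfun nu 2%:E.
Proof.
move=> hC fin; apply/Lfun2P; split; first exact: decay_class_measurable hC.
apply: le_lt_trans (decay_class_sqr_le hC) _; rewrite lte_mul_pinfty ?lee_fin ?sqr_ge0//.
Qed.

Lemma decay_classM b C h (L : R) : decay_class b C h -> decay_class b C (fun x => h x * cutoff L x).
Proof.
move=> [ch hC]; split=> x; first by apply: (@continuousM _ 'rV[R]_d h (cutoff L)); [exact: ch|exact: continuous_cutoff].
have /andP[c0 c1] := cutoff01 L x.
by rewrite normrM (ger0_norm c0) (le_trans _ (hC x))// ler_piMr.
Qed.

Lemma decay_class_tail b C h (p L : R) : decay_class b C h -> 0 <= p -> 0 <= L ->
  decay_class (b - p) (C * (1 + L) `^ (- p)) (fun x => h x * (1 - cutoff L x)).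
Proof.
move=> hC p0 L0; have C0 := decay_class_ge0 hC; have [ch hD] := hC; split=> x.
  apply: (@continuousM _ 'rV[R]_d h (fun x => 1 - cutoff L x)); first exact: ch.
  by apply: (@continuousB _ R^o 'rV[R]_d (fun=> 1) (cutoff L)); [exact: cst_continuous|exact: continuous_cutoff].
have /andP[c0 c1] := cutoff01 L x.
rewrite normrM [`|1 - _|]ger0_norm ?subr_ge0//.
have -> : C * (1 + L) `^ (- p) * decay (b - p) x = (C * decay b x) * ((1 + L) `^ (- p) * decay (- p) x).
  by rewrite -decayM; ring.
by apply: ler_pM => //; rewrite ?subr_ge0//; exact: cutoff_tail.
Qed.

Lemma decay_classZ b C k h : decay_class b C h ->
  decay_class b (`|k| * C) (fun x => k * h x).
Proof.
move=> [ch hD]; split=> x; last by rewrite normrM -mulrA ler_wpM2l.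
by apply: (@continuousM _ 'rV[R]_d (fun=> k) h); [exact: cst_continuous|exact: ch].
Qed.

Lemma Cc_decay_class (b : R) (phi : 'rV[R]_d -> R) : Cc phi -> exists C, decay_class b C phi.
Proof.
move=> cphi; have [c cP] := Cc_bounded cphi; have [r rP] := Cc_support cphi.
have c0 : 0 <= c by exact: le_trans (cP 0).
exists (c * (1 + `|r|) `^ `|b|); split=> [x|x]; first by have [+ _] := cphi; exact.
have [rx|xr] := ltP r `|x|; first by rewrite rP// normr0 !mulr_ge0 ?powR_ge0.
rewrite (le_trans (cP x))// -mulrA ler_peMr//.
have x1 : 1 <= 1 + `|x| by rewrite lerDl.
have x0 : 0 < 1 + `|x| by rewrite ltr_pwDl.
apply: (@le_trans _ _ ((1 + `|x|) `^ `|b| * decay b x)).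
  rewrite /decay -powRD; last by apply/implyP => _; rewrite gt_eqF.
  by have := ler_powR x1 (_ : 0 <= `|b| - b); rewrite powRr0; apply; rewrite subr_ge0 ler_norm.
rewrite ler_wpM2r ?decay_ge0//; apply: ge0_ler_powR => //; rewrite ?nnegrE ?addr_ge0//.
by rewrite lerD2l (le_trans xr)// ler_norm.
Qed.

Lemma cutoff_error_L2 h g (L : R) : h \in Lfun nu 2%:E -> g \in Lfun nu 2%:E ->
  (fun x => h x * cutoff L x) \in Lfun nu 2%:E -> (fun x => h x * (1 - cutoff L x)) \in Lfun nu 2%:E ->
  `|\int[nu]_x (h x * g x) - \int[nu]_x (h x * cutoff L x * g x)| <=
  Num.sqrt (\int[nu]_x ((h x * (1 - cutoff L x)) ^+ 2)) * Num.sqrt (\int[nu]_x (g x ^+ 2)).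
Proof.
move=> h2 g2 h2c h2t; apply: le_trans (cauchy_schwarz h2t g2).
rewrite -RintegralB//; last 2 first.
- exact: Lfun2_mulP.
- by have := Lfun2_mulP h2c g2.
apply: eq_leW; congr `| _ |; apply: eq_Rintegral => x _; ring.
Qed.

Lemma Rintegral_sqr_le h (B : R) : h \in Lfun nu 2%:E -> (\int[nu]_x (h x ^+ 2)%:E <= B%:E)%E ->
  \int[nu]_x (h x ^+ 2) <= B.
Proof. by move=> h2; rewrite -lee_fin Rintegral_sqr. Qed.

Lemma decay_class_norm b C h : decay_class b C h -> decay_class b C (fun x => `|h x|).
Proof.
move=> [ch hD]; split=> x; last by rewrite normr_id.
by apply: (@continuous_comp _ _ R^o h Num.norm); [exact: ch|exact: norm_continuous].
Qed.

Lemma decay_class_L1_le b C B h : decay_class b C h -> (\int[nu]_x (decay b x)%:E <= B%:E)%E ->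
  (\int[nu]_x `|h x|%:E <= (C * B)%:E)%E.
Proof.
move=> hC nB; have C0 := decay_class_ge0 hC; have [_ hD] := hC.
have md : measurable_fun setT (fun x : 'rV[R]_d => (decay b x)%:E) by apply/measurable_EFinP; exact: measurable_decay.
have ZE := @ge0_integralZl _ _ _ nu setT measurableT _ md C%:E.
apply: (@le_trans _ _ (C%:E * \int[nu]_x (decay b x)%:E)%E); last by rewrite [leRHS]EFinM lee_wpmul2l ?lee_fin.
rewrite -ZE; first last.
- by rewrite lee_fin.
- by move=> x _; rewrite lee_fin decay_ge0.
by apply: ge0_le_integralT => x; rewrite ?lee_fin// -EFinM lee_fin hD.
Qed.

Lemma decay_class_integrable b C B h : decay_class b C h -> (\int[nu]_x (decay b x)%:E <= B%:E)%E ->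
  nu.-integrable setT (EFin \o h) /\ `|\int[nu]_x h x| <= C * B.
Proof.
move=> hC nB; have L1 := decay_class_L1_le hC nB.
have i : nu.-integrable setT (EFin \o h).
  apply/integrableP; split; first by apply/measurable_EFinP; exact: decay_class_measurable hC.
  by rewrite (le_lt_trans L1)// ltry.
split=> //; rewrite -lee_fin; apply: le_trans L1; rewrite /Rintegral.
rewrite -abse_EFin fineK; last exact: integrable_fin_num.
by apply: le_abse_integral => //; have [] := integrableP _ _ _ i.
Qed.

End decay_L2.

(** * Strong convergence for decaying functions *)

Section decaying_convergence.
Context {R : realType} {d : nat}.
Variables (m : lfmeasure R d) (c : R).
Local Notation M e := (rescaled m e).
Local Notation leb := (lebesgue_rV d).
Hypothesis c0 : 0 <= c.
Hypothesis vague : forall phi, Cc phi ->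
  \int[M e]_x phi x @[e --> 0^'+] --> c * \int[leb]_x phi x.
Hypothesis decay_mass : forall g : R, d%:R < g -> exists B, [/\ 0 <= B,
  \forall e \near 0^'+, (\int[M e]_x (decay g x)%:E <= B%:E)%E,
  (\int[leb]_x (decay g x)%:E <= B%:E)%E &
  forall e, 0 < e -> (\int[M e]_x (decay g x)%:E < +oo)%E].
Implicit Types (h : 'rV[R]_d -> R) (v g : R -> 'rV[R]_d -> R).

Let pos_near : \forall e \near 0^'+, 0 < e :> R. Proof. exact: nbhs_right_gt. Qed.

Let d2 (b : R) : d%:R / 2 < b -> d%:R < 2 * b. Proof. by rewrite ltr_pdivrMr// mulrC. Qed.

(** Half of the spare exponent [g - d] pays for the smallness of the tail beyond the cutoff; the
    other half keeps the tail integrable uniformly in the scale. *)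
Lemma decay_vague (g C : R) h : d%:R < g -> decay_class g C h ->
  \int[M e]_x h x @[e --> 0^'+] --> c * \int[leb]_x h x.
Proof.
move=> dg hC; have C0 := decay_class_ge0 hC; pose p := (g - d%:R) / 2.
have p0 : 0 < p by rewrite divr_gt0// subr_gt0.
have dgp : d%:R < g - p by rewrite /p; lra.
have [B [B0 Bn Bl _]] := decay_mass dgp; have [Bg [_ Bgn Bgl _]] := decay_mass dg.
apply: cvg_approx => eta eta0.
have A0 : 0 <= C * B * (1 + c) by rewrite !mulr_ge0// addr_ge0.
have [L L0 LP] := small_power p0 A0 eta0.
have hT := decay_class_tail hC (ltW p0) L0; have hM := decay_classM L hC.
set q := _ `^ _ in LP hT.
have q0 : 0 <= C * q * B by rewrite !mulr_ge0// powR_ge0.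
have LE : C * B * (1 + c) * q = C * q * B + c * (C * q * B) by ring.
rewrite LE in LP; have cq := mulr_ge0 c0 q0.
have err (nu : {measure set 'rV[R]_d -> \bar R}) : (\int[nu]_x (decay g x)%:E <= Bg%:E)%E ->
    (\int[nu]_x (decay (g - p) x)%:E <= B%:E)%E ->
    `|\int[nu]_x h x - \int[nu]_x (h x * cutoff L x)| <= C * q * B.
  move=> n1 n2; have [i1 _] := decay_class_integrable hC n1; have [i2 _] := decay_class_integrable hM n1.
  have [_] := decay_class_integrable hT n2; apply: le_trans.
  rewrite -RintegralB//; apply: eq_leW; congr `| _ |.
  by apply: eq_Rintegral => x _; ring.
exists (fun e => \int[M e]_x (h x * cutoff L x)), (c * \int[leb]_x (h x * cutoff L x)); split.
- by apply: vague; apply: Cc_cutoffM; have [] := hC.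
- near=> e; apply: (@le_trans _ _ (C * q * B)); last by rewrite (le_trans _ LP)// lerDl.
  by apply: err; near: e.
- rewrite -mulrBr normrM (ger0_norm c0) (le_trans (ler_wpM2l c0 (err _ Bgl Bl)))//.
  by rewrite (le_trans _ LP)// lerDr.
Unshelve. all: by end_near.
Qed.

Lemma decay_class_family b C h : d%:R / 2 < b -> decay_class b C h ->
  (forall e, 0 < e -> h \in Lfun (M e) 2%:E) /\ h \in Lfun leb 2%:E.
Proof.
move=> /d2 db hC; have [B [B0 _ Bl Be]] := decay_mass db; split=> [e e0|].
  exact: (decay_class_L2 hC (Be e e0)).
by apply: (decay_class_L2 hC); exact: le_lt_trans Bl (ltry _).
Qed.

(** Replaces the upper limit of the norms, as an infimum of suprema, by an eventual bound on the
    integral of the square. *)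
Lemma L2_bounded_familyP v : L2_bounded_family m v <->
  (forall e, 0 < e -> v e \in Lfun (M e) 2%:E) /\
  exists B, \forall e \near 0^'+, \int[M e]_x (v e x ^+ 2) <= B.
Proof.
have NE e : 0 < e -> v e \in Lfun (M e) 2%:E ->
    'N[M e]_2%:E[EFin \o v e]%E = (Num.sqrt (\int[M e]_x (v e x ^+ 2)))%:E.
  move=> e0 v2; have [mv _] := (Lfun2P _ _).1 v2.
  rewrite Lnorm2E// -Rintegral_sqr// poweR_EFin powR12_sqrt//; exact: Rintegral_sqr_ge0.
split=> [[v2 lim]|[v2 [B BP]]]; split=> //.
  have [y [U FU <-] yoo] := ereal_inf_lt lim.
  exists (fine (ereal_sup ((fun e => 'N[M e]_2%:E[EFin \o v e]%E) @` U)) ^+ 2).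
  near=> e.
  have e0 : 0 < e by near: e.
  have Ue : U e by near: e.
  have le : ((Num.sqrt (\int[M e]_x (v e x ^+ 2)))%:E <= ereal_sup ((fun e => 'N[M e]_2%:E[EFin \o v e]%E) @` U))%E.
    by rewrite -(NE _ e0 (v2 e e0)); apply: ereal_sup_ubound; exists e.
  move: yoo le; case: (ereal_sup _) => [z|//|//] _; rewrite lee_fin /= => le.
  rewrite -[leLHS]sqr_sqrtr ?Rintegral_sqr_ge0//.
  by rewrite lerXn2r ?nnegrE ?sqrtr_ge0// (le_trans (sqrtr_ge0 _) le).
apply: (@le_lt_trans _ _ (Num.sqrt B)%:E); last exact: ltry.
apply: ge_ereal_inf; exists (ereal_sup ((fun e => 'N[M e]_2%:E[EFin \o v e]%E) @`
    [set e | 0 < e /\ \int[M e]_x (v e x ^+ 2) <= B])).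
  exists [set e | 0 < e /\ \int[M e]_x (v e x ^+ 2) <= B] => //.
  by near=> e; split; near: e.
apply: ge_ereal_sup => _ [e [e0 eB] <-]; rewrite (NE _ e0 (v2 e e0)) lee_fin.
by rewrite ler_wsqrtr.
Unshelve. all: by end_near.
Qed.

Lemma decay_class_bounded b C h : d%:R / 2 < b -> decay_class b C h -> L2_bounded_family m (fun=> h).
Proof.
move=> db hC; have [f2 _] := decay_class_family db hC; have [B [B0 Bn _ _]] := decay_mass (d2 db).
apply/L2_bounded_familyP; split=> //; exists (C ^+ 2 * B); near=> e.
have e0 : 0 < e by near: e.
apply: Rintegral_sqr_le; first exact: f2.
apply: (le_trans (decay_class_sqr_le _ hC)); rewrite [leRHS]EFinM lee_wpmul2l ?lee_fin ?sqr_ge0//.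
by near: e.
Unshelve. all: by end_near.
Qed.

Lemma decay_class_mul_Cc b C h phi : decay_class b C h -> Cc phi ->
  exists C', decay_class (d%:R + 1) C' (fun x => h x * phi x).
Proof.
move=> hC cphi; have [C' [cp pC]] := Cc_decay_class (d%:R + 1 - b) cphi; have [ch hD] := hC.
exists (C * C'); split=> x; first by apply: (@continuousM _ 'rV[R]_d h phi); [exact: ch|exact: cp].
rewrite normrM (_ : d%:R + 1 = b + (d%:R + 1 - b)); last by ring.
by rewrite -decayM mulrACA ler_pM.
Qed.

Lemma weak_self b C h : d%:R / 2 < b -> decay_class b C h -> weak_cvg m c (fun=> h) h.
Proof.
move=> db hC; have [_ h2] := decay_class_family db hC; split=> //; first exact: decay_class_bounded hC.
move=> phi cphi; have [C' hD] := decay_class_mul_Cc hC cphi.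
by apply: decay_vague hD; rewrite ltrDl.
Qed.

(** The product with a cutoff is a legitimate test function for the weak convergence of [g]; the
    rest is small in L^2 uniformly in the scale, and the norms of [g] are bounded. *)
Lemma strong_self b C h : d%:R / 2 < b -> decay_class b C h -> strong_cvg m c (fun=> h) h.
Proof.
move=> db hC; have [h2 h2l] := decay_class_family db hC; split=> //; first exact: decay_class_bounded hC.
move=> g g0 [/L2_bounded_familyP[g2 [Bg BgP]] g02 gw].
have C0 := decay_class_ge0 hC.
(* Then [b - p] is still above [d / 2], so the square of the tail is integrable. *)
pose p := (2 * b - d%:R) / 4.
have p0 : 0 < p by rewrite divr_gt0// subr_gt0 d2.
have dbp : d%:R / 2 < b - p by rewrite /p; have := d2 db; lra.
have [B [B0 Bn Bl _]] := decay_mass (d2 dbp).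
apply: cvg_approx => eta eta0.
pose G0 := \int[leb]_x (g0 x ^+ 2).
pose th := eta / (1 + Num.sqrt `|Bg| + c * Num.sqrt G0).
have den : 0 < 1 + Num.sqrt `|Bg| + c * Num.sqrt G0.
  by rewrite ltr_wpDr ?mulr_ge0 ?sqrtr_ge0// ltr_wpDr ?sqrtr_ge0.
have th0 : 0 < th by rewrite divr_gt0.
have CB : 0 <= C ^+ 2 * B by rewrite mulr_ge0 ?sqr_ge0.
have p2 : 0 < 2 * p by rewrite mulr_gt0.
have [L L0 LP] := small_power p2 CB (exprn_gt0 2 th0).
have hT := decay_class_tail hC (ltW p0) L0; have hM := decay_classM L hC.
have [hT2 hT2l] := decay_class_family dbp hT; have [hM2 hM2l] := decay_class_family db hM.
have tl nu : (fun x => h x * (1 - cutoff L x)) \in Lfun nu 2%:E ->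
    (\int[nu]_x (decay (2 * (b - p)) x)%:E <= B%:E)%E ->
    Num.sqrt (\int[nu]_x ((h x * (1 - cutoff L x)) ^+ 2)) <= th.
  move=> hn2 nB; rewrite -[leRHS]ger0_norm ?(ltW th0)// -sqrtr_sqr ler_wsqrtr// (le_trans _ LP)//.
  apply: Rintegral_sqr_le => //; apply: (le_trans (decay_class_sqr_le _ hT)).
  rewrite exprMn (_ : ((1 + L) `^ (- p)) ^+ 2 = (1 + L) `^ (- (2 * p))); last first.
    by rewrite -powR_mulrn ?powR_ge0// -powRrM; congr (_ `^ _); ring.
  by rewrite [X in (_ <= X%:E)%E]mulrAC [leRHS]EFinM lee_wpmul2l ?lee_fin ?mulr_ge0 ?sqr_ge0 ?powR_ge0.
exists (fun e => \int[M e]_x (h x * cutoff L x * g e x)), (c * \int[leb]_x (h x * cutoff L x * g0 x)); split.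
- have /gw : Cc (fun x => h x * cutoff L x) by apply: Cc_cutoffM; have [] := hC.
  rewrite (_ : \int[leb]_x (h x * cutoff L x * g0 x) = \int[leb]_x (g0 x * (h x * cutoff L x))); last first.
    by apply: eq_Rintegral => x _; rewrite mulrC.
  apply: cvg_trans; apply: near_eq_cvg; near=> e.
  by apply: eq_Rintegral => x _; rewrite mulrC.
- near=> e.
  have e0 : 0 < e by near: e.
  apply: (le_trans (cutoff_error_L2 (h2 e e0) (g2 e e0) (hM2 e e0) (hT2 e e0))).
  have t1 := tl _ (hT2 e e0).
  apply: (@le_trans _ _ (th * Num.sqrt `|Bg|)).
    apply: ler_pM; rewrite ?sqrtr_ge0//; first by apply: t1; near: e.
    by rewrite ler_wsqrtr// (@le_trans _ _ Bg) ?ler_norm//; near: e.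
  rewrite /th mulrAC ler_pdivrMr// ler_wpM2l ?(ltW eta0)//.
  have := sqrtr_ge0 G0; have := sqrtr_ge0 `|Bg|; move: (Num.sqrt _) (Num.sqrt G0) => x y x0 y0.
  have := mulr_ge0 c0 y0; lra.
- rewrite -mulrBr normrM (ger0_norm c0).
  apply: (le_trans (ler_wpM2l c0 (cutoff_error_L2 h2l g02 hM2l hT2l))).
  have t1 := tl _ hT2l Bl; rewrite -/G0.
  apply: (@le_trans _ _ (c * (th * Num.sqrt G0))).
    by rewrite ler_wpM2l// ler_wpM2r ?sqrtr_ge0.
  rewrite mulrCA /th mulrAC ler_pdivrMr// ler_wpM2l ?(ltW eta0)//.
  have := sqrtr_ge0 G0; have := sqrtr_ge0 `|Bg|; move: (Num.sqrt _) (Num.sqrt G0) => x y x0 y0.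
  have := mulr_ge0 c0 y0; lra.
Unshelve. all: by end_near.
Qed.

Lemma strong_weak v (v0 : 'rV[R]_d -> R) : strong_cvg m c v v0 -> weak_cvg m c v v0.
Proof.
move=> [bv v02 vs]; split=> // phi cphi.
have [C pC] := Cc_decay_class (d%:R / 2 + 1) cphi.
have : d%:R / 2 < (d%:R / 2 + 1 : R) by rewrite ltrDl.
by move=> /weak_self/(_ pC)/vs.
Qed.

Lemma strong_cvg_norm v (v0 : 'rV[R]_d -> R) (b C : R) : d%:R / 2 < b -> decay_class b C v0 -> strong_cvg m c v v0 ->
  (\int[M e]_x (`|v e x - v0 x| ^+ 2)%:E)%E @[e --> 0^'+] --> 0%E.
Proof.
move=> db vC sv; have [bv v02 vs] := sv; have [v2 _] := (L2_bounded_familyP _).1 bv.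
have [w2 _] := decay_class_family db vC.
(* The square of [v] converges because [v], converging also weakly, may be paired with itself; the
   cross term because the constant family [v0] converges weakly to [v0]. *)
have c1 := vs _ _ (strong_weak sv); have c2 := vs _ _ (weak_self db vC).
have c3 := decay_vague (d2 db) (decay_class_sqr vC).
set l := c * \int[leb]_x (v0 x * v0 x) in c1 c2.
have c3' : \int[M e]_x (v0 x ^+ 2) @[e --> 0^'+] --> l.
  by rewrite (_ : l = c * \int[leb]_x (v0 x ^+ 2)).
have H : (\int[M e]_x (v e x * v e x) - 2 * \int[M e]_x (v e x * v0 x) + \int[M e]_x (v0 x ^+ 2)) @[e --> 0^'+] --> l - 2 * l + l.
  by apply: cvgD => //; apply: cvgB => //; apply: cvgM => //; exact: cvg_cst.
rewrite (_ : l - 2 * l + l = 0) in H; last by ring.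
have {}H : (EFin \o (fun e => \int[M e]_x (v e x * v e x) - 2 * \int[M e]_x (v e x * v0 x) + \int[M e]_x (v0 x ^+ 2))) e @[e --> 0^'+] --> (0 : R)%:E.
  by apply: cvg_EFin => //; near=> x.
apply: cvg_trans H; apply: near_eq_cvg; near=> e.
have e0 : 0 < e by near: e.
have i1 := Lfun2_mulP (v2 e e0) (v2 e e0); have i2 := Lfun2_mulP (v2 e e0) (w2 e e0); have i3 := Lfun2_mulP (w2 e e0) (w2 e e0).
have i2' := integrableZl measurableT 2 i2.
have dif : (fun x => v e x - v0 x) \in Lfun (M e) 2%:E.
  exact: Lfun2B (v2 e e0) (w2 e e0).
have -> : (\int[M e]_x (`|v e x - v0 x| ^+ 2)%:E)%E = (\int[M e]_x ((v e x - v0 x) ^+ 2))%:E.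
  rewrite Rintegral_sqr//; apply: eq_integral => x _; by rewrite real_normK ?num_real.
congr (_%:E).
have E1 : 2 * \int[M e]_x (v e x * v0 x) = \int[M e]_x (2 * (v e x * v0 x)) by rewrite RintegralZl.
rewrite /= E1 -RintegralB// -RintegralD//; last exact: (integrableB measurableT i1 i2').
by apply: eq_Rintegral => x _; ring.
Unshelve. all: by end_near.
Qed.

(* On the complement of the support of a cutoff, |T_e f| is controlled by the
   symmetry of T_e, which moves the operator onto the cutoff. *)
Lemma L1_cvg (T : R -> ('rV[R]_d -> R) -> 'rV[R]_d -> R) (T0 : ('rV[R]_d -> R) -> 'rV[R]_d -> R) (b C : R) f :
  d%:R < b -> decay_class b C f -> (forall e, 0 < e -> markov_operator (M e) (T e)) -> limit_operator T0 ->
  (forall (b' C' : R) h, d%:R / 2 < b' -> decay_class b' C' h -> strong_cvg m c (fun e => T e h) (T0 h)) ->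
  (\int[M e]_x (`|T e f x - T0 f x|)%:E)%E @[e --> 0^'+] --> 0%E.
Proof.
move=> db fC mT [TD TC] sT.
have dge0 : 0 <= d%:R :> R by exact: ler0n.
have d2b : d%:R / 2 < b by lra.
have b0 : 0 < b by lra.
have d2b' : d%:R < 2 * b by lra.
(* To be read with [dd] the difference [|T f - T0 f|], [aa] and [bb] the moduli of its two terms,
   [a'] the value of [T |f|], and [ph] the cutoff. *)
have split_bound (dd aa a' bb ph : R) : 0 <= ph <= 1 -> dd <= aa + bb -> aa <= a' ->
    dd <= dd * ph + (a' - a' * ph + bb * (1 - ph)).
  move=> /andP[h1 h2] h3 h4.
  have h5 : (1 - ph) * dd <= (1 - ph) * (a' + bb).
    by rewrite ler_wpM2l ?subr_ge0// (le_trans h3)// lerD2r.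
  by rewrite -subr_ge0 in h5; rewrite -subr_ge0; apply: le_trans h5 _; apply: eq_leW; ring.
have sum4 (u1 u2 eta : R) : 0 < eta -> u1 + u2 <= eta / 4 -> eta / 4 + (u1 + eta / 4 + u2) <= eta by lra.
have C0 := decay_class_ge0 fC; have uf := decay_bounded_uniform b0 fC.
pose p := (b - d%:R) / 2.
have p0 : 0 < p by rewrite divr_gt0// subr_gt0.
have dbp : d%:R < b - p by rewrite /p; lra.
have [B [B0 Bn Bl Be]] := decay_mass dbp.
have [Bb [Bb0 _ Bbl Bbe]] := decay_mass db.
have [K K0 KP] := TD b; have [K' K'0 K'P] := TD (- p).
have T0f := KP C C f uf fC.
have fN := decay_class_norm fC.
have [f2 f2l] := decay_class_family d2b fC.
have [fn2 fn2l] := decay_class_family d2b fN.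
apply: ereal_cvg0 => [e|eta eta0]; first by apply: integral_ge0 => x _; rewrite lee_fin.
have A0 : 0 <= C * B * (K + c * K') by rewrite !mulr_ge0// addr_ge0// mulr_ge0.
have eta4 : 0 < eta / 4 by rewrite divr_gt0.
have [L L0 LP] := small_power p0 A0 eta4.
pose phi : 'rV[R]_d -> R := cutoff L.
pose q := (1 + L) `^ (- p).
have q0 : 0 <= q by exact: powR_ge0.
have phi01 x : 0 <= phi x <= 1 by exact: cutoff01.
have phiC := @cutoff_decay R d b L (ltW b0) L0.
have [phi2 phi2l] := decay_class_family d2b phiC.
have uphi := @cutoff_bounded_uniform R d L L0.
have lphi := sT _ _ _ d2b phiC; have [_ Tphi2l lphis] := lphi.
have l1 := lphis _ _ (weak_self d2b fN).
have l2 := decay_vague db fN.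
have l3 := strong_cvg_norm (v0 := T0 f) d2b T0f (sT _ _ _ d2b fC).
have l4 := decay_vague d2b' (decay_class_sqr phiC).
set Phi := c * _ in l4.
have Phi0 : 0 <= Phi by rewrite mulr_ge0// Rintegral_sqr_ge0.
have ccut : decay_class (- p) q (fun x => 1 - phi x).
  split=> x.
    by apply: (@continuousB _ R^o 'rV[R]_d (fun=> 1) phi); [exact: cst_continuous|exact: continuous_cutoff].
  have /andP[h1 h2] := phi01 x; rewrite ger0_norm ?subr_ge0//; apply: cutoff_tail => //; exact: ltW.
have ucc := @cocutoff_bounded_uniform R d L L0.
have T0cc := K'P q 1 _ ucc ccut.
(* The limiting mass that [T0] sends far away. Since [1 - T0 phi = T0 (1 - phi)] is a small constant
   times a weight growing like the power [p], its product with [|f|] still decays with exponent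
   [b - p > d]. *)
have limB : c * \int[leb]_x `|f x| - c * \int[leb]_x (T0 phi x * `|f x|) <= c * (C * (q * K') * B).
  have [i1 _] := decay_class_integrable fN Bbl.
  rewrite -mulrBr ler_wpM2l// -RintegralB//; last exact: (Lfun2_mulP Tphi2l fn2l).
  have fT : decay_class (b - p) (C * (q * K')) (fun x => `|f x| * T0 (fun y => 1 - phi y) x).
    have [cT DT] := T0cc; have [cf Df] := fN; split=> x.
      by apply: (@continuousM _ 'rV[R]_d (fun x => `|f x|) (T0 (fun y => 1 - phi y))); [exact: cf|exact: cT].
    by rewrite normrM -decayM mulrACA ler_pM.
  have [_ le] := decay_class_integrable fT Bl.
  apply: le_trans le; rewrite (le_trans _ (ler_norm _))//; apply: eq_leW.
  by apply: eq_Rintegral => x _; rewrite TC// mulrBr mulr1 [T0 phi x * _]mulrC.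
(* The threshold for the square of the difference which, by Cauchy-Schwarz against [phi] of square
   mass at most [Phi + 1], gives [eta / 4]. *)
have th0 : 0 < (eta / 4) ^+ 2 / (Phi + 1) by rewrite divr_gt0 ?exprn_gt0// ltr_wpDl.
have n3 : \forall e \near 0^'+, (\int[M e]_x (`|T e f x - T0 f x| ^+ 2)%:E <= ((eta / 4) ^+ 2 / (Phi + 1))%:E)%E.
  have /fine_cvgP[fl] := l3; move/cvgrPdist_le => /(_ _ th0) /= l3'.
  near=> e.
  have h1 : (\int[M e]_x (`|T e f x - T0 f x| ^+ 2)%:E)%E \is a fin_num by near: e.
  rewrite -(fineK h1) lee_fin (le_trans (ler_norm _))// -normrN -sub0r; near: e; exact: l3'.
have n4 : \forall e \near 0^'+, \int[M e]_x (phi x ^+ 2) <= Phi + 1.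
  move/cvgrPdist_le: l4 => /(_ _ ltr01); apply: filterS => e; rewrite distrC => h.
  by rewrite -lerBlDl (le_trans (ler_norm _)).
have n12 : \forall e \near 0^'+, \int[M e]_x `|f x| - \int[M e]_x (T e phi x * `|f x|) <=
    c * \int[leb]_x `|f x| - c * \int[leb]_x (T0 phi x * `|f x|) + eta / 4.
  have : (\int[M e]_x `|f x| - \int[M e]_x (T e phi x * `|f x|)) @[e --> 0^'+] -->
      c * \int[leb]_x `|f x| - c * \int[leb]_x (T0 phi x * `|f x|) by exact: cvgB.
  move=> /cvgrPdist_le/(_ _ eta4); apply: filterS => e; rewrite distrC => h.
  by rewrite -lerBlDl (le_trans (ler_norm _)).
near=> e.
have e0 : 0 < e by near: e.
have [ma na _ aL2 _] := mT e e0 f C uf.1; have {}aL2 := aL2 (f2 e e0).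
have fc1 x : `|(`|f x|)| <= C + 1 by rewrite normr_id (le_trans (uf.1 x))// lerDl.
have phc1 x : `|phi x| <= C + 1 by rewrite (le_trans (uphi.1 x))// lerDr.
have [ma' _ mass a'L2 sym] := mT e e0 (fun x => `|f x|) (C + 1) fc1.
have {}a'L2 := a'L2 (fn2 e e0); have {}sym := sym (fn2 e e0) phi phc1 (phi2 e e0).
have {}mass := mass (fun x => normr_ge0 (f x)) (decay_class_measurable fN).
have a'0 x : 0 <= T e (fun y => `|f y|) x by exact: le_trans (normr_ge0 _) (na x).
have [T0f2 _] := decay_class_family d2b T0f; have {}T0f2 := T0f2 e e0.
have mphi : measurable_fun setT phi by exact: decay_class_measurable phiC.
have mT0f : measurable_fun setT (T0 f) by exact: decay_class_measurable T0f.
pose Be' := fine (\int[M e]_x (decay b x)%:E)%E.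
have Be'P : (\int[M e]_x (decay b x)%:E <= Be'%:E)%E.
  by rewrite /Be' fineK// ge0_fin_numE ?Bbe//; apply: integral_ge0 => x _; rewrite lee_fin decay_ge0.
have [fi _] := decay_class_integrable fN Be'P.
have a'i : (M e).-integrable setT (EFin \o T e (fun y => `|f y|)).
  apply/integrableP; split; first exact/measurable_EFinP.
  have -> : (\int[M e]_x `|(EFin \o T e (fun y => `|f y|)%R) x| = \int[M e]_x (`|f x|)%:E)%E.
    by rewrite -mass; apply: eq_integral => x _; rewrite /= ger0_norm.
  by rewrite (le_lt_trans (decay_class_L1_le fC Be'P))// ltry.
have difL2 := Lfun2B aL2 T0f2.
have ndif : (fun x => `|T e f x - T0 f x|) \in Lfun (M e) 2%:E.
  have [md fd] := (Lfun2P _ _).1 difL2; apply/Lfun2P; split; first exact: measurableT_comp.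
  by under eq_integral do rewrite real_normK ?num_real//.
(* The difference is bounded by [X + Yy + Z]: the difference near the origin, the mass of [T |f|]
   far away, and the tail of the limit. *)
pose X x := `|T e f x - T0 f x| * phi x.
pose Yy x := T e (fun y => `|f y|) x - T e (fun y => `|f y|) x * phi x.
pose Z x := `|T0 f x * (1 - phi x)|.
have X0 x : 0 <= X x by rewrite mulr_ge0//; have /andP[] := phi01 x.
have Y0 x : 0 <= Yy x by rewrite /Yy subr_ge0 ler_piMr//; have /andP[] := phi01 x.
have Z0 x : 0 <= Z x by rewrite normr_ge0.
have mX : measurable_fun setT (fun x => (X x)%:E).
  by apply/measurable_EFinP; apply: measurable_funM => //; apply: measurableT_comp => //; exact: measurable_funB.
have mY : measurable_fun setT (fun x => (Yy x)%:E).
  by apply/measurable_EFinP; apply: measurable_funB => //; exact: measurable_funM.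
have mZ : measurable_fun setT (fun x => (Z x)%:E).
  apply/measurable_EFinP; apply: measurableT_comp => //; apply: measurable_funM => //.
  exact: measurable_funB.
have bX : (\int[M e]_x (X x)%:E <= (eta / 4)%:E)%E.
  have iX := Lfun2_mulP ndif (phi2 e e0).
  have -> : (\int[M e]_x (X x)%:E = (\int[M e]_x X x)%:E)%E.
    by rewrite /Rintegral fineK//; exact: integrable_fin_num.
  rewrite lee_fin; apply: (le_trans (ler_norm _)); apply: (le_trans (cauchy_schwarz ndif (phi2 e e0))).
  apply: (@le_trans _ _ (Num.sqrt ((eta / 4) ^+ 2 / (Phi + 1)) * Num.sqrt (Phi + 1))).
    apply: ler_pM; rewrite ?sqrtr_ge0// ler_wsqrtr//.
      by apply: Rintegral_sqr_le => //; near: e.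
    by near: e.
  rewrite -sqrtrM ?(ltW th0)// divfK; last by rewrite gt_eqF// ltr_wpDl.
  by rewrite sqrtr_sqr ger0_norm// ltW.
have bY : (\int[M e]_x (Yy x)%:E <= (c * (C * (q * K') * B) + eta / 4)%:E)%E.
  have iY := Lfun2_mulP a'L2 (phi2 e e0).
  have -> : (\int[M e]_x (Yy x)%:E = (\int[M e]_x Yy x)%:E)%E.
    rewrite /Rintegral fineK//; apply: integrable_fin_num => //.
    exact: (integrableB measurableT a'i iY).
  rewrite lee_fin RintegralB//.
  have -> : \int[M e]_x T e (fun y => `|f y|) x = \int[M e]_x `|f x| by rewrite /Rintegral mass.
  have -> : \int[M e]_x (T e (fun y => `|f y|) x * phi x) = \int[M e]_x (T e phi x * `|f x|).
    by rewrite sym; apply: eq_Rintegral => x _; rewrite mulrC.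
  apply: (@le_trans _ _ (c * \int[leb]_x `|f x| - c * \int[leb]_x (T0 phi x * `|f x|) + eta / 4)); last by rewrite lerD2r.
  by near: e.
have bZ : (\int[M e]_x (Z x)%:E <= (C * K * q * B)%:E)%E.
  have zt := decay_class_tail T0f (ltW p0) L0; apply: (decay_class_L1_le zt); by near: e.
apply: (@le_trans _ _ (\int[M e]_x ((X x)%:E + ((Yy x)%:E + (Z x)%:E)))%E).
  apply: ge0_le_integralT => x; first by rewrite lee_fin.
  rewrite -!EFinD lee_fin /X /Yy /Z normrM.
  have /andP[_ h1] := phi01 x; rewrite [`|1 - _|]ger0_norm ?subr_ge0//.
  exact: (split_bound _ _ _ _ _ (phi01 x) (ler_normB _ _) (na x)).
have -> : (\int[M e]_x ((X x)%:E + ((Yy x)%:E + (Z x)%:E)) =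
    \int[M e]_x (X x)%:E + (\int[M e]_x (Yy x)%:E + \int[M e]_x (Z x)%:E))%E.
  rewrite ge0_integralD//; last 3 first.
  - by move=> x _; rewrite lee_fin.
  - by move=> x _; rewrite adde_ge0 ?lee_fin.
  - exact: emeasurable_funD.
  congr (_ + _)%E; apply: ge0_integralD => //; by move=> x _; rewrite lee_fin.
apply: (le_trans (leeD bX (leeD bY bZ))); rewrite -!EFinD lee_fin.
have E : C * B * (K + c * K') * q = c * (C * (q * K') * B) + C * K * q * B by ring.
by apply: sum4 => //; rewrite -E.
Unshelve. all: by end_near.
Qed.
End decaying_convergence.

Section linv_integral.
Context {R : realType} {dT : measure_display} {T : measurableType dT}.
Variables (nu : {measure set T -> \bar R}) (K : R -> T -> R) (g : T -> R) (c : R).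
Hypothesis Ki : forall b, 0 < b -> nu.-integrable setT (EFin \o (fun x => K b x * g x)).

Lemma lapdiff_integral n a : 0 < a ->
  nu.-integrable setT (EFin \o (fun x => lapdiff n (fun b => K b x) a * g x)) /\
  lapdiff n (fun b => c * \int[nu]_x (K b x * g x)) a = c * \int[nu]_x (lapdiff n (fun b => K b x) a * g x).
Proof.
elim: n a => [|n IH] a a0 /=; first by split => //; exact: Ki.
have a1 : 0 < a + 1 by rewrite ltr_wpDr.
have [i1 e1] := IH a a0; have [i2 e2] := IH (a + 1) a1.
split; first by apply: eq_integrable (integrableB measurableT i1 i2) => // x _ /=; rewrite -EFinB mulrBl.
rewrite e1 e2 -mulrBr -RintegralB//; congr (c * _); apply: eq_Rintegral => x _; by rewrite mulrBl.
Qed.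

(** At fixed order the inversion is a finite linear combination of values of the transform, so it
    commutes with the integral. *)
Lemma linv_integral t n : 0 < t ->
  linv t n (fun b => c * \int[nu]_x (K b x * g x)) = c * \int[nu]_x (linv t n (fun b => K b x) * g x).
Proof.
move=> t0; have [i e] := lapdiff_integral n (kernel_pt_gt0 n t0).
rewrite /linv e -mulrA; congr (c * _); rewrite mulrC -RintegralZl//.
by apply: eq_Rintegral => x _; rewrite mulrA [_^-1 * _]mulrC.
Qed.

End linv_integral.

Section family_operations.
Context {R : realType} {d : nat}.
Variables (m : lfmeasure R d) (c : R).
Implicit Types v : R -> 'rV[R]_d -> R.
Local Notation M e := (rescaled m e).

Let pos_near : \forall e \near 0^'+, 0 < e :> R. Proof. exact: nbhs_right_gt. Qed.

Lemma strong_scale (k : R) v (v0 : 'rV[R]_d -> R) : strong_cvg m c v v0 ->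
  strong_cvg m c (fun e x => k * v e x) (fun x => k * v0 x).
Proof.
move=> [/L2_bounded_familyP[v2 [B BP]] v02 vs]; split.
- apply/L2_bounded_familyP; split=> [e e0|]; first exact/Lfun2_scale/v2.
  exists (k ^+ 2 * B); near=> e.
  have e0 : 0 < e by near: e.
  have i := Lfun2_mulP (v2 e e0) (v2 e e0).
  have -> : \int[M e]_x ((k * v e x) ^+ 2) = k ^+ 2 * \int[M e]_x (v e x ^+ 2).
    by rewrite -RintegralZl//; apply: eq_Rintegral => x _; rewrite exprMn.
  by rewrite ler_wpM2l ?sqr_ge0//; near: e.
- exact: Lfun2_scale.
move=> g g0 wg; have [/L2_bounded_familyP[g2 _] g02 _] := wg.
have -> : c * \int[lebesgue_rV d]_x (k * v0 x * g0 x) = k * (c * \int[lebesgue_rV d]_x (v0 x * g0 x)).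
  rewrite mulrCA; congr (c * _); rewrite -RintegralZl//; last exact: Lfun2_mulP.
  by apply: eq_Rintegral => x _; rewrite mulrA.
apply: cvg_trans (cvgM (cvg_cst k) (vs _ _ wg)); apply: near_eq_cvg; near=> e.
have e0 : 0 < e by near: e.
rewrite /= -RintegralZl//; last exact: Lfun2_mulP (v2 e e0) (g2 e e0).
by apply: eq_Rintegral => x _; rewrite mulrA.
Unshelve. all: by end_near.
Qed.

(** Used at time 0, where the semigroup returns [f] on the atoms and 0 elsewhere. *)
Lemma strong_cvg_ae v v' (v0 : 'rV[R]_d -> R) : (forall e, 0 < e -> measurable_fun setT (v' e)) ->
  (forall e, 0 < e -> exists N, [/\ measurable N, M e N = 0%E & forall x, ~ N x -> v' e x = v e x]) ->
  strong_cvg m c v v0 -> strong_cvg m c v' v0.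
Proof.
move=> mv' vv' [/L2_bounded_familyP[v2 [B BP]] v02 vs].
have E e (F : R -> 'rV[R]_d -> R) : 0 < e -> measurable_fun setT (fun x => F (v e x) x) ->
    (\int[M e]_x (F (v' e x) x)%:E = \int[M e]_x (F (v e x) x)%:E)%E.
  move=> e0 mF; have [N [mN N0 NP]] := vv' e e0.
  by apply: (integral_null_eq mN N0) => [|x /NP ->//]; exact/measurable_EFinP.
have mv e : 0 < e -> measurable_fun setT (v e) by move=> e0; have [] := (Lfun2P _ _).1 (v2 e e0).
split=> //.
- apply/L2_bounded_familyP; split=> [e e0|].
    have [m2 f2] := (Lfun2P _ _).1 (v2 e e0); apply/Lfun2P; split; first exact: mv'.
    by rewrite (E e (fun y _ => y ^+ 2) e0)//; exact: measurable_funX.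
  exists B; near=> e.
  have e0 : 0 < e by near: e.
  rewrite /Rintegral (E e (fun y _ => y ^+ 2) e0); last by apply: measurable_funX; exact: mv.
  by near: e.
move=> g g0 wg; have [/L2_bounded_familyP[g2 _] g02 _] := wg.
apply: cvg_trans (vs _ _ wg); apply: near_eq_cvg; near=> e.
have e0 : 0 < e by near: e.
rewrite /Rintegral (E e (fun y x => y * g e x) e0)//; apply: measurable_funM; first exact: mv.
by have [] := (Lfun2P _ _).1 (g2 e e0).
Unshelve. all: by end_near.
Qed.

End family_operations.

(** * Convergence of the semigroups and resolvents of the walk *)

Section walk_convergence.
Context {R : realType} {d : nat} {dO dX dB : measure_display}
  {Omega : measurableType dO} {Xi : measurableType dX} {B : measurableType dB}.
Variables (mu : Omega -> lfmeasure R d) (r : Omega -> 'rV[R]_d -> 'rV[R]_d -> R)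
  (Y : nat -> Xi -> 'rV[R]_d) (S : nat -> Xi -> R)
  (Q : Omega -> 'rV[R]_d -> probability Xi R) (w : Omega)
  (PB : probability B R) (W : R -> B -> 'rV[R]_d) (Sigma : 'M[R]_d) (c : R).
Local Notation m := (mu w).
Hypothesis atomic_m : purely_atomic m.
Hypothesis r_ge0 : forall x y, 0 <= r w x y.
Hypothesis rateA : forall x, atoms m x -> (0 < total_rate (atoms m) (r w) x < +oo)%E.
Hypothesis law : forall x, atoms m x -> walk_law Y S (atoms m) (r w) (Q w x) x.
Hypothesis nonexpl : forall x, atoms m x -> non_explosive S (Q w x).
Hypothesis balance : forall x y, atoms m x -> atoms m y -> (m [set x] * (r w x y)%:E = m [set y] * (r w y x)%:E)%E.
Hypothesis bm : brownian PB W Sigma.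
Hypothesis psd : forall a, 0 <= dot a (mulmv Sigma a).
Hypothesis c0 : 0 <= c.
Local Notation M e := (rescaled m e).
Local Notation leb := (lebesgue_rV d).
Hypothesis vague : forall phi, Cc phi ->
  \int[M e]_x phi x @[e --> 0^'+] --> c * \int[leb]_x phi x.
Hypothesis decay_mass : forall g : R, d%:R < g -> exists B, [/\ 0 <= B,
  \forall e \near 0^'+, (\int[M e]_x (decay g x)%:E <= B%:E)%E,
  (\int[leb]_x (decay g x)%:E <= B%:E)%E &
  forall e, 0 < e -> (\int[M e]_x (decay g x)%:E < +oo)%E].
Local Notation Pe := (walk_semigroup mu Y S Q).
Local Notation Re := (walk_resolvent mu Y S Q).
Local Notation Pt := (brownian_semigroup PB W).
Local Notation Rl := (brownian_resolvent PB W).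
Hypothesis homog : forall lambda, 0 < lambda -> forall (fe : R -> 'rV[R]_d -> R) (f : 'rV[R]_d -> R),
  strong_cvg m c fe f -> strong_cvg m c (fun e => Re e w lambda (fe e)) (Rl lambda f).
Implicit Types (f : 'rV[R]_d -> R) (t b C lam : R).

Let pos_near : \forall e \near 0^'+, 0 < e :> R. Proof. exact: nbhs_right_gt. Qed.

Let markovP e (e0 : 0 < e) := walk_semigroup_markov atomic_m r_ge0 rateA law nonexpl balance e0.
Let markovR e (e0 : 0 < e) := walk_resolvent_markov atomic_m r_ge0 rateA law nonexpl balance e0.

(** The first holding time is almost surely positive, so time 0 falls in the stay of index 0, whose
    position is almost surely [x]. *)
Lemma walk_start x : atoms m x -> {ae Q w x, forall xi, walk Y S 0 xi = x}.
Proof.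
move=> mx; have cA := countable_atoms atomic_m.
have [N [mN N0 NP]] := regular_path cA r_ge0 rateA mx (law mx) (nonexpl mx).
have [mY _ lx] := law mx.
have E := lx 0%N (fun=> x) (fun=> 0) (fun=> mx) (fun=> lexx 0).
rewrite eqxx big_ord0 mulr1 in E.
have mY0 : measurable [set xi | Y 0%N xi = x].
  by have := mY 0%N measurableT _ (measurable_set1_rV x); rewrite setTI.
have Y0 : Q w x (~` [set xi | Y 0%N xi = x]) = 0%E.
  rewrite probability_setC// (_ : [set xi | Y 0%N xi = x] = [set xi | (forall i, (i <= 0)%N -> Y i xi = x) /\
                    (forall i, (i < 0)%N -> 0 < S i xi)]).
    by rewrite E subee.
  apply/seteqP; split=> xi /=; last by move=> [h _]; exact: h.
  by move=> h; split=> // i; rewrite leqn0 => /eqP ->.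
exists (N `|` ~` [set xi | Y 0%N xi = x]); split; first by apply: measurableU => //; exact: measurableC.
  by apply: null_set_setU => //; exact: measurableC.
move=> xi /= nw; have [nN|nN] := pselect (N xi); [by left|right] => /= Y0x; apply: nw.
have [_ S0 _] := NP xi nN.
rewrite /walk; case: xgetP => [n _ /= n0|/(_ 0%N)[]]; last by rewrite /= jump_timeS /jump_time big_ord0 add0r lexx S0.
rewrite -Y0x; congr (Y _ xi).
by apply: (occupied_unique S0 n0); rewrite jump_timeS /jump_time big_ord0 add0r lexx S0.
Qed.

Lemma walk_semigroup0 e f z : 0 < e -> atoms m (e^-1 *: z) -> Pe e w 0 f z = f z.
Proof.
move=> e0 mz; rewrite /walk_semigroup; case: asboolP => // _.
have [N [mN N0 NP]] := walk_start mz.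
rewrite mulr0 /Rintegral (integral_null_eq (h := fun=> (f z)%:E) mN N0) => [||xi Nxi].
- by rewrite integral_cst// [X in (_ * X)%E]probability_setT mule1.
- exact: measurable_cst.
congr (_%:E); rewrite (_ : walk Y S 0 xi = e^-1 *: z) ?scalerA ?mulfV ?scale1r ?gt_eqF//.
by apply: contrapT => h; apply: Nxi; exact: NP.
Qed.

Lemma semigroup_strong0 b C f : d%:R / 2 < b -> 0 < b -> decay_class b C f ->
  strong_cvg m c (fun e => Pe e w 0 f) f.
Proof.
move=> db b0 fC; have uf := decay_bounded_uniform b0 fC.
apply: (strong_cvg_ae _ _ (strong_self c0 decay_mass db fC)) => e e0.
  by have [] := markovP e0 (lexx 0) uf.1.
have cA := countable_rescaled_atoms atomic_m e0.
have mA : measurable (~` rescaled_atoms m e) by apply: measurableC; exact: countable_measurable_rV.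
exists (~` rescaled_atoms m e); split=> //; last by move=> x /= /contrapT Ax; exact: walk_semigroup0.
have := integral_rescaled_atoms atomic_m e0 (h := fun x => (\1_(~` rescaled_atoms m e) x)%:E).
rewrite integral_indic// setIT => ->.
- by apply: esum1 => x Ax; rewrite indicE memNset ?mule0//= => /(_ Ax).
- by apply/measurable_EFinP; exact: measurable_indic.
- by move=> x; rewrite lee_fin.
Qed.

(** Pairings with a weakly convergent [g] are replaced by inversions of a fixed order [k], which
    involve finitely many resolvents and converge by homogenization. The error of the replacement is
    uniform in the scale by [linv_uniform], and in the limit it vanishes as [k] grows, by dominated
    convergence. *)
Lemma semigroup_strong t b C f : 0 < t -> d%:R / 2 < b -> 0 < b -> decay_class b C f ->
  strong_cvg m c (fun e => Pe e w t f) (Pt t f).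
Proof.
move=> t0 db b0 fC; have uf := decay_bounded_uniform b0 fC; have C0 := decay_class_ge0 fC.
have modulus_arith (x y dl et : R) : 0 <= x -> 0 <= y -> 0 <= dl -> dl * ((x + 1) * (y + 1)) <= t * et ^+ 2 ->
    x * dl / t * y <= et ^+ 2.
  move=> x0 y0 dl0 h; rewrite mulrAC ler_pdivrMr// [leRHS]mulrC; apply: le_trans h.
  have := mulr_ge0 dl0 (addr_ge0 (addr_ge0 x0 y0) ler01); lra.
have fs := strong_self c0 decay_mass db fC.
have [/L2_bounded_familyP[f2 [Bf BfP]] f2l _] := fs.
have [TD _] := semigroup_limit_operator bm psd (ltW t0); have [K K0 KP] := TD b.
have PtC := KP C C f uf fC; have [_ Pt2] := decay_class_family decay_mass db PtC.
split=> //.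
  apply/L2_bounded_familyP; split=> [e e0|].
    have [_ _ _ h _] := markovP e0 (ltW t0) uf.1.
    exact/h/f2.
  exists Bf; near=> e.
  have e0 : 0 < e by near: e.
  have [_ _ _ h _] := markovP e0 (ltW t0) uf.1.
  apply: (@le_trans _ _ (\int[M e]_x (f x ^+ 2))); last by near: e.
  apply: Rintegral_sqr_le; first exact/h/f2.
  rewrite Rintegral_sqr; last exact: f2.
  by apply: integral_walk_semigroup_sqr (ltW t0) uf.1 _ => //; exact: decay_class_measurable fC.
move=> g g0 wg; have [/L2_bounded_familyP[g2 [Bg BgP]] g02 _] := wg.
have [N0 [K1 dom]] := linv_resolvent_decay bm psd t0 uf fC.
have Rs lam : 0 < lam -> strong_cvg m c (fun e => Re e w lam f) (Rl lam f).
  by move=> l0; exact: (homog l0 fs).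
have R2 lam : 0 < lam -> Rl lam f \in Lfun leb 2%:E by move=> /Rs[].
have Ri lam : 0 < lam -> leb.-integrable setT (EFin \o (fun x => Rl lam f x * g0 x)).
  by move=> l0; exact: Lfun2_mulP (R2 _ l0) g02.
pose hn n x := linv t n (fun lam => Rl lam f x).
have hn_cvg : (\int[leb]_x (hn (n + N0)%N x * g0 x)) @[n --> \oo] --> \int[leb]_x (Pt t f x * g0 x).
  have [mg0 _] := (Lfun2P _ _).1 g02; have mPt := decay_class_measurable PtC.
  have dL2 : decay b \in Lfun leb 2%:E.
    have db1 : decay_class b 1 (@decay R d b).
      by split=> [|x]; [exact: continuous_decay|rewrite mul1r ger0_norm// decay_ge0].
    by have [] := decay_class_family decay_mass db db1.
  have ig : leb.-integrable setT (fun x => `|(K1 * (decay b x * g0 x))%:E|%E).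
    by apply: integrable_abse; have := integrableZl measurableT K1 (Lfun2_mulP dL2 g02).
  have mh n : measurable_fun setT (fun x => (hn (n + N0)%N x * g0 x)%:E).
    have [i _] := lapdiff_integral 1 Ri (n + N0) (kernel_pt_gt0 (n + N0) t0).
    have mi : measurable_fun setT (fun x => lapdiff (n + N0) (Rl^~ f ^~ x) (kernel_pt t (n + N0)) * g0 x).
      by apply/measurable_EFinP; have [] := integrableP _ _ _ i.
    apply/measurable_EFinP; rewrite (_ : (fun x => _) = (fun x =>
      (lapdiff (n + N0) GRing.inv (kernel_pt t (n + N0)))^-1 * (lapdiff (n + N0) (Rl^~ f ^~ x) (kernel_pt t (n + N0)) * g0 x))).
      exact: measurable_funM.
    by apply/funext => x; rewrite /hn /linv mulrA [_^-1 * _]mulrC.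
  have mP : measurable_fun setT (fun x => (Pt t f x * g0 x)%:E).
    by apply/measurable_EFinP; exact: measurable_funM.
  have pw : {ae leb, forall x, setT x -> (hn (n + N0)%N x * g0 x)%:E @[n --> \oo] --> (Pt t f x * g0 x)%:E}.
    apply: aeW => x _; apply: cvg_EFin; first exact: nearW.
    apply: cvgM; last exact: cvg_cst.
    have := linv_resolvent_cvg (x := x) bm psd t0 uf; by rewrite -(cvg_shiftn N0).
  have dm : {ae leb, forall x, forall n, setT x -> (`|(hn (n + N0)%N x * g0 x)%:E| <= `|(K1 * (decay b x * g0 x))%:E|)%E}.
    apply: aeW => x n _; rewrite /= lee_fin mulrA [leLHS]normrM [leRHS]normrM ler_wpM2r//.
    by rewrite (le_trans (dom (n + N0)%N x (leq_addl _ _)))// ler_norm.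
  have [i _ cv] := dominated_convergence measurableT mh mP pw ig dm.
  apply: fine_cvg; rewrite /Rintegral fineK; last exact: integrable_fin_num.
  exact: cv.
apply: cvg_approx => eta eta0; have eta2 : 0 < eta / 2 by rewrite divr_gt0.
pose Mb := Num.sqrt `|Bf| * Num.sqrt `|Bg|.
have t2 : 0 < t / 2 by rewrite divr_gt0.
have BB : 0 < (`|Bf| + 1) * (`|Bg| + 1) by rewrite mulr_gt0// ltr_wpDl.
(* The window stays beyond [t / 2], because the modulus of the semigroup degenerates at time 0. The
   second bound makes [|Bf| * (delta / t) * |Bg|] at most [(eta / 2) ^ 2]. *)
pose delta := Num.min (t / 2) (t * (eta / 2) ^+ 2 / ((`|Bf| + 1) * (`|Bg| + 1))).
have delta0 : 0 < delta by rewrite lt_min t2 divr_gt0// mulr_gt0// exprn_gt0.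
have [N1 NP] := linv_uniform Mb t0 delta0 eta2.
have : c * (\int[leb]_x (hn (n + N0)%N x * g0 x)) @[n --> \oo] --> c * \int[leb]_x (Pt t f x * g0 x).
  by apply: cvgM => //; exact: cvg_cst.
move=> /cvgrPdist_le/(_ _ eta0)[N2 _ N2P].
(* One order serves both errors: it is at least [N1] for the walk, and far enough along the sequence
   [hn] for the limit. *)
have {N2P} := N2P (N2 + N1)%N (leq_addr _ _); set k := (_ + N0)%N => N2P.
have kN1 : (N1 <= k)%N by rewrite /k addnAC leq_addl.
exists (fun e => linv t k (lap (fun s => \int[M e]_x (Pe e w s f x * g e x)))), (c * \int[leb]_x (hn k x * g0 x)); split=> //.
  rewrite -(linv_integral c Ri k t0); apply: linv_cvg => // lam l0; have [_ _ /(_ _ _ wg)] := Rs lam l0.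
  apply: cvg_trans; apply: near_eq_cvg; near=> e.
  have e0 : 0 < e by near: e.
  by have [] := lap_walk_semigroup atomic_m r_ge0 rateA law nonexpl balance e0 l0 uf.1 (f2 e e0) (g2 e e0).
near=> e.
have e0 : 0 < e by near: e.
have Bfe : \int[M e]_x (f x ^+ 2) <= `|Bf| by rewrite (@le_trans _ _ Bf) ?ler_norm//; near: e.
have Bge : \int[M e]_x (g e x ^+ 2) <= `|Bg| by rewrite (@le_trans _ _ Bg) ?ler_norm//; near: e.
have [_ [mG bG]] := lap_walk_semigroup atomic_m r_ge0 rateA law nonexpl balance e0 (ltr01 : 0 < (1 : R)) uf.1 (f2 e e0) (g2 e e0).
have bG' s : 0 <= s -> `|\int[M e]_x (Pe e w s f x * g e x)| <= Mb.
  by move=> s0; rewrite (le_trans (bG s s0))//; apply: ler_pM; rewrite ?sqrtr_ge0// ler_wsqrtr.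
have PL2 s : 0 <= s -> Pe e w s f \in Lfun (M e) 2%:E.
  move=> s0; have [_ _ _ h _] := markovP e0 s0 uf.1.
  exact/h/f2.
(* The modulus bound carries the factor [1 / (2 * s1)] of the earlier time, at most [1 / t] here;
   the two possible orders of [s] and [t] are treated below. *)
have mod_lt s1 s2 : t / 2 <= s1 -> s1 < s2 -> s2 - s1 < delta ->
    `|\int[M e]_x (Pe e w s1 f x * g e x) - \int[M e]_x (Pe e w s2 f x * g e x)| <= eta / 2.
  move=> ts1 s12 sd; have s10 : 0 < s1 by exact: lt_le_trans ts1.
  have s20 := lt_trans s10 s12.
  have i1 := Lfun2_mulP (PL2 _ (ltW s10)) (g2 e e0); have i2 := Lfun2_mulP (PL2 _ (ltW s20)) (g2 e e0).
  rewrite -RintegralB//.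
  have dL := Lfun2B (PL2 _ (ltW s10)) (PL2 _ (ltW s20)).
  have -> : \int[M e]_x (Pe e w s1 f x * g e x - Pe e w s2 f x * g e x) =
      \int[M e]_x ((Pe e w s1 f x - Pe e w s2 f x) * g e x).
    by apply: eq_Rintegral => x _; rewrite mulrBl.
  apply: (le_trans (cauchy_schwarz dL (g2 e e0))).
  have h0 : 0 < s2 - s1 by rewrite subr_gt0.
  have := walk_semigroup_modulus atomic_m r_ge0 rateA law nonexpl balance e0 s10 h0 uf.1 (f2 e e0).
  rewrite addrC subrK => md.
  have md2 : \int[M e]_x ((Pe e w s1 f x - Pe e w s2 f x) ^+ 2) <= `|Bf| * delta / t.
    apply: (le_trans md); rewrite ler_pdivrMr ?mulr_gt0// mulrAC ler_pdivlMr//.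
    apply: (@le_trans _ _ (`|Bf| * delta * t)).
      by rewrite ler_wpM2r ?(ltW t0)//; apply: ler_pM => //; [exact: Rintegral_sqr_ge0|exact: ltW|exact: ltW].
    rewrite ler_wpM2l ?mulr_ge0 ?(ltW delta0)//.
    by rewrite -ler_pdivrMl// mulrC.
  apply: (@le_trans _ _ (Num.sqrt (`|Bf| * delta / t) * Num.sqrt `|Bg|)).
    by apply: ler_pM; rewrite ?sqrtr_ge0// ler_wsqrtr.
  rewrite -sqrtrM; last by rewrite divr_ge0 ?mulr_ge0 ?(ltW delta0) ?(ltW t0).
  rewrite -[leRHS](ger0_norm (ltW eta2)) -[leRHS]sqrtr_sqr ler_wsqrtr//.
  by apply: modulus_arith => //; [exact: ltW|rewrite -ler_pdivlMr// ge_min lexx orbT].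
rewrite distrC [leRHS](splitr eta); apply: (NP k kN1 (eta / 2)); first exact: ltW.
- by split.
- exact/bG'/ltW.
move=> s s0 st; have := st; rewrite lt_min in st.
have /andP[st2 _] : (`|s - t| < t / 2) && (`|s - t| < t * (eta / 2) ^+ 2 / ((`|Bf| + 1) * (`|Bg| + 1))) by [].
move=> sd.
have [E|ts|ts] := ltgtP s t.
- apply: mod_lt => //.
    by move: st2; rewrite ltr_distl => /andP[h _]; rewrite ltW// (le_lt_trans _ h)// {2}(splitr t) addrK.
  by rewrite distrC gtr0_norm ?subr_gt0 in sd.
- rewrite distrC; apply: mod_lt => //.
    by rewrite ler_pdivrMr// ler_peMr ?(ltW t0)// ler1n.
  by rewrite gtr0_norm ?subr_gt0 in sd.
- by rewrite ts subrr normr0 ltW.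
Unshelve. all: by end_near.
Qed.

Let b_gt0 b : d%:R / 2 < b -> 0 < b.
Proof. by apply: le_lt_trans; rewrite divr_ge0. Qed.

Lemma walk_semigroup_cvg t b C f : 0 <= t -> d%:R / 2 < b -> decay_class b C f ->
  strong_cvg m c (fun e => Pe e w t f) (Pt t f).
Proof.
rewrite le_eqVlt => /predU1P[<-|t0] db fC; last first.
  exact: (semigroup_strong t0 db (b_gt0 db) fC).
have -> : Pt 0 f = f by apply/funext => x; apply: (semigroup0 bm); have [] := fC.
exact: (semigroup_strong0 db (b_gt0 db) fC).
Qed.

Lemma walk_resolvent_cvg lam b C f : 0 < lam -> d%:R / 2 < b -> decay_class b C f ->
  strong_cvg m c (fun e => Re e w lam f) (Rl lam f).
Proof. by move=> l0 db fC; apply: (homog l0); exact: (strong_self c0 decay_mass db fC). Qed.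

Lemma walk_L2_limits t lam b C f : 0 <= t -> 0 < lam -> d%:R / 2 < b -> decay_class b C f ->
  (\int[M e]_x (`|Pe e w t f x - Pt t f x| ^+ 2)%:E)%E @[e --> 0^'+] --> 0%E /\
  (\int[M e]_x (`|Re e w lam f x - Rl lam f x| ^+ 2)%:E)%E @[e --> 0^'+] --> 0%E.
Proof.
move=> t0 l0 db fC; have uf := decay_bounded_uniform (b_gt0 db) fC; split.
  have [TD _] := semigroup_limit_operator bm psd t0; have [K _ KP] := TD b.
  exact: (strong_cvg_norm c0 vague decay_mass db (KP C C f uf fC) (walk_semigroup_cvg t0 db fC)).
have [TD _] := resolvent_limit_operator bm psd l0; have [K _ KP] := TD b.
have := decay_classZ lam^-1 (KP C C f uf fC).
under [X in decay_class _ _ X]eq_fun do rewrite mulrA mulVf ?gt_eqF// mul1r.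
move=> RC; exact: (strong_cvg_norm c0 vague decay_mass db RC (walk_resolvent_cvg l0 db fC)).
Qed.

Lemma walk_L1_limits t lam b C f : 0 <= t -> 0 < lam -> d%:R < b -> decay_class b C f ->
  (\int[M e]_x (`|Pe e w t f x - Pt t f x|)%:E)%E @[e --> 0^'+] --> 0%E /\
  (\int[M e]_x (`|Re e w lam f x - Rl lam f x|)%:E)%E @[e --> 0^'+] --> 0%E.
Proof.
move=> t0 l0 db fC; split.
  apply: (L1_cvg c0 vague decay_mass db fC (T := fun e => Pe e w t) (T0 := Pt t)).
  - by move=> e e0; exact: (markovP e0 t0).
  - by have := semigroup_limit_operator bm psd t0.
  - by move=> b' C' h; exact: walk_semigroup_cvg.
(* It is [lam] times the resolvent that preserves mass and constants; the factor is divided out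
   afterwards. *)
have lim : (\int[M e]_x (`|lam * Re e w lam f x - lam * Rl lam f x|)%:E)%E @[e --> 0^'+] --> 0%E.
  apply: (L1_cvg c0 vague decay_mass db fC (T := fun e f x => lam * Re e w lam f x) (T0 := fun f x => lam * Rl lam f x)).
  - by move=> e e0; exact: (markovR e0 l0).
  - by have := resolvent_limit_operator bm psd l0.
  - by move=> b' C' h db' hC; apply: strong_scale; exact: (walk_resolvent_cvg l0 db' hC).
apply: ereal_cvg0 => [e|eta eta0]; first by apply: integral_ge0 => x _; rewrite lee_fin.
have /fine_cvgP[fl /cvgrPdist_le/(_ _ (mulr_gt0 l0 eta0)) /= le] := lim.
near=> e.
have h1 : (\int[M e]_x (`|lam * Re e w lam f x - lam * Rl lam f x|)%:E)%E \is a fin_num by near: e.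
have h2 : (\int[M e]_x (`|lam * Re e w lam f x - lam * Rl lam f x|)%:E <= (lam * eta)%:E)%E.
  by rewrite -(fineK h1) lee_fin (le_trans (ler_norm _))// -normrN -sub0r; near: e.
have e0 : 0 < e by near: e; exact: nbhs_right_gt.
have b0 : 0 < b by exact: le_lt_trans db.
have uf := decay_bounded_uniform b0 fC.
have [mR _ _ _ _] := markovR e0 l0 uf.1.
have [TD _] := resolvent_limit_operator bm psd l0; have [K _ KP] := TD b.
have mRl := decay_class_measurable (KP C C f uf fC).
have mI : measurable_fun setT (fun x => (`|lam * Re e w lam f x - lam * Rl lam f x|)%:E).
  by apply/measurable_EFinP; apply: measurableT_comp => //; exact: measurable_funB.
have ZE := @ge0_integralZl _ _ _ (M e) setT measurableT _ mI lam^-1%:E (fun x _ => normr_ge0 _).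
have -> : (\int[M e]_x (`|Re e w lam f x - Rl lam f x|)%:E =
    lam^-1%:E * \int[M e]_x (`|lam * Re e w lam f x - lam * Rl lam f x|)%:E)%E.
  rewrite -ZE; last by rewrite lee_fin invr_ge0 ltW.
  apply: eq_integral => x _; rewrite -EFinM -mulrBr normrM gtr0_norm// mulrA mulVf ?mul1r// gt_eqF//.
apply: (@le_trans _ _ (lam^-1%:E * (lam * eta)%:E)%E); first by rewrite lee_wpmul2l// lee_fin invr_ge0 ltW.
by rewrite -EFinM lee_fin mulrA mulVf ?mul1r// gt_eqF.
Unshelve. all: by end_near.
Qed.

End walk_convergence.

(** * Function classes and intensity *)

Section function_classes.
Context {R : realType} {d : nat}.
Implicit Types f : 'rV[R]_d -> R.

Lemma norm_le_enorm (x : 'rV[R]_d) : `|x| <= enorm x.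
Proof.
rewrite [leLHS]mx_normrE bigmax_le ?sqrtr_ge0// => -[i j] _ /=.
rewrite (ord1 i) -sqrtr_sqr ler_wsqrtr// (bigD1 j)//= lerDl.
by apply: sumr_ge0 => k _; exact: sqr_ge0.
Qed.

Lemma classG_decay (r : R) f : 0 <= r -> classG r f -> exists C b : R, r < b /\ decay_class b C f.
Proof.
move=> r0 [cf [C [b [C0 rb fC]]]]; exists C, b; split=> //; split=> // x.
have b0 := le_lt_trans r0 rb.
rewrite (le_trans (fC x))// ler_wpM2l ?(ltW C0)// /decay !powRN lef_pV2 ?posrE ?powR_gt0//.
- by apply: ge0_ler_powR; rewrite ?nnegrE ?addr_ge0 ?sqrtr_ge0 ?(ltW b0)// lerD2l norm_le_enorm.
by rewrite ltr_pwDl// sqrtr_ge0.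
Qed.

Lemma classG_le (r r' : R) f : r <= r' -> classG r' f -> classG r f.
Proof.
move=> rr [cf [C [b [C0 rb fC]]]]; split=> //; exists C, b; split=> //.
exact: le_lt_trans rb.
Qed.

End function_classes.

(** In the extended reals a cell of volume 0 has inverse [+oo] and one of infinite volume has
    inverse 0; each case makes the intensity 0 or [+oo]. Hence the volume and the mean mass of the
    cell are both finite. *)
Lemma intensity_fin {R : realType} {d : nat} {dO : measure_display} {Omega : measurableType dO}
    (V : 'M[R]_d) (P : probability Omega R) (mu : Omega -> lfmeasure R d) :
  (0 < intensity V P mu < +oo)%E -> exists l c : R, [/\ 0 < l, 0 <= c, lebesgue_rV d (cell V) = l%:E,
    fine (intensity V P mu) = c & (\int[P]_w mu w (cell V) = (c * l)%:E)%E].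
Proof.
rewrite /intensity; have l0 : (0 <= lebesgue_rV d (cell V))%E := measure_ge0 _ _.
have E0 : (0 <= \int[P]_w mu w (cell V))%E by apply: integral_ge0.
case: (lebesgue_rV d (cell V)) l0 => [l l0|_|]; last 2 first.
- by rewrite invey mul0e ltxx.
- by rewrite leeNy_eq.
case: (\int[P]_w _)%E E0 => [E E0|_|]; last by rewrite leeNy_eq.
  rewrite !lee_fin in E0 l0.
  have [->|ln] := eqVneq l 0.
    rewrite inve0; have [->|En] := eqVneq E 0; first by rewrite mule0 ltxx.
    by rewrite gt0_mulye ?ltxx ?andbF// lte_fin lt_neqAle eq_sym En.
  rewrite inver (negbTE ln) -EFinM => _; have lp : 0 < l by rewrite lt_neqAle eq_sym ln.
  exists l, (l^-1 * E); split=> //; first by rewrite mulr_ge0 ?invr_ge0.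
  by rewrite mulrC mulrA mulfV ?mul1r.
rewrite lee_fin in l0.
have [->|ln] := eqVneq l 0; first by rewrite inve0 mulyy ltxx andbF.
by rewrite inver (negbTE ln) gt0_muley ?ltxx ?andbF// lte_fin invr_gt0 lt_neqAle eq_sym ln.
Qed.

Theorem theorem4p3
  (R : realType) (d : nat) (d_gt0 : (0 < d)%N) (k : group_kind)
  (V : 'M[R]_d) (V_inv : V \in unitmx)
  (dO : measure_display) (Omega : measurableType dO) (P : probability Omega R)
  (theta : 'rV[R]_d -> Omega -> Omega) (theta_act : group_action k theta)
  (mu : Omega -> lfmeasure R d) (mu_meas : random_measure mu)
  (mu_atomic : forall w, purely_atomic (mu w))
  (r : Omega -> 'rV[R]_d -> 'rV[R]_d -> R) (r_rates : jump_rates mu r)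
  (A1 : stationary_ergodic k theta P)
  (A2 : covariant_measure k V P theta mu)
  (A3 : (0 < intensity V P mu < +oo)%E)
  (P0 : probability (palm_space R d k Omega) R)
  (P0_palm : is_palm V P theta mu P0)
  (A4 : walk_assumptions V P theta mu r P0)
  (D : 'M[R]_d) (D_eff : effective_matrix V theta mu r P0 D)
  (dX : measure_display) (Xi : measurableType dX)
  (Y : nat -> Xi -> 'rV[R]_d) (S : nat -> Xi -> R)
  (Q : Omega -> 'rV[R]_d -> probability Xi R)
  (Q_walk : walk_realization mu r Y S Q)
  (dB : measure_display) (B : measurableType dB) (PB : probability B R)
  (W : R -> B -> 'rV[R]_d) (W_brownian : brownian PB W (2 *: D))
  (Otyp : set Omega) (Otyp_full : full_invariant k P theta Otyp)
  (Otyp_walk : forall w, Otyp w -> walk_well_defined mu r S Q w)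
  (Otyp_hom : forall w, Otyp w ->
     resolvent_homogenization V P mu Y S Q PB W w) :
  exists Otyp_star : set Omega,
    [/\ Otyp_star `<=` Otyp, full_invariant k P theta Otyp_star &
        forall w t lambda, Otyp_star w -> 0 <= t -> 0 < lambda ->
        [/\ forall f, Cstar f ->
              L2_limits V P mu Y S Q PB W w t lambda f /\
              L1_limits mu Y S Q PB W w t lambda f,
            (forall f, classG (d%:R + 1) f ->
               L2_limits V P mu Y S Q PB W w t lambda f) /\
            (forall f, classG (2 * d%:R + 2) f ->
               L1_limits mu Y S Q PB W w t lambda f) &
            moment_condition V P mu ->
              (forall f, classG (d%:R / 2) f ->
                 L2_limits V P mu Y S Q PB W w t lambda f) /\
              (forall f, classG d%:R f ->
                 L1_limits mu Y S Q PB W w t lambda f)]].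
Proof.
have [l [c [l0 c0 cellE cE meanE]]] := intensity_fin A3.
have cell_fin : (lebesgue_rV d (cell V) < +oo)%E by rewrite cellE ltry.
have [A Afull AP] := A4.1; have [Ocov Ocov_full cov] := A2.
have [E [Efull _ EP]] := ergodic_boxes V_inv theta_act A1 mu_meas Ocov_full cov meanE.
(* [Otyp] brings the walk and the homogenization of its resolvents, [A] the balance of the rates,
   [E] the averages over boxes. *)
exists (Otyp `&` (A `&` E)); split=> [w [] //||w t lambda [Ow [Aw Ew]] t0 lambda0].
  by do 2!apply: (full_invariantI theta_act) => //.
have centred (p q : 'I_d -> nat) : (forall i, 0 < p i)%N -> (forall i, 0 < q i)%N ->
    box_mass V (mu w) (fun i => - (n * p i)%:R) (fun i => (n * q i)%:R) / n%:R ^+ d @[n --> \oo] -->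
    c * box_mass V (lebesgue_lfmeasure V_inv cell_fin) (fun i => - (p i)%:R) (fun i => (q i)%:R).
  move=> p0 q0; have := EP w Ew p q p0 q0; rewrite /centred_mass.
  (* The limit of the averages counts cells; it is rewritten as the constant [c] times the Lebesgue
     volume of the box. *)
  suff -> : c * l * (tile_volume p q)%:R =
      c * box_mass V (lebesgue_lfmeasure V_inv cell_fin) (fun i => - (p i)%:R) (fun i => (q i)%:R) by [].
  rewrite -mulrA; congr (c * _); rewrite /box_mass /=.
  rewrite (_ : (fun i => (q i)%:R) = (fun i => - (p i)%:R + (p i + q i)%:R)); last first.
    by apply/funext => i; rewrite natrD addrA addNr add0r.
  rewrite (lebesgue_vbox_nat V_inv) => [|i]; last by rewrite addn_gt0 p0.
  by rewrite cellE -EFinM /= mulrC natr_prod.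
have vague := vague_cvg c0 centred.
have dm := rescaled_decay_mass c0 centred.
have [_ rge0 _ _] := r_rates; have [rateA nonexpl] := Otyp_walk w Ow.
have law := Q_walk w rateA.
have balance x y := let: And4 _ _ b _ := AP w Aw in b x y.
have [_ psd _] := D_eff.
have psd2 a : 0 <= dot a (mulmv (2 *: D) a).
  rewrite (_ : dot a _ = 2 * dot a (mulmv D a)) ?mulr_ge0// /dot mulr_sumr; apply: eq_bigr => i _.
  by rewrite /mulmv linearZ /= -scalemxAr mxE mulrCA.
have homog lam (lam0 : 0 < lam) fe f := (Otyp_hom w Ow lam lam0 fe f).2.
rewrite cE in homog.
have L2 f : classG (d%:R / 2) f -> L2_limits V P mu Y S Q PB W w t lambda f.
  have dp : 0 <= d%:R / 2 :> R by rewrite divr_ge0.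
  move=> /(classG_decay dp)[C [b [db fC]]].
  have [n1 n2] := walk_L2_limits (mu_atomic w) (rge0 w) rateA law nonexpl balance W_brownian psd2 c0 vague dm homog t0 lambda0 db fC.
  split=> //; rewrite cE.
    exact: (walk_semigroup_cvg (mu_atomic w) (rge0 w) rateA law nonexpl balance W_brownian psd2 c0 dm homog t0 db fC).
  exact: (walk_resolvent_cvg c0 dm homog lambda0 db fC).
have L1 f : classG d%:R f -> L1_limits mu Y S Q PB W w t lambda f.
  move=> /(classG_decay (ler0n _ d))[C [b [db fC]]].
  exact: (walk_L1_limits (mu_atomic w) (rge0 w) rateA law nonexpl balance W_brownian psd2 c0 vague dm homog t0 lambda0 db fC).
have dn : 0 <= d%:R :> R by [].
(* Larger exponents define smaller classes, so the results for the exponents [d / 2] and [d] cover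
   the others. *)
have le2 : d%:R / 2 <= d%:R + 1 :> R by lra.
have le1 : d%:R <= 2 * d%:R + 2 :> R by lra.
split.
- move=> f fC; split; [apply/L2/(classG_le le2)|apply/L1/(classG_le le1)]; apply: fC; lra.
- by split=> f; [move/(classG_le le2)/L2|move/(classG_le le1)/L1].
- by [].
Qed.
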